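(* Let $(K,v)$ be an equicharacteristic $p>0$ separably defectless Kaplansky henselian nontrivially valued field. Then $\mathrm{Th}(K;\mathcal{L}_{val})$ is finitely undecidable. Moreover, if the valuation ring $\mathcal{O}_v$ is $\mathcal{L}_r$-definable in $K$, then $K$ is finitely undecidable as a field, i.e. $\mathrm{Th}(K;\mathcal{L}_r)$ is finitely undecidable.
   Context: $\mathcal{L}_r$ is the language of rings and $\mathcal{L}_{val}$ is $\mathcal{L}_r$ together with a unary predicate interpreted as the valuation ring. Equicharacteristic $p$ means $K$ and $Kv$ both have characteristic $p$. A valued field $(K,v)$ is separably defectless if for every finite separable extension $L/K$, $[L:K]=\sum_{w\supseteq v} e(w/v)f(w/v)$, the sum over all prolongations $w$ of $v$ to $L$, where $e(w/v)=(wL:vK)$ is the ramification index and $f(w/v)=[Lw:Kv]$ the inertia degree. A valued field of residue characteristic $p>0$ is Kaplansky if $vK$ is $p$-divisible and $Kv$ is perfect and admits no proper separable algebraic extensions of degree divisible by $p$. A theory $T$ in a language $\mathcal{L}$ is finitely undecidable if for every nonempty finite set $S\subseteq T$ of $\mathcal{L}$-sentences, the set $\mathrm{Cons}(S)$ of $\mathcal{L}$-sentences $\varphi$ with $S\models\varphi$ is undecidable. *)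

(* Defs.v *)
From Stdlib Require List.
From HB Require Import structures.
From mathcomp Require Import all_boot all_algebra all_field.
From mathcomp Require Import generic_quotient ring_quotient.

Set Implicit Arguments.
Unset Strict Implicit.
Unset Printing Implicit Defensive.

Import GRing.Theory.
Local Open Scope ring_scope.
Local Open Scope quotient_scope.

(* The language of rings {0, 1, -, +, *} expanded by one unary predicate symbol
   for each element of [U], so that [U := void] gives the language of rings and
   [U := unit] the language of valued fields. *)
Section Syntax.

Variable U : countType.

Inductive term :=
| tVar of nat
| tZero
| tOne
| tOpp of term
| tAdd of term & term
| tMul of term & term.

Inductive formula :=
| fFalse
| fEq of term & term
| fPred of U & term
| fImp of formula & formula
| fAll of nat & formula.

Fixpoint tvars (t : term) : seq nat :=
  match t with
  | tVar n => [:: n]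
  | tZero | tOne => [::]
  | tOpp t1 => tvars t1
  | tAdd t1 t2 | tMul t1 t2 => tvars t1 ++ tvars t2
  end.

Fixpoint free_vars (phi : formula) : seq nat :=
  match phi with
  | fFalse => [::]
  | fEq t1 t2 => tvars t1 ++ tvars t2
  | fPred _ t => tvars t
  | fImp phi1 phi2 => free_vars phi1 ++ free_vars phi2
  | fAll n phi1 => [seq m <- free_vars phi1 | m != n]
  end.

Definition sentence (phi : formula) : bool := free_vars phi == [::].

(* An arbitrary structure for the language: no ring axiom is imposed. *)
Record structure := Structure {
  carrier :> Type;
  s_zero : carrier;
  s_one : carrier;
  s_opp : carrier -> carrier;
  s_add : carrier -> carrier -> carrier;
  s_mul : carrier -> carrier -> carrier;
  s_pred : U -> carrier -> Prop
}.

Fixpoint teval (M : structure) (e : nat -> M) (t : term) : M :=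
  match t with
  | tVar n => e n
  | tZero => s_zero M
  | tOne => s_one M
  | tOpp t1 => s_opp (teval e t1)
  | tAdd t1 t2 => s_add (teval e t1) (teval e t2)
  | tMul t1 t2 => s_mul (teval e t1) (teval e t2)
  end.

Definition update (A : Type) (e : nat -> A) (n : nat) (x : A) : nat -> A :=
  fun m => if m == n then x else e m.

Fixpoint satisfies (M : structure) (e : nat -> M) (phi : formula) : Prop :=
  match phi with
  | fFalse => False
  | fEq t1 t2 => teval e t1 = teval e t2
  | fPred u t => s_pred u (teval e t)
  | fImp phi1 phi2 => satisfies e phi1 -> satisfies e phi2
  | fAll n phi1 => forall x : M, satisfies (update e n x) phi1
  end.

Definition models (M : structure) (phi : formula) : Prop :=
  forall e : nat -> M, satisfies e phi.

Definition Th (M : structure) (phi : formula) : Prop :=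
  sentence phi /\ models M phi.

Definition Cons (S : seq formula) (phi : formula) : Prop :=
  sentence phi /\
  forall M : structure, (forall psi, List.In psi S -> models M psi) ->
    models M phi.

Definition npair (m n : nat) : nat := (2 ^ m * n.*2.+1)%N.

Fixpoint term_code (t : term) : nat :=
  match t with
  | tVar n => npair 0 n
  | tZero => npair 1 0
  | tOne => npair 2 0
  | tOpp t1 => npair 3 (term_code t1)
  | tAdd t1 t2 => npair 4 (npair (term_code t1) (term_code t2))
  | tMul t1 t2 => npair 5 (npair (term_code t1) (term_code t2))
  end.

Fixpoint formula_code (phi : formula) : nat :=
  match phi with
  | fFalse => npair 0 0
  | fEq t1 t2 => npair 1 (npair (term_code t1) (term_code t2))
  | fPred u t => npair 2 (npair (pickle u) (term_code t))
  | fImp phi1 phi2 => npair 3 (npair (formula_code phi1) (formula_code phi2))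
  | fAll n phi1 => npair 4 (npair n (formula_code phi1))
  end.

Lemma npair_inj m n m' n' : npair m n = npair m' n' -> m = m' /\ n = n'.
Proof.
rewrite /npair; elim: m m' => [|m IH] [|m'].
- by rewrite !expn0 !mul1n => - [] /double_inj.
- rewrite expn0 mul1n expnS -mulnA mul2n => E.
  by have := congr1 odd E; rewrite /= !odd_double.
- rewrite expn0 mul1n expnS -mulnA mul2n => E.
  by have := congr1 odd E; rewrite /= !odd_double.
- by rewrite !expnS -!mulnA !mul2n => /double_inj /IH [-> ->].
Qed.

Lemma term_code_inj : injective term_code.
Proof.
elim=> [n|||t IH|t1 IH1 t2 IH2|t1 IH1 t2 IH2] [m|||s|s1 s2|s1 s2] //=
  /npair_inj [] //.
- by move=> _ ->.
- by move=> _ /IH ->.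
- by move=> _ /npair_inj [] /IH1 -> /IH2 ->.
- by move=> _ /npair_inj [] /IH1 -> /IH2 ->.
Qed.

Lemma formula_code_inj : injective formula_code.
Proof.
elim=> [|t1 t2|u t|f1 IH1 f2 IH2|n f IH] [|s1 s2|u' s|g1 g2|m g] //=
  /npair_inj [] // _.
- by move=> /npair_inj [] /term_code_inj -> /term_code_inj ->.
- by move=> /npair_inj [] /(pcan_inj pickleK) -> /term_code_inj ->.
- by move=> /npair_inj [] /IH1 -> /IH2 ->.
- by move=> /npair_inj [] -> /IH ->.
Qed.

End Syntax.

Arguments fFalse {U}.
Arguments fEq {U}.

Inductive recfun : nat -> Type :=
| RZero n : recfun n
| RSucc : recfun 1
| RProj n of 'I_n : recfun n
| RComp k n of recfun k & ('I_k -> recfun n) : recfun n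
| RPrec n of recfun n & recfun n.+2 : recfun n.+1
| RMin n of recfun n.+1 : recfun n.

(* [computes f x y]: the partial function [f] is defined at [x] with value [y].
   Primitive recursion and minimization act on the first argument; in the case
   of [RPrec], [u] is the sequence of the successive values. *)
Fixpoint computes (n : nat) (f : recfun n) : n.-tuple nat -> nat -> Prop :=
  match f in recfun n return n.-tuple nat -> nat -> Prop with
  | RZero _ => fun _ y => y = 0%N
  | RSucc => fun x y => y = (thead x).+1
  | RProj _ i => fun x y => y = tnth x i
  | RComp k _ g h => fun x y =>
      exists2 z : k.-tuple nat,
        (forall i, computes (h i) x (tnth z i)) & computes g z y
  | RPrec _ g h => fun x y =>
      exists u : nat -> nat,
        [/\ computes g [tuple of behead x] (u 0%N),
            forall m, (m < thead x)%N ->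
              computes h [tuple of m :: u m :: behead x] (u m.+1)
          & y = u (thead x)]
  | RMin _ g => fun x y =>
      computes g [tuple of y :: x] 0%N /\
      forall m, (m < y)%N -> exists z, computes g [tuple of m :: x] z.+1
  end.

Definition recursive_set (A : nat -> Prop) : Prop :=
  exists f : recfun 1, forall n,
    (A n -> computes f [tuple n] 1%N) /\ (~ A n -> computes f [tuple n] 0%N).

Definition undecidable (U : countType) (X : formula U -> Prop) : Prop :=
  ~ recursive_set (fun n => exists2 phi, X phi & n = formula_code phi).

Definition finitely_undecidable (U : countType) (T : formula U -> Prop) : Prop :=
  forall S : seq (formula U),
    S <> [::] -> (forall phi, List.In phi S -> T phi) -> undecidable (Cons S).

(* A valuation on [K], up to equivalence, is given by its valuation ring. *)
Record valuationRing (K : fieldType) := ValuationRing {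
  vr_pred :> {pred K};
  vr_subring : subring_closed vr_pred;
  vr_total : forall x : K, (x \in vr_pred) || (x^-1 \in vr_pred)
}.

HB.instance Definition _ (K : fieldType) (O : valuationRing K) :=
  GRing.isSubringClosed.Build K (vr_pred O) (vr_subring O).

Section ValuedField.

Variables (K : fieldType) (O : valuationRing K).

Definition vunit (x : K) : bool := [&& x != 0, x \in O & x^-1 \in O].

Lemma vunit1 : vunit 1.
Proof. by rewrite /vunit oner_eq0 invr1 andbb /= rpred1. Qed.

Lemma vunitV x : vunit x -> vunit x^-1.
Proof. by case/and3P=> x0 xO xVO; rewrite /vunit invr_eq0 x0 invrK xO xVO. Qed.

Lemma vunitM x y : vunit x -> vunit y -> vunit (x * y).
Proof.
case/and3P=> x0 xO xVO /and3P[y0 yO yVO].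
by rewrite /vunit mulf_neq0 // invfM !rpredM.
Qed.

Definition vring : Type := {x : K | x \in O}.

HB.instance Definition _ := [isSub of vring for @sval K (fun x => x \in O)].
HB.instance Definition _ := [Choice of vring by <:].
HB.instance Definition _ := [SubChoice_isSubComNzRing of vring by <:].

Definition maxideal : {pred vring} := [pred x | ~~ vunit (val x)].

Lemma maxideal_0 : 0 \in maxideal.
Proof. by rewrite inE /vunit eqxx. Qed.

Lemma nonunitM (x y : K) : x \in O -> y \in O -> vunit (x * y) -> vunit y.
Proof.
move=> xO yO /and3P[xy0 xyO xyVO].
have y0 : y != 0 by apply: contraNneq xy0 => ->; rewrite mulr0.
have x0 : x != 0 by apply: contraNneq xy0 => ->; rewrite mul0r.
rewrite /vunit y0 yO /=.
have -> : y^-1 = x * (x * y)^-1 by rewrite invfM mulrA divff // mul1r.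
exact: rpredM.
Qed.

Lemma maxideal_M (a x : vring) : x \in maxideal -> a * x \in maxideal.
Proof.
rewrite !inE; apply: contra; rewrite rmorphM /=.
exact: nonunitM (valP a) (valP x).
Qed.

Lemma maxideal_B (x y : vring) :
  x \in maxideal -> y \in maxideal -> x - y \in maxideal.
Proof.
rewrite !inE => xm ym; apply/negP; rewrite rmorphB /= => u.
have [x0|x0] := eqVneq (val x) 0.
  move: u; rewrite x0 sub0r -mulN1r => /nonunitM h; move: ym; rewrite h //.
    by rewrite rpredN rpred1.
  exact: (valP y).
have [y0|y0] := eqVneq (val y) 0.
  by move: u; rewrite y0 subr0 => h; rewrite h in xm.
have := vr_total O (val x / val y); rewrite invfM invrK => /orP[q|q].
  have E : val x - val y = (val x / val y - 1) * val y.
    by rewrite mulrBl mul1r divfK.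
  move: u; rewrite E => /nonunitM h; move: ym; rewrite h //.
    by rewrite rpredB ?rpred1.
  exact: (valP y).
have E : val x - val y = (1 - (val x)^-1 * val y) * val x.
  by rewrite mulrBl mul1r mulrAC mulVf // mul1r.
move: u; rewrite E => /nonunitM h; move: xm; rewrite h //.
  by rewrite rpredB ?rpred1.
exact: (valP x).
Qed.

Lemma maxideal_idealr : idealr_closed maxideal.
Proof.
split; first exact: maxideal_0.
  by rewrite inE negbK rmorph1 vunit1.
move=> a x y xm ym; rewrite -[y]opprK; apply: maxideal_B.
  exact: maxideal_M.
by rewrite -mulN1r; apply: maxideal_M.
Qed.

HB.instance Definition _ := isIdealr.Build vring maxideal maxideal_idealr.

Definition residueField : Type := {ideal_quot maxideal}.

HB.instance Definition _ := GRing.ComNzRing.on residueField.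

Definition residue (x : vring) : residueField := \pi_({ideal_quot maxideal}) x.

Lemma residue_eq (x y : vring) : (residue x == residue y) = (x - y \in maxideal).
Proof. by rewrite Quotient.idealrBE. Qed.

Definition vinv (x : vring) : vring := insubd (0 : vring) (val x)^-1.

Definition residue_inv (a : residueField) : residueField :=
  if a == 0 then 0 else residue (vinv (repr a)).

Lemma residueVf (a : residueField) : a != 0 -> residue_inv a * a = 1.
Proof.
move=> a0; rewrite /residue_inv (negbTE a0).
have ua : vunit (val (repr a : vring)).
  move: a0; rewrite -{1}[a]reprK -[0 : residueField]/(0 : {ideal_quot maxideal}).
  by rewrite -(rmorph0 \pi_({ideal_quot maxideal})) -Quotient.idealrBE subr0 negbK.
rewrite -{2}[a]reprK /residue -rmorphM.
have -> : vinv (repr a) * repr a = 1.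
  apply: val_inj; rewrite rmorphM rmorph1 /= /vinv val_insubd.
  by case/and3P: ua => u0 _ uV; rewrite uV mulVf.
exact: rmorph1.
Qed.

Lemma residueV0 : residue_inv 0 = 0.
Proof. by rewrite /residue_inv eqxx. Qed.

HB.instance Definition _ :=
  GRing.ComNzRing_isField.Build residueField residueVf residueV0.

(* The value group is the quotient of the multiplicative group of [K] by the
   units of [O], written additively. *)
Definition nonzero : Type := {x : K | x != 0}.

HB.instance Definition _ := [isSub of nonzero for @sval K (fun x => x != 0)].
HB.instance Definition _ := [Choice of nonzero by <:].

Definition veq (x y : nonzero) : bool := vunit (val x / val y).

Lemma veq_refl : reflexive veq.
Proof. by move=> x; rewrite /veq divff ?vunit1 // (valP x). Qed.

Lemma veq_sym : symmetric veq.
Proof.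
have sub x y : veq x y -> veq y x.
  by rewrite /veq => /vunitV; rewrite invfM invrK mulrC.
by move=> x y; apply/idP/idP; exact: sub.
Qed.

Lemma veq_trans : transitive veq.
Proof.
move=> y x z xy yz; rewrite /veq.
have -> : val x / val z = (val x / val y) * (val y / val z).
  by rewrite mulrA divfK // (valP y).
exact: vunitM.
Qed.

Canonical veq_equiv := EquivRel veq veq_refl veq_sym veq_trans.

Definition valueGroup : Type := {eq_quot veq}.

HB.instance Definition _ := Choice.on valueGroup.

Definition nz1 : nonzero := exist _ 1 (oner_neq0 K).
Definition nzM (x y : nonzero) : nonzero :=
  exist _ (val x * val y) (mulf_neq0 (valP x) (valP y)).
Definition nzV (x : nonzero) : nonzero :=
  exist _ (val x)^-1 (etrans (congr1 negb (invr_eq0 (val x))) (valP x)).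

Definition nzval (x : nonzero) : valueGroup := \pi_({eq_quot veq}) x.

Definition vg_zero : valueGroup := nzval nz1.
Definition vg_opp (g : valueGroup) : valueGroup :=
  nzval (nzV (repr (g : {eq_quot veq}))).
Definition vg_add (g h : valueGroup) : valueGroup :=
  nzval (nzM (repr (g : {eq_quot veq})) (repr (h : {eq_quot veq}))).

Lemma nzval_eq (x y : nonzero) : nzval x = nzval y <-> veq x y.
Proof. by split=> [|h]; [move/eqmodP | apply/eqmodP]. Qed.

Lemma nzval_repr (x : nonzero) :
  veq (repr (nzval x : {eq_quot veq})) x.
Proof. by apply/nzval_eq; rewrite /nzval reprK. Qed.

Lemma nzvalM x y : vg_add (nzval x) (nzval y) = nzval (nzM x y).
Proof.
apply/nzval_eq; have := vunitM (nzval_repr x) (nzval_repr y).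
by rewrite /veq /= invfM mulrACA.
Qed.

Lemma nzvalV x : vg_opp (nzval x) = nzval (nzV x).
Proof.
apply/nzval_eq; have := vunitV (nzval_repr x).
by rewrite /veq /= invfM.
Qed.

Lemma nzval_surj (g : valueGroup) : exists x, g = nzval x.
Proof. by exists (repr (g : {eq_quot veq})); rewrite /nzval reprK. Qed.

Lemma vg_addA : associative vg_add.
Proof.
move=> g h k; have [x ->] := nzval_surj g; have [y ->] := nzval_surj h.
have [z ->] := nzval_surj k; rewrite !nzvalM.
by congr nzval; apply: val_inj; rewrite /= mulrA.
Qed.

Lemma vg_addC : commutative vg_add.
Proof.
move=> g h; have [x ->] := nzval_surj g; have [y ->] := nzval_surj h.
by rewrite !nzvalM; congr nzval; apply: val_inj; rewrite /= mulrC.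
Qed.

Lemma vg_add0 : left_id vg_zero vg_add.
Proof.
move=> g; have [x ->] := nzval_surj g; rewrite /vg_zero nzvalM.
by congr nzval; apply: val_inj; rewrite /= mul1r.
Qed.

Lemma vg_addN : left_inverse vg_zero vg_opp vg_add.
Proof.
move=> g; have [x ->] := nzval_surj g; rewrite nzvalV nzvalM.
by congr nzval; apply: val_inj; rewrite /= mulVf // (valP x).
Qed.

HB.instance Definition _ :=
  GRing.isZmodule.Build valueGroup vg_addA vg_addC vg_add0 vg_addN.

Definition nontrivial : Prop := exists x : K, x \notin O.

Definition equicharacteristic (p : nat) : Prop :=
  p \in [pchar K] /\ p \in [pchar residueField].

(* Hensel's lemma: simple roots of the reduction of [f] lift. *)
Definition henselian : Prop :=
  forall (f : {poly vring}) (a : vring),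
    root (map_poly residue f) (residue a) ->
    ~~ root (map_poly residue f)^`() (residue a) ->
    exists2 b : vring, root f b & residue b = residue a.

End ValuedField.

(* Frobenius is onto in positive characteristic [p]. *)
Definition perfect_field (k : fieldType) : Prop :=
  forall p, p \in [pchar k] -> forall x : k, exists y : k, x = y ^+ p.

Definition kaplansky (K : fieldType) (O : valuationRing K) : Prop :=
  exists p : nat,
    [/\ p \in [pchar residueField O],
        forall g : valueGroup O, exists h : valueGroup O, g = h *+ p,
        perfect_field (residueField O)
      & ~ exists l : fieldExtType (residueField O),
          [/\ separable 1 {: l}, (1 < \dim {: l})%N & (p %| \dim {: l})%N] ].

(* [H] stands for a subgroup of [G]; the [r i] represent its cosets. *)
Definition has_index (G : zmodType) (H : G -> Prop) (n : nat) : Prop :=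
  exists r : 'I_n -> G, forall g : G, exists! i : 'I_n, H (g - r i).

(* [n] is the degree of [l] over its subfield [k]. *)
Definition has_degree (l : fieldType) (k : l -> Prop) (n : nat) : Prop :=
  exists b : 'I_n -> l, forall y : l,
    exists! c : 'rV[l]_n, (forall i, k (c 0 i)) /\ y = \sum_i c 0 i * b i.

Section Prolongation.

Variables (K : fieldType) (O : valuationRing K).
Variables (L : fieldExtType K) (W : valuationRing L).

Definition prolongs : Prop := forall x : K, (x%:A \in W) = (x \in O).

(* When [W] prolongs [O], these are the images of the value group and of the
   residue field of [O] in those of [W]. *)
Definition value_subgroup (g : valueGroup W) : Prop :=
  exists2 y : nonzero L, g = nzval W y & exists x : K, val y = x%:A.

Definition residue_subfield (a : residueField W) : Prop :=
  exists2 y : vring W, a = residue y & exists2 x : K, x \in O & val y = x%:A.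

Definition ramification_index (n : nat) : Prop := has_index value_subgroup n.

Definition inertia_degree (n : nat) : Prop := has_degree residue_subfield n.

End Prolongation.

(* [w] enumerates the prolongations without repetition. *)
Definition separably_defectless (K : fieldType) (O : valuationRing K) : Prop :=
  forall L : fieldExtType K, separable 1 {: L} ->
    exists (r : nat) (w : 'I_r -> valuationRing L) (e f : 'I_r -> nat),
      [/\ forall i, prolongs O (w i),
          forall i j, w i =i w j -> i = j,
          forall W : valuationRing L, prolongs O W -> exists i, W =i w i,
          forall i, ramification_index (w i) (e i) /\
                    inertia_degree O (w i) (f i)
        & \dim {: L} = (\sum_i e i * f i)%N].

Definition field_structure (K : fieldType) : structure void :=
  @Structure void K 0 1 -%R +%R *%R (fun u _ => match u with end).

Definition valued_field_structure (K : fieldType) (O : valuationRing K) :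
    structure unit :=
  @Structure unit K 0 1 -%R +%R *%R (fun _ x => x \in O).

(* The defined variable is number 0; the values of the other ones serve as
   parameters. *)
Definition ring_definable (K : fieldType) (O : valuationRing K) : Prop :=
  exists (phi : formula void) (e : nat -> K), forall x : K,
    x \in O <-> satisfies (M := field_structure K) (update e 0%N x) phi.

(* Main.v *)
(* Let [F] be a countable elementary subfield of [K]. For a prime [q], a limit [c] transcendental over [F] in an
   ultrapower of [F] generates there a field [M_q] in which [z ^+ q - z = g] is solvable exactly when the poles of [g]
   have values divisible by [q]; solvability defines the integral elements of [F] and codes finite sets of them, so
   arithmetic is interpreted in [M_q]. A back-and-forth argument, in which the hypotheses enter only through [SG], shows
   that the ultraproduct of the [M_q] is elementarily equivalent to [F]. So every finite part [S] of the theory holds in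
   some [M_q], where recursive functions are represented; diagonalisation then makes [Cons S] undecidable. *)
From Stdlib Require List.
From HB Require Import structures.
Require Import Defs.
From mathcomp Require Import all_boot all_order all_algebra all_field all_fingroup all_solvable.
From mathcomp Require Import generic_quotient ring_quotient ring zify.
From mathcomp.classical Require Import boolp classical_sets functions filter.

Set Implicit Arguments.
Unset Strict Implicit.
Unset Printing Implicit Defensive.

Import Order.TTheory GRing.Theory.
Local Open Scope ring_scope.
Local Open Scope quotient_scope.

(** Two demands on [M_q] pull apart. At the prime [q] it must visibly fail to be closed in the
    ultrapower [L] of [F], or nothing would be interpreted; yet the ultraproduct over all [q] must
    satisfy [SG], which passes to relatively separably closed subfields. Hence [M_q] is the
    intersection of all maximal subfields of [L], separable over the field generated by [c], in
    which one given value is still not divisible by [q]. An extension of degree less than [q] cannot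
    make it divisible, so [M_q] contains every root in [L] of a separable relation of degree less
    than [q]. The limit [c] is immediate, which keeps leading terms in [F], and it is adjoined
    together with all its [p]-power roots, so that finitely many elements of [F] that span [F] over
    its [p]-th powers still do so for [M_q]. Imperfection shapes the back-and-forth too: the fields
    must stay separable over the domains of the partial isomorphisms, and approximation takes place
    in perfect hulls, in which the fields are dense. Countability of [F] lets [c] avoid the elements
    of the algebraic closure one after the other. *)

Local Notation "P \over N" := (P \is a polyOver N) (at level 70).
Local Notation valring := valuationRing (only parsing).
Local Notation closedF := closedFieldType (only parsing).

(** * Absolute values attached to a valuation ring *)

Section Value.
Variables (E : fieldType) (O : valring E).

(** Multiplicative convention: 0 is the least element, and [O] consists of the elements that are at
    most 1. *)
Definition vle (x y : E) : bool := if y == 0 then x == 0 else x / y \in O.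

Lemma vle_refl : reflexive vle.
by move=> x; rewrite /vle; case: eqVneq => // x0; rewrite divff ?rpred1. Qed.

Lemma vle_trans : transitive vle.
move=> y x z; rewrite /vle; case: (eqVneq) => [y0|y0].
  by move=> /eqP ->; rewrite mul0r rpred0 eqxx if_same.
case: (eqVneq) => [//|z0].
by move=> xy yz; have := rpredM xy yz; rewrite mulrA divfK.
Qed.

Lemma vle_total : total vle.
move=> x y; rewrite /vle; case: (eqVneq) => [->|y0].
  by rewrite mul0r rpred0 if_same orbT.
case: (eqVneq) => [->|x0]; first by rewrite mul0r rpred0.
by have := vr_total O (x / y); rewrite invf_div.
Qed.

Definition vequiv (x y : E) : bool := vle x y && vle y x.

Lemma vequiv_refl : reflexive vequiv.
by move=> x; rewrite /vequiv vle_refl. Qed.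
Lemma vequiv_sym : symmetric vequiv.
by move=> x y; rewrite /vequiv andbC. Qed.
Lemma vequiv_trans : transitive vequiv.
move=> y x z /andP[xy yx] /andP[yz zy].
by rewrite /vequiv (vle_trans xy yz) (vle_trans zy).
Qed.

Canonical vequiv_equiv := EquivRel vequiv vequiv_refl vequiv_sym vequiv_trans.

Definition absval : Type := {eq_quot vequiv}.

HB.instance Definition _ := Choice.on absval.

Definition nv (x : E) : absval := \pi_({eq_quot vequiv}) x.

Definition absval_le (a b : absval) : bool := vle (repr (a : {eq_quot vequiv})) (repr (b : {eq_quot vequiv})).

Lemma nv_eq x y : (nv x == nv y) = vequiv x y.
by rewrite eqmodE. Qed.
Lemma nv_repr x : vequiv (repr (nv x : {eq_quot vequiv})) x.
by rewrite -nv_eq /nv reprK. Qed.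

Lemma absval_leE x y : absval_le (nv x) (nv y) = vle x y.
have /andP[a1 a2] := nv_repr x; have /andP[b1 b2] := nv_repr y.
apply/idP/idP => h; first exact: vle_trans (vle_trans a2 h) b1.
exact: vle_trans (vle_trans a1 h) b2.
Qed.

Lemma absvalP a : exists x, a = nv x.
by exists (repr a); rewrite /nv reprK. Qed.
Lemma absval_le_refl : reflexive absval_le.
by move=> a; apply: vle_refl. Qed.
Lemma absval_le_trans : transitive absval_le.
by move=> a b c; apply: vle_trans. Qed.
Lemma absval_le_anti : antisymmetric absval_le.
move=> a b; have [x ->] := absvalP a; have [y ->] := absvalP b.
by rewrite !absval_leE => h; apply/eqP; rewrite nv_eq.
Qed.
Lemma absval_le_total : total absval_le.
by move=> a b; apply: vle_total. Qed.

Fact absval_display : Order.disp_t. Proof. by []. Qed.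

HB.instance Definition _ := Order.Le_isPOrder.Build absval_display absval absval_le_refl absval_le_anti absval_le_trans.
HB.instance Definition _ := Order.POrder_isTotal.Build absval_display absval absval_le_total.
End Value.

Notation "x <=_[ O ] y" := (nv O x <= nv O y)%O (at level 70, O at level 0, format "x  <=_[ O ]  y") : ring_scope.
Notation "x <_[ O ] y" := (nv O x < nv O y)%O (at level 70, O at level 0, format "x  <_[ O ]  y") : ring_scope.

(** * Ultrametric inequalities and leading terms *)

Section Norm.
Variables (E : fieldType) (O : valring E).
Implicit Types x y z : E.

Lemma nvE x y : (x <=_[O] y) = if y == 0 then x == 0 else x / y \in O.
exact: absval_leE. Qed.
Lemma nv_le1 x : (x <=_[O] 1) = (x \in O).
by rewrite nvE oner_eq0 divr1. Qed.
Lemma nv_le0 x : (x <=_[O] 0) = (x == 0).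
by rewrite nvE eqxx. Qed.
Lemma nv_ge0 x : 0 <=_[O] x.
by rewrite nvE mul0r rpred0 eqxx if_same. Qed.
Lemma nv_gt0 x : (0 <_[O] x) = (x != 0).
by rewrite ltNge nv_le0. Qed.
Lemma nv_eq0 x : (nv O x == nv O 0) = (x == 0).
by rewrite eq_le nv_le0 nv_ge0 andbT. Qed.

Lemma nv_leM x y z t : x <=_[O] y -> z <=_[O] t -> x * z <=_[O] y * t.
rewrite !nvE mulf_eq0; case: eqVneq => [_ /eqP ->|y0]; first by rewrite mul0r eqxx.
case: eqVneq => [_ _ /eqP ->|t0] /=; first by rewrite mulr0.
by move=> xy zt; rewrite invfM mulrACA rpredM.
Qed.

Lemma nv_leM2r z x y : z != 0 -> (x * z <=_[O] y * z) = (x <=_[O] y).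
move=> z0; rewrite !nvE mulf_eq0 (negbTE z0) orbF mulf_eq0 (negbTE z0) orbF.
by rewrite -mulf_div divff // mulr1.
Qed.

Lemma nv_leM2l z x y : z != 0 -> (z * x <=_[O] z * y) = (x <=_[O] y).
by move=> z0; rewrite ![z * _]mulrC nv_leM2r. Qed.
Lemma nv_ltM2r z x y : z != 0 -> (x * z <_[O] y * z) = (x <_[O] y).
by move=> z0; rewrite !ltNge nv_leM2r. Qed.
Lemma nv_ltM2l z x y : z != 0 -> (z * x <_[O] z * y) = (x <_[O] y).
by move=> z0; rewrite !ltNge nv_leM2l. Qed.
Lemma nv_eqM x y z t : nv O x = nv O y -> nv O z = nv O t -> nv O (x * z) = nv O (y * t).
by move=> xy zt; apply: le_anti; rewrite !nv_leM ?xy ?zt. Qed.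
Lemma nv_eqM2r z x y : z != 0 -> (nv O (x * z) == nv O (y * z)) = (nv O x == nv O y).
by move=> z0; rewrite !eq_le !nv_leM2r. Qed.

Lemma nv_ltM_le x y z t : x <_[O] y -> z <=_[O] t -> t != 0 -> x * z <_[O] y * t.
move=> xy zt t0; apply: (@le_lt_trans _ _ (nv O (x * t))); first exact: nv_leM.
by rewrite nv_ltM2r.
Qed.

Lemma nv_ltM x y z t : x <_[O] y -> z <_[O] t -> x * z <_[O] y * t.
move=> xy zt; apply: nv_ltM_le => //; first exact: ltW.
by rewrite -nv_gt0; apply: le_lt_trans zt; apply: nv_ge0.
Qed.

Lemma nv_leM1 x y : x <=_[O] 1 -> y <=_[O] 1 -> x * y <=_[O] 1.
by move=> hx hy; have := nv_leM hx hy; rewrite mulr1. Qed.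
Lemma nv_ltM1 x y : x <_[O] 1 -> y <=_[O] 1 -> x * y <_[O] 1.
by move=> hx hy; have := nv_ltM_le hx hy; rewrite mulr1 oner_eq0; apply. Qed.
Lemma nv_leX n x y : x <=_[O] y -> x ^+ n <=_[O] y ^+ n.
by move=> h; elim: n => [|n IH]; rewrite // !exprS nv_leM. Qed.
Lemma nv_ltX n x y : (0 < n)%N -> x <_[O] y -> x ^+ n <_[O] y ^+ n.
move=> + h; case: n => // n _; elim: n => [|n IH] => //.
by rewrite nv_ltM.
Qed.
Lemma nv_leX2 n x y : (0 < n)%N -> (x ^+ n <=_[O] y ^+ n) = (x <=_[O] y).
move=> n0; apply/idP/idP; last exact: nv_leX.
by apply: contraLR; rewrite -!ltNge => /(nv_ltX n0).
Qed.
Lemma nv_ltX2 n x y : (0 < n)%N -> (x ^+ n <_[O] y ^+ n) = (x <_[O] y).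
by move=> n0; rewrite !ltNge nv_leX2. Qed.
Lemma nv_eqX2 n x y : (0 < n)%N -> (nv O (x ^+ n) == nv O (y ^+ n)) = (nv O x == nv O y).
by move=> n0; rewrite !eq_le !nv_leX2. Qed.
Lemma nv_eqX n x y : nv O x = nv O y -> nv O (x ^+ n) = nv O (y ^+ n).
by move=> h; elim: n => // IH; rewrite !exprS; apply: nv_eqM. Qed.

Lemma nv_leV x y : x != 0 -> y != 0 -> (x^-1 <=_[O] y^-1) = (y <=_[O] x).
move=> x0 y0; rewrite -(nv_leM2r _ _ x0) mulVf // -(nv_leM2r _ _ y0) mul1r.
by rewrite mulrAC mulVf // mul1r.
Qed.

Lemma nv_ltV x y : x != 0 -> y != 0 -> (x^-1 <_[O] y^-1) = (y <_[O] x).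
by move=> x0 y0; rewrite !ltNge nv_leV. Qed.

Lemma nv_eqV x y : nv O x = nv O y -> nv O x^-1 = nv O y^-1.
have [->|x0] := eqVneq x 0.
  by move/esym/eqP; rewrite nv_eq0 => /eqP ->.
have [->|y0] := eqVneq y 0; first by move/eqP; rewrite nv_eq0 => /eqP ->.
by move=> h; apply: le_anti; rewrite !nv_leV // h lexx.
Qed.

Lemma nv_le_divl x y z : z != 0 -> (x / z <=_[O] y) = (x <=_[O] y * z).
by move=> z0; rewrite -(nv_leM2r _ _ z0) divfK. Qed.
Lemma nv_lt_divr x y z : z != 0 -> (x <_[O] y / z) = (x * z <_[O] y).
by move=> z0; rewrite -(nv_ltM2r _ _ z0) divfK. Qed.
Lemma nv_lt_divl x y z : z != 0 -> (x / z <_[O] y) = (x <_[O] y * z).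
by move=> z0; rewrite -(nv_ltM2r _ _ z0) divfK. Qed.

Lemma nvN x : nv O (- x) = nv O x.
have h y : - y <=_[O] y.
  have [->|y0] := eqVneq y 0; first by rewrite oppr0.
  by rewrite nvE (negbTE y0) mulNr divff // rpredN rpred1.
by apply: le_anti; rewrite h -{1}[x]opprK h.
Qed.

Lemma nvB x y : nv O (x - y) = nv O (y - x).
by rewrite -nvN opprB. Qed.

Lemma nv_leD x y z : x <=_[O] z -> y <=_[O] z -> x + y <=_[O] z.
rewrite !nvE; case: eqVneq => [_ /eqP -> /eqP ->|_]; first by rewrite addr0.
by move=> xz yz; rewrite mulrDl rpredD.
Qed.

Lemma nv_ltD x y z : x <_[O] z -> y <_[O] z -> x + y <_[O] z.
wlog xy : x y / x <=_[O] y => [H xz yz|xz yz].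
  by have [h|h] := orP (le_total (nv O x) (nv O y)); [|rewrite addrC]; apply: H.
by apply: le_lt_trans yz; apply: nv_leD.
Qed.

Lemma nv_leB x y z : x <=_[O] z -> y <=_[O] z -> x - y <=_[O] z.
by move=> xz yz; apply: nv_leD => //; rewrite nvN. Qed.
Lemma nv_ltB x y z : x <_[O] z -> y <_[O] z -> x - y <_[O] z.
by move=> xz yz; apply: nv_ltD => //; rewrite nvN. Qed.

Lemma nv_le_sum I r (P : pred I) F z : (forall i, P i -> F i <=_[O] z) -> \sum_(i <- r | P i) F i <=_[O] z.
move=> h; elim/big_ind: _ => //; first exact: nv_ge0.
by move=> x y; apply: nv_leD.
Qed.

Lemma nv_lt_sum I r (P : pred I) F z : z != 0 -> (forall i, P i -> F i <_[O] z) -> \sum_(i <- r | P i) F i <_[O] z.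
move=> z0 h; elim/big_ind: _ => //; first by rewrite nv_gt0.
by move=> x y; apply: nv_ltD.
Qed.

Lemma nv_dom x y : y <_[O] x -> nv O (x + y) = nv O x.
move=> yx; apply: le_anti; rewrite nv_leD ?(ltW yx) //=.
rewrite leNgt; apply/negP => h.
by have := nv_ltB h yx; rewrite addrK ltxx.
Qed.

Lemma nv_domB x y : y <_[O] x -> nv O (x - y) = nv O x.
by move=> h; rewrite nv_dom // nvN. Qed.

Lemma nv_prod_eq I r (F G : I -> E) : (forall i, nv O (F i) = nv O (G i)) ->
  nv O (\prod_(i <- r) F i) = nv O (\prod_(i <- r) G i).
move=> h; elim: r => [|i r IH]; first by rewrite !big_nil.
by rewrite !big_cons; apply: nv_eqM.
Qed.

(** A Bezout relation modulo [p] exhibits a natural number as the inverse of [n], and natural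
    numbers are integral. *)
Lemma nv_nat1 p n : p \in [pchar E] -> ~~ (p %| n)%N -> nv O n%:R = nv O 1.
move=> pE pn.
have pp : prime p := pcharf_prime pE.
have co : coprime n p by rewrite coprime_sym prime_coprime.
have n0 : (0 < n)%N by case: n pn co => //; rewrite dvdn0.
have [u v e _] := egcdnP p n0; rewrite (eqP co) in e.
have inO m : m%:R <=_[O] 1 by rewrite nv_le1 rpred_nat.
apply: le_anti; rewrite inO.
have e1 : u%:R * n%:R = (1 : E) by rewrite -natrM e natrD natrM (pcharf0 pE) mulr0 add0r.
by have := nv_leM (t := n%:R) (inO u) (lexx _); rewrite e1 mul1r.
Qed.

(** Equality of leading terms, that is in the multiplicative group modulo [1 + m] with [m] the
    maximal ideal; 0 is related to itself only. *)
Definition rveq x y : bool := (x == y) || (x - y <_[O] y).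

Lemma rveqxx x : rveq x x.
by rewrite /rveq eqxx. Qed.
Lemma rveq_nv x y : rveq x y -> nv O x = nv O y.
by case/orP => [/eqP -> //|h]; rewrite -[x](subrK y) addrC nv_dom.
Qed.
Lemma rveq_sym x y : rveq x y -> rveq y x.
move=> h; rewrite /rveq (rveq_nv h) nvB; case/orP: h => [/eqP ->|->].
  by rewrite eqxx.
by rewrite orbT.
Qed.

Lemma rveq_trans x y z : rveq x y -> rveq y z -> rveq x z.
move=> xy yz; have e := rveq_nv yz.
case/orP: xy => [/eqP -> //|xy]; case/orP: yz => [/eqP <-|yz].
  by rewrite /rveq xy orbT.
by apply/orP; right; rewrite -(subrK y x) -addrA nv_ltD // -e.
Qed.

Lemma rveq0 x : rveq x 0 = (x == 0).
by rewrite /rveq ltNge nv_ge0 orbF. Qed.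
Lemma rveq0l y : rveq 0 y = (y == 0).
by rewrite -rveq0; apply/idP/idP => /rveq_sym. Qed.
Lemma rveq_eq0 x y : rveq x y -> (x == 0) = (y == 0).
by move/rveq_nv => e; rewrite -!(nv_eq0) e. Qed.
Lemma rveqP x y : y != 0 -> rveq x y = (x - y <_[O] y).
move=> y0; rewrite /rveq; case: eqVneq => //= ->.
by rewrite subrr nv_gt0.
Qed.

Lemma rveqM x y z t : rveq x y -> rveq z t -> rveq (x * z) (y * t).
have [->|y0] := eqVneq y 0.
  by rewrite rveq0 => /eqP -> _; rewrite !mul0r rveqxx.
have [->|t0] := eqVneq t 0.
  by rewrite rveq0 => _ /eqP ->; rewrite !mulr0 rveqxx.
move=> xy zt; have e := rveq_nv zt; move: xy zt.
rewrite !rveqP ?mulf_neq0 // => xy zt.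
have -> : x * z - y * t = (x - y) * z + y * (z - t) by rewrite mulrBl mulrBr addrA subrK.
by rewrite nv_ltD ?nv_ltM2l // (nv_ltM_le) ?e.
Qed.

Lemma rveqV x y : rveq x y -> rveq x^-1 y^-1.
have [->|y0] := eqVneq y 0; first by rewrite rveq0 => /eqP ->; rewrite rveqxx.
move=> h; have x0 : x != 0 by rewrite (rveq_eq0 h).
have e := rveq_nv h.
rewrite rveqP ?invr_eq0 // -(nv_ltM2r _ _ (mulf_neq0 x0 y0)).
rewrite mulrBl mulrA mulVf // mul1r mulrCA mulVf // mulr1.
by move: h; rewrite rveqP // e nvB.
Qed.

Lemma rveqX n x y : rveq x y -> rveq (x ^+ n) (y ^+ n).
by move=> h; elim: n => [|n IH]; rewrite ?rveqxx // !exprS rveqM. Qed.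
Lemma rveq_lt x y : x - y <_[O] y -> rveq x y.
by rewrite /rveq => ->; rewrite orbT. Qed.

Lemma expBp p k x y : p \in [pchar E] -> (x - y) ^+ (p ^ k) = x ^+ (p ^ k) - y ^+ (p ^ k).
move=> pE; have pk : [pchar E].-nat (p ^ k)%N by rewrite pnatX pnatE ?pE // (pcharf_prime pE).
by rewrite exprDn_pchar // exprNn_pchar.
Qed.

Lemma rveq_pX p k x y : p \in [pchar E] -> rveq (x ^+ (p ^ k)) (y ^+ (p ^ k)) = rveq x y.
move=> pE; have pp := pcharf_prime pE; apply/idP/idP; last exact: rveqX.
have k0 : (0 < p ^ k)%N by rewrite expn_gt0 prime_gt0.
have [->|y0] := eqVneq y 0.
  by rewrite expr0n eqn0Ngt k0 !rveq0 expf_eq0 k0.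
by rewrite !rveqP ?expf_neq0 // -expBp // nv_ltX2.
Qed.
End Norm.

Section Mono.
Variables (E : fieldType) (O : valring E).
Implicit Types x y : E.

Lemma nv_leX1 n x : x <=_[O] 1 -> x ^+ n <=_[O] 1.
by move/(nv_leX n); rewrite expr1n. Qed.
Lemma nv_ltX1 n x : (0 < n)%N -> x <_[O] 1 -> x ^+ n <_[O] 1.
by move=> n0 /(nv_ltX n0); rewrite expr1n. Qed.
Lemma nv_gtX1 n x : (0 < n)%N -> 1 <_[O] x -> 1 <_[O] x ^+ n.
by move=> n0 /(nv_ltX n0); rewrite expr1n. Qed.
Lemma nv_leMl x y : x <=_[O] 1 -> x * y <=_[O] y.
by move=> h; have := nv_leM h (lexx (nv O y)); rewrite mul1r. Qed.
Lemma nv_leMr x y : y <=_[O] 1 -> x * y <=_[O] x.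
by rewrite mulrC; apply: nv_leMl. Qed.
Lemma nv_geMl x y : 1 <=_[O] x -> y <=_[O] x * y.
by move=> h; have := nv_leM h (lexx (nv O y)); rewrite mul1r. Qed.
Lemma nv_eqMl x y : nv O x = nv O 1 -> nv O (x * y) = nv O y.
by move=> h; rewrite (nv_eqM h (erefl (nv O y))) mul1r. Qed.
Lemma nv_eqMr x y : nv O y = nv O 1 -> nv O (x * y) = nv O x.
by rewrite mulrC; apply: nv_eqMl. Qed.
Lemma nv_ltMl x y : y != 0 -> (x * y <_[O] y) = (x <_[O] 1).
by move=> y0; rewrite -[X in (_ < nv O X)%O]mul1r nv_ltM2r. Qed.
Lemma nv_gtV1 x : x != 0 -> (1 <_[O] x^-1) = (x <_[O] 1).
by move=> x0; have := nv_ltV O (oner_neq0 E) x0; rewrite invr1. Qed.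

Lemma nv_ltV1 x : x != 0 -> (x^-1 <_[O] 1) = (1 <_[O] x).
by move=> x0; have := nv_ltV O x0 (oner_neq0 E); rewrite invr1. Qed.
End Mono.

Lemma poly_roots (E : closedF) (P : {poly E}) : P != 0 ->
  exists2 rs, P = lead_coef P *: \prod_(z <- rs) ('X - z%:P) & forall z, root P z = (z \in rs).
move=> P0; have [rs eP] := closed_field_poly_normal P; exists rs => // z.
by rewrite eP rootZ ?lead_coef_eq0 // root_prod_XsubC.
Qed.

(** Zorn's lemma in which a chain is used only through its union: two elements of the union lie in a
    common member. *)
Lemma maximal_set T (P : set T -> Prop) X0 s0 : X0 s0 -> P X0 -> (forall F Y, F Y -> (forall Z, F Z -> P Z) ->
    (forall s t, (exists2 Z, F Z & Z s) -> (exists2 Z, F Z & Z t) -> exists2 Z, F Z & Z s /\ Z t) ->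
    P (fun s => exists2 Z, F Z & Z s)) -> exists2 X, P X & forall Y, P Y -> (forall s, X s -> Y s) -> forall s, Y s -> X s.
move=> X0s PX0 un; have [|X [QX mX]] := @Zorn_bigcup _ (fun X => X = set0 \/ P X).
  move=> F FQ tot; have [[Y [FY Y0]]|nF] := pselect (exists Y, F Y /\ Y <> set0); last first.
    left; apply/seteqP; split=> // s [Y FY Ys]; apply: nF; exists Y; split=> // Y0.
    by rewrite Y0 in Ys.
  right; pose F' Z := F Z /\ Z <> set0.
  have -> : (\bigcup_(X in F) X)%classic = (fun s => exists2 Z, F' Z & Z s).
    apply/seteqP; split=> s [Z]; last by case=> FZ _ Zs; exists Z.
    by move=> FZ Zs; exists Z => //; split=> // Z0; rewrite Z0 in Zs.
  apply: (un F' Y) => // [Z [FZ Z0]|s t [Z [FZ Z0] Zs] [W [FW W0] Wt]]; first by case: (FQ _ FZ).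
  by have [ZW|WZ] := tot _ _ FZ FW; [exists W|exists Z] => //; split=> //; [apply: ZW|apply: WZ].
have X_neq0 : X <> set0.
  move=> e; apply: (mX X0); last by right.
  by rewrite e; split=> [s []|h]; apply: (h s0).
case: QX => // PX; exists X => // Y PY XY s Ys; apply: contrapT => nXs; apply: (mX Y); last by right.
by split=> // h; apply/nXs/h.
Qed.

Lemma ex_least P : (exists n, P n) -> exists n, P n /\ forall m, P m -> (n <= m)%N.
move=> ex; have ex' : exists n, `[< P n >] by have [n] := ex; exists n; apply/asboolP.
case: (ex_minnP ex') => n /asboolP Pn h; exists n; split=> // m Pm.
by apply: h; apply/asboolP.
Qed.

(** * Subfields, irreducible polynomials and separable elements *)

Section Subfields.
Variable E : fieldType.

Record subfield := Subfield { sf_pred :> {pred E}; sf_closed : divring_closed sf_pred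
}.

HB.instance Definition _ (N : subfield) := GRing.isDivringClosed.Build E (sf_pred N) (sf_closed N).

Definition sfclosed (P : E -> Prop) := [/\ P 1, forall x y, P x -> P y -> P (x - y) & forall x y, P x -> P y -> P (x / y)].

Lemma sf_of_closed P : sfclosed P -> divring_closed [pred x | `[< P x >]].
case=> h1 hB hV; split; first by rewrite -topredE; apply/asboolP.
  by move=> x y /asboolP hx /asboolP hy; apply/asboolP; exact: hB.
by move=> x y /asboolP hx /asboolP hy; apply/asboolP; exact: hV.
Qed.

Definition sf_of P (h : sfclosed P) := Subfield (sf_of_closed h).

Lemma sf_ofE P (h : sfclosed P) x : (x \in sf_of h) <-> P x.
by rewrite /=; split => [/asboolP|?]; last apply/asboolP. Qed.

Section Carrier.
Variable N : subfield.

Definition sfT : Type := {x : E | x \in N}.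

HB.instance Definition _ := [isSub of sfT for @sval E (fun x => x \in N)].
HB.instance Definition _ := [Choice of sfT by <:].
HB.instance Definition _ := [SubChoice_isSubComUnitRing of sfT by <:].
HB.instance Definition _ := [SubComUnitRing_isSubIntegralDomain of sfT by <:].
HB.instance Definition _ := [SubIntegralDomain_isSubField of sfT by <:].

Lemma over_sfP P : reflect (exists Q : {poly sfT}, P = map_poly val Q) (P \over N).
apply: (iffP idP) => [/polyOverP h|[Q ->]]; last first.
  by apply/polyOverP => i; rewrite coef_map; apply: valP.
exists (\poly_(i < size P) (Sub P`_i (h i) : sfT)); apply/polyP => i.
by rewrite coef_map coef_poly; case: ltnP => // hi; rewrite nth_default.
Qed.

Lemma sf_divp P Q : P \over N -> Q \over N -> P %/ Q \over N.
move=> /over_sfP[P' ->] /over_sfP[Q' ->].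
by apply/over_sfP; exists (P' %/ Q'); rewrite map_divp.
Qed.
Lemma sf_modp P Q : P \over N -> Q \over N -> P %% Q \over N.
move=> /over_sfP[P' ->] /over_sfP[Q' ->].
by apply/over_sfP; exists (P' %% Q'); rewrite map_modp.
Qed.
Lemma sf_gcdp P Q : P \over N -> Q \over N -> gcdp P Q \over N.
move=> /over_sfP[P' ->] /over_sfP[Q' ->].
by apply/over_sfP; exists (gcdp P' Q'); rewrite gcdp_map.
Qed.

Definition irr (P : {poly E}) := [/\ P \over N, (1 < size P)%N & forall Q, Q \over N -> Q %| P -> size Q != 1%N -> Q %= P].

Definition alg_over (z : E) := exists P, [/\ P \over N, P != 0 & root P z].

(** A simple root of some polynomial, rather than of the minimal one: this form passes to larger
    fields at once. *)
Definition sepalg (z : E) := exists P, [/\ P \over N, root P z & ~~ root P^`() z].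

Lemma irr_neq0 P : irr P -> P != 0.
by case=> _ h _; rewrite -size_poly_gt0 ltnW. Qed.

Lemma irr_dvdp P Q z : irr P -> root P z -> Q \over N -> root Q z -> P %| Q.
move=> iP Pz NQ Qz; have P0 := irr_neq0 iP; case: iP => NP _ h.
have g : root (gcdp P Q) z by rewrite root_gcd Pz.
have /eqp_dvdl <- : gcdp P Q %= P.
  apply: h; rewrite ?dvdp_gcdl ?sf_gcdp //.
  by rewrite gtn_eqF // (root_size_gt1 _ g) ?gcdp_eq0 ?(negbTE P0).
by rewrite dvdp_gcdr.
Qed.

Lemma algebraic_irr z : alg_over z -> exists P, [/\ irr P, P \is monic & root P z].
case=> P0 [N0 P00 r0].
have [n [[P [NP Pn0 Pz sP]] min]] : exists n, (exists P, [/\ P \over N, P != 0, root P z & size P = n]) /\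
    forall m, (exists P, [/\ P \over N, P != 0, root P z & size P = m]) -> (n <= m)%N.
  by apply: ex_least; exists (size P0), P0.
pose R := (lead_coef P)^-1 *: P.
have l0 : lead_coef P != 0 by rewrite lead_coef_eq0.
have lN : lead_coef P \in N by apply: (polyOverP).
have : R \over N by apply: polyOverZ; rewrite ?rpredV.
have Rz : root R z by rewrite rootZ // invr_eq0.
have sR : size R = n by rewrite size_scale ?invr_eq0.
have R0 : R != 0 by rewrite scaler_eq0 invr_eq0 (negbTE l0).
exists R; split=> //; last by rewrite monicE lead_coefZ mulVf.
split=> //; first exact: root_size_gt1 Rz.
move=> Q NQ QR sQ; have Q0 : Q != 0 by apply: contraNneq R0 => Q0; move: QR; rewrite Q0 dvd0p.
have e : R = R %/ Q * Q by rewrite divpK.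
have Q'0 : R %/ Q != 0 by apply: contraNneq R0 => h; rewrite e h mul0r.
have [Qz|Qz] := boolP (root Q z).
  rewrite -dvdp_size_eqp // eqn_leq dvdp_leq // sR.
  by apply: min; exists Q.
have Q'z : root (R %/ Q) z by move: Rz; rewrite {1}e rootM (negbTE Qz) orbF.
have : (n <= size (R %/ Q)%R)%N by apply: min; exists (R %/ Q); rewrite sf_divp.
have := size_mul Q'0 Q0; rewrite -e sR.
move: sQ; rewrite -size_poly_gt0 in Q0.
case: (size) Q0 => [|[|k]] // _ _; rewrite !addnS => ->.
by rewrite leqNgt leq_addr.
Qed.

Lemma irr_separable P : irr P -> P^`() != 0 -> separable_poly P.
move=> iP d0; have P0 := irr_neq0 iP; case: iP => NP sP h.
apply: contraT; rewrite separable_poly.unlock => s1.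
have /eqp_dvdl e : gcdp P P^`() %= P by (apply: h; rewrite ?dvdp_gcdl // sf_gcdp ?polyOver_deriv).
have : P %| P^`() by rewrite -e dvdp_gcdr.
move/(dvdp_leq d0); rewrite leqNgt lt_size_deriv //.
Qed.

Lemma irr_comp P x : irr P -> x \in N -> irr (P \Po ('X + x%:P)).
move=> iP xN; case: iP => NP sP h; split.
- by apply: polyOver_comp; rewrite ?polyOverXaddC.
- by rewrite size_comp_poly2 // size_XaddC.
move=> Q NQ QP sQ.
have k R : (R \Po ('X - x%:P)) \Po ('X + x%:P) = R by rewrite -comp_polyA comp_polyB comp_polyX comp_polyC addrK comp_polyXr.
have k' R : (R \Po ('X + x%:P)) \Po ('X - x%:P) = R by rewrite -comp_polyA comp_polyD comp_polyX comp_polyC subrK comp_polyXr.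
rewrite -[Q]k.
have /eqpf_eq[c c0 ->] : Q \Po ('X - x%:P) %= P.
  apply: h; first by apply: polyOver_comp; rewrite ?polyOverXsubC.
    by rewrite -[P]k' dvdp_comp_poly.
  by rewrite size_comp_poly2 // size_XsubC.
by rewrite comp_polyZ eqp_scale.
Qed.
End Carrier.

Lemma subfieldN0 (N : subfield) : 0 \in N. Proof. exact: rpred0. Qed.
End Subfields.

Section PrimeChar.
Variables (E : fieldType) (p : nat) (pE : p \in [pchar E]).

Definition perf_sf (N : subfield E) := forall x, x \in N -> exists2 y, y \in N & x = y ^+ p.

Lemma deriv0_coef (P : {poly E}) i : P^`() = 0 -> ~~ (p %| i)%N -> P`_i = 0.
move=> d0; case: i => [|i]; first by rewrite dvdn0.
move=> pi; have := coef_deriv P i; rewrite d0 coef0 -mulr_natr => /esym/eqP.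
by rewrite mulf_eq0 -(dvdn_pcharf pE) (negbTE pi) orbF => /eqP.
Qed.

Lemma frob_inj (x y : E) : x ^+ p = y ^+ p -> x = y.
apply: (fmorph_inj (pFrobenius_aut pE)). Qed.

(** If the derivative vanished, the polynomial would be one in [X ^+ p] and, with [p]-th roots of
    its coefficients in [N], a proper [p]-th power. *)
Lemma perfect_irr_separable N P : perf_sf N -> irr N P -> separable_poly P.
move=> perf iP; apply: irr_separable (iP) _; apply/eqP => d0.
case: iP => NP sP h.
have pp := pcharf_prime pE.
have [i|r rP] := @choice _ _ (fun i y => y \in N /\ P`_(i * p) = y ^+ p).
  by have [y] := perf _ (polyOverP NP (i * p)%N); exists y.
pose Q := \poly_(i < size P) r i.
have e : P = Q ^+ p.
  rewrite -[Q ^+ p]/(pFrobenius_aut (rmorph_pchar polyC pE) Q).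
  rewrite /Q poly_def rmorph_sum /=; apply/polyP => i; rewrite coef_sum.
  under eq_bigr => j.
    rewrite pFrobenius_autE exprZn -exprM -(proj2 (rP _)) coefZ coefXn; over.
  have [pi|pi] := boolP (p %| i)%N; last first.
    rewrite (deriv0_coef d0 pi) big1 // => j.
    by case: eqP => [e|]; rewrite ?mulr0 //; move: pi; rewrite e dvdn_mull.
  have [si|si] := ltnP i (size P); last first.
    rewrite nth_default // big1 // => j.
    by case: eqP => [<-|]; rewrite ?mulr0 // nth_default ?mul0r.
  have ik : (i %/ p < size P)%N by apply: leq_ltn_trans si; apply: leq_div.
  rewrite (bigD1 (Ordinal ik)) //= divnK // eqxx mulr1 big1 ?addr0 //.
  move=> j ji; case: eqP => [e|]; rewrite ?mulr0 //.
  by case/eqP: ji; apply: val_inj; rewrite /= e mulnK // prime_gt0.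
have NQ : Q \over N by apply: polyOver_poly => i _; case: (rP i).
have /eqp_size : Q %= P.
  apply: h => //; first by rewrite e -(prednK (prime_gt0 pp)) exprS dvdp_mulr.
  apply: contraL sP => /eqP sQ; rewrite e.
  by rewrite -leqNgt (leq_trans (size_poly_exp_leq _ _)) // sQ.
move: sP; rewrite e => sP sQ; have := size_exp Q p; move: sP; rewrite -sQ.
case: (size) => [|[|m]] //= _ /esym/eqP; rewrite -[X in _ == X]muln1 eqn_pmul2l //.
by move=> /eqP p1; rewrite p1 in pp.
Qed.
End PrimeChar.

Section ClosedField.
Variable E : closedF.

Lemma monic_roots P : P \is monic -> exists rs : seq E, P = \prod_(z <- rs) ('X - z%:P).
move=> /monicP lP; have [rs e] := closed_field_poly_normal P.
by exists rs; rewrite e lP scale1r.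
Qed.

Lemma size_gt1_root (P : {poly E}) : (1 < size P)%N -> exists z, root P z.
by move=> sP; apply/closed_rootP; rewrite gtn_eqF. Qed.
End ClosedField.

(** * Chevalley's existence theorem for valuation rings *)

Section Chevalley.
Variable E : fieldType.
Implicit Types (R I : E -> Prop).

Definition subring_closed_prop R := [/\ R 1, forall x y, R x -> R y -> R (x - y) & forall x y, R x -> R y -> R (x * y)].

Definition proper_ideal R I := [/\ I 0, forall x y, I x -> I y -> I (x - y),
      forall x y, R x -> I y -> I (x * y), forall x, I x -> R x & ~ I 1].

Let good R I := subring_closed_prop R /\ proper_ideal R I.

Lemma proper_ideal_maximal R0 I0 : good R0 I0 -> exists R I, [/\ good R I, (forall x, R0 x -> R x), (forall x, I0 x -> I x)
    & forall R' I', good R' I' -> (forall x, R x -> R' x) -> (forall x, I x -> I' x) ->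
        (forall x, R' x -> R x) /\ (forall x, I' x -> I x)].
move=> g0.
(* A ring and an ideal are encoded as one subset of a disjoint sum, to which Zorn's lemma
   applies. *)
pose P (X : set (E + E)) := [/\ good (fun x => X (inl x)) (fun x => X (inr x)),
  (forall x, R0 x -> X (inl x)) & (forall x, I0 x -> X (inr x))].
pose enc R I : set (E + E)%type := fun s => match s with inl x => R x | inr x => I x end.
have [||F Y FY FP up|X [gX hR hI] mX] := @maximal_set _ P (enc R0 I0) (inl 1).
- by case: g0 => [[]].
- by split.
- have {}up s t : (exists2 Z, F Z & Z s) -> (exists2 Z, F Z & Z t) ->
      exists Z, [/\ F Z, good (fun x => Z (inl x)) (fun x => Z (inr x)), Z s & Z t].
    by move=> hs ht; have [Z FZ [Zs Zt]] := up _ _ hs ht; have [] := FP _ FZ; exists Z.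
  have [[[h1 _ _] [i0 _ _ _ _]] hR hI] := FP _ FY.
  split; [split; split|by move=> x /hR; exists Y|by move=> x /hI; exists Y].
  - by exists Y.
  - by move=> x y hx hy; have [Z [FZ [[_ k _] _] Zx Zy]] := up _ _ hx hy; exists Z => //; apply: k.
  - by move=> x y hx hy; have [Z [FZ [[_ _ k] _] Zx Zy]] := up _ _ hx hy; exists Z => //; apply: k.
  - by exists Y.
  - by move=> x y hx hy; have [Z [FZ [_ [_ k _ _ _]] Zx Zy]] := up _ _ hx hy; exists Z => //; apply: k.
  - by move=> x y hx hy; have [Z [FZ [_ [_ _ k _ _]] Zx Zy]] := up _ _ hx hy; exists Z => //; apply: k.
  - by move=> x hx; have [Z [FZ [_ [_ _ _ k _]] Zx _]] := up _ _ hx hx; exists Z => //; apply: k.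
  - by move=> hx; have [Z [FZ [_ [_ _ _ _ k]]]] := up _ _ hx hx.
exists (fun x => X (inl x)), (fun x => X (inr x)); split=> // R' I' g' RR' II'.
have {}mX := mX (enc R' I') (And3 g' (fun x h => RR' _ (hR x h)) (fun x h => II' _ (hI x h))).
by split=> x; [apply: (mX _ (inl x)); case|apply: (mX _ (inr x)); case].
Qed.

(* The descent on the degree of relations witnessing that both [R[x]] and
   [R[1/x]] are generated by the maximal ideal. *)
Theorem chevalley R0 I0 : good R0 I0 -> exists V : valring E, (forall x, R0 x -> x \in V) /\ (forall x, I0 x -> x <_[V] 1).
move=> g0; have [R [I [gR hR hI mx]]] := proper_ideal_maximal g0.
have [[h1 hB hM] [i0 iB iM iR i1]] := gR.
have r0 : R 0 by rewrite -(subrr 1); apply: hB.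
have rN x : R x -> R (- x) by move=> hx; rewrite -sub0r; apply: hB.
have rD x y : R x -> R y -> R (x + y) by (move=> hx hy; rewrite -[y]opprK; apply: hB => //; apply: rN).
have iN x : I x -> I (- x) by move=> hx; rewrite -sub0r; apply: iB.
have iD x y : I x -> I y -> I (x + y) by (move=> hx hy; rewrite -[y]opprK; apply: iB => //; apply: iN).
have rX x n : R x -> R (x ^+ n) by (move=> hx; elim: n => [|n IH]; rewrite // exprS; apply: hM).
pose pR S (P : {poly E}) := forall i, S P`_i.
have n0 i : I i -> 1 - i != 0 by (move=> hi; apply/eqP => /eqP; rewrite subr_eq0 => /eqP e; apply: i1; rewrite e).
(* By maximality [R[x]] with the ideal generated by [I] is not a proper pair, so 1 is a polynomial
   in [x] with coefficients in [I]. *)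
have adj x : ~ R x -> exists P, pR I P /\ P.[x] = 1.
  move=> nx; apply: contrapT => nP.
  have cst S y : S 0 -> S y -> pR S y%:P by move=> S0 Sy i; rewrite coefC; case: eqP.
  have sB S P Q : (forall x y, S x -> S y -> S (x - y)) -> pR S P -> pR S Q -> pR S (P - Q) by (move=> SB hP hQ i; rewrite coefB; apply: SB).
  pose eva S y := exists P, pR S P /\ y = P.[x].
  have evB S : (forall x y, S x -> S y -> S (x - y)) -> forall y z, eva S y -> eva S z -> eva S (y - z).
    by move=> SB _ _ [P [hP ->]] [Q [hQ ->]]; exists (P - Q); rewrite hornerD hornerN; split=> //; apply: sB.
  have evM S : S 0 -> (forall x y, S x -> S y -> S (x + y)) -> (forall x y, R x -> S y -> S (x * y)) ->
      forall y z, eva R y -> eva S z -> eva S (y * z).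
    move=> S0 SD SM _ _ [P [hP ->]] [Q [hQ ->]]; exists (P * Q); rewrite hornerM; split=> // i.
    by rewrite coefM; elim/big_ind: _ => // j _; apply: SM.
  have [|y hy|y hy|h _] := mx (eva R) (eva I); last first.
  - by apply: nx; apply: h; exists 'X; split=> [i|]; rewrite ?hornerX // coefX; case: eqP.
  - by exists y%:P; rewrite hornerC; split=> //; apply: cst.
  - by exists y%:P; rewrite hornerC; split=> //; apply: cst.
  split; split; [|exact: evB|by move=> z; apply: evM| |exact: evB|by move=> z; apply: evM| |].
  - by exists 1%:P; rewrite hornerC; split=> //; apply: cst.
  - by exists 0%:P; rewrite hornerC; split=> //; apply: cst.
  - by move=> _ [P [hP ->]]; exists P; split=> // i; apply: iR.
  - by move=> [P [hP e]]; apply: nP; exists P.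
(* The ring is local: clearing denominators in a relation for the inverse of [1 - i] would put a
   power of [1 - i], and hence 1, into [I]. *)
have unit1 i : I i -> R (1 - i)^-1.
  move=> hi; apply: contrapT => /adj[P [hP e]]; have d0 := n0 _ hi; set d := 1 - i in d0.
  have Rd : R d by apply: hB => //; apply: iR.
  have dn n : I (1 - d ^+ n).
    elim: n => [|n IH]; first by rewrite subrr.
    have -> : 1 - d ^+ n.+1 = (1 - d ^+ n) + d ^+ n * i by rewrite exprSr /d; ring.
    by apply: iD => //; apply: iM => //; apply: rX.
  have : I (d ^+ size P).
    rewrite -[_ ^+ _]mul1r -e horner_coef mulr_suml; elim/big_ind: _ => // k _.
    move: (nat_of_ord k) (ltnW (ltn_ord k)) => l ln.
    rewrite exprVn -(subnK ln) exprD mulrACA mulVf ?expf_neq0 // mulr1 mulrC.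
    by apply: iM => //; apply: rX.
  by move=> /iD/(_ (dn (size P))); rewrite addrC subrK.
have tot x : R x \/ R x^-1.
  have [->|x0] := eqVneq x 0; first by left.
  apply: contrapT => /not_orP[nx nx'].
  (* [P] has degree at most [n] in [y], [Q] at most [m] in [1/y]. *)
  pose rel y n := y != 0 /\ exists P, [/\ pR I P, P.[y] = 1 & (size P <= n.+1)%N].
  have relx y : y != 0 -> ~ R y -> exists n, rel y n.
    move=> y0 ny; have [P [e]] := adj _ ny; exists (size P); split=> //.
    by exists P.
  have step y n m : rel y n -> rel y^-1 m -> (m <= n)%N -> exists2 n', (n' < n)%N & rel y n'.
    move=> [y0 [P [hP eP sP]]] [_ [Q [hQ eQ sQ]]] mn.
    have : (0 < n)%N.
      case: n sP {mn} => // sP; case: i1.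
      by rewrite -eP (size1_polyC sP) hornerC.
    pose u := (1 - Q`_0)^-1.
    have : R u by apply: unit1.
    have : 1 - Q`_0 != 0 by apply: n0.
    (* The relation for [y^-1], multiplied by [y ^+ n] and solved for [y ^+ n], replaces the leading
       term of [P]. *)
    pose P1 := \poly_(i < n) (P`_i + P`_n * u * Q`_(n - i)).
    exists n.-1; first by rewrite prednK.
    split=> //; exists P1; split.
    - move=> i; rewrite coef_poly; case: ifP => // _.
      by apply: iD => //; apply: iM => //; apply: hM => //; apply: iR.
    - rewrite horner_poly.
      have eQ' : \sum_(i < n) Q`_(n - i) * y ^+ i = (1 - Q`_0) * y ^+ n.
        have e1 : 1 = \sum_(i < n.+1) Q`_i * y^-1 ^+ i.
          rewrite -{1}eQ (horner_coef_wide (n := n.+1)) //.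
          exact: leq_trans sQ _.
        rewrite mulrBl mul1r {1}[y ^+ n](_ : _ = \sum_(i < n.+1) Q`_i * y ^+ (n - i)).
          rewrite big_ord_recl subn0 [X in X - _]addrC addrK.
          rewrite (reindex_inj rev_ord_inj) /=; apply: eq_bigr => i.
          rewrite ?subKn //.
        rewrite -{1}[y ^+ n]mul1r e1 mulr_suml; apply: eq_bigr => i _.
        rewrite -mulrA exprVn; congr (_ * _).
        have hi : (nat_of_ord i <= n)%N by rewrite -ltnS.
        move: (nat_of_ord i) hi => k hi; by rewrite -[in LHS](subnK hi) exprD mulrCA mulVf ?mulr1 // expf_neq0.
      under eq_bigr => i do rewrite mulrDl -!mulrA.
      rewrite big_split -!mulr_sumr eQ' [u * _]mulrA mulVf // mul1r.
      rewrite -eP (horner_coef_wide _ sP) big_ord_recr.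
      by [].
    - by rewrite prednK // size_poly.
  have desc k : forall y n m, (n + m <= k)%N -> rel y n -> rel y^-1 m -> False.
    elim: k => [|k IH] y n m h hn hm.
      have [] := step y n m hn hm _; first by move: h; lia.
      by move: h; case: n {hn}.
    have [mn|mn] := leqP m n.
      have [n' n'n hn'] := step y n m hn hm mn.
      by apply: (IH y n' m) => //; lia.
    have hn' : rel y^-1^-1 n by rewrite invrK.
    have [m' hm'] := step _ _ _ hm hn' (ltnW mn).
    by apply: (IH y n) => //; lia.
  have [n hn] := relx x x0 nx; have [|m] := relx x^-1 _ nx'; first by rewrite invr_eq0.
  exact: (desc (n + m)%N).
have cl : subring_closed [pred x | `[< R x >]].
  split; first exact/asboolP.
    by move=> x y /asboolP hx /asboolP hy; apply/asboolP; exact: hB.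
  by move=> x y /asboolP hx /asboolP hy; apply/asboolP; exact: hM.
have tt x : (x \in [pred x | `[< R x >]]) || (x^-1 \in [pred x | `[< R x >]]) by (case: (tot x) => h; apply/orP; [left|right]; apply/asboolP).
exists (ValuationRing cl tt); split=> x hx.
  by apply/asboolP; apply: hR.
have {}hx := hI _ hx; rewrite ltNge; apply/negP.
have [->|x0] := eqVneq x 0; first by rewrite nv_le0 oner_eq0.
rewrite nvE (negbTE x0) div1r => /asboolP h; apply: i1.
by rewrite -(mulVf x0); apply: iM.
Qed.
End Chevalley.

(** * Linear algebra over a subfield *)

Section Span.
Variables (E : fieldType) (N : subfield E).

Definition spans n (u : 'I_n -> E) (x : E) := exists a : 'I_n -> E, (forall i, a i \in N) /\ x = \sum_i a i * u i.

Definition lfree n (u : 'I_n -> E) := forall a : 'I_n -> E, (forall i, a i \in N) -> \sum_i a i * u i = 0 -> forall i, a i = 0.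

Lemma spans_id n (u : 'I_n -> E) i : spans u (u i).
exists (fun j => (j == i)%:R); split=> [j|]; first by rewrite rpred_nat.
rewrite (bigD1 i) //= eqxx mul1r big1 ?addr0 // => j /negbTE ->.
by rewrite mul0r.
Qed.

Lemma spans0 n (u : 'I_n -> E) : spans u 0.
by exists (fun=> 0); rewrite ?rpred0 big1 // => i _; rewrite mul0r.
Qed.

Lemma spansB n (u : 'I_n -> E) x y : spans u x -> spans u y -> spans u (x - y).
move=> [a [aN ->]] [b [bN ->]]; exists (fun i => a i - b i).
split=> [i|]; first by rewrite rpredB.
by rewrite -sumrB; apply: eq_bigr => i _; rewrite mulrBl.
Qed.

Lemma spansD n (u : 'I_n -> E) x y : spans u x -> spans u y -> spans u (x + y).
move=> hx hy; rewrite -[y]opprK; apply: spansB => //.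
by rewrite -sub0r; apply: spansB => //; apply: spans0.
Qed.

Lemma spansZ n (u : 'I_n -> E) c x : c \in N -> spans u x -> spans u (c * x).
move=> cN [a [aN ->]]; exists (fun i => c * a i).
split=> [i|]; first by rewrite rpredM.
by rewrite mulr_sumr; apply: eq_bigr => i _; rewrite mulrA.
Qed.

Lemma spans_sum n (u : 'I_n -> E) I r (Q : pred I) F : (forall i, Q i -> spans u (F i)) -> spans u (\sum_(i <- r | Q i) F i).
move=> h; elim/big_ind: _ => //; first exact: spans0.
apply: spansD.
Qed.

Lemma spans_trans n m (u : 'I_n -> E) (v : 'I_m -> E) x : spans u x -> (forall i, spans v (u i)) -> spans v x.
by move=> [a [aN ->]] h; apply: spans_sum => i _; apply: spansZ.
Qed.

Lemma span_matrix n m u v : (forall j, spans u (v j)) -> exists A : 'M[sfT N]_(m, n), forall j, v j = \sum_i val (A j i) * u i.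
move=> h; have [a ha] := choice h.
exists (\matrix_(j, i) (Sub (a j i) (proj1 (ha j) i) : sfT N)) => j.
rewrite {1}(proj2 (ha j)); apply: eq_bigr => i.
by rewrite mxE.
Qed.

(** Expressing the [v j] in the [u i] gives a matrix with more rows than columns, whose left kernel
    provides a relation. *)
Lemma span_dep n m (u : 'I_n -> E) (v : 'I_m -> E) : (n < m)%N -> (forall j, spans u (v j)) -> ~ lfree v.
move=> nm /span_matrix[A hA] fv.
have : kermx A != 0.
  rewrite -mxrank_eq0 mxrank_ker -lt0n subn_gt0.
  exact: leq_ltn_trans (rank_leq_col A) nm.
case/rowV0Pn => c /sub_kermxP cA /eqP; apply; apply/rowP => j; rewrite mxE.
apply: val_inj.
apply: (fv (fun j => val (c 0 j))); first by move=> i; apply: valP.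
under eq_bigr => k do rewrite hA mulr_sumr.
rewrite exchange_big big1 //= => i.
under eq_bigr => k do rewrite mulrA.
rewrite -mulr_suml; move/matrixP: cA => /(_ 0 i); rewrite !mxE => /(congr1 val).
by rewrite rmorph_sum => ->; rewrite mul0r.
Qed.

Lemma not_lfree n (u : 'I_n.+1 -> E) : ~ lfree u -> exists k, spans (fun i => u (lift k i)) (u k).
move=> nf; have [a [aN e [k ak]]] : exists a : 'I_n.+1 -> E,
    [/\ (forall i, a i \in N), \sum_i a i * u i = 0 & exists k, a k != 0].
  apply: contrapT => h; apply: nf => a aN e i; apply: contrapT => /eqP ai.
  by apply: h; exists a; split=> //; exists i.
exists k, (fun i => - a (lift k i) / a k); split=> [i|].
  by rewrite rpredM ?rpredN // rpredV.
apply: (mulfI ak); rewrite mulr_sumr.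
move/eqP: e; rewrite (bigD1_ord k) //= addr_eq0 -sumrN => /eqP ->.
by apply: eq_bigr => i _; field.
Qed.

(** A dependent spanning family could be shortened, and [span_dep] would contradict the freeness of
    [u]. *)
Lemma span_lfree n (u v : 'I_n -> E) : lfree u -> (forall i, spans v (u i)) -> lfree v.
case: n u v => [|n] u v fu h; first by move=> a _ _ [].
apply: contrapT => /not_lfree[k hk].
apply: (@span_dep n n.+1 (fun i => v (lift k i)) u) => // j.
apply: spans_trans (h j) _ => i.
by case: (unliftP k i) => [i' ->|->] //; apply: spans_id.
Qed.

Lemma spans_basis n (u : 'I_n -> E) : exists d (w : 'I_d -> E), [/\ lfree w, forall i, spans w (u i) & forall i, spans u (w i)].
have [d [[w [hu hw]] min]] := @ex_least (fun d => exists w : 'I_d -> E, (forall i, spans w (u i)) /\ (forall i, spans u (w i)))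
  (ex_intro _ n (ex_intro _ u (conj (spans_id u) (spans_id u)))).
exists d, w; split=> //; case: d w hu hw min => [|d] w hu hw min.
  by move=> a _ _ [].
apply: contrapT => /not_lfree[k hk].
suff h : (d.+1 <= d)%N by rewrite ltnn in h.
apply: min; exists (fun i => w (lift k i)); split=> i => //.
apply: spans_trans (hu i) _ => j.
by case: (unliftP k j) => [j' ->|->] //; apply: spans_id.
Qed.

Lemma lfree_matrix n m u (A : 'M[sfT N]_(m, n)) : lfree u -> row_free A -> lfree (fun j => \sum_i val (A j i) * u i).
move=> fu /row_free_inj fA c cN; under eq_bigr => j do rewrite mulr_sumr.
rewrite exchange_big.
under eq_bigr => i. under eq_bigr => j do rewrite mulrA. rewrite -mulr_suml. over.
move=> /fu h j.
pose c' : 'rV[sfT N]_m := \row_j Sub (c j) (cN j).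
have : c' = 0.
  apply: fA; rewrite mul0mx; apply/rowP => i; rewrite !mxE; apply: val_inj.
  rewrite rmorph_sum -[RHS](h _ i).
    by apply: eq_bigr => k _; rewrite mxE.
  by move=> {}i; apply: rpred_sum => k _; rewrite rpredM //; apply: (valP).
by move/rowP/(_ j)/(congr1 val); rewrite !mxE.
Qed.

Lemma matrix_lfree n m (u : 'I_n -> E) (A : 'M[sfT N]_(m, n)) : lfree (fun j => \sum_i val (A j i) * u i) -> row_free A.
move=> f; rewrite -kermx_eq0; apply/rowV0P => c /sub_kermxP cA.
apply/rowP => j; rewrite mxE; apply: val_inj.
apply: (f (fun j => val (c 0 j))); first by move=> i; apply: valP.
under eq_bigr => k do rewrite mulr_sumr.
rewrite exchange_big big1 //= => i.
under eq_bigr => k do rewrite mulrA.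
rewrite -mulr_suml; move/matrixP: cA => /(_ 0 i); rewrite !mxE => /(congr1 val).
by rewrite rmorph_sum => ->; rewrite mul0r.
Qed.

Lemma powers_dep m s : ~ lfree (fun i : 'I_m => s ^+ i) -> exists T, [/\ T \over N, T != 0, (size T <= m)%N & root T s].
case: m => [[] //|m nf]; first by move=> a _ _ [].
apply: contrapT => na; apply: nf => a aN e i; apply: contrapT => ai; apply: na.
exists (\poly_(i < m.+1) a (inord i)); split.
- exact: polyOver_poly.
- by apply/eqP => /polyP/(_ i); rewrite coef_poly ltn_ord inord_val coef0.
- by [].
- rewrite /root horner_poly -[X in _ == X]e; apply/eqP; apply: eq_bigr => k.
  by rewrite inord_val.
Qed.

Lemma lfree_powers m s : (forall T, T \over N -> T != 0 -> root T s -> (m < size T)%N) -> lfree (fun i : 'I_m => s ^+ i).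
move=> h; apply: contrapT => /powers_dep[T [NT T0 sT Ts]].
by have := h T NT T0 Ts; rewrite ltnNge sT.
Qed.

Definition pfam n m (u : 'I_n -> E) (v : 'I_m -> E) (k : 'I_#|{: 'I_n * 'I_m}|) := u (enum_val k).1 * v (enum_val k).2.

Lemma spans_product n m (u : 'I_n -> E) (v : 'I_m -> E) x y : spans u x -> spans v y -> spans (pfam u v) (x * y).
move=> [a [aN ->]] [b [bN ->]]; rewrite mulr_suml; apply: spans_sum => i _.
rewrite mulr_sumr; apply: spans_sum => j _; rewrite mulrACA; apply: spansZ; rewrite ?rpredM //.
by have := spans_id (pfam u v) (enum_rank (i, j)); rewrite /pfam enum_rankK.
Qed.
End Span.

Section Adjunction.
Variables (E : fieldType) (N : subfield E).

Definition polyvals (z x : E) := exists2 S, S \over N & x = S.[z].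

Lemma polyvals_closed z : alg_over N z -> sfclosed (polyvals z).
move=> /algebraic_irr[P [iP mP Pz]]; split.
- by exists 1; rewrite ?rpred1 // hornerC.
- move=> _ _ [S NS ->] [T NT ->]; exists (S - T); first by rewrite rpredB.
  by rewrite hornerD hornerN.
- move=> _ _ [S NS ->] [T NT ->].
  have [T0|T0] := eqVneq T.[z] 0.
    by exists 0; rewrite ?rpred0 // T0 invr0 mulr0 hornerC.
  have [NP sP hP] := iP.
  case/over_sfP: (NT) => T' eT; case/over_sfP: (NP) => P' eP.
  have cTP : coprimep P T.
    apply: contraT => s1.
    have /eqp_dvdl e : gcdp P T %= P by apply: hP; rewrite ?dvdp_gcdl // sf_gcdp.
    have : P %| T by rewrite -e dvdp_gcdr.
    by move/root_dvdp => /(_ z Pz); rewrite /root (negbTE T0).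
  rewrite eT eP coprimep_map in cTP.
  have [[a b] e] := Bezout_eq1_coprimepP _ _ cTP.
  have {}e := congr1 (fun Q => (map_poly val Q).[z]) e.
  rewrite rmorphD !rmorphM rmorph1 /= -eT -eP hornerD !hornerM hornerC in e.
  rewrite (eqP Pz) mulr0 add0r in e.
  exists (S * map_poly val b); first by rewrite rpredM //; apply/over_sfP; exists b.
  by rewrite hornerM; congr (_ * _); apply: (mulIf T0); rewrite mulVf.
Qed.

Lemma span_powers P z T : P \over N -> P != 0 -> root P z -> T \over N -> spans N (fun i : 'I_(size P).-1 => z ^+ i) T.[z].
move=> NP P0 Pz NT; exists (fun i => (T %% P)`_i); split=> [i|]; first exact/polyOverP/sf_modp.
rewrite {1}(divp_eq T P) hornerD hornerM (eqP Pz) mulr0 add0r.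
by rewrite (horner_coef_wide (n := (size P).-1)) // -ltnS prednK ?size_poly_gt0 // ltn_modpN0.
Qed.

Lemma algebraic_horner z S : alg_over N z -> S \over N -> alg_over N S.[z].
move=> [P [NP P0 Pz]] NS; set n := (size P).-1.
have red T (NT : T \over N) : spans N (fun i : 'I_n => z ^+ i) T.[z] := span_powers NP P0 Pz NT.
have : ~ lfree N (fun i : 'I_n.+1 => S.[z] ^+ i).
  apply: (@span_dep _ _ n) => // j.
  by rewrite -horner_exp; apply: red; rewrite rpredX.
by move/powers_dep => [T [? ? _ ?]]; exists T.
Qed.

(** A finite-dimensional domain over a field is a field: the inverse of [y] is a polynomial in
    [y]. *)
Lemma span_algebra_closed n (u : 'I_n -> E) : spans N u 1 ->
  (forall x y, spans N u x -> spans N u y -> spans N u (x * y)) -> sfclosed (spans N u).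
move=> u1 uM; split=> // [x y|x y ux uy]; first exact: spansB.
apply: (uM) => //; have [->|y0] := eqVneq y 0; first by rewrite invr0; apply: spans0.
have uX m : spans N u (y ^+ m) by elim: m => [//|m IH]; rewrite exprS; apply: uM.
have [T [NT T0 _ rT]] : exists T, [/\ T \over N, T != 0, (size T <= n.+1)%N & root T y] by (apply: powers_dep; apply: (span_dep (u := u))).
have aly : alg_over N y by exists T.
have [_ _ /(_ 1 y)] := polyvals_closed aly; case.
- by exists 1; rewrite ?rpred1 ?hornerE.
- by exists 'X; rewrite ?polyOverX ?hornerE.
move=> S NS; rewrite mul1r => ->; rewrite horner_coef; apply: spans_sum => i _.
by apply: spansZ => //; apply: (polyOverP).
Qed.
End Adjunction.

(** * The separable elements form a field *)

Section Separable.
Variables (E : fieldType) (p : nat) (pE : p \in [pchar E]) (N : subfield E).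

Let pp : prime p. Proof. exact: pcharf_prime pE. Qed.
Let p0 : (0 < p)%N. Proof. exact: prime_gt0. Qed.

Lemma sepalg_alg (M : subfield E) z : sepalg M z -> alg_over M z.
move=> [P [NP Pz P'z]]; exists P; split=> //; apply: contraNneq P'z => ->.
by rewrite derivC root0.
Qed.

(** In characteristic [p] the polynomial [X^p - z^p] has [z] as its only root, so its greatest
    common divisor with a polynomial that has [z] as a simple root is linear, with coefficients in
    [B]. *)
Lemma sepalg_pth_power z (B : subfield E) : sepalg N z -> {subset N <= B} -> z ^+ p \in B -> z \in B.
move=> [P [NP Pz P'z]] NB zB; set Q := 'X^p - (z ^+ p)%:P.
have eQ : Q = ('X - z%:P) ^+ p.
  rewrite -(pFrobenius_autE (rmorph_pchar polyC pE)) rmorphB /= !pFrobenius_autE.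
  by rewrite -rmorphXn.
have BP : P \over B := polyOverS NB NP.
have BQ : Q \over B by rewrite polyOverXnsubC.
have [k [kp ek]] : exists k, (k <= p)%N /\ gcdp P Q %= ('X - z%:P) ^+ k.
  have := dvdp_gcdr P Q; rewrite {2}eQ => /dvdp_exp_XsubCP [k].
  by exists k.
have gB : gcdp P Q \over B by apply: sf_gcdp.
have k1 : k = 1%N.
  case: k kp ek => [|[|k]] // _ ek.
    have : root (gcdp P Q) z by rewrite root_gcd Pz /root !hornerE subrr.
    by rewrite (eqp_root ek) (negbTE (root1 _)).
  have : ('X - z%:P) ^+ 2 %| P.
    apply: dvdp_trans (dvdp_gcdl P Q); rewrite (eqp_dvdr _ ek).
    by rewrite dvdp_exp2l.
  case/dvdpP => R eP; move: P'z; rewrite eP !derivM rootE.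
  by rewrite !(hornerD, hornerM, hornerN, hornerX, hornerC) subrr !(mulr0, mul0r, addr0) eqxx.
rewrite k1 in ek; move/eqpf_eq: ek => [c c0 e].
have := polyOverP gB 1; rewrite e coefZ coefB coefX coefC subr0 mulr1 => cB.
have := polyOverP gB 0; rewrite e coefZ coefB coefX coefC sub0r mulrN => czB.
by rewrite -[z](mulKf c0) rpredM ?rpredV // -rpredN.
Qed.

(** A finite-dimensional algebra spanned by the [p]-th powers of its generators. Every separable
    element lies in such an algebra, and all elements of such an algebra are separable; sums and
    products are then handled by product families, without primitive elements. *)
Definition sepmod n (u : 'I_n -> E) := [/\ spans N u 1, forall i j, spans N u (u i * u j)
    & forall i, spans N (fun j => u j ^+ p) (u i)].

Lemma sepmod_mul n (u : 'I_n -> E) x y : sepmod u -> spans N u x -> spans N u y -> spans N u (x * y).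
move=> [_ h _] [a [aN ->]] [b [bN ->]]; rewrite mulr_suml.
apply: spans_sum => i _; rewrite mulr_sumr; apply: spans_sum => j _.
by rewrite mulrACA; apply: spansZ; rewrite ?rpredM.
Qed.

Lemma sepalg_sepmod z : sepalg N z -> exists n (u : 'I_n -> E), sepmod u /\ spans N u z.
move=> sz; have az := sepalg_alg sz; have [P [NP P0 Pz]] := az.
set n := (size P).-1.
have red T (NT : T \over N) : spans N (fun i : 'I_n => z ^+ i) T.[z] := span_powers NP P0 Pz NT.
have redX i : spans N (fun i : 'I_n => z ^+ i) (z ^+ i) by (have := red 'X^i; rewrite hornerXn; apply; rewrite polyOverXn).
exists n, (fun i => z ^+ i); split; last by have := redX 1%N.
have azp : alg_over N (z ^+ p) by (have := algebraic_horner az (polyOverXn N p); rewrite hornerXn).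
pose B := sf_of (polyvals_closed azp).
have : z \in B.
  apply: sepalg_pth_power sz _ _.
    by move=> x xN; apply/sf_ofE; exists x%:P; rewrite ?polyOverC ?hornerC.
  by apply/sf_ofE; exists 'X; rewrite ?polyOverX ?hornerX.
have [T [NT T0 sT Tzp]] : exists T, [/\ T \over N, T != 0, (size T <= n.+1)%N & root T (z ^+ p)].
  have nf : ~ lfree N (fun i : 'I_n.+1 => (z ^+ p) ^+ i).
    apply: (@span_dep _ _ n) => // j.
    by rewrite -exprM.
  by have [T] := powers_dep nf; exists T.
have redp x : x \in B -> spans N (fun i : 'I_n => (z ^+ i) ^+ p) x.
  move=> /sf_ofE[S NS ->]; exists (fun i => (S %% T)`_i); split=> [i|].
    exact/polyOverP/sf_modp.
  rewrite {1}(divp_eq S T) hornerD hornerM (eqP Tzp) mulr0 add0r.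
  have sS : (size (S %% T)%R <= n)%N by rewrite -ltnS (leq_trans (ltn_modpN0 S T0)).
  by rewrite (horner_coef_wide _ sS); apply: eq_bigr => i _; rewrite -!exprM mulnC.
split.
- by have := redX 0%N.
- by move=> i j; rewrite -exprD.
- by move=> i; apply: redp; rewrite rpredX.
Qed.

Lemma sepmod_prod n m (u : 'I_n -> E) (v : 'I_m -> E) : sepmod u -> sepmod v ->
  exists k (w : 'I_k -> E), [/\ sepmod w, forall i, spans N w (u i) & forall i, spans N w (v i)].
move=> [u1 u2 u3] [v1 v2 v3]; have wP x y := @spans_product x y.
exists #|{: 'I_n * 'I_m}|, (pfam u v); split.
- split=> [|i j|i].
  + by rewrite -[1]mulr1; apply: wP.
  + by rewrite mulrACA; apply: wP.
  + rewrite (_ : (fun => _) = pfam (fun i => u i ^+ p) (fun i => v i ^+ p)).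
      exact: spans_product.
    by apply: funext => k; rewrite exprMn.
- by move=> i; rewrite -[u i]mulr1; apply: wP => //; apply: spans_id.
- by move=> i; rewrite -[v i]mul1r; apply: wP => //; apply: spans_id.
Qed.

(** Were the minimal polynomial of [s] a polynomial in [X ^+ p], it would relate the powers
    [s ^+ (i * p)]. But the [p]-th powers of a basis are again free, so Frobenius keeps the powers
    of [s] below the degree free. *)
Lemma sepmod_sepalg n (u : 'I_n -> E) s : sepmod u -> spans N u s -> sepalg N s.
move=> hu hs; have [d [w [fw uw wu]]] := spans_basis N u.
have sX i : spans N u (s ^+ i).
  elim: i => [|i IH]; first by rewrite expr0; case: hu.
  by rewrite exprS; apply: sepmod_mul.
have sXw i : spans N w (s ^+ i) by apply: spans_trans.
have as_ : alg_over N s.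
  have nf : ~ lfree N (fun i : 'I_d.+1 => s ^+ i) by apply: (@span_dep _ _ d).
  by have [T [?]] := powers_dep nf; exists T.
have [P [iP mP Ps]] := algebraic_irr as_.
have [NP sP] := iP.
have [d0|d0] := eqVneq P^`() 0; last first.
  exists P; split=> //; apply/negP => r.
  have := dvdp_leq d0 (irr_dvdp iP Ps (polyOver_deriv NP) r).
  by rewrite leqNgt lt_size_deriv // (irr_neq0 iP).
set m := (size P).-1; have m0 : (0 < m)%N by rewrite /m; case: (size) sP => [].
have fs : lfree N (fun i : 'I_m => s ^+ i).
  apply: lfree_powers => T NT T0 Ts; rewrite (ltn_predK sP).
  exact: dvdp_leq (irr_dvdp iP Ps NT Ts).
have fwp : lfree N (fun i => w i ^+ p).
  apply: span_lfree fw _ => i; apply: spans_trans (wu i) _ => j.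
  have [_ _ h] := hu; apply: spans_trans (h j) _ => k.
  have [a [aN ->]] := uw k; exists (fun i => a i ^+ p); split=> [l|].
    by rewrite rpredX.
  rewrite -(pFrobenius_autE) rmorph_sum; apply: eq_bigr => l.
  by rewrite rmorphM.
have [A hA] := span_matrix (fun i : 'I_m => sXw i).
have fA : row_free A.
  apply: (@matrix_lfree) => a aN e; apply: fs => //.
  by rewrite -[RHS]e; apply: eq_bigr => i _; rewrite hA.
have pN : p \in [pchar sfT N] by rewrite inE pp /= -(inj_eq val_inj) rmorph_nat (pcharf0).
have fAp : row_free (map_mx (pFrobenius_aut pN) A) by rewrite row_free_map.
have fsp := lfree_matrix fwp fAp.
have esp i : \sum_j val (map_mx (pFrobenius_aut pN) A i j) * w j ^+ p = s ^+ (i * p).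
  rewrite exprM hA -(pFrobenius_autE) rmorph_sum; apply: eq_bigr => l.
  by rewrite mxE [RHS]pFrobenius_autE exprMn rmorphXn.
have pm : (p %| m)%N.
  apply: contraT => pm; have := deriv0_coef pE d0 pm.
  by rewrite -/(lead_coef P) (monicP mP) => /eqP; rewrite oner_eq0.
have km : (m %/ p < m)%N by rewrite ltn_Pdiv // prime_gt1.
(* The index [m / p] carries the leading coefficient 1, so this relation is not trivial. *)
have := fsp (fun i : 'I_m => P`_(i * p)) _ _ (Ordinal km).
rewrite divnK // -/(lead_coef P) (monicP mP) => /(_ (fun => polyOverP NP _)).
suff e0 : \sum_(i < m) P`_(i * p) * s ^+ (i * p) = 0.
  under eq_bigr => i do rewrite esp.
  by move=> /(_ e0) /eqP; rewrite oner_eq0.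
pose Q := \poly_(i < m) P`_(i * p).
have e0 : P.[s] = 0 by apply/eqP.
have eP : P = Q \Po 'X^p.
  apply/polyP => i; rewrite coef_comp_poly_Xn //; case: ifP => pi; last first.
    by rewrite (deriv0_coef pE) ?pi.
  rewrite coef_poly; case: ltnP => h; first by rewrite divnK.
  rewrite nth_default // -(ltn_predK sP) -(divnK pi).
  have : (m * p <= i %/ p * p)%N by rewrite leq_mul2r h orbT.
  by apply: leq_trans; rewrite -[X in (X < _)%N]muln1 ltn_pmul2l // prime_gt1.
rewrite -[RHS]e0 [in RHS]eP horner_comp hornerXn horner_poly; apply: eq_bigr => i.
by rewrite exprM exprAC.
Qed.

Lemma sepalg_base x : x \in N -> sepalg N x.
exists ('X - x%:P); rewrite ?polyOverXsubC ?root_XsubC.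
by rewrite derivXsubC root1.
Qed.

Lemma sepalg_closed : sfclosed (sepalg N).
have key op : (forall n (u : 'I_n -> E), sfclosed (spans N u) -> forall x y, spans N u x -> spans N u y -> spans N u (op x y)) ->
    forall x y, sepalg N x -> sepalg N y -> sepalg N (op x y).
  move=> hop x y /sepalg_sepmod[n [u [hu xu]]] /sepalg_sepmod[m [v [hv yv]]].
  have [k [w [hw uw vw]]] := sepmod_prod hu hv; apply: (sepmod_sepalg hw).
  apply: hop; [|exact: spans_trans uw|exact: spans_trans vw].
  by apply: span_algebra_closed => [|a b]; [case: hw|apply: sepmod_mul].
by split; [apply: sepalg_base; rewrite rpred1|apply: key => n u []|apply: key => n u []].
Qed.
End Separable.

Section SepAlg.
Variables (E : fieldType) (p : nat) (pE : p \in [pchar E]).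

Lemma sepalg_sub (N M : subfield E) z : {subset N <= M} -> sepalg N z -> sepalg M z.
by move=> NM [P [NP ? ?]]; exists P; split=> //; apply: polyOverS NP. Qed.

Definition sep_minpoly (N : subfield E) z P := [/\ irr N P, P \is monic, separable_poly P & root P z].

Lemma sepalg_minpoly N z : sepalg N z -> exists P, sep_minpoly N z P.
move=> sz; have [P [iP mP Pz]] := algebraic_irr (sepalg_alg sz).
exists P; split=> //; apply: irr_separable (iP) _; case: sz => Q [NQ Qz Q'z].
apply: contraNneq Q'z => P'0; have /dvdpP[R ->] := irr_dvdp iP Pz NQ Qz.
by rewrite derivM P'0 mulr0 addr0 rootM Pz orbT.
Qed.

Lemma sep_minpoly_sepalg N z P : sep_minpoly N z P -> sepalg N z.
move=> [[NP _ _] mP sepP Pz]; exists P; split=> //.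
apply/negP => P'z; move: sepP; rewrite separable_poly.unlock => /coprimep_root.
by move=> /(_ _ Pz); rewrite -/(root _ _) P'z.
Qed.

Lemma perfect_sepalg (N : subfield E) z : perf_sf p N -> alg_over N z -> sepalg N z.
move=> pN /algebraic_irr[P [iP mP Pz]]; apply: (@sep_minpoly_sepalg N z P).
by split=> //; apply: (perfect_irr_separable pE pN).
Qed.
End SepAlg.

(** * Averaging over conjugates, and perfect hulls *)

Section SG.
Variables (E : closedF) (O : valring E) (p : nat).
Hypothesis pE : p \in [pchar E].

Let pp : prime p. Proof. exact: pcharf_prime pE. Qed.
Let p0 : (0 < p)%N. Proof. exact: prime_gt0. Qed.

(* Irreducible separable polynomials over [N] have degree prime to [p] and
   roots of equal absolute value: the only consequence of the hypotheses on the
   valued field that is needed, apart from the valued field being nontrivial. *)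
Definition SG (N : subfield E) := forall P, irr N P -> P \is monic -> separable_poly P -> ~~ (p %| (size P).-1)%N /\
  forall z t, root P z -> root P t -> nv O z = nv O t.

(** The number of conjugates of [z] is prime to [p], so it has absolute value 1 and the average of
    the conjugates lies in [N]. Translating the minimal polynomial by [x] shows that all conjugates
    are equally far from [x]; hence the average is at least as close to [x] as [z]. *)
Lemma sg_average N z : SG N -> sepalg N z -> exists rs zb, [/\ z \in rs, uniq rs & ~~ (p %| size rs)%N] /\
  [/\ irr N (\prod_(t <- rs) ('X - t%:P)), zb \in N, zb *+ size rs = \sum_(t <- rs) t,
      forall x t, x \in N -> t \in rs -> nv O (t - x) = nv O (z - x) & forall x, x \in N -> x - zb <=_[O] x - z].
move=> sgN /sepalg_minpoly[P [iP mP sP Pz]]; have [rs eP] := monic_roots mP.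
have [pn] := sgN _ iP mP sP; rewrite eP in iP sP Pz pn.
rewrite size_prod_XsubC in pn.
have zrs : z \in rs by rewrite -root_prod_XsubC.
have urs : uniq rs by rewrite -separable_prod_XsubC.
have NP : \prod_(t <- rs) ('X - t%:P) \over N by case: iP.
have rs0 : size rs != 0%N by case: (rs) zrs.
have : (size rs)%:R != 0 :> E by rewrite -(dvdn_pcharf pE).
have : \sum_(t <- rs) t \in N by rewrite -rpredN -coefPn_prod_XsubC // (polyOverP NP).
have dist x t : x \in N -> t \in rs -> nv O (t - x) = nv O (z - x).
  move=> xN trs.
  have e : \prod_(t <- rs) ('X - t%:P) \Po ('X + x%:P) = \prod_(t <- [seq t - x | t <- rs]) ('X - t%:P).
    rewrite big_map rmorph_prod /=; apply: eq_bigr => s.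
    by rewrite comp_polyB comp_polyX comp_polyC polyCB opprB addrA.
  have := sgN _ (irr_comp iP xN); rewrite e monic_prod_XsubC separable_prod_XsubC.
  rewrite map_inj_uniq; last exact: subIr.
  case=> // _; apply; rewrite root_prod_XsubC; exact: map_f.
exists rs, ((\sum_(t <- rs) t) / (size rs)%:R); split=> //; split=> //.
- by rewrite rpredM // rpredV rpred_nat.
- by rewrite -[LHS]mulr_natr divfK.
move=> x xN; have -> : x - (\sum_(t <- rs) t) / (size rs)%:R = (\sum_(t <- rs) (x - t)) / (size rs)%:R.
  by rewrite sumrB big_const_seq iter_addr_0 -[x *+ _]mulr_natr mulrBl mulfK.
rewrite nv_le_divl // -[X in X <=_[O] _]mulr1; apply: nv_leM.
  rewrite big_seq; apply: nv_le_sum => t trs.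
  by rewrite [in X in (X <= _)%O]nvB dist // nvB.
by rewrite (nv_nat1 O pE).
Qed.

(** The conjugates of [z] are roots of [Q] at the same distance from [x]; if [z] is the only one, it
    equals its average. *)
Lemma sg_hensel N z Q x : SG N -> sepalg N z -> Q \over N -> root Q z -> x \in N ->
  (forall t, root Q t -> nv O (t - x) = nv O (z - x) -> t = z) -> z \in N.
move=> sgN sz NQ Qz xN h.
have [rs [zb [[zrs urs _] [iP zbN e dist _]]]] := sg_average sgN sz.
have all_z t : t \in rs -> t = z.
  move=> trs; apply: h; last exact: dist.
  by apply: (root_dvdp (irr_dvdp iP _ NQ Qz)); rewrite root_prod_XsubC.
have rs1 : rs = [:: z].
  case: rs zrs urs all_z {iP e dist} => // a [|b r] zr ur h'.
    by rewrite (h' a) ?mem_head.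
  move: ur; rewrite /= (h' a) (h' b) ?inE ?eqxx ?orbT //.
by move: e; rewrite rs1 big_seq1 => <-.
Qed.

Lemma nat_pow_pchar n k : (n%:R : E) ^+ (p ^ k) = n%:R.
elim: k => [|k IH] => //.
by rewrite expnSr exprM IH -(pFrobenius_autE) rmorph_nat.
Qed.

Lemma frobk_sum k I r (F : I -> E) : (\sum_(i <- r) F i) ^+ (p ^ k) = \sum_(i <- r) F i ^+ (p ^ k).
elim: k => [|k IH] => //.
rewrite expnSr exprM IH -(pFrobenius_autE) rmorph_sum; apply: eq_bigr => i.
by rewrite exprM.
Qed.

(** The equation is additive up to its constant term, so differences of roots form a group stable
    under the prime field. The average of the conjugates of a root differs from that root by an
    element of the group, and is therefore a root in [N]. *)
Lemma sg_artin_schreier N k x eta : SG N -> (0 < k)%N -> x \in N -> eta \in N ->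
  eta != 0 -> exists2 y, y \in N & y ^+ (p ^ k) = eta * y + x.
move=> sgN k0 xN etaN eta0; set q := (p ^ k)%N.
have q0 : (0 < q)%N by rewrite expn_gt0 p0.
have q1 : (1 < q)%N by rewrite -{1}(expn0 p) ltn_exp2l // prime_gt1.
have qE : q%:R = 0 :> E by apply/eqP; rewrite -(dvdn_pcharf pE) /q -(prednK k0) expnS dvdn_mulr.
pose Q := 'X^q - eta *: 'X - x%:P.
have NQ : Q \over N by rewrite !rpredB ?polyOverXn ?polyOverC // polyOverZ ?polyOverX.
have rQ y : root Q y = (y ^+ q == eta * y + x) by rewrite rootE !hornerE -[in LHS]addrA -opprD subr_eq0.
have [z Qz] : exists z, root Q z.
  apply: size_gt1_root; rewrite /Q -addrA size_polyDl ?size_polyXn => //.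
  rewrite -opprD size_polyN (leq_ltn_trans (size_polyD _ _)) // gtn_max.
  rewrite (leq_ltn_trans (size_scale_leq _ _)) ?size_polyX ?ltnS //=.
  by rewrite (leq_trans (size_polyC_leq1 _)).
have sz : sepalg N z.
  exists Q; rewrite !derivB derivXn derivZ derivX derivC subr0.
  by rewrite -mulr_natl -polyC_natr qE mul0r sub0r rootN rootZ // root1.
have [rs [zb [[zrs urs pn] [iP zbN e _ _]]]] := sg_average sgN sz.
have n0 : (size rs)%:R != 0 :> E by rewrite -(dvdn_pcharf pE).
exists zb => //.
have roots t : t \in rs -> (t - z) ^+ q = eta * (t - z).
  move=> trs; rewrite expBp //.
  have : root Q t by (apply: (root_dvdp (irr_dvdp iP _ NQ Qz)); rewrite root_prod_XsubC).
  move: Qz; rewrite !rQ => /eqP -> /eqP ->.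
  by rewrite opprD addrACA subrr addr0 mulrBr.
have ez : (zb - z) * (size rs)%:R = \sum_(t <- rs) (t - z) by rewrite sumrB big_const_seq iter_addr_0 -e mulr_natr mulrnBl.
have : (zb - z) ^+ q = eta * (zb - z).
  apply: (mulIf n0); rewrite -{1}(nat_pow_pchar _ k) -exprMn ez frobk_sum.
  rewrite -mulrA ez mulr_sumr [LHS]big_seq [RHS]big_seq.
  exact: eq_bigr => t.
rewrite expBp // mulrBr => /eqP; rewrite subr_eq => /eqP ->.
by move: Qz; rewrite rQ => /eqP ->; rewrite addrA subrK.
Qed.

(** A solution of [y ^+ (p ^ k) = eta * y + x] cannot exceed the bound [B] of 1 and [x], since its
    power would dominate the right-hand side; with [eta * B] smaller than [eps] its power is close
    to [x]. *)
Lemma sg_dense N k x eps pi : SG N -> x \in N -> eps \in N -> eps != 0 -> pi \in N -> pi != 0 -> pi <_[O] 1 ->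
  exists2 y, y \in N & y ^+ (p ^ k) - x <_[O] eps.
move=> sgN xN epsN eps0 piN pi0 pi1; case: k => [|k].
  by exists x => //; rewrite subrr nv_gt0.
pose e1 := if eps <=_[O] 1 then eps else 1.
pose B := if x <=_[O] 1 then 1 else x.
have [e1N e10 e1l e1e] : [/\ e1 \in N, e1 != 0, e1 <=_[O] 1 & e1 <=_[O] eps] by (rewrite /e1; case: leP => h; split; rewrite ?rpred1 ?oner_eq0 // ltW).
have [BN B0 B1 xB] : [/\ B \in N, B != 0, 1 <=_[O] B & x <=_[O] B].
  rewrite /B; case: leP => h; split; rewrite ?rpred1 ?oner_eq0 // ?ltW //.
  by rewrite -(nv_gt0 O); apply: le_lt_trans h; apply: nv_ge0.
pose eta := pi * e1 / B.
have eta0 : eta != 0 by rewrite !mulf_neq0 ?invr_eq0.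
have eB : eta * B = pi * e1 by rewrite divfK.
have pe : pi * e1 <_[O] e1 by rewrite nv_ltMl.
have : eta <=_[O] 1.
  rewrite nv_le_divl // mul1r (le_trans (ltW pe)) // (le_trans e1l) //.
have [|y yN hy] := sg_artin_schreier sgN (ltn0Sn k) xN _ eta0.
  by rewrite rpredM ?rpredV // rpredM.
exists y => //; rewrite hy addrK; apply: le_lt_trans (lt_le_trans pe e1e).
rewrite -eB nv_leM2l // leNgt; apply/negP => By.
have y1 : 1 <_[O] y by apply: le_lt_trans By.
have y0 : y != 0 by rewrite -(nv_gt0 O); apply: le_lt_trans y1; apply: nv_ge0.
have : y <_[O] y ^+ (p ^ k.+1).
  have : (1 < p ^ k.+1)%N by rewrite -{1}(expn0 p) ltn_exp2l // prime_gt1.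
  case: (p ^ k.+1)%N => [|[|m]] //.
  rewrite exprS -[X in X <_[O] _]mulr1 nv_ltM2l // -(expr1n E m.+1) nv_ltX //.
rewrite hy ltNge => /negP; apply; apply: nv_leD; last by rewrite (le_trans xB) ?ltW.
by rewrite nv_leMl.
Qed.

Lemma pth_root_ex (x : E) : exists y, x = y ^+ p.
have [z] : exists z, root ('X^p - x%:P) z by apply: size_gt1_root; rewrite size_XnsubC.
by rewrite rootE !hornerE subr_eq0 => /eqP e; exists z.
Qed.

Lemma pth_root_closed (N : subfield E) : sfclosed (fun x => x ^+ p \in N).
split; first by rewrite expr1n rpred1.
  move=> x y; rewrite -!(pFrobenius_autE) rmorphB => *; exact: rpredB.
by move=> x y hx hy; rewrite expr_div_n rpredM ?rpredV.
Qed.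

Definition pth_root N := sf_of (pth_root_closed N).

(** Frobenius maps irreducible polynomials over the field of [p]-th roots to irreducible polynomials
    over [N], and raises the absolute values of the roots to the power [p]. *)
Lemma sg_pth_root N : SG N -> SG (pth_root N).
move=> sgN P iP mP sP; pose phi := pFrobenius_aut pE.
have [NP szP hP] := iP; pose Q := map_poly phi P.
have sQ : size Q = size P by rewrite size_map_poly.
have iQ : irr N Q.
  split; rewrite ?sQ //.
    by apply/polyOverP => i; rewrite coef_map /= pFrobenius_autE; apply/(sf_ofE (pth_root_closed N))/(polyOverP).
  move=> R NR RQ sR; have [r hr] := choice (fun i => pth_root_ex R`_i).
  pose R1 := \poly_(i < size R) r i.
  have eR : R = map_poly phi R1.
    apply/polyP => i; rewrite coef_map coef_poly /= pFrobenius_autE.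
    by case: ltnP => h; rewrite // nth_default // expr0n eqn0Ngt p0.
  have sR1 : size R1 = size R by rewrite eR size_map_poly.
  rewrite eR eqp_map; apply: hP; rewrite ?sR1 //; last by rewrite -(dvdp_map phi) -eR.
  apply/polyOverP => i; rewrite coef_poly; case: ifP => _; last exact: rpred0.
  by apply/sf_ofE; rewrite -hr (polyOverP NR).
have mQ : Q \is monic by rewrite map_monic.
have sepQ : separable_poly Q by rewrite separable_map.
have [h1 h2] := sgN Q iQ mQ sepQ; rewrite sQ in h1; split=> // z t Pz Pt.
apply/eqP; rewrite -(nv_eqX2 O (n := p)) //; apply/eqP; apply: h2.
  by rewrite fmorph_root.
by rewrite fmorph_root.
Qed.

Fixpoint pth_rootn k N := if k is k'.+1 then pth_root (pth_rootn k' N) else N.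

Lemma pth_rootnE k N x : (x \in pth_rootn k N) = (x ^+ (p ^ k) \in N).
elim: k x => [|k IH] x => //.
have e : (x \in pth_rootn k.+1 N) = (x ^+ p \in pth_rootn k N) by apply/idP/idP => /(sf_ofE (pth_root_closed _)).
by rewrite e IH -exprM -expnS.
Qed.

Lemma pth_rootn_leq k l (N : subfield E) x : (k <= l)%N -> x ^+ (p ^ k) \in N -> x ^+ (p ^ l) \in N.
by move=> kl h; rewrite -(subnK kl) expnD mulnC exprM rpredX. Qed.

Lemma phull_closed (N : subfield E) : sfclosed (fun x => exists k, x ^+ (p ^ k) \in N).
split; first by exists 0%N; rewrite rpred1.
  move=> x y [k hx] [l hy]; exists (maxn k l); rewrite expBp //.
  by rewrite rpredB ?(pth_rootn_leq _ hx, pth_rootn_leq _ hy) ?leq_maxl ?leq_maxr.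
move=> x y [k hx] [l hy]; exists (maxn k l); rewrite expr_div_n rpredM ?rpredV //.
  by apply: pth_rootn_leq hx; apply: leq_maxl.
by apply: pth_rootn_leq hy; apply: leq_maxr.
Qed.

Definition phull N := sf_of (phull_closed N).

Lemma phullE N x : (x \in phull N) <-> exists k, x ^+ (p ^ k) \in N.
exact: sf_ofE. Qed.
Lemma phull_sub (N : subfield E) x : x \in N -> x \in phull N.
by move=> h; apply/phullE; exists 0%N. Qed.
Lemma phull_perfect N : perf_sf p (phull N).
move=> x /phullE[k hx]; have [y e] := pth_root_ex x; exists y => //.
by apply/phullE; exists k.+1; rewrite expnS exprM -e.
Qed.
Lemma irr_subfield (N M : subfield E) P : {subset N <= M} -> P \over N -> irr M P -> irr N P.
by move=> NM NP [_ sP h]; split=> // Q NQ; apply: h; apply: polyOverS NQ.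
Qed.

(** A polynomial over the perfect hull has its coefficients in some [pth_rootn k N], over which it
    is irreducible a fortiori. *)
Lemma phull_sg N : SG N -> SG (phull N).
move=> sgN P iP; have [NP sP hP] := iP.
have [k hk] : exists k, P \over (pth_rootn k N).
  have [k hk] : exists k, forall i, (i < size P)%N -> P`_i ^+ (p ^ k) \in N.
    elim: (size) => [|n [k hk]]; first by exists 0%N.
    have [l hl] := (phullE N _).1 (polyOverP NP n).
    exists (maxn k l) => i; rewrite ltnS leq_eqVlt => /predU1P[->|/hk h].
      exact: pth_rootn_leq (leq_maxr _ _) hl.
    exact: pth_rootn_leq (leq_maxl _ _) h.
  exists k; apply/polyOverP => i; rewrite pth_rootnE.
  by case: (ltnP i (size P)) => [/hk //|h]; rewrite nth_default // expr0n expn_eq0 eqn0Ngt p0 rpred0.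
have sgk : SG (pth_rootn k N) by elim: k {hk} => //= k; apply: sg_pth_root.
apply: sgk; apply: irr_subfield hk iP => x; rewrite pth_rootnE => hx.
by apply/phullE; exists k.
Qed.

(** A factor over [M] of an irreducible separable polynomial over [N] has coefficients separable
    over [N], hence in [N]; so the polynomial stays irreducible over [M]. *)
Lemma sg_sepclosed (N M : subfield E) : {subset N <= M} -> SG M -> (forall x, x \in M -> sepalg N x -> x \in N) -> SG N.
move=> NM sgM h P iP mP sP; have [NP szP hP] := iP.
apply: sgM => //; split=> //; first exact: polyOverS NP.
move=> Q MQ QP sQ; have P0 := irr_neq0 iP.
have Q0 : Q != 0 by apply: contraNneq P0 => Q0; rewrite Q0 dvd0p in QP.
have lQ : lead_coef Q != 0 by rewrite lead_coef_eq0.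
pose R := (lead_coef Q)^-1 *: Q.
have RQ : R %= Q by rewrite eqp_scale ?invr_eq0.
have mR : R \is monic by rewrite monicE lead_coefZ mulVf.
have MR : R \over M by rewrite polyOverZ // rpredV (polyOverP MQ).
have [rs eR] := monic_roots mR.
rewrite -(eqp_ltrans RQ); apply: hP; last by rewrite (eqp_size RQ).
  have SR : R \over (sf_of (sepalg_closed pE N)).
    rewrite eR big_seq; apply: rpred_prod => t trs; rewrite polyOverXsubC.
    apply/sf_ofE; apply: (sep_minpoly_sepalg (P := P)); split=> //.
    by apply: (root_dvdp QP); rewrite -(eqp_root RQ) eR root_prod_XsubC.
  apply/polyOverP => i; apply: h; first exact: (polyOverP).
  by have /sf_ofE := polyOverP SR i.
by rewrite (eqp_dvdl _ RQ).
Qed.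
End SG.

(** * Estimates for values and Taylor coefficients of polynomials *)

Section Bounds.
Variables (E : fieldType) (O : valring E).
Implicit Types (P Q : {poly E}) (z e w : E).

Lemma coef_prod_le (r : seq E) a b m k : (forall i, i \in r -> a i <=_[O] m i) -> (forall i, i \in r -> b i <=_[O] m i) ->
  (\prod_(i <- r) (a i *: 'X + (b i)%:P))`_k <=_[O] \prod_(i <- r) m i.
elim: r k => [|i r IH] k ha hb.
  by rewrite !big_nil coef1; case: eqP => _; rewrite ?nv_ge0.
have {}IH l : (\prod_(i <- r) (a i *: 'X + (b i)%:P))`_l <=_[O] \prod_(i <- r) m i by (apply: IH => j jr; [apply: ha|apply: hb]; rewrite inE jr orbT).
rewrite !big_cons mulrDl coefD -scalerAl coefZ coefXM mul_polyC coefZ.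
apply: nv_leD; last by apply: nv_leM => //; apply: hb; rewrite mem_head.
by apply: nv_leM; [apply: ha; rewrite mem_head|case: k => [|k]; rewrite ?nv_ge0 ?IH].
Qed.

Lemma coef_prod_lt (r : seq E) a b k : (0 < k)%N -> (forall i, i \in r -> a i <_[O] b i) ->
  (\prod_(i <- r) (a i *: 'X + (b i)%:P))`_k <_[O] \prod_(i <- r) b i.
move=> + h; have b0 i : i \in r -> b i != 0.
  by move=> /h hi; rewrite -(nv_gt0 O); apply: le_lt_trans hi; apply: nv_ge0.
have P0 : \prod_(i <- r) b i != 0 by rewrite prodf_seq_neq0; apply/allP => i /b0 ->.
elim: r k h b0 P0 => [|i r IH] k h b0 P0 k0.
  by rewrite !big_nil coef1 gtn_eqF // nv_gt0 oner_eq0.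
have hr j : j \in r -> a j <_[O] b j by move=> jr; apply: h; rewrite inE jr orbT.
rewrite !big_cons in P0 *; have Pr : \prod_(i <- r) b i != 0.
  by apply: contraNneq P0 => ->; rewrite mulr0.
have bi : b i != 0 by apply: b0; rewrite mem_head.
rewrite mulrDl coefD -scalerAl coefZ coefXM mul_polyC coefZ gtn_eqF //.
apply: nv_ltD.
  apply: nv_ltM_le => //; first by apply: h; rewrite mem_head.
  by apply: coef_prod_le => j /hr /ltW.
by rewrite nv_ltM2l //; apply: IH => // j jr; apply: b0; rewrite inE jr orbT.
Qed.

(** The [k]-th Taylor coefficient of [P] at [z]. *)
Definition tc P z k := (P \Po ('X + z%:P))`_k.

Lemma tc0 P z : tc P z 0 = P.[z].
by rewrite /tc -horner_coef0 horner_comp !hornerE. Qed.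

Lemma taylor P z e : P.[z + e] = \sum_(k < size P) tc P z k * e ^+ k.
have -> : P.[z + e] = (P \Po ('X + z%:P)).[e] by rewrite horner_comp !hornerE addrC.
by rewrite horner_coef size_comp_poly2 // size_XaddC.
Qed.

Lemma coef_comp_scale Q e k : (Q \Po (e *: 'X))`_k = Q`_k * e ^+ k.
elim/poly_ind: Q k => [|Q c IH] k; first by rewrite comp_poly0 !coef0 mul0r.
rewrite comp_polyD comp_polyM comp_polyX comp_polyC !coefD !coefC -scalerAr coefZ !coefMX.
case: k => [|k] /=; first by rewrite mulr0 mulr1.
by rewrite !addr0 IH exprS mulrCA.
Qed.

Lemma tc_prod rs z e k : tc (\prod_(w <- rs) ('X - w%:P)) z k * e ^+ k = (\prod_(w <- rs) (e *: 'X + (z - w)%:P))`_k.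
rewrite -coef_comp_scale -comp_polyA comp_polyD comp_polyX comp_polyC rmorph_prod /=.
congr (polyseq _)`_k; apply: eq_bigr => w _; rewrite comp_polyB comp_polyX comp_polyC.
by rewrite -addrA polyCB.
Qed.

Lemma tc_far_le (rs : seq E) z e k : (forall w, w \in rs -> e <=_[O] z - w) ->
  tc (\prod_(w <- rs) ('X - w%:P)) z k * e ^+ k <=_[O] (\prod_(w <- rs) ('X - w%:P)).[z].
move=> h; rewrite tc_prod horner_prod; under [X in _ <=_[O] X]eq_bigr do rewrite hornerXsubC.
exact: coef_prod_le.
Qed.

Lemma tc_far_lt (rs : seq E) z e k : (0 < k)%N -> (forall w, w \in rs -> e <_[O] z - w) ->
  tc (\prod_(w <- rs) ('X - w%:P)) z k * e ^+ k <_[O] (\prod_(w <- rs) ('X - w%:P)).[z].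
rewrite tc_prod horner_prod.
under [X in _ <_[O] X]eq_bigr do rewrite hornerXsubC.
exact: coef_prod_lt.
Qed.

Lemma nderivn_shift P z j : (P \Po ('X + z%:P))^`N(j) = P^`N(j) \Po ('X + z%:P).
elim/poly_ind: P j => [|P c IH] [|j]; rewrite ?nderivn0 ?linear0 //.
rewrite nderivnMXaddC !comp_polyD !comp_polyM comp_polyX comp_polyC -!IH.
set Q := P \Po _.
have -> : Q * ('X + z%:P) + c%:P = (Q * 'X + c%:P) + z *: Q by rewrite mulrDr addrAC -mul_polyC [z%:P * _]mulrC.
by rewrite nderivnD nderivnMXaddC nderivnZ mulrDr addrA -mul_polyC [z%:P * _]mulrC.
Qed.

Lemma tc_nderivn P z j i : tc P^`N(j) z i = tc P z (j + i) *+ 'C(j + i, j).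
by rewrite /tc -nderivn_shift coef_nderivn. Qed.

Lemma sum_distinct n (F : 'I_n -> E) : (forall i j, i != j -> F i != 0 -> F j != 0 -> nv O (F i) != nv O (F j)) ->
  (forall i, F i = 0) \/ exists k, [/\ F k != 0, forall i, i != k -> F i <_[O] F k & nv O (\sum_i F i) = nv O (F k)].
move=> h; have [all0|/existsNP[i0 /eqP Fi0]] := pselect (forall i, F i = 0); first by left.
right; have [k Hk] : exists k, forall i, F i <=_[O] F k.
  have [k _ hk] := @arg_maxP _ _ _ i0 xpredT (fun i => nv O (F i)) isT.
  by exists k => i; apply: hk.
have Fk : F k != 0 by apply: contraNneq Fi0 => Fk; rewrite -(nv_le0 O) -Fk.
have lt i : i != k -> F i <_[O] F k.
  move=> ik; have [->|Fi] := eqVneq (F i) 0; first by rewrite nv_gt0.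
  by rewrite lt_neqAle Hk andbT; apply: h.
exists k; split=> //; rewrite (bigD1 k) //=; apply: nv_dom.
exact: nv_lt_sum.
Qed.

(** Replacing coefficients and argument by elements with the same leading terms changes the value by
    less than any bound of the terms. So the leading term of the value is kept whenever the terms do
    not cancel. *)
Lemma rveq_horner_lt P P' s t M : M != 0 -> (forall i, rveq O P`_i P'`_i) ->
  rveq O s t -> (forall i, P`_i * s ^+ i <=_[O] M) -> P.[s] - P'.[t] <_[O] M.
move=> M0 PP st h.
rewrite (horner_coef_wide s (leq_maxl (size P) (size P'))).
rewrite (horner_coef_wide t (leq_maxr (size P) (size P'))) -sumrB.
apply: nv_lt_sum => // i _.
have r : rveq O (P`_i * s ^+ i) (P'`_i * t ^+ i) by apply: rveqM (rveqX _ st).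
case/orP: (r) => [/eqP ->|lt]; first by rewrite subrr nv_gt0.
by apply: lt_le_trans lt _; rewrite -(rveq_nv r).
Qed.

Lemma horner_int_le P u : (forall i, P`_i <=_[O] 1) -> u <=_[O] 1 -> P.[u] <=_[O] 1.
move=> hP hu; rewrite horner_coef; apply: nv_le_sum => i _.
by apply: nv_leM1 => //; apply: nv_leX1.
Qed.

Lemma monic_root_le1 P w : P \is monic -> (forall i, P`_i <=_[O] 1) -> root P w -> w <=_[O] 1.
move=> mP hP rw; rewrite leNgt; apply/negP => w1.
have w0 : w != 0 by rewrite -(nv_gt0 O); apply: le_lt_trans w1; apply: nv_ge0.
have sP : size P = (size P).-1.+1 by rewrite prednK // size_poly_gt0 monic_neq0.
have : P.[w] = 0 by apply/eqP.
rewrite horner_coef sP big_ord_recr /= -/(lead_coef P) (monicP mP) mul1r => /eqP.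
rewrite addrC addr_eq0 => /eqP e.
have : w ^+ (size P).-1 <_[O] w ^+ (size P).-1.
  rewrite {1}e nvN; apply: nv_lt_sum; first by rewrite expf_neq0.
  move=> i _; apply: (@le_lt_trans _ _ (nv O (w ^+ i))).
    by apply: nv_leMl.
  case: i => k /=; move: (size P).-1 => n kn.
  have -> : w ^+ n = w ^+ k * w ^+ (n - k) by rewrite -exprD subnKC // ltnW.
  rewrite -[X in X <_[O] _]mulr1 nv_ltM2l ?expf_neq0 //.
  by rewrite -(expr1n E (n - k)) nv_ltX // subn_gt0.
by rewrite ltxx.
Qed.

Lemma coef_XD1n n j : (('X + 1 : {poly E}) ^+ n)`_j = 'C(n, j)%:R.
rewrite exprD1n coef_sum; have [jn|jn] := ltnP j n.+1.
  rewrite (bigD1 (Ordinal jn)) //= coefMn coefXn eqxx big1 ?addr0 // => i ij.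
  rewrite coefMn coefXn; case: eqP => [e|]; last by rewrite mul0rn.
  by case/eqP: ij; apply: val_inj.
rewrite bin_small // big1 // => i _; rewrite coefMn coefXn gtn_eqF ?mul0rn //.
exact: leq_trans.
Qed.

(** Write [k = m * p ^ v] with [m > 1] prime to [p]: the binomial coefficient of index [p ^ v] is
    [m] modulo [p]. *)
Lemma ex_binomial_unit p k : p \in [pchar E] -> (0 < k)%N ->
  (forall v, k <> (p ^ v)%N) -> exists j, [/\ (0 < j)%N, (j < k)%N & ~~ (p %| 'C(k, j))%N].
move=> pE k0 hk; have pp := pcharf_prime pE.
have [m pm e] := pfactor_coprime pp k0; set v := logn p k in e.
have pv0 : (0 < p ^ v)%N by rewrite expn_gt0 prime_gt0.
have : (1 < m)%N.
  rewrite ltn_neqAle; apply/andP; split; last by move: k0; rewrite {1}e muln_gt0 => /andP[].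
  by apply/eqP => m1; apply: (hk v); rewrite e -m1 mul1n.
exists (p ^ v)%N; split=> //.
  by rewrite e -{1}[(p ^ v)%N]mul1n ltn_pmul2r.
have e1 : ('X + 1 : {poly E}) ^+ k = (('X + 1) ^+ m) \Po 'X^(p ^ v).
  rewrite rmorphXn /= comp_polyD comp_polyX comp_polyC [in LHS]e mulnC exprM.
  rewrite exprDn_pchar ?expr1n // pnatX pnatE //.
  by rewrite (rmorph_pchar polyC).
have := congr1 (fun Q : {poly E} => Q`_(p ^ v)) e1.
rewrite coef_XD1n coef_comp_poly_Xn // dvdnn divnn pv0 coef_XD1n bin1 => eb.
by rewrite (dvdn_pcharf pE) eb -(dvdn_pcharf pE) -prime_coprime.
Qed.

Lemma nv_prod_le (I : eqType) (r : seq I) F G : (forall i, i \in r -> F i <=_[O] G i) ->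
  \prod_(i <- r) F i <=_[O] \prod_(i <- r) G i.
elim: r => [|i r IH] h; first by rewrite !big_nil.
rewrite !big_cons; apply: nv_leM; first by apply: h; rewrite mem_head.
by apply: IH => j jr; apply: h; rewrite inE jr orbT.
Qed.

Lemma rveq_prod_in (I : eqType) (r : seq I) F G : (forall i, i \in r -> rveq O (F i) (G i)) ->
  rveq O (\prod_(i <- r) F i) (\prod_(i <- r) G i).
elim: r => [|i r IH] h; first by rewrite !big_nil rveqxx.
rewrite !big_cons; apply: rveqM; first by apply: h; rewrite mem_head.
by apply: IH => j jr; apply: h; rewrite inE jr orbT.
Qed.

Lemma nv_prod_lt (I : eqType) (r : seq I) F G k : (forall i, i \in r -> F i <=_[O] G i) -> (forall i, i \in r -> G i != 0) ->
  k \in r -> F k <_[O] G k -> \prod_(i <- r) F i <_[O] \prod_(i <- r) G i.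
move=> h G0 kr lt; rewrite !(perm_big _ (perm_to_rem kr)) !big_cons.
apply: nv_ltM_le => //; first by apply: nv_prod_le => i /mem_rem; apply: h.
by rewrite prodf_seq_neq0; apply/allP => i /mem_rem /G0 ->.
Qed.
End Bounds.

(** * Hensel's lemma and roots in a cut *)

Section Hensel.
Variables (E : closedF) (O : valring E) (p : nat).
Hypothesis pE : p \in [pchar E].

(** Some root is close to [u] because the product of the [u - w] is small, and only one because the
    derivative at [u] is a unit; uniqueness puts it into [N] by [sg_hensel]. *)
Lemma sg_hensel_simple N P u : SG O p N -> perf_sf p N -> P \over N -> P \is monic -> (forall i, P`_i <=_[O] 1) ->
  u \in N -> u <=_[O] 1 -> P.[u] <_[O] 1 -> nv O P^`().[u] = nv O 1 -> exists2 s, s \in N & root P s /\ s - u <_[O] 1.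
move=> sgN pN NP mP hP uN hu Pu P'u; have [rs eP] := monic_roots mP.
have rs1 w : w \in rs -> w <=_[O] 1 by (move=> wr; apply: monic_root_le1 mP hP _; rewrite eP root_prod_XsubC).
have [w wrs wu] : exists2 w, w \in rs & u - w <_[O] 1.
  apply: contrapT => h; move: Pu; rewrite ltNge => /negP; apply.
  rewrite eP horner_prod; under [X in _ <=_[O] X]eq_bigr do rewrite hornerXsubC.
  have {}h w : w \in rs -> 1 <=_[O] u - w by (move=> wr; rewrite leNgt; apply/negP => hw; apply: h; exists w).
  elim: rs h {eP rs1} => [|w r IH] h; first by rewrite big_nil.
  rewrite big_cons -[X in X <=_[O] _](mulr1 1); apply: nv_leM; first by apply: h; rewrite mem_head.
  by apply: IH => t tr; apply: h; rewrite inE tr orbT.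
have uniq_w t : root P t -> t - u <_[O] 1 -> t = w.
  move=> Pt tu; apply: contrapT => /eqP tw; move: P'u.
  have := perm_to_rem wrs; set r := rem w rs => pr.
  have eP' : P = ('X - w%:P) * \prod_(z <- r) ('X - z%:P) by rewrite eP (perm_big _ pr) big_cons.
  have tr : t \in r by move: Pt; rewrite eP' rootM root_XsubC (negbTE tw) root_prod_XsubC.
  have := perm_to_rem tr; set r' := rem t r => pr'.
  rewrite (perm_big _ pr') big_cons in eP'; set R := \prod_(z <- r') _ in eP'.
  have hR i : R`_i <=_[O] 1.
    have -> : R = \prod_(z <- r') (1 *: 'X + (- z)%:P) by (apply: eq_bigr => z _; rewrite scale1r polyCN).
    apply: le_trans (coef_prod_le (m := fun=> 1) _ _ _) _; rewrite //.
    - move=> z zr; rewrite nvN; apply: rs1; rewrite (perm_mem pr) inE (perm_mem pr') inE zr !orbT //.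
    - by rewrite big1_seq.
  have hR' i : R^`()`_i <=_[O] 1 by (rewrite coef_deriv -mulr_natr; apply: nv_leM1; rewrite // nv_le1 rpred_nat).
  rewrite eP' !derivM !derivXsubC !mul1r !hornerD !hornerM !hornerXsubC => h.
  have : (u - t) * R.[u] + (u - w) * (R.[u] + (u - t) * R^`().[u]) <_[O] 1.
    have ut : u - t <_[O] 1 by rewrite nvB.
    apply: nv_ltD; apply: nv_ltM1 => //; first exact: horner_int_le.
    apply: nv_leD; first exact: horner_int_le.
    by apply/ltW/nv_ltM1 => //; apply: horner_int_le.
  by move: h; rewrite [(R + _).[u]]hornerD hornerM hornerXsubC => ->; rewrite ltxx.
have Pw : root P w by rewrite eP root_prod_XsubC.
have aw : alg_over N w by exists P; rewrite ?monic_neq0.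
exists w; last by rewrite nvB.
apply: (sg_hensel pE sgN (perfect_sepalg pE pN aw) NP Pw uN) => t Pt e.
by apply: uniq_w; rewrite // e nvB.
Qed.
End Hensel.

Section Cut.
(* [Fam c d] says that [c] is a centre at distance [|d|] from the pseudo-limit;
   [cut] is the set of pseudo-limits. *)
Variables (E : closedF) (O : valring E) (Fam : E -> E -> Prop).
Hypothesis Fam0 : exists c d, Fam c d.
Hypothesis nobest : forall c d, Fam c d -> exists c' d', Fam c' d' /\ d' <_[O] d.

Definition cut (z : E) := forall c d, Fam c d -> nv O (z - c) = nv O d.

Lemma cut_near z z' : cut z -> (forall c d, Fam c d -> z' - z <_[O] d) -> cut z'.
move=> Cz h c d F; have e := Cz _ _ F; rewrite -e -[z' - c](subrK (z - c)) addrC.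
by apply: nv_dom; rewrite e opprB addrA subrK; apply: h F.
Qed.

Lemma cut_average z zb : cut z -> (forall c d, Fam c d -> c - zb <=_[O] c - z) -> cut zb.
move=> Cz h; apply: cut_near (Cz) _ => c d F.
have [c' [d' [F' lt]]] := nobest F; apply: le_lt_trans lt.
have -> : zb - z = (c' - z) - (c' - zb) by ring.
rewrite -(Cz _ _ F') (nvB _ z); apply: nv_leB => //; exact: h F'.
Qed.

Lemma cut_separate z (rs : seq E) : cut z -> (forall w, w \in rs -> ~ cut w) ->
  exists c d, Fam c d /\ forall w, w \in rs -> d <_[O] z - w.
move=> Cz; elim: rs => [|w rs IH] h; first by have [c [d]] := Fam0; exists c, d.
have [w' wr|c [d [F hd]]] := IH; first by apply: h; rewrite inE wr orbT.
have [c' [d' [F' hd']]] : exists c' d', Fam c' d' /\ d' <_[O] z - w.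
  apply: contrapT => nc; apply: (h w); rewrite ?mem_head //; apply: cut_near (Cz) _ => a b Fab.
  have [a' [b' [Fab' lt]]] := nobest Fab; apply: le_lt_trans lt; rewrite nvB leNgt.
  by apply/negP => lt; apply: nc; exists a', b'.
have [] := leP (nv O d) (nv O d').
  exists c, d; split=> // t; rewrite inE => /predU1P[->|/hd //].
  exact: le_lt_trans hd'.
exists c', d'; split=> // t; rewrite inE => /predU1P[->//|/hd].
exact: lt_trans.
Qed.

Variables (p : nat) (pE : p \in [pchar E]) (N : subfield E).
Hypotheses (sgN : SG O p N) (pN : perf_sf p N).
Hypothesis FamN : forall c d, Fam c d -> c \in N.

(* Among the roots of [P] in the cut pick one, [z], as close to [N] as
   possible, and let [zb] be the average of its conjugates.  Were [z] not in
   [N], summing the Taylor expansions of [P] at [zb] over the conjugates would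
   produce a root of [P] closer to [zb]. *)
Lemma root_in_cut P : P \over N -> P \is monic -> (exists z, root P z /\ cut z) ->
  (forall j z, (0 < j)%N -> P^`N(j) != 0 -> root P^`N(j) z -> ~ cut z) -> exists z, [/\ z \in N, root P z & cut z].
move=> NP mP [z0 [Pz0 Cz0]] hj; have [rs eP] := monic_roots mP.
have av w : root P w -> exists ws zb, [/\ w \in ws, uniq ws & ~~ (p %| size ws)%N] /\
    [/\ irr N (\prod_(t <- ws) ('X - t%:P)), zb \in N, zb *+ size ws = \sum_(t <- ws) t,
      forall x t, x \in N -> t \in ws -> nv O (t - x) = nv O (w - x) & forall x, x \in N -> x - zb <=_[O] x - w].
  move=> Pw; apply: (sg_average pE sgN); apply: (perfect_sepalg pE pN).
  by exists P; rewrite ?monic_neq0.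
have [z [zrs Cz zmin]] : exists z, [/\ z \in rs, cut z & forall w, w \in rs -> cut w ->
    forall x, x \in N -> exists2 y, y \in N & z - y <=_[O] w - x].
  have hz0 : z0 \in rs by rewrite -root_prod_XsubC -eP.
  suff /(_ rs (fun _ h => h)) [H|//] : forall l : seq E, {subset l <= rs} ->
    (forall w, w \in l -> ~ cut w) \/ exists z, [/\ z \in rs, cut z & forall w, w \in l -> cut w ->
    forall x, x \in N -> exists2 y, y \in N & z - y <=_[O] w - x].
    by case: (H z0).
  elim=> [|w l IH] lr; first by left.
  have {}IH := IH (fun x hx => lr x (mem_behead (s := w :: l) hx)).
  have wr : w \in rs by apply: lr; rewrite mem_head.
  have [Cw|nCw] := pselect (cut w); last first.
    case: IH => [h|[z [zr Cz h]]]; [left|right].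
      by move=> t; rewrite inE => /predU1P[->|/h].
    by exists z; split=> // t; rewrite inE => /predU1P[->//|]; apply: h.
  right; have Pw : root P w by rewrite eP root_prod_XsubC.
  have [ws [wb [_ [_ wbN _ _ hw]]]] := av w Pw.
  have wbest x : x \in N -> w - wb <=_[O] w - x.
    move=> xN; have -> : w - wb = (x - wb) - (x - w) by ring.
    by apply: nv_leB; rewrite ?(nvB _ w) ?hw.
  case: IH => [h|[z [zr Cz h]]].
    exists w; split=> // t; rewrite inE => /predU1P[->|/h //] _ x xN.
    by exists wb => //; apply: wbest.
  have [[y yN hy]|hn] := pselect (exists2 y, y \in N & z - y <=_[O] w - wb).
    exists z; split=> // t; rewrite inE => /predU1P[->|]; last exact: h.
    by move=> _ x xN; exists y => //; apply: le_trans (wbest x xN).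
  exists w; split=> // t; rewrite inE => /predU1P[->|tl] Ct x xN.
    by exists wb => //; apply: wbest.
  have [y yN hy] := h t tl Ct x xN; exists wb => //; apply: le_trans hy.
  by rewrite leNgt; apply/negP => lt; apply: hn; exists y; rewrite ?ltW.
have Pz : root P z by rewrite eP root_prod_XsubC.
have [ws [zb [[zws uws pn] [iW zbN ezb dist hzb]]]] := av z Pz.
have Czb : cut zb by apply: cut_average Cz _ => c d F; apply: hzb; apply: FamN F.
have [ezz|nzz] := eqVneq z zb; first by exists zb; split=> //; rewrite -ezz.
set e := z - zb; have e0 : e != 0 by rewrite subr_eq0.
have zbest x : x \in N -> e <=_[O] z - x.
  move=> xN; have -> : e = (x - zb) - (x - z) by rewrite /e; ring.
  by apply: nv_leB; rewrite ?(nvB _ z) ?hzb.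
have eps t : t \in ws -> nv O (t - zb) = nv O e by move=> tw; apply: dist.
have Pws t : t \in ws -> root P t.
  move=> tw; apply: (root_dvdp (irr_dvdp iW _ NP Pz)); by rewrite root_prod_XsubC.
have [P0|P0] := eqVneq P.[zb] 0; first by exists zb; split=> //; apply/eqP.
pose S k := \sum_(t <- ws) (t - zb) ^+ k.
have S1 : S 1%N = 0.
  rewrite /S.
  by rewrite sumrB big_const_seq iter_addr_0 ezb subrr.
have Sle k : S k <=_[O] e ^+ k.
  rewrite /S big_seq; apply: nv_le_sum => t tw.
  by rewrite (nv_eqX k (eps t tw)).
have sum0 : \sum_(k < size P) tc P zb k * S k = 0.
  under eq_bigr do rewrite mulr_sumr.
  rewrite exchange_big big_seq big1 // => t tw; rewrite -taylor.
  by have /eqP := Pws t tw; rewrite addrC subrK.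
have sP : (0 < size P)%N by rewrite size_poly_gt0 monic_neq0.
have [k [k0 kge]] : exists k, (0 < k)%N /\ P.[zb] <=_[O] tc P zb k * S k.
  apply: contrapT => hn; move: sum0; rewrite -(prednK sP) big_ord_recl tc0.
  move/eqP; rewrite addr_eq0 => /eqP h.
  have : P.[zb] * S 0%N <_[O] P.[zb].
    rewrite h nvN; apply: nv_lt_sum => // i _; rewrite ltNge; apply/negP => hi.
    by apply: hn; exists (lift ord0 i).
  rewrite /S.
  rewrite big_const_seq iter_addr_0 -{2}[P.[zb]]mulr1 nv_ltM2l //.
  by rewrite (nv_nat1 O pE pn) ltxx.
(* Power sums whose index is a power of [p] are Frobenius images of the first one, which vanishes by
   the choice of [zb]. *)
have notp v : k <> (p ^ v)%N.
  move=> ek; have S0 : S k = 0.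
    have := frobk_sum pE v ws (fun t => t - zb); rewrite -[X in _ = X]/(S (p ^ v)%N) -ek => <-.
    have -> : \sum_(t <- ws) (t - zb) = S 1%N by [].
    by rewrite S1 expr0n eqn0Ngt k0.
  by move: kge; rewrite S0 mulr0 nv_le0 (negbTE P0).
(* Up to a unit, the Taylor coefficient of [P] of index [k] is one of the [j]-th divided derivative.
   As that has no root in the cut, the [k]-th Taylor term of [P] is smaller than the [j]-th. *)
have [j [j0 jk pb]] := ex_binomial_unit pE k0 notp.
have b0 : ('C(k, j))%:R != 0 :> E by rewrite -(dvdn_pcharf pE).
have etc : tc P^`N(j) zb (k - j) = tc P zb k * 'C(k, j)%:R by rewrite tc_nderivn subnKC ?mulr_natr // ltnW.
have tk0 : tc P zb k != 0 by (apply: contraNneq P0 => tk; move: kge; rewrite tk mul0r nv_le0).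
have Q0 : P^`N(j) != 0.
  apply: contraNneq tk0 => Q0; move/eqP: etc; rewrite Q0 /tc comp_poly0 coef0 eq_sym.
  by rewrite mulf_eq0 (negbTE b0) orbF.
have [qs eQ] := closed_field_poly_normal P^`N(j).
have lQ : lead_coef P^`N(j) != 0 by rewrite lead_coef_eq0.
have [c [d [F hd]]] : exists c d, Fam c d /\ forall w, w \in qs -> d <_[O] zb - w.
  apply: cut_separate => // w wq; apply: hj j0 Q0 _.
  by rewrite eQ rootZ // root_prod_XsubC.
have ed : e <=_[O] d by (rewrite -(Cz _ _ F); apply: zbest; apply: FamN F).
have lt1 : tc P zb k * e ^+ k <_[O] tc P zb j * e ^+ j.
  have kj0 : (0 < k - j)%N by rewrite subn_gt0.
  have := tc_far_lt (O := O) (rs := qs) (z := zb) (e := e) kj0.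
  move=> /(_ (fun w wq => le_lt_trans ed (hd w wq))) lt.
  have : tc P^`N(j) zb (k - j) * e ^+ (k - j) <_[O] P^`N(j).[zb] by rewrite eQ /tc comp_polyZ coefZ -mulrA hornerZ nv_ltM2l.
  rewrite etc -(tc0) tc_nderivn addn0 binn.
  rewrite -(nv_ltM2r _ _ _ (expf_neq0 j e0)) -[_ * e ^+ (k - j) * _]mulrA -exprD subnK ?(ltnW jk) //.
  apply: le_lt_trans; rewrite mulrAC -[X in X <=_[O] _]mulr1; apply: nv_leM => //.
  by rewrite (nv_nat1 O pE).
have [w [wr hw]] : exists w, w \in rs /\ zb - w <_[O] e.
  apply: contrapT => hn.
  have far w : w \in rs -> e <=_[O] zb - w by (move=> wr; rewrite leNgt; apply/negP => h; apply: hn; exists w).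
  have := tc_far_le j far; rewrite -eP leNgt => /negP; apply.
  apply: le_lt_trans lt1; apply: le_trans kge _; exact: nv_leM.
have Cw : cut w.
  apply: cut_near Czb _ => c' d' F'; rewrite nvB; apply: lt_le_trans hw _.
  by rewrite -(Cz _ _ F'); apply: zbest; apply: FamN F'.
have [y yN hy] := zmin w wr Cw zb zbN.
have := le_lt_trans hy (_ : w - zb <_[O] e); rewrite nvB => /(_ hw).
by rewrite ltNge zbest.
Qed.
End Cut.

(** * Extending embeddings of perfect fields *)

Section Embeddings.
Variables (E : closedF) (O : valring E) (p : nat).
Hypothesis pE : p \in [pchar E].
Variables N1 N2 : subfield E.
Hypotheses (sg1 : SG O p N1) (sg2 : SG O p N2).
Hypotheses (perf1 : perf_sf p N1) (perf2 : perf_sf p N2).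
Hypothesis rv12 : forall x, x \in N1 -> exists2 y, y \in N2 & rveq O x y.
Variables (A : fieldType) (i1 i2 : {rmorphism A -> E}).
Notation mp1 := (map_poly i1).
Notation mp2 := (map_poly i2).
Hypotheses (A1 : forall a, i1 a \in N1) (A2 : forall a, i2 a \in N2).
Hypothesis A12 : forall a, rveq O (i1 a) (i2 a).

Let pp : prime p. Proof. exact: pcharf_prime pE. Qed.

(** The condition under which sending [s] to [t] extends to an isomorphism of the generated fields
    that preserves leading terms. *)
Definition ext_to (s t : E) := forall Q : {poly A}, rveq O (mp1 Q).[s] (mp2 Q).[t].

Lemma i1_over1 Q : mp1 Q \over N1.
by apply/polyOverP => i; rewrite coef_map; apply: A1. Qed.
Lemma i2_over2 Q : mp2 Q \over N2.
by apply/polyOverP => i; rewrite coef_map; apply: A2. Qed.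
Lemma nv12 a : nv O (i1 a) = nv O (i2 a).
exact: rveq_nv. Qed.

Lemma ext_to_small (P : {poly A}) s t : P != 0 -> root (mp1 P) s -> root (mp2 P) t ->
  (forall Q : {poly A}, (size Q < size P)%N -> rveq O (mp1 Q).[s] (mp2 Q).[t]) -> ext_to s t.
move=> P0 Ps Pt h Q; rewrite (divp_eq Q P) !rmorphD !rmorphM !hornerD !hornerM.
rewrite (eqP Ps) (eqP Pt) !mulr0 !add0r.
by apply: h; apply: ltn_modpN0.
Qed.

Lemma rveq_map Q i : rveq O (mp1 Q)`_i (mp2 Q)`_i.
by rewrite !coef_map; apply: A12. Qed.

Lemma max_term (Q : {poly A}) u : Q != 0 -> u != 0 ->
  exists k, i1 Q`_k * u ^+ k != 0 /\ forall i, i1 Q`_i * u ^+ i <=_[O] i1 Q`_k * u ^+ k.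
move=> Q0 u0; have sQ : ((size Q).-1 < size Q)%N by rewrite prednK ?size_poly_gt0.
have [k _ hk] := @arg_maxP _ _ _ (Ordinal sQ) xpredT (fun i : 'I_(size Q) => nv O (i1 Q`_i * u ^+ i)) isT.
have {}hk i : i1 Q`_i * u ^+ i <=_[O] i1 Q`_k * u ^+ k.
  have [si|si] := ltnP i (size Q); first exact: hk (Ordinal si) isT.
  by rewrite nth_default // rmorph0 mul0r nv_ge0.
exists k; split=> //; apply: contraNneq Q0 => e; have := hk (size Q).-1.
by rewrite e nv_le0 mulf_eq0 fmorph_eq0 expf_eq0 (negbTE u0) andbF orbF lead_coef_eq0.
Qed.

(** Substituting [u * X] and dividing by the dominant leading term reduces to Hensel's lemma at
    1. *)
Lemma hensel_near N P u : SG O p N -> perf_sf p N -> P \over N ->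
  u \in N -> u != 0 -> (forall i, P`_i * u ^+ i <=_[O] lead_coef P * u ^+ (size P).-1) ->
  P.[u] <_[O] lead_coef P * u ^+ (size P).-1 -> nv O (P^`().[u] * u) = nv O (lead_coef P * u ^+ (size P).-1) ->
  exists2 s, s \in N & root P s /\ rveq O s u.
set M := lead_coef P * _ => sgN pN NP uN u0 hP Pu dP.
have M0 : M != 0 by rewrite -(nv_gt0 O) (le_lt_trans (nv_ge0 _ _) Pu).
pose P1 := M^-1 *: (P \Po (u *: 'X)).
have c1 i : P1`_i = P`_i * u ^+ i / M by rewrite coefZ coef_comp_scale mulrC.
have h1 z : P1.[z] = P.[u * z] / M by rewrite hornerZ horner_comp !hornerE mulrC.
have N1P : P1 \over N by (apply/polyOverP => i; rewrite c1 rpredM ?rpredV ?rpredM ?rpredX ?(polyOverP NP)).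
have mP1 : P1 \is monic.
  rewrite monicE lead_coefE size_scale ?invr_eq0 // size_comp_poly2 ?size_scale ?size_polyX //.
  by rewrite c1 divff.
have int1 i : P1`_i <=_[O] 1 by rewrite c1 nv_le_divl // mul1r.
have [||s sN [rs s1]] := sg_hensel_simple pE sgN pN N1P mP1 int1 (rpred1 N) (lexx _).
- by rewrite h1 mulr1 nv_lt_divl // mul1r.
- rewrite derivZ deriv_comp derivZ derivX hornerZ hornerM horner_comp !hornerZ hornerX hornerC !mulr1.
  by rewrite -[in RHS](mulVf M0); apply: nv_eqM.
exists (u * s); first by rewrite rpredM.
move: rs; rewrite rootE h1 mulf_eq0 invr_eq0 (negbTE M0) orbF => rs; split=> //.
by apply: rveq_lt; rewrite -[X in _ - X]mulr1 -mulrBr -[X in _ <_[O] X]mulr1 nv_ltM2l.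
Qed.

Hypothesis perfA : forall a : A, exists b, a = b ^+ p.

Definition cancels u (Q : {poly A}) := exists k,
  (forall i, i1 Q`_i * u ^+ i <=_[O] i1 Q`_k * u ^+ k) /\ (mp1 Q).[u] <_[O] i1 Q`_k * u ^+ k.

(* A polynomial of least degree whose terms cancel at [u] is separable by
   minimality and perfection, so that Hensel's lemma moves [u] to one of its roots. *)
Lemma graded_step u : u \in N1 -> u != 0 -> (exists Q, cancels u Q) ->
  exists s t, [/\ s \in N1, t \in N2, ext_to s t & rveq O s u].
move=> uN u0 [Q0 cQ0].
have [n [[P [cP sP]] pmin]] := @ex_least (fun n => exists Q, cancels u Q /\ size Q = n)
  (ex_intro _ _ (ex_intro _ Q0 (conj cQ0 erefl))).
have min (Q : {poly A}) : (size Q < size P)%N -> ~ cancels u Q by (move=> sQ cQ; have := pmin _ (ex_intro _ Q (conj cQ erefl)); rewrite -sP leqNgt sQ).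
have low (Q : {poly A}) : Q != 0 -> (size Q < size P)%N -> exists k, [/\ i1 Q`_k * u ^+ k != 0,
    forall i, i1 Q`_i * u ^+ i <=_[O] i1 Q`_k * u ^+ k & nv O (mp1 Q).[u] = nv O (i1 Q`_k * u ^+ k)].
  move=> nQ sQ; have [k [k0 hk]] := max_term nQ u0; exists k; split=> //; apply: le_anti; apply/andP; split.
    by rewrite horner_coef; apply: nv_le_sum => i _; rewrite coef_map; exact: hk.
  by rewrite leNgt; apply/negP => lt; apply: (min _ sQ); exists k.
set m := (size P).-1; set M := i1 P`_m * u ^+ m.
have sPm : size P = m.+1.
  rewrite prednK // size_poly_gt0; have [k [_ h]] := cP; apply: contraTneq h => ->.
  by rewrite coef0 !rmorph0 mul0r -leNgt nv_ge0.
(* By minimality the leading term is maximal; otherwise the polynomial without it would still cancel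
   at [u]. *)
have [hP Pu] : (forall i, i1 P`_i * u ^+ i <=_[O] M) /\ (mp1 P).[u] <_[O] M.
  have [k [hk Pu]] := cP; have [e|ne] := eqVneq (nv O M) (nv O (i1 P`_k * u ^+ k)).
    by split=> [i|]; rewrite e.
  have lt : M <_[O] i1 P`_k * u ^+ k by rewrite lt_neqAle ne hk.
  have cQ i : (P - P`_m *: 'X^m)`_i = if i == m then 0 else P`_i.
    by rewrite coefB coefZ coefXn; case: eqP => [->|_]; rewrite ?mulr1 ?subrr // mulr0 subr0.
  have [] := @min (P - P`_m *: 'X^m).
    rewrite sPm ltnS; apply/leq_sizeP => j mj; rewrite cQ; case: eqP => // /eqP jm.
    by rewrite nth_default // sPm ltn_neqAle eq_sym jm.
  have km : k != m by apply: contraTneq lt => ->; rewrite ltxx.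
  exists k; rewrite cQ (negbTE km); split=> [i|].
    by rewrite cQ; case: eqP => _; rewrite // rmorph0 mul0r nv_ge0.
  by rewrite rmorphB /= map_polyZ map_polyXn !hornerE nv_ltB.
have M0 : M != 0 by rewrite -(nv_gt0 O) (le_lt_trans (nv_ge0 _ _) Pu).
have m0 : (0 < m)%N.
  rewrite lt0n; apply: contraTneq Pu => m0; rewrite -leNgt /M horner_coef size_map_poly sPm m0.
  by rewrite big_ord1 coef_map.
(* If all maximal terms had indices divisible by [p], the polynomial [R], whose [p]-th power
   collects the terms with such indices, would cancel at [u] in smaller degree. This is where [A]
   has to be perfect. *)
have [j pj ej] : exists2 j, ~~ (p %| j)%N & nv O (i1 P`_j * u ^+ j) = nv O M.
  apply: contrapT => nu.
  have small i : ~~ (p %| i)%N -> i1 P`_i * u ^+ i <_[O] M by (move=> pi; rewrite lt_neqAle hP andbT; apply/eqP => e; apply: nu; exists i).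
  have [r hr] := choice (fun i => perfA P`_(i * p)).
  have pm : (p %| m)%N by apply: contraT => /small; rewrite ltxx.
  pose R := \poly_(i < (m %/ p).+1) r i.
  have cR i : (i < (m %/ p).+1)%N -> (i1 R`_i * u ^+ i) ^+ p = i1 P`_(i * p) * u ^+ (i * p).
    by move=> hi; rewrite coef_poly hi exprMn -rmorphXn -hr exprM.
  apply: (@min R).
    by rewrite (leq_ltn_trans (size_poly _ _)) // sPm ltnS ltn_Pdiv // prime_gt1.
  exists (m %/ p)%N; split=> [i|].
    rewrite -(nv_leX2 O _ _ (prime_gt0 pp)) (cR (m %/ p)%N) // divnK //.
    have [hi|hi] := ltnP i (m %/ p).+1; first by rewrite cR.
    by rewrite coef_poly ltnNge hi rmorph0 mul0r expr0n eqn0Ngt prime_gt0 // nv_ge0.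
  rewrite -(nv_ltX2 O _ _ (prime_gt0 pp)) cR // divnK //.
  have -> : (mp1 R).[u] ^+ p = (mp1 P).[u] - \sum_(i < m.+1 | ~~ (p %| i)%N) i1 P`_i * u ^+ i.
    rewrite [(mp1 P).[u]]horner_coef size_map_poly sPm (bigID (fun i : 'I_m.+1 => (p %| i)%N)) /=.
    under [X in _ = X + _ - _]eq_bigr do rewrite coef_map.
    under [X in _ = _ + X - _]eq_bigr do rewrite coef_map.
    rewrite addrK (horner_coef_wide _ (_ : _ <= (m %/ p).+1)%N) ?size_map_poly ?size_poly //.
    have := frobk_sum pE 1 (index_enum 'I_(m %/ p).+1) (fun i => (mp1 R)`_i * u ^+ i).
    rewrite expn1 => ->.
    rewrite [RHS](reindex_onto (fun i : 'I_(m %/ p).+1 => inord (i * p) : 'I_m.+1) (fun j => inord (j %/ p))) /=.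
      have bnd (i : 'I_(m %/ p).+1) : (i * p < m.+1)%N by rewrite ltnS -[X in (_ <= X)%N](divnK pm) leq_mul2r -ltnS ltn_ord orbT.
      apply: eq_big => [i|i _]; last by rewrite inordK // coef_map cR.
      by rewrite inordK // dvdn_mull // mulnK ?prime_gt0 // inord_val eqxx.
    move=> j pj; have hj : (j %/ p < (m %/ p).+1)%N by rewrite ltnS leq_div2r // -ltnS.
    by rewrite (inordK hj) divnK // inord_val.
  by apply: nv_ltB => //; apply: nv_lt_sum => // i; apply: small.
have sdP : (size P^`() < size P)%N by rewrite lt_size_deriv // -size_poly_gt0 sPm.
have dP : nv O ((mp1 P)^`().[u] * u) = nv O M.
  case: j pj ej => [|j] pj ej; first by rewrite dvdn0 in pj.
  have dE i : i1 P^`()`_i * u ^+ i * u = i.+1%:R * (i1 P`_i.+1 * u ^+ i.+1) by rewrite coef_deriv rmorphMn -mulr_natl -!mulrA -exprSr.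
  have dj : nv O (i1 P^`()`_j * u ^+ j * u) = nv O M by rewrite dE (nv_eqM (nv_nat1 O pE pj) ej) mul1r.
  have [|k [_ hk ek]] := low _ _ sdP.
    by apply/eqP => e; move/eqP: dj; rewrite e coef0 rmorph0 !mul0r eq_sym nv_eq0 (negbTE M0).
  rewrite deriv_map (nv_eqM ek (erefl (nv O u))); apply: le_anti; rewrite -{2}dj nv_leM2r // hk andbT.
  rewrite dE -[X in _ <=_[O] X]mul1r; apply: nv_leM => //; by rewrite nv_le1 rpred_nat.
have [y yN uy] := rv12 uN; have y0 : y != 0 by rewrite -(rveq_eq0 uy).
have trans (Q : {poly A}) s t : (size Q < size P)%N -> rveq O u s -> rveq O u t -> rveq O (mp1 Q).[s] (mp2 Q).[t].
  have [->|nQ] := eqVneq Q 0; first by rewrite !rmorph0 !horner0 rveqxx.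
  move=> sQ us ut; have [k [k0 hk ek]] := low _ nQ sQ.
  have cl (h : {rmorphism A -> E}) z : (forall a, rveq O (i1 a) (h a)) -> rveq O u z -> rveq O (map_poly h Q).[z] (mp1 Q).[u].
    move=> hh uz; apply: rveq_lt; rewrite nvB ek; apply: rveq_horner_lt => // i; rewrite !coef_map; [exact: hh|exact: hk].
  exact: rveq_trans (cl i1 s (fun => rveqxx O _) us) (rveq_sym (cl i2 t A12 ut)).
have lE (h : {rmorphism A -> E}) z : lead_coef (map_poly h P) * z ^+ (size (map_poly h P)).-1 = h P`_m * z ^+ m.
  by rewrite lead_coef_map size_map_poly.
have e12 i : nv O (i2 P`_i * y ^+ i) = nv O (i1 P`_i * u ^+ i) by (apply/rveq_nv/rveq_sym/rveqM => //; apply: rveqX).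
have [s sN [Ps su]] : exists2 s, s \in N1 & root (mp1 P) s /\ rveq O s u.
  by apply: (hensel_near sg1 perf1 (i1_over1 P) uN u0); rewrite lE // => i; rewrite coef_map; exact: hP.
have [t tN [Pt ty]] : exists2 t, t \in N2 & root (mp2 P) t /\ rveq O t y.
  apply: (hensel_near sg2 perf2 (i2_over2 P) yN y0) => [i||]; rewrite lE ?e12.
  - by rewrite coef_map e12; apply: hP.
  - rewrite -[_.[y]](subrK (mp1 P).[u]); apply: nv_ltD => //; rewrite nvB.
    by apply: rveq_horner_lt => // i; [apply: rveq_map|rewrite coef_map; exact: hP].
  - rewrite -/M -dP !deriv_map; apply/esym/rveq_nv/rveqM => //; exact: trans (rveqxx _ _) uy.
exists s, t; split=> //; apply: (ext_to_small _ Ps Pt) => [|Q sQ]; first by rewrite -size_poly_gt0 sPm.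
exact: trans (rveq_sym su) (rveq_trans uy (rveq_sym ty)).
Qed.

Definition fam (h : A -> E) (x c d : E) := exists a : A, c = h a /\ d = x - i1 a.

Section Immed.
Variable x : E.
Hypothesis improve : forall a, exists b, x - i1 b <_[O] x - i1 a.

Lemma improve_neq a : x - i1 a != 0.
have [b hb] := improve a; rewrite -(nv_gt0 O); apply: le_lt_trans hb; exact: nv_ge0.
Qed.

(** Kaplansky's dichotomy: a nonzero [Q] is stable exactly when it has no root in the cut. Stability
    is the same for both embeddings, so this compares the roots on the two sides. *)
Let stable (Q : {poly A}) := exists a0, forall a, x - i1 a <=_[O] x - i1 a0 -> nv O (i1 Q.[a]) = nv O (i1 Q.[a0]).

Section Stability.
Variable h : {rmorphism A -> E}.
Hypothesis hnv : forall a, nv O (h a) = nv O (i1 a).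

Lemma fam_not_cut w : ~ cut O (fam h x) w -> exists a0, forall a, x - i1 a <=_[O] x - i1 a0 -> nv O (h a - w) = nv O (h a0 - w).
move=> nC; have [c hc] : exists c, nv O (w - h c) <> nv O (x - i1 c).
  apply: contrapT => n; apply: nC => _ _ [a [-> ->]]; apply: contrapT => n'.
  by apply: n; exists a.
have dist a : x - i1 a <_[O] x - i1 c -> nv O (h a - w) = if w - h c <_[O] x - i1 c then nv O (x - i1 c) else nv O (w - h c).
  move=> lt; have e : nv O (h a - h c) = nv O (x - i1 c).
    rewrite -rmorphB hnv rmorphB; have -> : i1 a - i1 c = (x - i1 c) - (x - i1 a) by ring.
    exact: nv_domB.
  have -> : h a - w = (h a - h c) - (w - h c) by ring.
  case: (ltgtP) => [l|l|l] //.
    by rewrite nv_domB ?e.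
  by rewrite nvB nv_domB ?e.
have [a0] := improve c; exists a0 => a le0.
by rewrite !dist // (le_lt_trans le0).
Qed.

Lemma fam_not_cut_seq (rs : seq E) : exists a0, forall w, w \in rs -> cut O (fam h x) w \/ forall a, x - i1 a <=_[O] x - i1 a0 ->
    nv O (h a - w) = nv O (h a0 - w).
elim: rs => [|w rs [a0 IH]]; first by exists 0.
have [C|/fam_not_cut[b hb]] := pselect (cut O (fam h x) w).
  by exists a0 => t; rewrite inE => /predU1P[->|/IH]; [left|].
have [ba|ab] := leP (nv O (x - i1 b)) (nv O (x - i1 a0)).
  exists b => t; rewrite inE => /predU1P[->|/IH[]]; [by right|by left|move=> h0; right].
  by move=> a ha; rewrite (h0 _ ba) h0 // (le_trans ha).
exists a0 => t; rewrite inE => /predU1P[->|/IH //]; right=> a ha.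
by rewrite (hb a0) ?ltW // hb // (le_trans ha) ?ltW.
Qed.

Lemma not_cut_stable Q : (forall w, root (map_poly h Q) w -> ~ cut O (fam h x) w) -> stable Q.
move=> nC; have [rs eQ] := closed_field_poly_normal (map_poly h Q).
have [Q0|Q0] := eqVneq Q 0; first by exists 0 => a _; rewrite Q0 !horner0.
have : lead_coef (map_poly h Q) != 0 by rewrite lead_coef_eq0 map_poly_eq0.
have [a0 ha0] := fam_not_cut_seq rs; exists a0 => a ha.
rewrite -!hnv -!horner_map eQ !hornerZ; apply: nv_eqM => //; rewrite !horner_prod.
have e w : w \in rs -> nv O ('X - w%:P).[h a] = nv O ('X - w%:P).[h a0].
  move=> wr; rewrite !hornerXsubC; have [C|] := ha0 _ wr; last by apply.
  by have := nC w; rewrite eQ rootZ // root_prod_XsubC => /(_ wr).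
by apply: le_anti; rewrite !nv_prod_le // => w /e ->.
Qed.

Lemma cut_not_stable Q w : Q != 0 -> root (map_poly h Q) w -> cut O (fam h x) w -> ~ stable Q.
move=> Q0 Qw Cw [a1 ha1]; have [rs eQ] := closed_field_poly_normal (map_poly h Q).
have lQ : lead_coef (map_poly h Q) != 0 by rewrite lead_coef_eq0 map_poly_eq0.
have [a0 ha0] := fam_not_cut_seq rs.
have [c [c0 c1]] : exists c, x - i1 c <=_[O] x - i1 a0 /\ x - i1 c <=_[O] x - i1 a1.
  by have [] := leP (nv O (x - i1 a0)) (nv O (x - i1 a1)); [exists a0|exists a1; rewrite ltW].
have [a lt] := improve c.
have dist t b : cut O (fam h x) t -> nv O (h b - t) = nv O (x - i1 b) by (move=> Ct; rewrite nvB; apply: Ct; exists b).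
have wr : w \in rs by move: Qw; rewrite eQ rootZ // root_prod_XsubC.
have : (map_poly h Q).[h a] <_[O] (map_poly h Q).[h c].
  rewrite eQ !hornerZ nv_ltM2l // !horner_prod; apply: (nv_prod_lt (k := w)) => //.
  - move=> t tr; rewrite !hornerXsubC; have [Ct|e] := ha0 t tr.
      by rewrite !dist // ltW.
    by rewrite (e c) // (e) // (le_trans (ltW lt)).
  - move=> t tr; rewrite hornerXsubC; have [Ct|e] := ha0 t tr.
      by rewrite -(nv_eq0 O) dist // nv_eq0 improve_neq.
    apply/eqP => ht; have := e a (le_trans (ltW lt) c0).
    rewrite -(e c) // ht => /eqP; rewrite nv_eq0 subr_eq0 => /eqP ha.
    have : h a = h c by rewrite ha; apply/eqP; rewrite eq_sym -subr_eq0 ht.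
    by move/fmorph_inj => ac; rewrite ac ltxx in lt.
  - by rewrite !hornerXsubC !dist.
by rewrite !horner_map !hnv (ha1 c) // (ha1) ?ltxx // (le_trans (ltW lt)).
Qed.
End Stability.

Lemma fam_rveq (h : {rmorphism A -> E}) s Q : (forall a, nv O (h a) = nv O (i1 a)) ->
  cut O (fam h x) s -> (forall w, root (map_poly h Q) w -> ~ cut O (fam h x) w) ->
  exists a0, forall a, x - i1 a <=_[O] x - i1 a0 -> rveq O (map_poly h Q).[s] (h Q.[a]).
move=> hnv Cs nC; have [rs eQ] := closed_field_poly_normal (map_poly h Q).
have [Q0|Q0] := eqVneq Q 0.
  by exists 0 => a _; rewrite Q0 !rmorph0 !horner0 rmorph0 rveqxx.
have lQ : lead_coef (map_poly h Q) != 0 by rewrite lead_coef_eq0 map_poly_eq0.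
have [||w wr|c [d [[a0 [_ ed]] ha0]]] := @cut_separate _ O (fam h x) _ _ s rs Cs.
- by exists (h 0), (x - i1 0), 0.
- move=> _ d [a [_ ->]]; have [b] := improve a.
  by exists (h b), (x - i1 b); split=> //; exists b.
- by apply: nC; rewrite eQ rootZ // root_prod_XsubC.
rewrite {d}ed in ha0; exists a0 => a ha; rewrite -horner_map eQ !hornerZ; apply: rveqM; first exact: rveqxx.
rewrite !horner_prod; apply: rveq_prod_in => w wr; rewrite !hornerXsubC.
apply: rveq_sym; apply: rveq_lt; have -> : h a - w - (s - w) = h a - s by ring.
apply: le_lt_trans (ha0 w wr); rewrite nvB.
by rewrite (Cs (h a) (x - i1 a)) //; exists a.
Qed.

(** A polynomial of least degree with a root in the cut has divided derivatives without one, so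
    [root_in_cut] yields a root in [N1] and one in [N2]. Polynomials of lower degree have the
    leading term that they take near the cut, which makes the two roots correspond. *)
Lemma immed_step : (exists2 P : {poly A}, P != 0 & root (mp1 P) x) ->
  exists s t, [/\ s \in N1, t \in N2, ext_to s t & forall a, s <> i1 a].
move=> [P0 P00 P0x].
have C1x : cut O (fam i1 x) x by move=> _ _ [a [-> ->]].
have nv11 a : nv O (i1 a) = nv O (i1 a) by [].
have nv21 a : nv O (i2 a) = nv O (i1 a) by rewrite nv12.
have [n [[P1 [P10 sP1 [w [P1w Cw]]]] pmin]] := @ex_least (fun n => exists P : {poly A},
  [/\ P != 0, size P = n & exists w, root (mp1 P) w /\ cut O (fam i1 x) w])
  (ex_intro _ _ (ex_intro _ P0 (And3 P00 erefl (ex_intro _ x (conj P0x C1x))))).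
pose P := (lead_coef P1)^-1 *: P1.
have lP : lead_coef P1 != 0 by rewrite lead_coef_eq0.
have P_0 : P != 0 by rewrite scaler_eq0 invr_eq0 (negbTE lP).
have mP : P \is monic by rewrite monicE lead_coefZ mulVf.
have sP : size P = n by rewrite size_scale ?invr_eq0.
have Pw : root (mp1 P) w by rewrite map_polyZ rootZ // fmorph_eq0 invr_eq0.
have low1 (Q : {poly A}) : Q != 0 -> (size Q < size P)%N -> forall z, root (mp1 Q) z -> ~ cut O (fam i1 x) z.
  move=> Q0; rewrite sP ltnNge => /negP sQ z Qz Cz; apply: sQ; apply: pmin.
  by exists Q; split=> //; exists z.
have low2 (Q : {poly A}) : Q != 0 -> (size Q < size P)%N -> forall z, root (mp2 Q) z -> ~ cut O (fam i2 x) z.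
  move=> Q0 sQ z Qz Cz; apply: (cut_not_stable nv21 Q0 Qz Cz).
  by apply: (not_cut_stable nv11); apply: low1.
have [w2 [Pw2 Cw2]] : exists w2, root (mp2 P) w2 /\ cut O (fam i2 x) w2.
  apply: contrapT => nw; apply: (cut_not_stable nv11 P_0 Pw Cw).
  by apply: (not_cut_stable nv21) => z Pz Cz; apply: nw; exists z.
have fam0 h : exists c d, fam h x c d by exists (h 0), (x - i1 0), 0.
have famb h c d : fam h x c d -> exists c' d', fam h x c' d' /\ d' <_[O] d.
  move=> [a [_ ->]]; have [b] := improve a.
  by exists (h b), (x - i1 b); split=> //; exists b.
have sder j : (0 < j)%N -> (size P^`N(j) < size P)%N.
  move=> j0; rewrite (leq_ltn_trans (n := (size P - j)%N)) //; last first.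
    by rewrite ltn_subrL j0 size_poly_gt0.
  apply/leq_sizeP => i hi; rewrite coef_nderivn nth_default ?mul0rn //.
  by rewrite -leq_subLR.
have [s [sN Ps Cs]] : exists s, [/\ s \in N1, root (mp1 P) s & cut O (fam i1 x) s].
  apply: (root_in_cut (fam0 _) (famb _) pE sg1 perf1); rewrite ?map_monic ?i1_over1 //.
  - by move=> _ _ [a [-> _]].
  - by exists w.
  move=> j z j0; rewrite nderivn_map map_poly_eq0 => Qj.
  by apply: low1 => //; apply: sder.
have [t [tN Pt Ct]] : exists t, [/\ t \in N2, root (mp2 P) t & cut O (fam i2 x) t].
  apply: (root_in_cut (fam0 _) (famb _) pE sg2 perf2); rewrite ?map_monic ?i2_over2 //.
  - by move=> _ _ [a [-> _]].
  - by exists w2.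
  move=> j z j0; rewrite nderivn_map map_poly_eq0 => Qj.
  by apply: low2 => //; apply: sder.
exists s, t; split=> //.
  apply: (ext_to_small P_0 Ps Pt) => Q sQ.
  have [->|Q0] := eqVneq Q 0; first by rewrite !rmorph0 !horner0 rveqxx.
  have [a ha] := fam_rveq nv11 Cs (low1 Q Q0 sQ).
  have [b hb] := fam_rveq nv21 Ct (low2 Q Q0 sQ).
  have [c [ca cb]] : exists c, x - i1 c <=_[O] x - i1 a /\ x - i1 c <=_[O] x - i1 b.
    by have [] := leP (nv O (x - i1 a)) (nv O (x - i1 b)); [exists a|exists b; rewrite ltW].
  exact: rveq_trans (ha _ ca) (rveq_trans (_) (rveq_sym (hb _ cb))).
move=> a e; have : nv O (s - i1 a) = nv O (x - i1 a) by apply: Cs; exists a.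
by rewrite e subrr => /esym/eqP; rewrite nv_eq0 (negbTE (improve_neq a)).
Qed.
End Immed.

Lemma im_closed : sfclosed (fun x => exists a, x = i1 a).
split; first by exists 1; rewrite rmorph1.
  by move=> _ _ [a ->] [b ->]; exists (a - b); rewrite rmorphB.
by move=> _ _ [a ->] [b ->]; exists (a / b); rewrite fmorph_div.
Qed.

Definition imA := sf_of im_closed.

Lemma imAP x : x \in imA <-> exists a, x = i1 a.
exact: sf_ofE. Qed.
Lemma imA_i1 a : i1 a \in imA. Proof. by apply/imAP; exists a. Qed.
Lemma imA_perfect : perf_sf p imA.
move=> _ /imAP[a ->]; have [b ->] := perfA a.
by exists (i1 b); rewrite ?imA_i1 // rmorphXn.
Qed.

Lemma imA_polyOver P : P \over imA -> exists Q, P = mp1 Q.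
move=> /polyOverP h; have [f] := choice (fun i => (imAP P`_i).1 (h i)).
exists (\poly_(i < size P) f i); apply/polyP => i; rewrite coef_map coef_poly.
case: ltnP => hi => //.
rewrite nth_default //; symmetry; exact: rmorph0.
Qed.

Lemma algebraic_imA x : alg_over imA x <-> exists2 P : {poly A}, P != 0 & root (mp1 P) x.
split=> [[P [/imA_polyOver[Q ->] Q0 Qx]]|[P]].
  by exists Q; rewrite map_poly_eq0 in Q0.
exists (mp1 P); split; rewrite ?map_poly_eq0 //.
by apply/polyOverP => i; rewrite coef_map imA_i1.
Qed.

Hypothesis maxA : forall s t, s \in N1 -> t \in N2 -> ext_to s t -> exists a, s = i1 a.

(** Without a best approximation of [x] by [A] the immediate case applies. With a best one [a], an
    element with the leading term of [x - i1 a] extends the embeddings; by maximality it is in the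
    image of [A] and improves [a]. *)
Lemma relatively_closed x : x \in N1 -> alg_over imA x -> exists a, x = i1 a.
move=> xN ax; apply: contrapT => nx.
have [improve|] := pselect (forall a, exists b, x - i1 b <_[O] x - i1 a).
  have [s [t [sN tN ext ns]]] := immed_step improve ((algebraic_imA x).1 ax).
  by have [a /ns] := maxA sN tN ext.
move=> /existsNP[a /forallNP nb].
have y0 : x - i1 a != 0 by rewrite subr_eq0; apply/eqP => e; apply: nx; exists a.
have ay : alg_over imA (x - i1 a).
  have oS : 'X - (i1 a)%:P \over imA by rewrite polyOverXsubC imA_i1.
  by have := algebraic_horner ax oS; rewrite hornerXsubC.
have [||s [t [sN tN ext sy]]] := graded_step _ y0.
- by rewrite rpredB.
- have [P P0 /eqP Py] := (algebraic_imA _).1 ay; have [k [hk]] := max_term P0 y0.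
  by exists P, k; rewrite Py nv_gt0.
have [d ed] := maxA sN tN ext; apply: (nb (a + d)).
rewrite rmorphD opprD addrA -ed nvB; move: sy; rewrite rveqP //.
Qed.

(** Take [a] as close to [x] as every root of the given polynomials. If an element of [A] is closer
    still, it can replace [x]. Otherwise there is no cancellation in the Taylor expansions at [a],
    and any element with the leading term of [x - i1 a] corresponds to that difference. *)
Lemma transfer_point x (Ps : seq {poly A}) : x \in N1 -> exists2 y, y \in N2 & forall P, P \in Ps ->
    rveq O (mp1 P).[x] (mp2 P).[y].
move=> xN.
have near w : alg_over imA w -> exists a, x - i1 a <=_[O] x - w.
  move=> aw; have sub : {subset imA <= N1} by move=> _ /imAP[a ->].
  have sw := perfect_sepalg pE imA_perfect aw.
  have [rs [wb [[wrs _ pn] [iR wbN ewb _ hwb]]]] := sg_average pE sg1 (sepalg_sub sub sw).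
  have n0 : (size rs)%:R != 0 :> E by rewrite -(dvdn_pcharf pE).
  have awb : alg_over imA wb.
    apply: sepalg_alg; apply/(sf_ofE (sepalg_closed pE imA)).
    have -> : wb = (\sum_(t <- rs) t) / (size rs)%:R by rewrite -ewb -[wb *+ _]mulr_natr mulfK.
    rewrite rpredM ?rpredV ?rpred_nat // big_seq; apply: rpred_sum => t tr.
    apply/sf_ofE; apply: (perfect_sepalg pE imA_perfect).
    have [P [NP P0 Pw]] := aw; exists P; split=> //.
    by apply: (root_dvdp (irr_dvdp iR _ (polyOverS sub NP) Pw)); rewrite root_prod_XsubC.
  have [a ea] := relatively_closed wbN awb; exists a; rewrite -ea; exact: hwb.
have near_seq (rs : seq E) : (forall w, w \in rs -> alg_over imA w) -> exists a, forall w, w \in rs -> x - i1 a <=_[O] x - w.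
  elim: rs => [|w rs IH] h; first by exists 0.
  have [t tr|a ha] := IH; first by apply: h; rewrite inE tr orbT.
  have [b hb] := near w (h w (mem_head _ _)).
  have [] := leP (nv O (x - i1 a)) (nv O (x - i1 b)).
    by exists a => t; rewrite inE => /predU1P[->|/ha //]; apply: le_trans hb.
  by exists b => t; rewrite inE => /predU1P[-> //|/ha]; apply/le_trans/ltW.
have [a ha] : exists a, forall P, P \in Ps -> P != 0 -> forall w, root (mp1 P) w -> x - i1 a <=_[O] x - w.
  elim: Ps => [|P Ps [a IH]]; first by exists 0.
  have [P0|P0] := eqVneq P 0.
    by exists a => Q; rewrite inE => /predU1P[->|/IH //]; rewrite P0 eqxx.
  have [|rs _ rP] := @poly_roots _ (mp1 P); first by rewrite map_poly_eq0.
  have [w wr|b hb] := near_seq rs; first by apply/algebraic_imA; exists P; rewrite ?rP.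
  have [l|l] := leP (nv O (x - i1 a)) (nv O (x - i1 b)).
    exists a => Q; rewrite inE => /predU1P[->|/IH //] _ w.
    by rewrite rP => /hb; apply: le_trans.
  exists b => Q; rewrite inE => /predU1P[->|QP] Q0 w; first by rewrite rP => /hb.
  by move=> Qw; apply: le_trans (ltW l) _; apply: IH Qw.
have [[b lt]|best] := pselect (exists b, x - i1 b <_[O] x - i1 a).
  exists (i2 b) => // P PP; have [->|P0] := eqVneq P 0.
    by rewrite !rmorph0 !horner0 rveqxx.
  rewrite horner_map; apply: rveq_trans (A12 _); rewrite -horner_map.
  have [|rs eP rP] := @poly_roots _ (mp1 P); first by rewrite map_poly_eq0.
  rewrite eP !hornerZ; apply: rveqM; first exact: rveqxx.
  rewrite !horner_prod; apply: rveq_prod_in => w wr; rewrite !hornerXsubC.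
  apply: rveq_sym; apply: rveq_lt; have -> : i1 b - w - (x - w) = i1 b - x by ring.
  rewrite nvB; apply: lt_le_trans lt _; apply: (ha P PP P0).
  by rewrite rP.
have {}best b : x - i1 a <=_[O] x - i1 b by (rewrite leNgt; apply/negP => lt; apply: best; exists b).
have [x0|x0] := eqVneq (x - i1 a) 0.
  exists (i2 a) => // P _; have -> : x = i1 a by apply/eqP; rewrite -subr_eq0 x0.
  by rewrite !horner_map.
have xaN : x - i1 a \in N1 by rewrite rpredB.
have [y] := rv12 xaN.
exists (y + i2 a) => [|P PP]; first by rewrite rpredD.
have [->|P0] := eqVneq P 0; first by rewrite !rmorph0 !horner0 rveqxx.
pose Q := P \Po ('X + a%:P).
have eQ (h : {rmorphism A -> E}) z : (map_poly h P).[z + h a] = (map_poly h Q).[z].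
  by rewrite map_comp_poly rmorphD /= map_polyX map_polyC horner_comp !hornerE.
have [rs eP] := closed_field_poly_normal (mp1 P).
have lP : lead_coef (mp1 P) != 0 by rewrite lead_coef_eq0 map_poly_eq0.
have Px0 : (mp1 P).[x] != 0.
  apply/negP => Px; have [|c ec] := relatively_closed xN; first by apply/algebraic_imA; exists P.
  by have := best c; rewrite -ec subrr nv_le0 (negbTE x0).
apply: rveq_sym; apply: rveq_lt; rewrite nvB.
rewrite -{1}[x](subrK (i1 a)) !eQ; apply: rveq_horner_lt => // i; first exact: rveq_map.
have -> : (mp1 Q)`_i = tc (mp1 P) (i1 a) i by rewrite map_comp_poly rmorphD /= map_polyX map_polyC.
rewrite eP /tc comp_polyZ coefZ -mulrA hornerZ nv_leM2l // tc_prod horner_prod.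
have far w : w \in rs -> x - i1 a <=_[O] x - w by (move=> wr; apply: (ha P PP P0); rewrite eP rootZ // root_prod_XsubC).
under [X in _ <=_[O] X]eq_bigr do rewrite hornerXsubC.
apply: coef_prod_le => w wr; first exact: far.
have -> : i1 a - w = (x - w) - (x - i1 a) by ring.
by apply: nv_leB; rewrite // far.
Qed.
End Embeddings.

(** * Partial isomorphisms that preserve leading terms *)

Section Piso.
Variables (E : closedF) (O : valring E).
Variables N1 N2 : subfield E.
Implicit Types G : E -> E -> Prop.

(** Related elements have equal leading terms, so 0 is related to 0 only; with closure under
    differences this makes the relation the graph of an injective function. *)
Definition ring_piso G := [/\ G 1 1, forall x y x' y', G x y -> G x' y' -> G (x - x') (y - y'),
      forall x y x' y', G x y -> G x' y' -> G (x * x') (y * y') & forall x y, G x y -> [/\ x \in N1, y \in N2 & rveq O x y]].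

Definition piso G : Prop := ring_piso G /\ forall x y, G x y -> G x^-1 y^-1.

Definition dom G (x : E) := exists y, G x y.
Definition sub_piso G G' := forall x y, G x y -> G' x y.

Lemma piso_maximal G0 : ring_piso G0 -> exists G, [/\ ring_piso G, sub_piso G0 G
  & forall G', ring_piso G' -> sub_piso G G' -> sub_piso G' G].
move=> h0.
pose P (X : set (E * E)) := ring_piso (fun x y => X (x, y)) /\ sub_piso G0 (fun x y => X (x, y)).
have [||F Y FY FP up|X [gX hX] mX] := @maximal_set _ P [set s | G0 s.1 s.2]%classic (1, 1).
- by case: h0.
- by split.
- have [[h1 _ _ _] hX] := FP _ FY; split; last by move=> x y /hX; exists Y.
  split; first by exists Y.
  + move=> x y x' y' hx hy; have [Z FZ [Zx Zy]] := up _ _ hx hy; exists Z => //.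
    by have [[_ k _ _] _] := FP _ FZ; apply: k.
  + move=> x y x' y' hx hy; have [Z FZ [Zx Zy]] := up _ _ hx hy; exists Z => //.
    by have [[_ _ k _] _] := FP _ FZ; apply: k.
  + by move=> x y [Z FZ]; have [[_ _ _ k] _] := FP _ FZ; apply: k.
exists (fun x y => X (x, y)); split=> // G' g' XG' x y h.
apply: (mX [set s | G' s.1 s.2]%classic _ _ (x, y) h) => [|[a b]]; last exact: XG'.
by split=> // a b /hX /XG'.
Qed.

Section Field.
Variable G : E -> E -> Prop.
Hypothesis hG : piso G.

Lemma piso_closed : sfclosed (dom G).
case: hG => [[h1 hB hM _] hV]; split; first by exists 1.
  by move=> x y [x' hx] [y' hy]; exists (x' - y'); apply: hB.
by move=> x y [x' hx] [y' hy]; exists (x' / y'); apply: hM => //; apply: hV.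
Qed.

Definition pdom := sf_of piso_closed.

Lemma pdomP x : x \in pdom <-> dom G x.
exact: sf_ofE. Qed.

Lemma piso_fun x y y' : G x y -> G x y' -> y = y'.
case: hG => [[_ hB _ hr] _] h h'; apply/eqP; rewrite -subr_eq0 -(rveq0l O).
by have [_] := hr _ _ (hB _ _ _ _ h h'); rewrite subrr.
Qed.

Lemma piso_inj x x' y : G x y -> G x' y -> x = x'.
case: hG => [[_ hB _ hr] _] h h'; apply/eqP; rewrite -subr_eq0 -(rveq0 O).
by have [_] := hr _ _ (hB _ _ _ _ h h'); rewrite subrr.
Qed.

Lemma piso_choice : exists g : sfT pdom -> E, forall a, G (val a) (g a).
have h (a : sfT pdom) : exists y, G (val a) y by apply/pdomP; apply: valP.
by have [g] := choice h; exists g.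
Qed.

Definition piso_fn : sfT pdom -> E := sval (cid piso_choice).

Lemma piso_fnP a : G (val a) (piso_fn a).
by rewrite /piso_fn; case: cid => hg. Qed.
Lemma piso_fnB : {morph piso_fn : a b / a - b}.
move=> a b; case: (hG) => [[_ hB _ _] _]; apply: piso_fun (piso_fnP _) _.
apply: hB; apply: piso_fnP.
Qed.

Lemma piso_fnM : monoid_morphism piso_fn.
case: (hG) => [[h1 _ hM _] _]; split.
  exact: piso_fun (piso_fnP _) _.
move=> a b; apply: piso_fun (piso_fnP _) _.
apply: hM; apply: piso_fnP.
Qed.

HB.instance Definition _ := GRing.isZmodMorphism.Build (sfT pdom) E piso_fn piso_fnB.
HB.instance Definition _ := GRing.isMonoidMorphism.Build (sfT pdom) E piso_fn piso_fnM.

Lemma piso_rmorphism : exists (A : fieldType) (i1 i2 : {rmorphism A -> E}),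
  (forall a, G (i1 a) (i2 a)) /\ forall x y, G x y -> exists a, x = i1 a /\ y = i2 a.
exists (sfT pdom), (\val : {rmorphism sfT pdom -> E}), piso_fn.
split=> [a|x y h]; first exact: piso_fnP.
have xd : x \in pdom by apply/pdomP; exists y.
by exists (Sub x xd); split=> //; apply: piso_fun (piso_fnP (Sub x xd)).
Qed.
End Field.

Section Extension.
Variables (A : fieldType) (i1 i2 : {rmorphism A -> E}).
Hypotheses (A1 : forall a, i1 a \in N1) (A2 : forall a, i2 a \in N2).
Variables (s t : E).
Hypotheses (sN : s \in N1) (tN : t \in N2) (ext : ext_to O i1 i2 s t).

Definition adj_piso (x y : E) := exists P Q : {poly A},
  [/\ (map_poly i1 Q).[s] != 0, x = (map_poly i1 P).[s] / (map_poly i1 Q).[s] & y = (map_poly i2 P).[t] / (map_poly i2 Q).[t]].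

Lemma adj_piso_ok : [/\ piso adj_piso, forall a, adj_piso (i1 a) (i2 a) & adj_piso s t].
have den Q : (map_poly i1 Q).[s] != 0 -> (map_poly i2 Q).[t] != 0 by rewrite (rveq_eq0 (ext Q)).
have n1 P : (map_poly i1 P).[s] \in N1 by (apply: rpred_horner => //; apply/polyOverP => i; rewrite coef_map; apply: A1).
have n2 P : (map_poly i2 P).[t] \in N2 by (apply: rpred_horner => //; apply/polyOverP => i; rewrite coef_map; apply: A2).
have base P : adj_piso (map_poly i1 P).[s] (map_poly i2 P).[t] by (exists P, 1; rewrite !rmorph1 !hornerC !divr1; split=> //; apply: oner_neq0).
split.
- split; [split|].
  + by have := base 1; rewrite !rmorph1 !hornerC.
  + move=> _ _ _ _ [P [Q [Q0 -> ->]]] [P' [Q' [Q0' -> ->]]].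
    exists (P * Q' - P' * Q), (Q * Q'); rewrite !rmorphB !rmorphM !(hornerD, hornerN, hornerM).
    by split; rewrite ?mulf_neq0 // -mulNr addf_div ?den // mulNr.
  + move=> _ _ _ _ [P [Q [Q0 -> ->]]] [P' [Q' [Q0' -> ->]]].
    exists (P * P'), (Q * Q'); rewrite !rmorphM !hornerM.
    by split; rewrite ?mulf_neq0 // mulf_div.
  + move=> _ _ [P [Q [Q0 -> ->]]]; split; rewrite ?rpredM ?rpredV //.
    exact: rveqM (rveqV (ext Q)).
  + move=> _ _ [P [Q [Q0 -> ->]]]; rewrite !invf_div.
    have [P0|P0] := eqVneq (map_poly i1 P).[s] 0; last by exists Q, P.
    have /eqP Pt : (map_poly i2 P).[t] == 0 by rewrite -(rveq_eq0 (ext P)) P0.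
    by exists 0, 1; rewrite P0 Pt !invr0 !mulr0 !rmorph0 !rmorph1 !hornerC !mul0r; split=> //; apply: oner_neq0.
- by move=> a; have := base a%:P; rewrite !map_polyC !hornerC.
- by have := base 'X; rewrite !map_polyX !hornerX.
Qed.
End Extension.

Lemma piso_fraction G : ring_piso G -> exists G', piso G' /\ sub_piso G G'.
move=> [h1 hB hM hr].
have : G 0 0 by rewrite -(subrr 1); apply: hB.
have nz x y : G x y -> (x == 0) = (y == 0) by move=> /hr[_ _ /rveq_eq0].
pose G' x y := exists a b c d, [/\ G a b, G c d, c != 0, x = a / c & y = b / d].
have dn a b : G a b -> a != 0 -> b != 0 by move=> /nz ->.
exists G'; split; [split; [split|]|].
- by exists 1, 1, 1, 1; rewrite divr1; split=> //; apply: oner_neq0.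
- move=> _ _ _ _ [a [b [c [d [ab cd c0 -> ->]]]]] [a' [b' [c' [d' [ab' cd' c0' -> ->]]]]].
  exists (a * c' - a' * c), (b * d' - b' * d), (c * c'), (d * d').
  have := dn _ _ cd c0; have := dn _ _ cd' c0'.
  split; rewrite ?mulf_neq0 //; try by rewrite -mulNr addf_div // mulNr.
    by apply: hB; apply: hM.
  exact: hM.
- move=> _ _ _ _ [a [b [c [d [ab cd c0 -> ->]]]]] [a' [b' [c' [d' [ab' cd' c0' -> ->]]]]].
  exists (a * a'), (b * b'), (c * c'), (d * d').
  by split; rewrite ?mulf_neq0 ?mulf_div //; apply: hM.
- move=> _ _ [a [b [c [d [/hr[aN bN rab] /hr[cN dN rcd] c0 -> ->]]]]].
  by split; rewrite ?rpredM ?rpredV //; apply: rveqM (rveqV rcd).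
- move=> _ _ [a [b [c [d [ab cd c0 -> ->]]]]]; rewrite !invf_div.
  have [a0|a0] := eqVneq a 0; last by exists c, d, a, b.
  have /eqP b0 : b == 0 by rewrite -(nz _ _ ab) a0.
  by exists 0, 0, 1, 1; rewrite a0 b0 !invr0 !mulr0 !mul0r; split=> //; apply: oner_neq0.
- by move=> x y h; exists x, y, 1, 1; rewrite !divr1; split=> //; apply: oner_neq0.
Qed.
End Piso.

Section Maximal.
Variables (E : closedF) (O : valring E) (p : nat).
Hypothesis pE : p \in [pchar E].
Variables N1 N2 : subfield E.
Hypotheses (perf1 : perf_sf p N1) (perf2 : perf_sf p N2).

(** By [rveq_pX] a relation can be pulled back along Frobenius, so a maximal one has a domain closed
    under [p]-th roots; nor can it be extended by a single element. *)
Lemma maximal_embeddings G0 : ring_piso O N1 N2 G0 -> exists (A : fieldType) (i1 i2 : {rmorphism A -> E}),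
  [/\ forall a, [/\ i1 a \in N1, i2 a \in N2 & rveq O (i1 a) (i2 a)], forall a : A, exists b, a = b ^+ p,
      forall s t, s \in N1 -> t \in N2 -> ext_to O i1 i2 s t -> exists a, s = i1 a
    & forall x y, G0 x y -> exists a, x = i1 a /\ y = i2 a].
move=> h0; have [G [hG GG0 mG]] := piso_maximal h0.
have [h1 hB hM hr] := hG.
have pG : piso O N1 N2 G by (split=> //; have [G' [pG' GG']] := piso_fraction hG; move=> x y /GG' h; apply: (mG _ pG'.1 GG'); apply: (pG'.2)).
have [A [i1 [i2 [gi ig]]]] := piso_rmorphism pG.
have A12 a : [/\ i1 a \in N1, i2 a \in N2 & rveq O (i1 a) (i2 a)] by apply: hr.
exists A, i1, i2; split=> //.
- move=> a; have [/perf1[x xN ex] /perf2[y yN ey]] := A12 a.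
  pose G' x y := [/\ x \in N1, y \in N2 & exists k, G (x ^+ (p ^ k)) (y ^+ (p ^ k))].
  have hX b c k : G b c -> G (b ^+ k) (c ^+ k) by (move=> h; elim: k => [|k IH]; rewrite // !exprS; apply: hM).
  have lift b c k l : G (b ^+ (p ^ k)) (c ^+ (p ^ k)) -> G (b ^+ (p ^ (k + l))) (c ^+ (p ^ (k + l))).
    rewrite expnD !exprM; apply: hX.
  have h' : ring_piso O N1 N2 G'.
    split.
    + by split; rewrite ?rpred1 //; exists 0%N.
    + move=> b c b' c' [bN cN [k hk]] [bN' cN' [l hl]]; split; rewrite ?rpredB //.
      exists (k + l)%N; rewrite !(expBp _ _ _ pE); apply: hB; first exact: lift.
      by rewrite addnC; apply: lift.
    + move=> b c b' c' [bN cN [k hk]] [bN' cN' [l hl]]; split; rewrite ?rpredM //.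
      exists (k + l)%N; rewrite !exprMn; apply: hM; first exact: lift.
      by rewrite addnC; apply: lift.
    + move=> b c [bN cN [k hk]]; have [_] := hr _ _ hk.
      by rewrite rveq_pX.
  have GG' : sub_piso G G' by (move=> b c h; have [cN] := hr _ _ h; split=> //; exists 0%N).
  have : G x y by (apply: (mG _ h' GG'); split=> //; exists 1%N; rewrite -ex -ey).
  by move=> /ig[b [eb _]]; exists b; apply: (fmorph_inj i1); rewrite rmorphXn -eb.
- move=> s t sN tN ext.
  have [||pA GA st] := @adj_piso_ok E O N1 N2 A i1 i2 _ _ s t sN tN ext.
  + by move=> a; case: (A12 a).
  + by move=> a; case: (A12 a).
  have : G s t.
    apply: (mG _ pA.1) => // x y /ig[a [-> ->]]; exact: GA.
  by move=> /ig[a [-> _]]; exists a.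
- by move=> x y /GG0 /ig.
Qed.
End Maximal.

(** * Ultrapowers of fields and of valuation rings *)

Local Open Scope classical_set_scope.

Lemma ex_free_ultrafilter : exists U : set_system nat, UltraFilter U /\ forall n, U [set i | (n <= i)%N].
have [U [ultraU sub]] := @ultraFilterLemma nat \oo%classic.
by exists U; split=> // n; apply: sub; exists n.
Qed.

Definition free_ultrafilter : set_system nat := sval (cid ex_free_ultrafilter).
Local Notation U := free_ultrafilter.

#[local] Instance ultraU : UltraFilter U.
by rewrite /free_ultrafilter; case: cid => V []. Qed.

Lemma freeU n : U [set i | (n <= i)%N].
by rewrite /free_ultrafilter; case: cid => V [_] /=. Qed.

Definition ae (P : nat -> Prop) : Prop := U [set i | P i].

Lemma aeT P : (forall i, P i) -> ae P.
by move=> h; apply: filterS filterT => i. Qed.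
Lemma ae_imp P Q : (forall i, P i -> Q i) -> ae P -> ae Q.
apply: filterS. Qed.
Lemma ae_and P Q : ae P -> ae Q -> ae (fun i => P i /\ Q i).
exact: filterI. Qed.
Lemma ae2 P Q R : (forall i, P i -> Q i -> R i) -> ae P -> ae Q -> ae R.
by move=> h hP hQ; apply: ae_imp (ae_and hP hQ) => i []; apply: h. Qed.
Lemma ae_ex P : ae P -> exists i, P i.
apply: (@filter_ex). Qed.
Lemma ae_not P : ~ ae P -> ae (fun i => ~ P i).
by move=> h; case: (in_ultra_setVsetC [set i | P i]). Qed.
Lemma ae_not_iff P : ae (fun i => ~ P i) <-> ~ ae P.
by split=> [h h'|]; [have [i []] := ae_ex (ae_and h h')|apply: ae_not].
Qed.
Lemma ae_or P Q : ae (fun i => P i \/ Q i) -> ae P \/ ae Q.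
move=> h; have [|nP] := pselect (ae P); [by left|right].
by apply: ae2 h (ae_not nP) => i [].
Qed.

Lemma ae_all n P : (forall k, (k < n)%N -> ae (P k)) -> ae (fun i => forall k, (k < n)%N -> P k i).
elim: n => [|n IH] h; first exact: aeT.
have h1 := IH (fun k hk => h k (ltnW hk)); apply: ae2 h1 (h n (ltnSn n)) => i h2 h3 k.
by rewrite ltnS leq_eqVlt => /predU1P[->|/h2].
Qed.

Lemma ae_pigeon n P : ae (fun i => exists k, (k < n)%N /\ P k i) -> exists k, (k < n)%N /\ ae (P k).
elim: n => [|n IH] h; first by have [i [k []]] := ae_ex h.
have /ae_or[/IH[k [kn hk]]|hn] : ae (fun i => (exists k, (k < n)%N /\ P k i) \/ P n i).
- apply: ae_imp h => i [k []]; rewrite ltnS leq_eqVlt => /predU1P[->|kn] hk; first by right.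
  by left; exists k.
- by exists k; rewrite ltnW.
- by exists n.
Qed.

Lemma ae_choice T (t0 : T) P : ae (fun i => exists t, P i t) -> exists f : nat -> T, ae (fun i => P i (f i)).
move=> h; have [f hf] : exists f : nat -> T, forall i, (exists t, P i t) -> P i (f i).
  have h' i : exists t, (exists t, P i t) -> P i t.
    have [[t ht]|n] := pselect (exists t, P i t); first by exists t.
    by exists t0.
  by have [f] := choice h'; exists f.
by exists f; apply: ae_imp h => i; apply: hf.
Qed.

(** At coordinate [i] take a witness for the longest initial segment of the conditions, of length at
    most [i], that is satisfiable there. *)
Lemma saturation X (C : nat -> forall i, X i -> Prop) : (forall i, inhabited (X i)) ->
  (forall n, exists y : forall i, X i, forall k, (k < n)%N -> ae (fun i => C k i (y i))) ->
  exists y : forall i, X i, forall k, ae (fun i => C k i (y i)).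
move=> inh h.
pose good n i := exists x : X i, forall k, (k < n)%N -> C k i x.
have aeg n : ae (good n).
  have [y hy] := h n; apply: ae_imp (ae_all hy) => i hi; by exists (y i).
have hi i : exists x : X i, forall n, (n <= i)%N -> good n i -> forall k, (k < n)%N -> C k i x.
  have [x0] := inh i.
  suff H m : exists x : X i, forall n, (n <= m)%N -> good n i -> forall k, (k < n)%N -> C k i x by [].
  elim: m => [|m [x hx]]; first by exists x0 => n; rewrite leqn0 => /eqP ->.
  have [[x' hx']|ng] := pselect (good m.+1 i).
    by exists x' => n nm _ k kn; apply: hx'; apply: leq_trans nm.
  exists x => n; rewrite leq_eqVlt => /predU1P[-> /ng //|]; exact: hx.
exists (fun i => sval (cid (hi i))) => k; apply: ae2 (aeg k.+1) (freeU k.+1) => i g ki.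
by case: cid => x hx; apply: (hx k.+1).
Qed.

Section Field.
Variable K : fieldType.

Definition null : {pred (nat -> K)} := [pred f | `[< ae (fun i => f i = 0) >]].

Lemma null_ideal : idealr_closed null.
split.
- exact/asboolP/aeT.
- apply/asboolP => /ae_ex[i] /eqP; rewrite oner_eq0 //.
- move=> a f g /asboolP hf /asboolP hg; apply/asboolP.
  apply: ae2 hf hg => i; rewrite !fctE => -> ->.
  by rewrite mulr0 addr0.
Qed.

HB.instance Definition _ := isIdealr.Build (nat -> K) null null_ideal.

Definition UP : Type := {ideal_quot null}.

HB.instance Definition _ := GRing.ComNzRing.on UP.

Definition cls (f : nat -> K) : UP := \pi_({ideal_quot null}) f.

Lemma cls_eq f g : cls f = cls g <-> ae (fun i => f i = g i).
have -> : (cls f = cls g) <-> (f - g \in null) by (rewrite (Quotient.idealrBE _ f g); split=> [e|/eqP //]; apply/eqP).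
split=> [/asboolP|h]; last apply/asboolP.
  by apply: ae_imp => i /eqP; rewrite subr_eq0 => /eqP.
by apply: ae_imp h => i; rewrite fctE => ->; rewrite subrr.
Qed.

Lemma cls_surj x : exists f, x = cls f.
by exists (repr x); rewrite /cls reprK. Qed.
Lemma clsD f g : cls (fun i => f i + g i) = cls f + cls g.
exact: (rmorphD). Qed.
Lemma clsB f g : cls (fun i => f i - g i) = cls f - cls g.
exact: (rmorphB). Qed.
Lemma clsM f g : cls (fun i => f i * g i) = cls f * cls g.
exact: (rmorphM). Qed.
Lemma cls1 : cls (fun=> 1) = 1.
exact: (rmorph1). Qed.
Lemma cls0 : cls (fun=> 0) = 0.
exact: (rmorph0). Qed.
Lemma cls_eq0 f : cls f = 0 <-> ae (fun i => f i = 0).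
by rewrite -cls0 cls_eq. Qed.

Definition up_inv (x : UP) : UP := cls (fun i => (repr x i)^-1).

Lemma up_invE f : up_inv (cls f) = cls (fun i => (f i)^-1).
apply/cls_eq; have : cls (repr (cls f)) = cls f by rewrite /cls reprK.
by move/cls_eq; apply: ae_imp => i ->.
Qed.

Lemma up_mulVf (x : UP) : x != 0 -> up_inv x * x = 1.
have [f ->] := cls_surj x => f0; rewrite up_invE -clsM -cls1; apply/cls_eq.
have : ~ ae (fun i => f i = 0) by move=> /cls_eq0 e; rewrite e eqxx in f0.
by move/ae_not; apply: ae_imp => i /eqP fi; rewrite mulVf.
Qed.

Lemma up_inv0 : up_inv 0 = 0.
by rewrite -cls0 up_invE; rewrite invr0. Qed.

HB.instance Definition _ := GRing.ComNzRing_isField.Build UP up_mulVf up_inv0.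

Lemma clsV f : cls (fun i => (f i)^-1) = (cls f)^-1.
by rewrite -up_invE. Qed.
Lemma clsX f n : cls (fun i => f i ^+ n) = cls f ^+ n.
elim: n => [|n IH]; first by rewrite expr0 -cls1.
by rewrite exprS -IH -clsM; apply/cls_eq/aeT => i; rewrite exprS.
Qed.

Lemma cls_sum I r (Q : pred I) F : cls (fun i => \sum_(j <- r | Q j) F j i) = \sum_(j <- r | Q j) cls (F j).
elim: r => [|j r IH].
  by rewrite big_nil -cls0; apply/cls_eq/aeT => i; rewrite big_nil.
rewrite big_cons; case: ifP => qj; rewrite -IH -?clsD; apply/cls_eq/aeT => i; by rewrite big_cons qj.
Qed.

Definition diag (x : K) : UP := cls (fun=> x).

Lemma diagD : nmod_morphism diag.
by split=> [|x y]; rewrite /diag ?cls0 ?clsD. Qed.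
Lemma diagM : monoid_morphism diag.
by split=> [|x y]; rewrite /diag ?cls1 ?clsM. Qed.

HB.instance Definition _ := GRing.isNmodMorphism.Build K UP diag diagD.
HB.instance Definition _ := GRing.isMonoidMorphism.Build K UP diag diagM.

(** The common bound [m] on the degrees is what turns a sequence of polynomials into a polynomial
    over the ultrapower. *)
Definition clsP (m : nat) (P : nat -> {poly K}) : {poly UP} := \poly_(j < m) cls (fun i => (P i)`_j).

Lemma clsP_coef m (P : nat -> {poly K}) j : (forall i, (size (P i) <= m)%N) -> (clsP m P)`_j = cls (fun i => (P i)`_j).
move=> h; rewrite coef_poly; case: ltnP => // jm; rewrite -cls0.
by apply/cls_eq/aeT => i; rewrite nth_default // (leq_trans (h i)).
Qed.

Lemma clsP_surj (Q : {poly UP}) : exists P : nat -> {poly K}, (forall i, (size (P i) <= size Q)%N) /\ Q = clsP (size Q) P.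
have [c hc] := choice (fun j => cls_surj Q`_j).
exists (fun i => \poly_(j < size Q) c j i); split=> [i|] => //.
apply/polyP => j; rewrite coef_poly; case: ltnP => jQ; last by rewrite nth_default.
by rewrite hc; apply/cls_eq/aeT => i; rewrite coef_poly jQ.
Qed.

Lemma clsP_horner m (P : nat -> {poly K}) z : (forall i, (size (P i) <= m)%N) -> (clsP m P).[cls z] = cls (fun i => (P i).[z i]).
move=> h; rewrite horner_poly.
transitivity (\sum_(j < m) cls (fun i => (P i)`_j * z i ^+ j)).
  by apply: eq_bigr => j _; rewrite clsM clsX.
by rewrite -cls_sum; apply/cls_eq/aeT => i; rewrite (horner_coef_wide _ (h i)).
Qed.

Lemma clsP_mul m n (P Q : nat -> {poly K}) : (forall i, (size (P i) <= m)%N) -> (forall i, (size (Q i) <= n)%N) ->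
  clsP m P * clsP n Q = clsP (m + n) (fun i => P i * Q i).
move=> hP hQ; apply/polyP => j; rewrite coefM clsP_coef; last first.
  by move=> i; apply: leq_trans (size_polyMleq _ _) _; rewrite (leq_trans (leq_pred _)) // leq_add.
under eq_bigr => k do rewrite !clsP_coef // -clsM.
by rewrite -cls_sum; apply/cls_eq/aeT => i; rewrite coefM.
Qed.

Lemma clsP_eq m n (P Q : nat -> {poly K}) : (forall i, (size (P i) <= m)%N) -> (forall i, (size (Q i) <= n)%N) ->
  ae (fun i => P i = Q i) -> clsP m P = clsP n Q.
move=> hP hQ h; apply/polyP => j; rewrite !clsP_coef //.
by apply/cls_eq; apply: ae_imp h => i ->.
Qed.

Lemma up_pchar p : p \in [pchar K] -> p \in [pchar UP].
exact: (rmorph_pchar diag). Qed.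

Definition in_up (N : nat -> subfield K) (x : UP) := exists f, ae (fun i => f i \in N i) /\ x = cls f.

Lemma in_up_closed N : sfclosed (in_up N).
split.
- by exists (fun=> 1); rewrite cls1; split=> //; apply: aeT => i; rewrite rpred1.
- move=> _ _ [f [hf ->]] [g [hg ->]]; exists (fun i => f i - g i).
  by rewrite clsB; split=> //; apply: ae2 hf hg => i; apply: rpredB.
- move=> _ _ [f [hf ->]] [g [hg ->]]; exists (fun i => f i / g i).
  rewrite clsM clsV; split=> //; apply: ae2 hf hg => i fN gN.
  by rewrite rpredM ?rpredV.
Qed.

Definition upF N := sf_of (@in_up_closed N).

Lemma upFP N f : cls f \in upF N <-> ae (fun i => f i \in N i).
split=> [/sf_ofE[g [hg /cls_eq e]]|h]; last by apply/sf_ofE; exists f.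
by apply: ae2 hg e => i gN ->.
Qed.

Lemma upF_rep N x : x \in upF N -> exists f, (forall i, f i \in N i) /\ x = cls f.
move=> /sf_ofE[f [hf ->]].
exists (fun i => if f i \in N i then f i else 0); split=> [i|].
  by case: ifP => // _; rewrite rpred0.
by apply/cls_eq; apply: ae_imp hf => i ->.
Qed.

Variable O : valring K.

Definition in_upO : pred UP := fun x => `[< exists f, ae (fun i => f i \in O) /\ x = cls f >].

Lemma in_upOP f : cls f \in in_upO <-> ae (fun i => f i \in O).
split=> [/asboolP[g [hg /cls_eq e]]|h]; last by apply/asboolP; exists f.
by apply: ae2 hg e => i gN ->.
Qed.

Lemma upO_subring : subring_closed in_upO.
split.
- by rewrite -cls1; apply/in_upOP/aeT => i; rewrite rpred1.
- move=> _ _ /asboolP[f [hf ->]] /asboolP[g [hg ->]]; rewrite -clsB; apply/in_upOP.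
  by apply: ae2 hf hg => i; apply: rpredB.
- move=> _ _ /asboolP[f [hf ->]] /asboolP[g [hg ->]]; rewrite -clsM; apply/in_upOP.
  by apply: ae2 hf hg => i; apply: rpredM.
Qed.

Lemma upO_total x : (x \in in_upO) || (x^-1 \in in_upO).
have [f ->] := cls_surj x; have [h|h] := pselect (ae (fun i => f i \in O)).
  by apply/orP; left; apply/in_upOP.
apply/orP; right; rewrite -clsV; apply/in_upOP; apply: ae_imp (ae_not h) => i /negP fi.
by have := vr_total O (f i); rewrite (negbTE fi).
Qed.

Definition upO := ValuationRing upO_subring upO_total.

Lemma up_le f g : cls f <=_[upO] cls g <-> ae (fun i => f i <=_[O] g i).
rewrite nvE; case: eqP => [g0|g0].
  have g0' := (cls_eq0 g).1 g0; split=> [/eqP/cls_eq0 h|h].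
    by apply: ae2 g0' h => i -> ->.
  by apply/eqP/cls_eq0; apply: ae2 g0' h => i ->; rewrite nv_le0 => /eqP.
have g0' : ae (fun i => g i <> 0) by apply: ae_not => /cls_eq0.
rewrite -clsV -clsM; split=> [/in_upOP h|h].
  by apply: ae2 g0' h => i /eqP gi; rewrite nvE (negbTE gi).
by apply/in_upOP; apply: ae2 g0' h => i /eqP gi; rewrite nvE (negbTE gi).
Qed.

Lemma up_lt f g : cls f <_[upO] cls g <-> ae (fun i => f i <_[O] g i).
rewrite ltNge; split=> [/negP h|h].
  have /ae_not : ~ ae (fun i => g i <=_[O] f i) by move=> /up_le.
  by apply: ae_imp => i /negP; rewrite -ltNge.
apply/negP => /up_le h'; have [i []] := ae_ex (ae_and h h').
by rewrite ltNge => /negP.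
Qed.

Lemma up_nv_eq f g : nv upO (cls f) = nv upO (cls g) <-> ae (fun i => nv O (f i) = nv O (g i)).
split=> [e|h].
  have /up_le h1 : cls f <=_[upO] cls g by rewrite e.
  have /up_le h2 : cls g <=_[upO] cls f by rewrite e.
  by apply: ae2 h1 h2 => i a b; apply: le_anti; rewrite a.
by apply: le_anti; apply/andP; split; apply/up_le; apply: ae_imp h => i ->.
Qed.

Lemma up_rveq f g : rveq upO (cls f) (cls g) <-> ae (fun i => rveq O (f i) (g i)).
split=> [/orP[/eqP/cls_eq|]|].
- by apply: ae_imp => i ->; apply: rveqxx.
- by rewrite -clsB => /up_lt; apply: ae_imp => i; apply: rveq_lt.
move=> h; have /ae_or[e|lt] : ae (fun i => f i = g i \/ f i - g i <_[O] g i).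
- by apply: ae_imp h => i /orP[/eqP ->|]; [left|right].
- by apply/orP; left; apply/eqP/cls_eq.
by apply/orP; right; rewrite -clsB; apply/up_lt.
Qed.

Lemma diag_nv_le x y : (diag x <=_[upO] diag y) = (x <=_[O] y).
apply/idP/idP => [/up_le/ae_ex[_] //|h]; exact/up_le/aeT.
Qed.

Lemma diag_in_upO x : (diag x \in upO) = (x \in O).
by rewrite -!nv_le1 -(rmorph1 diag) diag_nv_le. Qed.
End Field.

Section Closed.
Variable K : closedF.

Lemma up_closed_axiom : GRing.closed_field_axiom (UP K).
move=> n P n0; have [c hc] := choice (fun j => cls_surj (P j)).
have h i : exists x : K, x ^+ n = \sum_(j < n) c j i * x ^+ j.
  exact: (solve_monicpoly (fun j => c j i)).
have [x] := choice h; exists (cls x); rewrite -clsX.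
transitivity (\sum_(j < n) cls (fun i => c j i * x i ^+ j)).
  by rewrite -cls_sum; apply/cls_eq/aeT.
by apply: eq_bigr => j _; rewrite clsM clsX hc.
Qed.

Lemma up_dec_axiom : GRing.decidable_field_axiom (fun (e : seq (UP K)) f => `[< GRing.holds e f >]).
by move=> e f; apply: asboolP. Qed.

HB.instance Definition _ := GRing.Field_isDecField.Build (UP K) up_dec_axiom.
HB.instance Definition _ := GRing.DecField_isAlgClosed.Build (UP K) up_closed_axiom.
End Closed.

Local Close Scope classical_set_scope.

Section Fields.
Variable K : fieldType.

Lemma up_spans N n (u : 'I_n -> nat -> K) x : spans (upF N) (fun k => cls (u k)) (cls x) <->
  ae (fun i => spans (N i) (fun k => u k i) (x i)).
split=> [[a [aN e]]|h].
  have [b hb] := choice (fun k => upF_rep (aN k)).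
  have /cls_eq : cls x = cls (fun i => \sum_k b k i * u k i) by (rewrite e cls_sum; apply: eq_bigr => k _; rewrite clsM (proj2 (hb k))).
  by apply: ae_imp => i ->; exists (fun k => b k i); split=> // k; apply: (proj1 (hb k)).
have [b hb] := ae_choice (fun=> 0 : K) h.
exists (fun k => cls (fun i => b i k)); split=> [k|].
  by apply/upFP; apply: ae_imp hb => i [].
transitivity (\sum_k cls (fun i => b i k * u k i)).
  by rewrite -cls_sum; apply/cls_eq; apply: ae_imp hb => i [].
by apply: eq_bigr => k _; rewrite clsM.
Qed.

Lemma up_lfree N n (u : 'I_n -> nat -> K) : lfree (upF N) (fun k => cls (u k)) <-> ae (fun i => lfree (N i) (fun k => u k i)).
split=> [fu|fu a aN e k]; last first.
  have [b hb] := choice (fun k => upF_rep (aN k)).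
  have /cls_eq0 h : cls (fun i => \sum_k b k i * u k i) = 0 by (rewrite -e cls_sum; apply: eq_bigr => l _; rewrite clsM (proj2 (hb l))).
  rewrite (proj2 (hb k)); apply/cls_eq0; apply: ae2 h fu => i ei fi.
  by apply: (fi (fun l => b l i)) => // l; apply: (proj1 (hb l)).
apply: contrapT => /ae_not nf.
have {nf} nf : ae (fun i => exists a : 'I_n -> K, [/\ forall k, a k \in N i, \sum_k a k * u k i = 0 & exists k, a k != 0]).
  apply: ae_imp nf => i; apply: contra_notP => h a aN e k; apply: contrapT => /eqP ak.
  by apply: h; exists a; split=> //; exists k.
have [a ha] := ae_choice (fun=> 0 : K) nf.
have [k [kn hk]] : exists k, (k < n)%N /\ ae (fun i => exists kn : (k < n)%N, a i (Ordinal kn) != 0).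
  apply: ae_pigeon; apply: ae_imp ha => i [_ _ [[k kn] ak]]; exists k; split=> //.
  by exists kn.
have /eqP : cls (fun i => a i (Ordinal kn)) = 0.
  apply: (fu (fun k => cls (fun i => a i k))) => [l|].
    by apply/upFP; apply: ae_imp ha => i [].
  transitivity (\sum_k cls (fun i => a i k * u k i)).
    by apply: eq_bigr => l _; rewrite clsM.
  by rewrite -cls_sum; apply/cls_eq0; apply: ae_imp ha => i [].
move=> /eqP/cls_eq0 h; have [i [e [kn' /eqP]]] := ae_ex (ae_and h hk).
by rewrite (bool_irrelevance kn' kn).
Qed.

Lemma clsMn (f : nat -> K) n : cls (fun i => f i *+ n) = cls f *+ n.
elim: n => [|n IH]; first by rewrite mulr0n -cls0.
by rewrite mulrS -IH -clsD; apply/cls_eq/aeT => i; rewrite mulrS.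
Qed.

Lemma clsP_deriv m (P : nat -> {poly K}) : (forall i, (size (P i) <= m)%N) -> (clsP m P)^`() = clsP m (fun i => (P i)^`()).
move=> h; apply/polyP => j; rewrite coef_deriv !clsP_coef // -?clsMn.
  by apply/cls_eq/aeT => i; rewrite coef_deriv.
move=> i; apply: leq_trans (h i); have [->|nz] := eqVneq (P i) 0.
  by rewrite linear0.
exact/ltnW/lt_size_deriv.
Qed.

Lemma clsP_size k (Q : nat -> {poly K}) : (forall i, (size (Q i) <= k)%N) -> ae (fun i => size (Q i) = k) -> size (clsP k Q) = k.
move=> hQ h; case: k hQ h => [|k] hQ h.
  by apply/eqP; rewrite -leqn0; apply: size_poly.
rewrite size_poly_eq //; apply/eqP => /cls_eq0 h0.
have [i [e /eqP]] := ae_ex (ae_and h h0).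
have <- : (size (Q i)).-1 = k by rewrite e.
by rewrite lead_coef_eq0 -size_poly_eq0 e.
Qed.

Lemma clsP_polyOver (N : nat -> subfield K) m (P : nat -> {poly K}) :
  (forall i, (size (P i) <= m)%N) -> ae (fun i => P i \over (N i)) -> clsP m P \over (upF N).
move=> hP h; apply/polyOverP => j; rewrite clsP_coef //; apply/upFP.
by apply: ae_imp h => i /polyOverP.
Qed.
End Fields.

Section InternalSG.
Variables (K : closedF) (O : valring K) (p : nat).

(** Since factors have bounded degree, failures of irreducibility or separability on a large set of
    coordinates would assemble to a failure in the ultrapower. So [SG] can be applied
    coordinatewise. *)
Lemma up_sg N : (forall i, SG O p (N i)) -> SG (upO O) p (upF N).
move=> sgN P iP mP sP; have [NP szP hP] := iP.
set n := (size P).-1; have sPn : size P = n.+1 by rewrite /n; case: (size) szP.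
have [c hc] := choice (fun j => upF_rep (polyOverP NP j)).
pose Q i : {poly K} := 'X^n + \poly_(j < n) c j i.
have sQ i : size (Q i) = n.+1 by rewrite size_polyDl size_polyXn // ltnS.
have mQ i : Q i \is monic by rewrite monicE lead_coefDl ?lead_coefXn // size_polyXn ltnS.
have leQ i : (size (Q i) <= n.+1)%N by rewrite sQ.
have oQ i : Q i \over (N i) by (rewrite rpredD ?polyOverXn // polyOver_poly // => j _; case: (hc j)).
have eP : P = clsP n.+1 Q.
  apply/polyP => j; rewrite clsP_coef // (proj2 (hc j)).
  have [jn|jn|->] := ltngtP j n.
  - by apply/cls_eq/aeT => i; rewrite coefD coefXn coef_poly jn ltn_eqF // add0r.
  - rewrite -(proj2 (hc j)) nth_default ?sPn // -cls0; apply/cls_eq/aeT => i.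
    by rewrite nth_default // sQ.
  - rewrite -(proj2 (hc n)) -/(lead_coef P) (monicP mP) -cls1.
    by apply/cls_eq/aeT => i; rewrite coefD coefXn coef_poly ltnn eqxx addr0.
have irrQ : ae (fun i => irr (N i) (Q i)).
  apply: contrapT => /ae_not nirr.
  have h : ae (fun i => exists R : {poly K}, [/\ R \over (N i), R %| Q i, size R != 1%N & ~~ (R %= Q i)]).
    apply: ae_imp nirr => i ni; apply: contrapT => nR; apply: ni; split=> //.
      by rewrite sQ -sPn.
    move=> R NR RQ sR; apply: contrapT => /negP nRQ; apply: nR; by exists R.
  have [R hR] := ae_choice 0 h.
  have [k [kn hk]] : exists k, (k < n.+2)%N /\ ae (fun i => size (R i) = k).
    apply: ae_pigeon; apply: ae_imp hR => i [_ RQ _ _]; exists (size (R i)); split=> //.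
    by rewrite ltnS -(sQ i) dvdp_leq // monic_neq0.
  pose R' i := if size (R i) == k then R i else 0.
  have leR' i : (size (R' i) <= k)%N by rewrite /R'; case: eqP => [->|]; rewrite ?size_poly0.
  have eR' : ae (fun i => R' i = R i) by apply: ae_imp hk => i; rewrite /R' => ->; rewrite eqxx.
  pose T i := Q i %/ R' i.
  have leT i : (size (T i) <= n.+1)%N by rewrite -(sQ i) leq_divp.
  have eQ : ae (fun i => R' i * T i = Q i).
    apply: ae2 hR eR' => i [_ RQ _ _] e; rewrite /T mulrC e divpK //.
  have dvd : clsP k R' %| P.
    apply/dvdpP; exists (clsP n.+1 T); rewrite mulrC clsP_mul // eP.
    apply: clsP_eq => // [i|].
      apply: leq_trans (size_polyMleq _ _) _; rewrite (leq_trans (leq_pred _)) // leq_add //.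
    exact: ae_imp eQ => ->.
  have sR' : size (clsP k R') = k by (apply: clsP_size => //; apply: ae2 hk eR' => i e ->).
  have [i [[_ RQ s1 nRQ] ek]] := ae_ex (ae_and hR hk).
  have /eqp_size : clsP k R' %= P.
    apply: hP => //; last by rewrite sR' -ek.
    by apply: clsP_polyOver => //; apply: ae2 hR eR' => j [oR _ _ _] ->.
  rewrite sR' sPn => kn'; move/negP: nRQ; apply.
  by rewrite -dvdp_size_eqp // ek kn' sQ.
have sepQ : ae (fun i => separable_poly (Q i)).
  apply: contrapT => /ae_not nsep.
  have h : ae (fun i => exists w, root (Q i) w /\ root (Q i)^`() w).
    apply: ae_imp nsep => i; rewrite separable_poly.unlock /coprimep => /negP s1.
    have [w] := closed_rootP _ s1; by rewrite root_gcd => /andP[]; exists w.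
  have [w hw] := ae_choice 0 h.
  have r1 : root P (cls w).
    rewrite eP rootE clsP_horner //; apply/eqP/cls_eq0.
    by apply: ae_imp hw => i [/eqP].
  have r2 : root P^`() (cls w).
    rewrite eP clsP_deriv // rootE clsP_horner; last first.
      by move=> i; apply: leq_trans (leQ i); apply/ltnW/lt_size_deriv/monic_neq0.
    by apply/eqP/cls_eq0; apply: ae_imp hw => i [_ /eqP].
  move: sP; rewrite separable_poly.unlock => /coprimep_root/(_ r1).
  by rewrite -/(root _ _) r2.
have sgQ := ae_and irrQ sepQ.
split.
  have [i [iQ sepi]] := ae_ex sgQ; have [] := sgN i (Q i) iQ (mQ i) sepi.
  by rewrite sQ.
move=> z t; have [z' ->] := cls_surj z; have [t' ->] := cls_surj t.
rewrite eP !rootE !clsP_horner // => /eqP/cls_eq0 hz /eqP/cls_eq0 ht.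
apply/up_nv_eq; apply: ae2 sgQ (ae_and hz ht) => i [iQ sepi] [/eqP zi /eqP].
by have [_] := sgN i (Q i) iQ (mQ i) sepi; apply.
Qed.
End InternalSG.

(** * Separable extensions and linear disjointness from [p]-th powers *)

Section Separability.
Variables (E : fieldType) (p : nat) (pE : p \in [pchar E]).

Let pp : prime p. Proof. exact: pcharf_prime pE. Qed.

Lemma ppow_closed (N : subfield E) : sfclosed (fun x => exists2 y, y \in N & x = y ^+ p).
split; first by exists 1; rewrite ?rpred1 ?expr1n.
  move=> _ _ [x xN ->] [y yN ->]; exists (x - y); first by rewrite rpredB.
  by have := expBp 1 x y pE.
by move=> _ _ [x xN ->] [y yN ->]; exists (x / y); rewrite ?rpredM ?rpredV ?expr_div_n.
Qed.

Definition ppow N := sf_of (ppow_closed N).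

Lemma ppowP N x : x \in ppow N <-> exists2 y, y \in N & x = y ^+ p.
exact: sf_ofE. Qed.
Lemma ppow_sub (N M : subfield E) : {subset N <= M} -> {subset ppow N <= ppow M}.
by move=> NM x /ppowP[y yN ->]; apply/ppowP; exists y; rewrite ?NM. Qed.
Lemma lfree_sub (N M : subfield E) n (u : 'I_n -> E) : {subset N <= M} -> lfree M u -> lfree N u.
by move=> NM fu a aN; apply: fu => i; apply: NM. Qed.
Lemma spans_sub (N M : subfield E) n (u : 'I_n -> E) x : {subset N <= M} -> spans N u x -> spans M u x.
by move=> NM [a [aN ->]]; exists a; split=> // i; apply: NM. Qed.

(* [A] and the field of [p]-th powers of [N] are linearly disjoint over the
   field of [p]-th powers of [A]. *)
Definition sep_ext (A : E -> Prop) (N : subfield E) := forall n (u : 'I_n -> E), (forall i, A (u i)) ->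
  exists d (e : 'I_d -> E), [/\ forall j, A (e j), lfree (ppow N) e
    & forall i, exists g : 'I_d -> E, (forall j, A (g j)) /\ u i = \sum_j g j ^+ p * e j].

Section Adjoin.
Variables (A : subfield E) (N : subfield E).
Hypothesis AN : {subset A <= N}.

(** The compositum of [A] with the [p]-th powers of [N]; inverses come for free, as [y^-1] is
    [y ^+ p.-1] times a [p]-th power. *)
Definition cmps (x : E) := exists n (a : 'I_n -> E), (forall i, a i \in A) /\ spans (ppow N) a x.

Lemma cmps_base x : x \in A -> cmps x.
exists 1%N, (fun=> x); split=> //; apply: (spans_id _ (fun=> x) ord0). Qed.
Lemma cmps_N x : cmps x -> x \in N.
move=> [n [a [aA [z [zN ->]]]]]; apply: rpred_sum => i _; apply: rpredM; last exact/AN/aA.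
by have /ppowP[y yN ->] := zN i; rewrite rpredX.
Qed.

Lemma cmpsB x y : cmps x -> cmps y -> cmps (x - y).
move=> [n [a [aA xa]]] [m [b [bA yb]]].
exists (n + m)%N, (fun k : 'I_(n + m) => match fintype.split k with inl i => a i | inr j => b j end); split.
  by move=> k; case: fintype.split.
apply: spansB; [apply: spans_trans xa _ => i|apply: spans_trans yb _ => j].
  have := spans_id (ppow N) (fun k : 'I_(n + m) => match fintype.split k with inl i => a i | inr j => b j end) (lshift m i).
  by rewrite (unsplitK (inl i)).
have := spans_id (ppow N) (fun k : 'I_(n + m) => match fintype.split k with inl i => a i | inr j => b j end) (rshift n j).
by rewrite (unsplitK (inr j)).
Qed.

Lemma cmpsM x y : cmps x -> cmps y -> cmps (x * y).
move=> [n [a [aA xa]]] [m [b [bA yb]]]; exists _, (pfam a b); split; last exact: spans_product.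
by move=> k; rewrite rpredM.
Qed.

Lemma cmps_pth x : x \in N -> cmps (x ^+ p).
exists 1%N, (fun=> 1); split; first by move=> _; rewrite rpred1.
exists (fun=> x ^+ p); split; first by move=> _; apply/ppowP; exists x.
by rewrite big_ord1 mulr1.
Qed.

Lemma cmps_closed : sfclosed cmps.
have : cmps 1 by apply: cmps_base; rewrite rpred1.
split=> //; first exact: cmpsB.
move=> x y hx hy; apply: cmpsM => //.
have [->|y0] := eqVneq y 0; first by rewrite invr0; apply: cmps_base; rewrite rpred0.
have -> : y^-1 = y ^+ p.-1 * (y^-1) ^+ p by rewrite -(prednK (prime_gt0 pp)) exprS mulrCA -exprMn divff // expr1n mulr1.
apply: cmpsM; last by apply: cmps_pth; rewrite rpredV cmps_N.
by elim: p.-1 => [|k IH]; rewrite // exprS; apply: cmpsM.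
Qed.

Definition NA := sf_of cmps_closed.

Lemma NAP x : x \in NA <-> cmps x.
exact: sf_ofE. Qed.

(** The minimal polynomial of [w] is [(X - w)^d] with [d <= p]; if [d < p], its second coefficient
    would put [w] into [B]. *)
Lemma lfree_pth_degree (B : subfield E) w : w ^+ p \in B -> w \notin B -> lfree B (fun i : 'I_p => w ^+ i).
move=> wpB wB; apply: lfree_powers => T BT T0 Tw.
set Q := 'X^p - (w ^+ p)%:P.
have eQ : Q = ('X - w%:P) ^+ p.
  rewrite -(pFrobenius_autE (rmorph_pchar polyC pE)) rmorphB /= !pFrobenius_autE.
  by rewrite -rmorphXn.
have BQ : Q \over B by rewrite polyOverXnsubC.
have aw : alg_over B w by exists T.
have [P [iP mP Pw]] := algebraic_irr aw.
have Qw : root Q w by rewrite /root !hornerE subrr.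
have := irr_dvdp iP Pw BQ Qw; rewrite eQ => /dvdp_exp_XsubCP[d dp eP].
have eP' : P = ('X - w%:P) ^+ d by (apply/eqP; rewrite -eqp_monic // monic_exp // monicXsubC).
have sP : size P = d.+1 by rewrite eP' size_exp_XsubC.
have PT := dvdp_leq T0 (irr_dvdp iP Pw BT Tw).
apply: leq_trans PT; rewrite sP leqNgt; apply/negP => ltdp.
have d0 : (0 < d)%N by case: iP => _; rewrite sP.
have [BP] := iP.
have := polyOverP BP d.-1.
have -> : P`_d.-1 = - (d%:R * w).
  have := @coefPn_prod_XsubC E (nseq d w); rewrite size_nseq big_nseq iter_mulr_1 -eP'.
  by rewrite big_nseq iter_addr_0 mulr_natl => -> //; case: (d) d0.
rewrite rpredN => dw; have dE : d%:R != 0 :> E.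
  by rewrite -(dvdn_pcharf pE) gtnNdvd.
by move: wB; rewrite -[w](mulKf dE) rpredM // rpredV rpred_nat.
Qed.

Definition fracs (w x : E) := exists P Q : {poly E}, [/\ P \over A, Q \over A, Q.[w] != 0 & x = P.[w] / Q.[w]].

Lemma fracs_closed w : sfclosed (fracs w).
split=> [|_ _ [P [Q [AP AQ Q0 ->]]] [R [S [AR AS S0 ->]]]|_ _ [P [Q [AP AQ Q0 ->]]] [R [S [AR AS S0 ->]]]].
- by exists 1, 1; rewrite rpred1 hornerC divr1 oner_eq0.
- exists (P * S - R * Q), (Q * S); rewrite rpredB ?rpredM // hornerD hornerN !hornerM mulf_neq0 //.
  by rewrite -[- (_ / _)]mulNr addf_div // mulNr.
have [R0|R0] := eqVneq R.[w] 0.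
  by rewrite R0 mul0r invr0 mulr0; exists 0, 1; rewrite rpred0 rpred1 !hornerC mul0r oner_eq0.
exists (P * S), (Q * R); rewrite !rpredM // !hornerM mulf_neq0 //.
by rewrite invf_div mulf_div.
Qed.

(** As [w] has degree [p] over the compositum, the products of a family free over the [p]-th powers
    with the [w ^+ j], [j < p], are again free. Polynomials in [w] are expressed in them by grouping
    exponents modulo [p]. *)
Lemma sep_ext_adjoin w : sep_ext (fun x => x \in A) N -> w \in N -> ~ cmps w -> sep_ext (fracs w) N.
move=> sepA wN wNA n u hu.
have [Pf hP] := choice hu; have [Qf {}hP] := choice hP.
(* Multiplying numerator and denominator by the power [p.-1] of the denominator turns the
   denominator into a [p]-th power. *)
pose R i := Pf i * Qf i ^+ p.-1.
have AR i : R i \over A by case: (hP i) => *; rewrite rpredM ?rpredX.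
have eu i : u i = (Qf i).[w]^-1 ^+ p * (R i).[w].
  have [_ _ Q0 ->] := hP i; rewrite hornerM horner_exp -(prednK (prime_gt0 pp)) exprS.
  by rewrite mulrACA [_ ^+ _ * _]mulrC -[_ * _^-1 ^+ _]exprMn divff // expr1n mulr1 mulrC.
have [m hm] : exists m, forall i, (size (R i) <= m)%N by (exists (\max_i size (R i)) => i; apply: (leq_bigmax)).
pose a (k : 'I_#|{: 'I_n * 'I_m}|) := (R (enum_val k).1)`_(enum_val k).2.
have [d [e [eA fe he]]] := sepA _ a (fun => polyOverP (AR _) _).
have fw := @lfree_pth_degree.
have {}fw : lfree NA (fun i : 'I_p => w ^+ i) by (apply: fw; [apply/NAP/cmps_pth|apply/negP => /NAP]).
have AF x : x \in A -> fracs w x.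
  exists x%:P, 1; rewrite polyOverC rpred1 !hornerC divr1; split=> //.
  exact: oner_neq0.
pose Fw := sf_of (fracs_closed w).
have FP x : x \in Fw <-> fracs w x by apply: sf_ofE.
have AF' x : x \in A -> x \in Fw by move=> /AF/FP.
have wF : w \in Fw.
  apply/FP; exists 'X, 1; rewrite polyOverX rpred1 hornerX hornerC divr1; split=> //; exact: oner_neq0.
pose T := ('I_d * 'I_p)%type.
have sumT (F : T -> E) : \sum_(k < #|{: T}|) F (enum_val k) = \sum_(l < d) \sum_(j < p) F (l, j).
  by rewrite pair_bigA -(big_enum_val) /=; apply: eq_bigr => -[].
exists #|{: T}|, (fun k : 'I_#|{: T}| => e (enum_val k).1 * w ^+ (enum_val k).2); split.
- by move=> k; apply/FP/rpredM; [apply/AF'/eA|apply: rpredX].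
- move=> z zN e0 k.
  have e1 : \sum_(j < p) (\sum_(l < d) z (enum_rank (l, j)) * e l) * w ^+ j = 0.
    rewrite -[RHS]e0 (reindex_onto (fun t : T => enum_rank t) enum_val) /=; last first.
      by move=> l _; rewrite enum_valK.
    under [RHS]eq_bigl => t do rewrite enum_rankK eqxx.
    under eq_bigr => j do rewrite mulr_suml.
    rewrite exchange_big pair_bigA /=; apply: eq_bigr => -[l j].
    by rewrite enum_rankK mulrA.
  have e2 j : \sum_(l < d) z (enum_rank (l, j)) * e l = 0.
    apply: (fw _ _ e1) => {}j; apply: rpred_sum => l _; apply: rpredM; last first.
      exact/NAP/cmps_base/eA.
    have /ppowP[y yN ->] := zN (enum_rank (l, j)); exact/NAP/cmps_pth.
  have := fe (fun l => z (enum_rank (l, (enum_val k).2))) (fun => zN _) (e2 _) (enum_val k).1.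
  by rewrite -surjective_pairing enum_valK.
- move=> i.
  have [g hg] := choice (fun k : 'I_m => he (enum_rank (i, k))).
  exists (fun k : 'I_#|{: T}| => (Qf i).[w]^-1 * \sum_(s < m | (s %% p)%N == (enum_val k).2 :> nat) g s (enum_val k).1 * w ^+ (s %/ p)%N).
  split=> [k|].
    apply/FP/rpredM.
      apply/FP; have [Q0] := hP i; exists 1, (Qf i); rewrite rpred1 hornerC div1r; split=> //.
    by apply: rpred_sum => s _; apply: rpredM; [apply/AF'; apply: (proj1 (hg s))|apply: rpredX].
  rewrite eu (horner_coef_wide _ (hm i)).
  have es (s : 'I_m) : (R i)`_s * w ^+ s = \sum_(l < d) (g s l * w ^+ (s %/ p)%N) ^+ p * (e l * w ^+ (s %% p)%N).
    have := proj2 (hg s); rewrite /a enum_rankK => ->; rewrite mulr_suml.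
    apply: eq_bigr => l _; rewrite [in LHS](divn_eq s p) exprD exprM exprMn.
    by rewrite -!mulrA; congr (_ * _); rewrite mulrCA.
  under eq_bigr => s do rewrite es.
  rewrite exchange_big (sumT (fun t => ((Qf i).[w]^-1 * \sum_(s < m | (s %% p)%N == t.2 :> nat) g s t.1 * w ^+ (s %/ p)%N) ^+ p * (e t.1 * w ^+ t.2))).
  rewrite mulr_sumr; apply: eq_bigr => l _.
  have lt_mod (s : 'I_m) : (s %% p < p)%N by rewrite ltn_mod prime_gt0.
  rewrite (partition_big (fun s => Ordinal (lt_mod s)) xpredT) //=.
  rewrite mulr_sumr; apply: eq_bigr => j _; rewrite exprMn -!mulrA; congr (_ * _).
  rewrite -(pFrobenius_autE) rmorph_sum mulr_suml.
  by apply: eq_bigr => s /eqP <-.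
Qed.
End Adjoin.
End Separability.

(** * Transfer through perfect hulls *)

Section Hulls.
Variables (E : closedF) (O : valring E) (p : nat).
Hypothesis pE : p \in [pchar E].
Variables N1 N2 : subfield E.
Hypotheses (sg1 : SG O p N1) (sg2 : SG O p N2).
Hypothesis rv12 : forall x, x \in N1 -> exists2 y, y \in N2 & rveq O x y.

Let pp : prime p. Proof. exact: pcharf_prime pE. Qed.
Let p0 : (0 < p)%N. Proof. exact: prime_gt0. Qed.

Notation H1 := (phull pE N1).
Notation H2 := (phull pE N2).

Lemma pth_rootn_ex k (x : E) : exists y, x = y ^+ (p ^ k).
elim: k => [|k [y ->]]; first by exists x.
by have [z ->] := pth_root_ex pE y; exists z; rewrite -exprM expnS.
Qed.

Let sgh1 : SG O p H1. Proof. exact: phull_sg. Qed.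
Let sgh2 : SG O p H2. Proof. exact: phull_sg. Qed.
Let pfh1 : perf_sf p H1. Proof. exact: phull_perfect. Qed.
Let pfh2 : perf_sf p H2. Proof. exact: phull_perfect. Qed.

Lemma nv_le_pow n x : (0 < n)%N -> x <=_[O] 1 -> x ^+ n <=_[O] x.
by case: n => // n _ x1; rewrite exprS nv_leMr // nv_leX1.
Qed.

Lemma hull_lower N t : t \in phull pE N -> t != 0 -> exists2 e, e \in N & [/\ e != 0, e <=_[O] t & e <=_[O] 1].
move=> /phullE[k] t0; have [] := leP (nv O t) (nv O 1); last first.
  by exists 1; rewrite ?rpred1 ?oner_eq0 //; split=> //; exact: ltW.
exists (t ^+ (p ^ k)) => //; rewrite expf_neq0 //; split=> //.
  by apply: nv_le_pow; rewrite ?expn_gt0 ?p0.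
exact: nv_leX1.
Qed.

Lemma lower_list N (ts : seq E) : (forall t, t \in ts -> t \in phull pE N /\ t != 0) ->
  exists2 e, e \in N & [/\ e != 0, forall t, t \in ts -> e <=_[O] t & e <=_[O] 1].
elim: ts => [|t ts IH] h; first by exists 1; rewrite ?rpred1 ?oner_eq0.
have [e eN [e0 ets]] := IH (fun s sts => h s (mem_behead (s := t :: ts) sts)).
have [tN t0] := h t (mem_head _ _); have [d dN [d1]] := hull_lower tN t0.
exists (d * e); rewrite ?rpredM ?mulf_neq0 //; split=> // [s|]; last exact: nv_leM1.
rewrite inE => /predU1P[->|/ets es].
  by rewrite -[t in leRHS]mulr1; apply: nv_leM.
by rewrite -[s]mul1r; apply: nv_leM.
Qed.

Lemma horner_continuous N P y : P \over (phull pE N) -> y \in phull pE N -> P.[y] != 0 ->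
  exists2 e, e \in N & [/\ e != 0, e <=_[O] 1 & forall z, z - y <_[O] e -> rveq O P.[z] P.[y]].
move=> NP yN Py0.
have tcN k : tc P y k \in phull pE N by (apply/polyOverP; rewrite polyOver_comp // rpredD ?polyOverX // polyOverC).
have [|e eN [e0 ets e1]] := @lower_list N [seq P.[y] / tc P y k | k <- iota 0 (size P) & tc P y k != 0].
  move=> t /mapP[k]; rewrite mem_filter => /andP[k0 _] ->.
  by rewrite rpredM ?rpredV ?rpred_horner // mulf_neq0 // invr_eq0.
exists e => //; split=> // z ze; apply: rveq_lt.
have -> : P.[z] - P.[y] = \sum_(k < size P | (0 < k)%N) tc P y k * (z - y) ^+ k.
  rewrite -{1}[z](subrKC y) taylor.
  have : (0 < size P)%N by rewrite size_poly_gt0; apply: contraNneq Py0 => ->; rewrite horner0.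
  case: (size) => // n _; rewrite big_ord_recl mulr1 tc0 addrAC subrr.
  by rewrite [RHS]big_mkcond big_ord_recl.
apply: nv_lt_sum => // k k_gt0.
have [->|k0] := eqVneq (tc P y k) 0; first by rewrite mul0r nv_gt0.
have := ets (P.[y] / tc P y k); rewrite (map_f (fun k => P.[y] / tc P y k)); last first.
  by rewrite mem_filter k0 mem_iota /=.
move=> /(_ isT) h; rewrite mulrC -nv_lt_divr //; apply: lt_le_trans h; apply: le_lt_trans (ze).
by apply: nv_le_pow => //; apply: le_trans (ltW ze) e1.
Qed.

Lemma hull_dense N pi x e : SG O p N -> pi \in N -> pi != 0 -> pi <_[O] 1 ->
  x \in phull pE N -> e \in N -> e != 0 -> exists2 y, y \in N & y - x <_[O] e.
move=> sg piN pi0 pi1 /phullE[k xN] eN e0.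
have [y] := sg_dense pE k sg xN (rpredX (p ^ k) eN) (expf_neq0 _ e0) piN pi0 pi1.
exists y => //; rewrite -(nv_ltX2 O (n := p ^ k)) ?expn_gt0 ?p0 //.
by rewrite (expBp).
Qed.

Section Transfer.
Variables (A : fieldType) (i1 i2 : {rmorphism A -> E}).
Notation mp1 := (map_poly i1).
Notation mp2 := (map_poly i2).
Hypotheses (A1 : forall a, i1 a \in N1) (A2 : forall a, i2 a \in N2).
Hypothesis A12 : forall a, rveq O (i1 a) (i2 a).

Lemma hull_embeddings : exists (B : fieldType) (j1 j2 : {rmorphism B -> E}),
  [/\ forall b, [/\ j1 b \in H1, j2 b \in H2 & rveq O (j1 b) (j2 b)], forall b : B, exists c, b = c ^+ p,
      forall s t, s \in H1 -> t \in H2 -> ext_to O j1 j2 s t -> exists b, s = j1 b & forall P : {poly A}, exists Q : {poly B},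
        mp1 P = map_poly j1 Q /\ mp2 P = map_poly j2 Q].
have [|B [j1 [j2 [jH pB maxB ext]]]] := @maximal_embeddings E O p pE H1 H2 pfh1 pfh2 (fun x y => exists a, x = i1 a /\ y = i2 a).
  split.
  - by exists 1; rewrite !rmorph1.
  - by move=> _ _ _ _ [a [-> ->]] [b [-> ->]]; exists (a - b); rewrite !rmorphB.
  - by move=> _ _ _ _ [a [-> ->]] [b [-> ->]]; exists (a * b); rewrite !rmorphM.
  - by move=> _ _ [a [-> ->]]; rewrite ?phull_sub.
exists B, j1, j2; split=> // P.
have [f hf] := choice (fun a => ext (i1 a) (i2 a) (ex_intro _ a (conj erefl erefl))).
exists (\poly_(i < size P) f P`_i).
split; apply/polyP => i; rewrite !coef_map coef_poly; case: ltnP => [_|h].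
- by have [] := hf P`_i.
- by rewrite [P`_i]nth_default //; apply: (etrans (rmorph0 i1) (esym (rmorph0 j1))).
- by have [] := hf P`_i.
- by rewrite [P`_i]nth_default //; apply: (etrans (rmorph0 i2) (esym (rmorph0 j2))).
Qed.

Lemma hull_rv x : x \in H1 -> exists2 y, y \in H2 & rveq O x y.
move=> /phullE[k /rv12[y' yN]]; have [y ey] := pth_rootn_ex k y'.
rewrite ey (rveq_pX O k _ _ pE) => h; exists y => //; apply/phullE.
by exists k; rewrite -ey.
Qed.

(* Transfer inside the perfect hulls, then use that [N2] is dense in its
   perfect hull. *)
Lemma nonzero_transfer x (Ps : seq {poly A}) pi n (b : 'I_n -> E) z0 : pi \in N2 -> pi != 0 -> pi <_[O] 1 ->
  z0 \in N2 -> ~ spans (ppow pE N2) b z0 -> x \in N1 -> (forall P, P \in Ps -> (mp1 P).[x] != 0) ->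
  exists2 y, y \in N2 & ~ spans (ppow pE N2) b y /\ forall P, P \in Ps -> rveq O (mp1 P).[x] (mp2 P).[y].
move=> piN pi0 pi1 zN zb xN Px0.
have [B [j1 [j2 [jH pB maxB lift]]]] := hull_embeddings.
have [f hf] := choice lift.
have [] := @transfer_point E O p pE H1 H2 sgh1 sgh2 pfh1 pfh2 hull_rv B j1 j2
  (fun b => let: And3 h _ _ := jH b in h) (fun b => let: And3 _ h _ := jH b in h)
  (fun b => let: And3 _ _ h := jH b in h) pB maxB x (map f Ps).
  exact: phull_sub.
move=> yh yhH hy.
have {}hy P : P \in Ps -> rveq O (mp1 P).[x] (mp2 P).[yh] by (move=> PPs; have [-> ->] := hf P; apply: hy; apply: map_f).
have [e eN [e0 e1 he]] : exists2 e, e \in N2 & [/\ e != 0, e <=_[O] 1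
    & forall P z, P \in Ps -> z - yh <_[O] e -> rveq O (mp2 P).[z] (mp2 P).[yh]].
  elim: (Ps) Px0 hy => [|P Qs IH] Px0 hy; first by exists 1; rewrite ?rpred1 ?oner_eq0.
  have [||e eN [e0 e1 he]] := IH.
  - by move=> Q QQ; apply: Px0; rewrite inE QQ orbT.
  - by move=> Q QQ; apply: hy; rewrite inE QQ orbT.
  have Py0 : (mp2 P).[yh] != 0 by rewrite -(rveq_eq0 (hy P _)) ?mem_head // Px0 ?mem_head.
  have P2 : mp2 P \over H2 by (apply/polyOverP => i; rewrite coef_map; apply/phull_sub/A2).
  have [d dN [d0 d1 hd]] := horner_continuous P2 yhH Py0.
  exists (d * e); rewrite ?rpredM ?mulf_neq0 //; split=> // [|Q z]; first exact: nv_leM1.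
  rewrite inE => /predU1P[->|QQ] ze.
    apply: hd; apply: lt_le_trans ze _; exact: nv_leMr.
  apply: he => //; apply: lt_le_trans ze _; exact: nv_leMl.
have [y yN ye] := hull_dense sg2 piN pi0 pi1 yhH eN e0.
(* A proper subspace over the [p]-th powers has dense complement: adding a small [p]-th power times
   [z0] leaves it. *)
have [y' [y'N y'b y'e]] : exists y', [/\ y' \in N2, ~ spans (ppow pE N2) b y' & y' - yh <_[O] e].
  have [yb|yb] := pselect (spans (ppow pE N2) b y); last by exists y.
  have z00 : z0 != 0 by apply: contra_notN zb => /eqP ->; apply: spans0.
  have [|t tN [t0 tz t1]] := @hull_lower N2 (e / z0) _ (mulf_neq0 e0 (invr_neq0 z00)).
    by apply: phull_sub; rewrite rpredM ?rpredV.
  have tN2 : (t * pi) ^+ p \in ppow pE N2 by apply/ppowP; exists (t * pi); rewrite ?rpredM.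
  have tp0 : (t * pi) ^+ p != 0 by rewrite expf_neq0 // mulf_neq0.
  exists (y + (t * pi) ^+ p * z0); split; first by rewrite rpredD ?rpredM ?rpredX // rpredM.
    move=> h; have := spansB h yb; rewrite addrAC subrr add0r => h'.
    by have := spansZ (rpredVr tN2) h'; rewrite mulKf.
  rewrite addrAC; apply: nv_ltD => //; rewrite -nv_lt_divr //; apply: lt_le_trans tz.
  apply: (@le_lt_trans).
    by apply: nv_le_pow => //; apply: nv_leM1 => //; apply: ltW.
  by rewrite mulrC nv_ltMl.
exists y' => //; split=> // P PPs; apply: rveq_trans (hy P PPs) _.
by apply: rveq_sym; apply: he.
Qed.

(** In the perfect hulls [x] already belongs to the maximal domain. Its image is separable over
    [N2], and some [p]-power of it lies in [N2]; hence it is in [N2]. *)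
Lemma separable_transfer x : x \in N1 -> sepalg (imA i1) x -> exists2 y, y \in N2 & ext_to O i1 i2 x y.
move=> xN sx; have [B [j1 [j2 [jH pB maxB lift]]]] := hull_embeddings.
have ax : alg_over (imA j1) x.
  have [P [AP]] := sepalg_alg sx; exists P; split=> //.
  have [P' eP] := imA_polyOver AP; have [Q [eQ _]] := lift P'.
  by rewrite eP eQ; apply/polyOverP => i; rewrite coef_map; apply: imA_i1.
have [] := @relatively_closed E O p pE H1 H2 sgh1 sgh2 pfh1 pfh2 hull_rv B j1 j2
  (fun b => let: And3 h _ _ := jH b in h) (fun b => let: And3 _ h _ := jH b in h)
  (fun b => let: And3 _ _ h := jH b in h) pB maxB x.
- exact: phull_sub.
- by [].
move=> b xb; have ext : ext_to O i1 i2 x (j2 b).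
  move=> Q; have [Q' [-> ->]] := lift Q; rewrite xb !horner_map.
  by have [] := jH Q'.[b].
exists (j2 b) => //.
have sy : sepalg N2 (j2 b).
  have [P [AP Px P'x]] := sx; have [Q eQ] := imA_polyOver AP.
  exists (mp2 Q); split.
  - by apply/polyOverP => i; rewrite coef_map; apply: A2.
  - by move: Px; rewrite eQ => /eqP h; have := ext Q; rewrite h rveq0l.
  - by move: P'x; rewrite eQ /root !deriv_map (rveq_eq0 (ext Q^`())).
have [_ /phullE[k yk]] := jH b.
elim: k yk => [|k IH] => //.
rewrite expnSr exprM => h; apply: IH; apply: (sepalg_pth_power pE (N := N2)) => //.
by apply/(sf_ofE (sepalg_closed pE N2)); rewrite rpredX //; apply/sf_ofE.
Qed.
End Transfer.
End Hulls.

From mathcomp Require Import mpoly.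

(** * Finitely generated fields and MacLane's criterion *)

Section Generated.
Variables (E : fieldType) (A : subfield E).

Definition fracs_in n (u : 'I_n -> E) (x : E) := exists P Q : {mpoly E[n]}, [/\ P \is a mpolyOver n A, Q \is a mpolyOver n A,
    Q.@[u] != 0 & x = P.@[u] / Q.@[u]].

Lemma fracs_in_closed n (u : 'I_n -> E) : sfclosed (fracs_in u).
have : 1 \is a mpolyOver n A by rewrite rpred1.
split; first by exists 1, 1; rewrite rmorph1 divr1 oner_eq0.
  move=> _ _ [P [Q [AP AQ Q0 ->]]] [P' [Q' [AP' AQ' Q'0 ->]]].
  exists (P * Q' - P' * Q), (Q * Q'); rewrite rpredB ?rpredM // rmorphB !rmorphM mulf_neq0 //.
  by rewrite -[- (_ / _)]mulNr addf_div // mulNr.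
move=> _ _ [P [Q [AP AQ Q0 ->]]] [P' [Q' [AP' AQ' Q'0 ->]]].
have [P'0|P'0] := eqVneq P'.@[u] 0.
  by exists 0, 1; rewrite rpred0 rmorph0 rmorph1 oner_eq0 P'0 !mul0r invr0 mulr0.
exists (P * Q'), (Q * P'); rewrite !rpredM // !rmorphM mulf_neq0 //.
by rewrite invf_div mulf_div.
Qed.

Definition gen n (u : 'I_n -> E) := sf_of (fracs_in_closed u).

Lemma genP n (u : 'I_n -> E) x : x \in gen u <-> fracs_in u x.
exact: sf_ofE. Qed.
Lemma gen_base n (u : 'I_n -> E) x : x \in A -> x \in gen u.
move=> xA; apply/genP; exists x%:MP, 1.
by rewrite mpolyOverC rpred1 mevalC rmorph1 divr1 oner_eq0.
Qed.
Lemma gen_id n (u : 'I_n -> E) i : u i \in gen u.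
apply/genP; exists 'X_i, 1.
by rewrite mpolyOverX rpred1 mevalXU rmorph1 divr1 oner_eq0.
Qed.

Lemma gen_min n (u : 'I_n -> E) (B : subfield E) : {subset A <= B} -> (forall i, u i \in B) -> {subset gen u <= B}.
move=> AB uB _ /genP[P [Q [AP AQ Q0 ->]]].
have h R : R \is a mpolyOver n A -> R.@[u] \in B.
  move=> AR; rewrite mevalE rpred_sum // => m _; rewrite rpredM //.
    by apply: AB; move/mpolyOverP: AR.
  by rewrite rpred_prod // => i _; rewrite rpredX.
by rewrite rpredM ?rpredV ?h.
Qed.

Lemma gen_algebraic n u : alg_over (gen (fun i => u (lift ord0 i))) (u ord0) ->
  exists P : {mpoly E[n.+1]}, [/\ P \is a mpolyOver n.+1 A, P != 0 & P.@[u] = 0].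
set v := (fun i => u (lift ord0 i)); move=> [T [BT T0 Tu]].
have hT (i : 'I_(size T)) : exists PQ : {mpoly E[n]} * {mpoly E[n]},
  [/\ PQ.1 \is a mpolyOver n A, PQ.2 \is a mpolyOver n A, PQ.2.@[v] != 0 & T`_i = PQ.1.@[v] / PQ.2.@[v]].
  by have /genP[P [Q]] := polyOverP BT i; exists (P, Q).
have [f hf] := choice hT.
pose D := \prod_i (f i).2; pose R i := (f i).1 * \prod_(j | j != i) (f j).2.
have D0 : D.@[v] != 0 by rewrite rmorph_prod; apply/prodf_neq0 => i _; have [] := hf i.
have eR i : (R i).@[v] = T`_i * D.@[v].
  have [_ _ Q0 ->] := hf i; rewrite /D [in RHS](bigD1 i) // !rmorphM mulrA.
  by rewrite divfK.
have AR i : R i \is a mpolyOver n A by (rewrite rpredM ?rpred_prod //; [have [] := hf i | move=> j _; have [] := hf j]).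
pose lf Q : {mpoly E[n.+1]} := mmap (@mpolyC n.+1 E) (fun j => 'X_(lift ord0 j)) Q.
have Alf Q : Q \is a mpolyOver n A -> lf Q \is a mpolyOver n.+1 A.
  move=> /mpolyOverP AQ; rewrite rpred_sum // => m _; rewrite rpredM ?mpolyOverC //.
  by rewrite rpred_prod // => i _; rewrite rpredX // mpolyOverX.
pose P := \sum_(i < size T) lf (R i) * 'X_ord0 ^+ i.
have mm (S : comNzRingType) (g : {rmorphism E -> S}) h Q : mmap g h (lf Q) = mmap g (fun j => h (lift ord0 j)) Q.
  rewrite rmorph_sum; apply: eq_bigr => m _.
  rewrite rmorphM /= mmapC; congr (_ * _); rewrite rmorph_prod; apply: eq_bigr => i.
  by rewrite rmorphXn /= mmapX mmap1U.
have mP (S : comNzRingType) (g : {rmorphism E -> S}) h :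
    mmap g h P = \sum_(i < size T) mmap g (fun j => h (lift ord0 j)) (R i) * h ord0 ^+ i.
  rewrite rmorph_sum; apply: eq_bigr => i.
  by rewrite rmorphM /= mm rmorphXn /= mmapX mmap1U.
exists P; split.
- by rewrite rpred_sum // => i _; rewrite rpredM ?Alf // rpredX // mpolyOverX.
- apply/eqP => P0.
  (* Specialising all variables but the first to [v] turns [P] into a nonzero multiple of [T], so
     [P] is not zero. *)
  pose h j := if unlift ord0 j is Some i then (v i)%:P else 'X : {poly E}.
  have := mP {poly E} polyC h; rewrite P0 rmorph0.
  have -> : \sum_(i < size T) mmap polyC (fun j => h (lift ord0 j)) (R i) * h ord0 ^+ i = D.@[v] *: T.
    rewrite -[in RHS](coefK T) poly_def scaler_sumr; apply: eq_bigr => i _.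
    rewrite scalerA [D.@[v] * _]mulrC -eR {2}/h unlift_none -mul_polyC; congr (_ * _).
    rewrite rmorph_sum; apply: eq_bigr => m _; rewrite rmorphM; congr (_ * _).
    rewrite rmorph_prod; apply: eq_bigr => j.
    by rewrite /h liftK rmorphXn.
  by move/eqP; rewrite eq_sym scaler_eq0 (negPf D0) (negPf T0).
- have := mP E idfun u; rewrite -/(meval u P) => ->.
  transitivity (D.@[v] * T.[u ord0]); last by rewrite (eqP Tu) mulr0.
  rewrite horner_coef mulr_sumr; by apply: eq_bigr => i _; rewrite mulrA [D.@[v] * _]mulrC -eR.
Qed.

Lemma mmap_polyC_deriv n u k (P : {mpoly E[n]}) : let T := mmap polyC (fun i => if i == k then 'X else (u i)%:P) P in
  T.[u k] = P.@[u] /\ T^`().[u k] = P^`M(k).@[u].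
set h := fun => _; pose c m := \prod_(i | i != k) u i ^+ m i.
have eh m : mmap1 h m = 'X^(m k) * (c m)%:P.
  rewrite /mmap1 (bigD1 k) //= {1}/h eqxx rmorph_prod; congr (_ * _).
  by apply: eq_bigr => i ik; rewrite /h (negPf ik) rmorphXn.
have eu m : \prod_i u i ^+ m i = u k ^+ m k * c m by rewrite (bigD1 k).
split.
  rewrite horner_sum mevalE; apply: eq_bigr => m.
  by rewrite eh !hornerM !hornerC hornerXn eu.
have -> : P^`M(k) = \sum_(m <- msupp P) P@_m *: ('X_[m])^`M(k) by (rewrite {1}[P]mpolyE (raddf_sum (mderiv k)); apply: eq_bigr => m _; apply: mderivZ).
rewrite (raddf_sum) (raddf_sum) horner_sum; apply: eq_bigr => m _.
rewrite /= eh !derivM !derivC mul0r add0r mulr0 addr0 derivXn mderivX !mevalZ mevalX.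
rewrite !hornerM !hornerC hornerMn hornerXn; congr (_ * _).
rewrite eu mnmBE mnm1E eqxx subn1 mulrA mulr_natl; congr (_ * _).
by apply: eq_bigr => i ik; rewrite mnmBE mnm1E eq_sym (negPf ik) subn0.
Qed.

Variables (p : nat) (pE : p \in [pchar E]) (N : subfield E).
Hypothesis AN : {subset A <= N}.

Let pp : prime p. Proof. exact: pcharf_prime pE. Qed.

(* MacLane: in a relation of least degree some partial derivative does not
   vanish; otherwise the relation would be a polynomial in the [p]-th powers,
   and separability would produce one of smaller degree. *)
Lemma maclane n (u : 'I_n.+1 -> E) : sep_ext pE (fun x => x \in A) N -> (forall i, u i \in N) ->
  alg_over (gen (fun i => u (lift ord0 i))) (u ord0) -> exists k, sepalg (gen (fun i => u (lift k i))) (u k).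
move=> sepA uN /gen_algebraic rel0.
pose rel P := [/\ P \is a mpolyOver n.+1 A, P != 0 & P.@[u] = 0].
have [|d [[P [[AP P0 Pu] eP]] mind]] := ex_least (P := fun d => exists P, rel P /\ msize P = d).
  by have [P] := rel0; exists (msize P), P.
have Ac m : P@_m \in A by move/mpolyOverP: AP.
have msize_le k (Q : {mpoly E[n.+1]}) : (forall m, m \in msupp Q -> (mdeg m < k)%N) -> (msize Q <= k)%N.
  by move=> h; apply/bigmax_leqP_seq => m mQ _; apply: h.
have dgt1 : (1 < d)%N.
  rewrite ltnNge -eP; apply/negP => /msize1_polyC eP1; move: Pu P0; rewrite eP1 mevalC => ->.
  by rewrite eqxx.
have dgt0 := ltnW dgt1.
have [[k dk]|nok] := pselect (exists k, P^`M(k).@[u] <> 0).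
  exists k; exists (mmap polyC (fun i => if i == k then 'X else (u i)%:P) P).
  have [e1 e2] := mmap_polyC_deriv u k P.
  split; last by rewrite /root e2; apply/eqP.
    rewrite rpred_sum // => m _; rewrite rpredM //; first by rewrite polyOverC; apply/gen_base/Ac.
    rewrite rpred_prod // => i _; rewrite rpredX //; case: eqP => [_|/eqP ik]; first exact: polyOverX.
    rewrite polyOverC; case: (unliftP k i) ik => [j ->|->]; last by rewrite eqxx.
    by move=> _; apply: (gen_id).
  by rewrite /root e1 Pu.
have dP k : P^`M(k) = 0.
  apply/eqP/negPn/negP => Pk0; suff : (d <= msize P^`M(k))%N.
    apply/negP; rewrite -ltnNge -(prednK dgt0) ltnS; apply: msize_le => m.
    rewrite mcoeff_msupp mcoeff_deriv => h.
    have : (m + U_(k))%MM \in msupp P by rewrite mcoeff_msupp; apply: contraNneq h => ->; rewrite mul0rn.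
    by move/msize_mdeg_lt; rewrite mdegD mdeg1 addn1 eP; case: (d).
  apply: mind; exists P^`M(k); split=> //; split=> //; last first.
    by apply: contrapT => h; apply: nok; exists k.
  by apply/mpolyOverP => m; rewrite mcoeff_deriv rpredMn.
have pm m k : m \in msupp P -> (p %| m k)%N.
  rewrite mcoeff_msupp => m0; have [->|mk] := posnP (m k) => //.
  have := mcoeff_deriv k (m - U_(k))%MM P; rewrite dP mcoeff0 submK ?lep1mP -?lt0n //.
  rewrite mnmBE mnm1E eqxx subn1 prednK // => /esym/eqP.
  by rewrite -mulr_natr mulf_eq0 (negPf m0) -(dvdn_pcharf pE).
pose M i := nth 0%MM (msupp P) i; pose M' i := [multinom (M i k %/ p)%N | k < n.+1].
have MP (i : 'I_(size (msupp P))) : M i \in msupp P by apply: mem_nth.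
have eM (i : 'I_(size (msupp P))) k : M i k = (M' i k * p)%N by rewrite mnmE divnK // pm.
have [e [v [vA fv hv]]] := sepA _ (fun i : 'I_(size (msupp P)) => P@_(M i)) (fun => Ac _).
have [g hg] := choice hv.
(* [P] is the sum of the [v j] times the [p]-th powers of the [S j]; freeness of [v] makes every
   [S j] vanish at [u]. *)
pose S j := \sum_i g i j *: 'X_[M' i].
have AS j : S j \is a mpolyOver n.+1 A.
  rewrite rpred_sum // => i _; apply: mpolyOverZ; last exact: mpolyOverX.
  by have [] := hg i.
have M'inj (i i' : 'I_(size (msupp P))) : M' i = M' i' -> i = i'.
  move=> e1; apply/val_inj/eqP; rewrite -(nth_uniq 0%MM (ltn_ord i) (ltn_ord i') (msupp_uniq P)).
  by apply/eqP/mnmP => k; rewrite !eM e1.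
have Sc j (i : 'I_(size (msupp P))) : (S j)@_(M' i) = g i j.
  rewrite (raddf_sum) (bigD1 i) //= mcoeffZ mcoeffX eqxx mulr1 big1 ?addr0 // => i' ii'.
  rewrite mcoeffZ mcoeffX; case: eqP => [/M'inj e1|_]; last exact: mulr0.
  by rewrite e1 eqxx in ii'.
have Su j : (S j).@[u] = 0.
  apply: (frob_inj pE); rewrite expr0n gtn_eqF ?prime_gt0 //.
  move: j; apply: (fv).
    move=> j; apply/ppowP; exists ((S j).@[u]) => //.
    rewrite mevalE rpred_sum // => m _; rewrite rpredM //; first exact/AN/mpolyOverP.
    by rewrite rpred_prod // => i _; rewrite rpredX.
  rewrite -[RHS]Pu [P in RHS]mpolyE (big_nth 0%MM) big_mkord (raddf_sum (meval u)).
  transitivity (\sum_i \sum_j (g i j *: 'X_[M' i]).@[u] ^+ p * v j).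
    rewrite exchange_big; apply: eq_bigr => j _.
    rewrite -mulr_suml (raddf_sum (meval u)); congr (_ * _).
    by rewrite -(pFrobenius_autE) rmorph_sum.
  apply: eq_bigr => i _; rewrite [RHS]mevalZ mevalX -/(M i); have [_ ->] := hg i.
  rewrite mulr_suml; apply: eq_bigr => j _; rewrite [(_ *: _).@[u]]mevalZ mevalX exprMn mulrAC; congr (_ * _).
  by rewrite -prodrXl; apply: eq_bigr => k _; rewrite -exprM eM.
have S0 j : S j = 0.
  apply: contrapT => /eqP Sj; suff : (d <= msize (S j))%N.
    apply/negP; rewrite -ltnNge -(prednK dgt0) ltnS; apply: msize_le => m.
    rewrite mcoeff_msupp => mS.
    have [i ->] : exists i : 'I_(size (msupp P)), m = M' i.
      apply: contrapT => h; case/eqP: mS; rewrite (raddf_sum (mcoeff m)) big1 // => i _.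
      rewrite /= mcoeffZ mcoeffX; case: eqP => [e1|_]; last exact: mulr0.
      by case: h; exists i.
    have := msize_mdeg_lt (MP i); rewrite eP.
    have -> : mdeg (M i) = (mdeg (M' i) * p)%N by (rewrite !mdegE big_distrl; apply: eq_bigr => k).
    have := prime_gt1 pp; nia.
  by apply: mind; exists (S j).
have g0 i j : g i j = 0 by rewrite -Sc S0 mcoeff0.
case/negP: P0; rewrite [P]mpolyE (big_nth 0%MM) big_mkord big1 // => i.
have [_] := hg i; rewrite -/(i) => ->; rewrite big1 ?scale0r // => j.
by rewrite g0 expr0n gtn_eqF ?prime_gt0 // mul0r.
Qed.
End Generated.

(** * Countable closures *)

Section Countability.
Definition ctbl (X : Type) (P : X -> Prop) := exists s : nat -> option X, forall x, P x -> exists n, s n = Some x.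

Lemma countable_image (T : countType) X (f : T -> X) P : (forall x, P x -> exists t, x = f t) -> ctbl P.
move=> h; exists (fun n => omap f (unpickle n)) => x /h[t ->].
by exists (pickle t); rewrite pickleK.
Qed.

Lemma countable_enum X x0 P : ctbl P -> P x0 -> exists s : nat -> X, (forall n, P (s n)) /\ forall x, P x -> exists n, s n = x.
move=> [s hs] Px0; exists (fun n => if s n is Some x then if `[< P x >] then x else x0 else x0).
split=> [n|x Px]; first by case: (s) => // x; case: asboolP.
by have [n e] := hs x Px; exists n; rewrite e; case: asboolP.
Qed.

Lemma countable_sub X (P Q : X -> Prop) : (forall x, P x -> Q x) -> ctbl Q -> ctbl P.
by move=> PQ [s hs]; exists s => x /PQ/hs. Qed.

(** Elements of the closure are values of finite trees: a leaf names an initial element, and a node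
    names an operation applied to the list of its children. *)
Lemma countable_closure X x0 (c : nat -> X) (f : seq X -> nat -> X) P : P x0 -> (forall n, P (c n)) ->
  (forall s, (forall i, P (nth x0 s i)) -> forall i, P (f s i)) ->
  exists d : nat -> X, [/\ forall n, P (d n), forall n, exists m, c n = d m
    & forall s : seq nat, forall i, exists m, f (map d s) i = d m].
move=> Px0 Pc Pf.
pose fix ev t : X := match t with GenTree.Leaf n => c n
  | GenTree.Node k ts => f ((fix evs ts := if ts is t :: ts' then ev t :: evs ts' else [::]) ts) k end.
have evN k ts : ev (GenTree.Node k ts) = f (map ev ts) k by [].
have Pev : forall t, P (ev t).
  fix IH 1; case=> [n|k ts]; first exact: Pc.
  rewrite evN; apply: Pf; elim: ts => [|t ts IHts] [|i] //=.
pose d n := if unpickle n is Some t then ev t else c 0%N.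
have dE t : ev t = d (pickle t) by rewrite /d pickleK.
exists d; split=> [n|n|s i].
- by rewrite /d; case: unpickle.
- by exists (pickle (GenTree.Leaf n : GenTree.tree nat)); rewrite -dE.
- have [ts ->] : exists ts, map d s = map ev ts.
    elim: s => [|n s [ts IH]]; first by exists [::].
    by exists (odflt (GenTree.Leaf 0%N) (unpickle n) :: ts); rewrite /= IH /d; case: unpickle.
  by exists (pickle (GenTree.Node i ts)); rewrite -dE evN.
Qed.
End Countability.

(** * Internal relations on ultrapowers *)

Section Internal.
Variable K : fieldType.
Implicit Types (y : nat -> UP K) (f : nat -> nat -> K).

Definition int_term (t : (nat -> UP K) -> UP K) := exists t' : nat -> (nat -> K) -> K, forall f : nat -> nat -> K,
    t (fun k => cls (f k)) = cls (fun i => t' i (fun k => f k i)).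

(** Relations that can be decided coordinatewise, almost everywhere. Saturation needs no more than
    this, so no formulas have to be formed. *)
Definition intl (R : (nat -> UP K) -> Prop) := exists D : nat -> (nat -> K) -> Prop, forall f : nat -> nat -> K,
    R (fun k => cls (f k)) <-> ae (fun i => D i (fun k => f k i)).

Lemma intl_saturation R : (forall n, intl (R n)) ->
  (forall n, exists y, forall k, (k < n)%N -> R k y) -> exists y, forall k, R k y.
move=> iR fin; have [D hD] := choice iR.
have [|n|y] := @saturation (fun=> nat -> K) D.
- by move=> i; apply: inhabits (0).
- have [y hy] := fin n; have [f] := choice (fun k => cls_surj (y k)).
  exists (fun i k => f k i) => k kn; apply/hD.
  have -> : (fun k => cls (f k)) = y by apply: funext => j.
  exact: hy.
- by exists (fun k => cls (fun i => y i k)) => k; apply/hD.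
Qed.

Lemma intl_var k : int_term (fun y => y k).
by exists (fun i v => v k). Qed.
Lemma intl_cst c : int_term (fun=> c).
by have [f ->] := cls_surj c; exists (fun i _ => f i). Qed.
Lemma intlB s t : int_term s -> int_term t -> int_term (fun y => s y - t y).
by move=> [s' hs] [t' ht]; exists (fun i v => s' i v - t' i v) => f; rewrite hs ht -clsB.
Qed.
Lemma intlM s t : int_term s -> int_term t -> int_term (fun y => s y * t y).
by move=> [s' hs] [t' ht]; exists (fun i v => s' i v * t' i v) => f; rewrite hs ht -clsM.
Qed.

Lemma intl_horner (P : {poly UP K}) t : int_term t -> int_term (fun y => P.[t y]).
move=> [t' ht]; have [Q [sQ ->]] := clsP_surj P.
by exists (fun i v => (Q i).[t' i v]) => f; rewrite ht clsP_horner.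
Qed.

Lemma intl_eq s t : int_term s -> int_term t -> intl (fun y => s y = t y).
by move=> [s' hs] [t' ht]; exists (fun i v => s' i v = t' i v) => f; rewrite hs ht; exact: cls_eq. Qed.

Lemma intl_rveq O s t : int_term s -> int_term t -> intl (fun y => rveq (upO O) (s y) (t y)).
by move=> [s' hs] [t' ht]; exists (fun i v => rveq O (s' i v) (t' i v)) => f; rewrite hs ht; exact: up_rveq. Qed.

Lemma intl_mem N t : int_term t -> intl (fun y => t y \in upF N).
by move=> [t' ht]; exists (fun i v => t' i v \in N i) => f; rewrite ht; exact: upFP. Qed.
Lemma intl_not R : intl R -> intl (fun y => ~ R y).
by move=> [D hD]; exists (fun i v => ~ D i v) => f; rewrite hD ae_not_iff. Qed.

Lemma intl_true P : intl (fun=> P).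
have [] := pselect P; first by exists (fun _ _ => True) => f; split=> // _; apply: aeT.
by exists (fun _ _ => False) => f; split=> // h; have [] := ae_ex h.
Qed.

Lemma intl_lfree N n (u : 'I_n -> (nat -> UP K) -> UP K) :
  (forall k, int_term (u k)) -> intl (fun y => lfree (upF N) (fun k => u k y)).
move=> /choice[u' hu]; exists (fun i v => lfree (N i) (fun k => u' k i v)) => f.
rewrite -(up_lfree).
by have -> : (fun k => u k (fun j => cls (f j))) = (fun k => cls (fun i => u' k i (fun j => f j i))) by apply: funext.
Qed.

Lemma intl_span N n (u : 'I_n -> (nat -> UP K) -> UP K) t : (forall k, int_term (u k)) -> int_term t ->
  intl (fun y => spans (upF N) (fun k => u k y) (t y)).
move=> /choice[u' hu] [t' ht]; exists (fun i v => spans (N i) (fun k => u' k i v) (t' i v)) => f.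
rewrite -(up_spans) ht.
by have -> : (fun k => u k (fun j => cls (f j))) = (fun k => cls (fun i => u' k i (fun j => f j i))) by apply: funext.
Qed.

Variables (p : nat) (pE : p \in [pchar K]).

Lemma ppow_upF N x : (x \in ppow (up_pchar pE) (upF N)) = (x \in upF (fun i => ppow pE (N i))).
apply/idP/idP => [/ppowP[y /upF_rep[f [fN ->]] ->]|/upF_rep[f [fN ->]]].
  by rewrite -clsX; apply/upFP/aeT => i; apply/ppowP; exists (f i).
have /choice[g hg] : forall i, exists z, z \in N i /\ f i = z ^+ p by (move=> i; have /ppowP[y] := fN i; exists y).
apply/ppowP; exists (cls g); first by apply/upFP/aeT => i; have [] := hg i.
by rewrite -clsX; apply/cls_eq/aeT => i; have [] := hg i.
Qed.

Lemma lfree_eq E (N N' : subfield E) n (u : 'I_n -> E) : N =i N' -> lfree N u <-> lfree N' u.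
by move=> e; split; apply: lfree_sub => x; rewrite e. Qed.
Lemma spans_eq E (N N' : subfield E) n (u : 'I_n -> E) x : N =i N' -> spans N u x <-> spans N' u x.
by move=> e; split; apply: spans_sub => z; rewrite e. Qed.
Lemma intl_iff R R' : (forall y, R y <-> R' y) -> intl R -> intl R'.
by move=> h [D hD]; exists D => f; rewrite -h. Qed.

Lemma intl_plfree N n (u : 'I_n -> (nat -> UP K) -> UP K) : (forall k, int_term (u k)) ->
  intl (fun y => lfree (ppow (up_pchar pE) (upF N)) (fun k => u k y)).
move=> hu; apply: intl_iff (intl_lfree (fun i => ppow pE (N i)) hu) => y.
by apply: lfree_eq => x; rewrite ppow_upF.
Qed.

Lemma intl_pspan N n (u : 'I_n -> (nat -> UP K) -> UP K) t : (forall k, int_term (u k)) -> int_term t ->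
  intl (fun y => spans (ppow (up_pchar pE) (upF N)) (fun k => u k y) (t y)).
move=> hu ht; apply: intl_iff (intl_span (fun i => ppow pE (N i)) hu ht) => y.
by apply: spans_eq => x; rewrite ppow_upF.
Qed.
End Internal.

(** * Positions of the back-and-forth game *)

Section PisoOps.
Variables (E : closedF) (O : valring E) (N1 N2 : subfield E).
Variables (G : E -> E -> Prop) (hG : piso O N1 N2 G).

Lemma pisoM x y x' y' : G x y -> G x' y' -> G (x * x') (y * y').
by have [[_ _ GM _] _] := hG; apply: GM. Qed.
Lemma pisoX x y m : G x y -> G (x ^+ m) (y ^+ m).
move=> h; elim: m => [|m IH]; last by rewrite !exprS; apply: pisoM.
by have [[G1]] := hG.
Qed.
Lemma piso0 : G 0 0.
by have [[G1 GB _ _] _] := hG; rewrite -(subrr 1); apply: GB. Qed.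
Lemma pisoB x y x' y' : G x y -> G x' y' -> G (x - x') (y - y').
by have [[_ GB _ _] _] := hG; apply: GB. Qed.

Lemma pisoD x y x' y' : G x y -> G x' y' -> G (x + x') (y + y').
move=> h h'; rewrite -[x']opprK -[y']opprK; apply: pisoB => //.
by rewrite -(sub0r) -(sub0r y'); apply: pisoB => //; apply: piso0.
Qed.

Lemma piso_sum (I : finType) (F F' : I -> E) : (forall i, G (F i) (F' i)) -> G (\sum_i F i) (\sum_i F' i).
by move=> h; elim/big_rec2: _ => [|i a b _]; [apply: piso0|apply: pisoD]. Qed.
End PisoOps.

Section Positions.
Variables (E : closedF) (O : valring E) (p : nat) (pE : p \in [pchar E]).

Let pp : prime p. Proof. exact: pcharf_prime pE. Qed.

Definition conv (G : E -> E -> Prop) (x y : E) : Prop := G y x.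

Lemma piso_conv N1 N2 G : piso O N1 N2 G -> piso O N2 N1 (conv G).
move=> [[G1 GB GM GN] GV]; split; last by move=> x y; apply: GV.
split=> //; [by move=> *; apply: GB | by move=> *; apply: GM|].
by move=> x y /GN[? ? h]; split=> //; apply: rveq_sym.
Qed.

Variables N1 N2 : subfield E.

(** Separability of the two fields over domain and range lets [p]-independence inside the domain
    pass from one field to the other. *)
Definition pos (G : E -> E -> Prop) := [/\ piso O N1 N2 G, ctbl (fun xy => G xy.1 xy.2), sep_ext pE (dom G) N1
    & sep_ext pE (dom (conv G)) N2].

(** Either [N2] always offers an element that is [p]-independent of finitely many given ones, or the
    domain already [p]-spans [N1] and such an element is never asked for. *)
Definition pdeg_ok (G : E -> E -> Prop) : Prop := (forall n (b : 'I_n -> E), exists2 z, z \in N2 & ~ spans (ppow pE N2) b z) \/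
  exists n (b : 'I_n -> E), (forall k, dom G (b k)) /\ forall x, x \in N1 -> spans (ppow pE N1) b x.

Lemma pdeg_ok_sub G G' : sub_piso G G' -> pdeg_ok G -> pdeg_ok G'.
move=> GG' [h|[n [b [bG hb]]]]; [by left|right; exists n, b; split=> // k].
by have [y] := bG k; exists y; apply: GG'.
Qed.

Lemma row_free_map (A : fieldType) (i : {rmorphism A -> E}) n d (h : 'M[A]_(n, d)) (c : 'I_n -> E) :
  row_free h -> (forall j, \sum_k c k * i (h k j) = 0) -> forall k, c k = 0.
move=> fh hc k; have fi : row_free (map_mx i h) by rewrite /row_free mxrank_map.
have /(row_free_inj fi) : (\row_k c k) *m map_mx i h = 0 *m map_mx i h.
  rewrite mul0mx; apply/rowP => j; rewrite !mxE -[RHS](hc j).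
  by apply: eq_bigr => l _; rewrite !mxE.
by move/rowP/(_ k); rewrite !mxE.
Qed.

(** Freeness of [u] forces the coefficient matrix, which lives in the common domain [A], to have
    independent rows; its rank is the same after either embedding. *)
Lemma lfree_transfer G n d u u' (h h' : 'I_n -> 'I_d -> E) (e e' : 'I_d -> E) :
  piso O N1 N2 G -> (forall k j, G (h k j) (h' k j)) ->
  (forall k, u k = \sum_j h k j ^+ p * e j) -> (forall k, u' k = \sum_j h' k j ^+ p * e' j) ->
  lfree (ppow pE N2) e' -> lfree (ppow pE N1) u -> lfree (ppow pE N2) u'.
move=> hG Gh eu eu' fe fu; have [A [i1 [i2 [Gi onto]]]] := piso_rmorphism hG.
have [[_ _ _ GN] _] := hG.
have /choice[m hm] : forall kj : 'I_n * 'I_d, exists a, h kj.1 kj.2 = i1 a /\ h' kj.1 kj.2 = i2 a by (move=> kj; apply: onto).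
pose M : 'M[A]_(n, d) := \matrix_(k, j) m (k, j).
have p_sum (I : finType) (F : I -> E) : (\sum_i F i) ^+ p = \sum_i F i ^+ p by rewrite -(pFrobenius_autE) rmorph_sum.
have p_eq0 (x : E) : x ^+ p = 0 -> x = 0 by (move/eqP; rewrite expf_eq0 => /andP[_ /eqP]).
have fM : row_free M.
  rewrite -kermx_eq0; apply/eqP/row_matrixP => r; rewrite row0.
  set c := row r _; have cM : c *m M = 0 by apply/sub_kermxP; apply: row_sub.
  apply/rowP => k; rewrite [RHS]mxE; apply: (fmorph_inj i1); rewrite rmorph0; apply: p_eq0.
  move: k; apply: (fu).
    move=> k; apply/ppowP; exists (i1 (c 0 k)) => //; by have [] := GN _ _ (Gi (c 0 k)).
  transitivity (\sum_j i1 ((c *m M) 0 j) ^+ p * e j); last first.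
    by rewrite cM big1 // => j _; rewrite mxE rmorph0 expr0n gtn_eqF ?prime_gt0 // mul0r.
  under [RHS]eq_bigr => j do rewrite mxE rmorph_sum p_sum mulr_suml.
  rewrite exchange_big; apply: eq_bigr => k _; rewrite eu mulr_sumr; apply: eq_bigr => j.
  have -> : h k j = i1 (M k j) by rewrite mxE; have [] := hm (k, j).
  by rewrite rmorphM exprMn mulrA.
move=> z zN z0.
have /choice[c hc] : forall k, exists c, c \in N2 /\ z k = c ^+ p by (move=> k; have /ppowP[c] := zN k; exists c).
have c0 : forall k, c k = 0.
  apply: (row_free_map fM) => j; apply: p_eq0.
  move: j; apply: (fe).
    move=> j; apply/ppowP; exists (\sum_k c k * i2 (M k j)) => //.
    apply: rpred_sum => k _; rewrite rpredM //; first by have [] := hc k.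
    by have [] := GN _ _ (Gi (M k j)).
  rewrite -[RHS]z0; under eq_bigr => j do rewrite p_sum mulr_suml.
  rewrite exchange_big; apply: eq_bigr => k _; rewrite eu' mulr_sumr; apply: eq_bigr => j.
  by rewrite mxE exprMn; have [_ ->] := hc k; have [_ ->] := hm (k, j); rewrite mulrA.
by move=> k; have [_ ->] := hc k; rewrite c0 expr0n gtn_eqF ?prime_gt0.
Qed.

Lemma pos_lfree G n (u u' : 'I_n -> E) : pos G -> (forall k, G (u k) (u' k)) -> lfree (ppow pE N1) u -> lfree (ppow pE N2) u'.
move=> [hG _ _ sep2] Gu; have [|d [e' [eG fe he]]] := sep2 _ u'; first by move=> k; exists (u k).
have /choice[e {}eG] : forall j, exists x, G x (e' j) by [].
have /choice[g' {}he] := he.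
have /choice[g hg] : forall kj : 'I_n * 'I_d, exists x, G x (g' kj.1 kj.2) by (move=> kj; have [h] := he kj.1; have [x] := h kj.2; exists x).
apply: (lfree_transfer (h := fun k j => g (k, j)) hG _ _ _ fe) => [j|k|k].
- by [].
- apply: (piso_inj hG (Gu k)); have [_ ->] := he k.
  apply: (piso_sum hG) => j; apply: (pisoM hG) => //; apply: (pisoX hG); exact: (hg).
- by have [] := he k.
Qed.
End Positions.

Section Adjunctions.
Variables (E : closedF) (O : valring E) (p : nat) (pE : p \in [pchar E]).
Variables (N1 N2 : subfield E) (G : E -> E -> Prop) (hG : piso O N1 N2 G).

Definition generic (x : E) : Prop := ~ alg_over (pdom hG) x.

Lemma poly_enum (A : fieldType) (i1 i2 : {rmorphism A -> E}) : ctbl (fun xy => G xy.1 xy.2) -> (forall a, G (i1 a) (i2 a)) ->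
  exists P : nat -> {poly A}, forall Q, exists n, P n = Q.
move=> [s hs] Gi; pose e n : A := if s n is Some xy then
  if pselect (exists a, xy.1 = i1 a) is left h then sval (cid h) else 0 else 0.
have he a : exists n, e n = a.
  have [n hn] := hs (i1 a, i2 a) (Gi a); exists n; rewrite /e hn.
  case: pselect => [h|[]]; last by exists a.
  by case: cid => b /= /fmorph_inj.
exists (fun n => Poly (map e (odflt [::] (unpickle n)))) => Q.
have [f hf] := choice he; exists (pickle (map f Q)); rewrite pickleK -map_comp.
by rewrite (_ : map _ Q = Q) ?polyseqK //; rewrite -[RHS]map_id; apply: eq_map => a; apply: hf.
Qed.

Lemma adj_piso_countable (A : fieldType) (i1 i2 : {rmorphism A -> E}) s t :
  ctbl (fun xy => G xy.1 xy.2) -> (forall a, G (i1 a) (i2 a)) -> ctbl (fun xy => adj_piso i1 i2 s t xy.1 xy.2).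
move=> cG Gi; have [P hP] := poly_enum cG Gi.
apply: (@countable_image (nat * nat)%type _ (fun mn => ((map_poly i1 (P mn.1)).[s] / (map_poly i1 (P mn.2)).[s],
   (map_poly i2 (P mn.1)).[t] / (map_poly i2 (P mn.2)).[t]))).
move=> [x y] /= [S [T [_ -> ->]]]; have [m <-] := hP S; have [n <-] := hP T.
by exists (m, n).
Qed.

Lemma polyOver_pdom (A : fieldType) (i1 i2 : {rmorphism A -> E}) P : (forall x y, G x y -> exists a, x = i1 a /\ y = i2 a) ->
  P \over (pdom hG) -> exists Q, P = map_poly i1 Q.
move=> onto AP.
have /choice[f hf] : forall k, exists a, P`_k = i1 a by (move=> k; have /pdomP[y /onto[a [ea]]] := polyOverP AP k; exists a).
exists (\poly_(k < size P) f k); apply/polyP => k; rewrite coef_map coef_poly.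
by case: ltnP => [_|h]; [apply: hf|rewrite nth_default //; apply/esym/(rmorph0)].
Qed.

Lemma map_polyOver_pdom (A : fieldType) (i1 i2 : {rmorphism A -> E}) Q :
  (forall a, G (i1 a) (i2 a)) -> map_poly i1 Q \over (pdom hG).
by move=> Gi; apply/polyOverP => k; rewrite coef_map; apply/pdomP; exists (i2 Q`_k); apply: Gi. Qed.

Lemma dom_adjoin (A : fieldType) (i1 i2 : {rmorphism A -> E}) s t x :
  (forall a, G (i1 a) (i2 a)) -> (forall x y, G x y -> exists a, x = i1 a /\ y = i2 a) ->
  dom (adj_piso i1 i2 s t) x <-> fracs (pdom hG) s x.
move=> Gi onto; split=> [[y [P [Q [Q0 -> _]]]]|[P [Q [AP AQ Q0 ->]]]].
  exists (map_poly i1 P), (map_poly i1 Q); split=> //; exact: map_polyOver_pdom.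
have [P' eP] := polyOver_pdom onto AP; have [Q' eQ] := polyOver_pdom onto AQ.
exists ((map_poly i2 P').[t] / (map_poly i2 Q').[t]), P', Q'.
by rewrite -eQ -eP.
Qed.
End Adjunctions.

(** * The extension step of the game *)

Section Game.
Variables (K : closedF) (O : valring K) (p : nat) (pK : p \in [pchar K]).
Variables M1 M2 : nat -> subfield K.
Hypothesis rvM : forall i x, x \in M1 i -> exists2 y, y \in M2 i & rveq O x y.
Notation E := (UP K).
Notation V := (upO O).
Notation pE := (up_pchar pK).
Notation N1 := (upF M1).
Notation N2 := (upF M2).
Hypotheses (sg1 : SG V p N1) (sg2 : SG V p N2).
Hypothesis small2 : exists2 pi, pi \in N2 & pi != 0 /\ pi <_[V] 1.

Let pp : prime p. Proof. exact: pcharf_prime pK. Qed.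

Let rv12 x : x \in N1 -> exists2 y, y \in N2 & rveq V x y.
move=> /upF_rep[f [fN ->]].
have /choice[g hg] : forall i, exists y, y \in M2 i /\ rveq O (f i) y by (move=> i; have [y] := rvM (fN i); exists y).
exists (cls g); first by apply/upFP/aeT => i; have [] := hg i.
by apply/up_rveq/aeT => i; have [] := hg i.
Qed.
Notation pos := (pos V pE N1 N2).
Notation P2 := (ppow pE N2).
Notation P1 := (ppow pE N1).
Implicit Type G : E -> E -> Prop.

Lemma intl_and (R R' : (nat -> E) -> Prop) : intl R -> intl R' -> intl (fun y => R y /\ R' y).
move=> [D hD] [D' hD']; exists (fun i v => D i v /\ D' i v) => f; rewrite hD hD'.
split=> [[]|h]; first exact: ae_and.
by split; apply: ae_imp h => i [].
Qed.

(** The image has to satisfy countably many conditions; [nonzero_transfer] meets finitely many of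
    them, and saturation all. *)
Lemma transc_step G (A : fieldType) (i1 i2 : {rmorphism A -> E}) x d (b : forall n, 'I_(d n) -> E) :
  piso V N1 N2 G -> ctbl (fun xy => G xy.1 xy.2) -> (forall a, G (i1 a) (i2 a)) -> x \in N1 ->
  (forall P, P != 0 -> (map_poly i1 P).[x] != 0) -> (forall n, exists2 z, z \in N2 & ~ spans (ppow pE N2) (b n) z) ->
  (forall m n z, (m <= n)%N -> spans (ppow pE N2) (b m) z -> spans (ppow pE N2) (b n) z) ->
  exists y, [/\ y \in N2, ext_to V i1 i2 x y & forall n, ~ spans (ppow pE N2) (b n) y].
move=> hG cG Gi xN trx hb bmono; have [P hP] := poly_enum cG Gi.
have [[_ _ _ GN]] := hG.
pose R n y := y 0%N \in N2 /\ (rveq V (map_poly i1 (P n)).[x] (map_poly i2 (P n)).[y 0%N] /\ ~ spans (ppow pE N2) (b n) (y 0%N)).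
have [|n|y hy] := @intl_saturation K R.
- move=> n; apply: intl_and; first by apply: intl_mem; apply: intl_var.
  apply: intl_and.
    by apply: intl_rveq; [apply: intl_cst|apply: intl_horner; apply: intl_var].
  apply: intl_not; apply: intl_pspan; last exact: intl_var.
  by move=> k; apply: intl_cst.
- have [z0 zN zb] := hb n; have [pi piN [pi0 pi1]] := small2.
  have A1 a : i1 a \in N1 by have [] := GN _ _ (Gi a).
  have A2 a : i2 a \in N2 by have [] := GN _ _ (Gi a).
  have A12 a : rveq V (i1 a) (i2 a) by have [] := GN _ _ (Gi a).
  have Px0 Q : Q \in [seq P k | k <- iota 0 n & P k != 0] -> (map_poly i1 Q).[x] != 0.
    by move=> /mapP[k]; rewrite mem_filter => /andP[k0 _] ->; apply: trx.
  have [y yN [yb hy]] := nonzero_transfer sg1 sg2 rv12 A1 A2 A12 piN pi0 pi1 zN zb xN Px0.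
  exists (fun=> y) => k kn; split=> //; split; last by move/(bmono _ _ _ (ltnW kn)).
  have [->|k0] := eqVneq (P k) 0; first by rewrite !rmorph0 !horner0 rveqxx.
  by apply: hy; apply: map_f; rewrite mem_filter k0 mem_iota.
exists (y 0%N); split; [by have [] := hy 0%N| |by move=> n; have [_ []] := hy n].
by move=> Q; have [n <-] := hP Q; have [_ []] := hy n.
Qed.

Lemma generic_i1 G (hG : piso V N1 N2 G) (A : fieldType) (i1 i2 : {rmorphism A -> E}) x :
  (forall a, G (i1 a) (i2 a)) -> generic hG x -> forall P : {poly A}, P != 0 -> (map_poly i1 P).[x] != 0.
move=> Gi gx P P0; apply/negP => Px; apply: gx; exists (map_poly i1 P); split=> //.
  apply: (map_polyOver_pdom hG _ Gi).
by rewrite map_poly_eq0.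
Qed.

Lemma generic_extension G (hG : piso V N1 N2 G) x : ctbl (fun xy => G xy.1 xy.2) ->
  x \in N1 -> generic hG x -> exists G', [/\ piso V N1 N2 G', sub_piso G G', ctbl (fun xy => G' xy.1 xy.2) & dom G' x].
move=> cG xN gx; have [A [i1 [i2 [Gi onto]]]] := piso_rmorphism hG.
have [||y [yN ext]] := @transc_step G A i1 i2 x (fun=> 0%N) (fun => 0) hG cG Gi xN (generic_i1 Gi gx) => //.
  exists 1; first exact: rpred1.
  by move=> [a [_]]; rewrite big_ord0 => /eqP; rewrite oner_eq0.
have [[_ _ _ GN] _] := hG.
have [h3] := @adj_piso_ok _ V N1 N2 A i1 i2 (fun a => let: And3 h _ _ := GN _ _ (Gi a) in h)
  (fun a => let: And3 _ h _ := GN _ _ (Gi a) in h) x y xN yN ext.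
exists (adj_piso i1 i2 x y); split=> //.
- by move=> a b /onto[c [-> ->]].
- exact: adj_piso_countable Gi.
- by exists y.
Qed.

Lemma separable_extension G (hG : piso V N1 N2 G) x : ctbl (fun xy => G xy.1 xy.2) ->
  x \in N1 -> sepalg (pdom hG) x -> exists G', [/\ piso V N1 N2 G', sub_piso G G', ctbl (fun xy => G' xy.1 xy.2) & dom G' x].
move=> cG xN sx; have [A [i1 [i2 [Gi onto]]]] := piso_rmorphism hG.
have [[_ _ _ GN] _] := hG.
have A1 a : i1 a \in N1 by have [] := GN _ _ (Gi a).
have A2 a : i2 a \in N2 by have [] := GN _ _ (Gi a).
have A12 a : rveq V (i1 a) (i2 a) by have [] := GN _ _ (Gi a).
have [|y yN ext] := @separable_transfer _ _ _ pE N1 N2 sg1 sg2 rv12 A i1 i2 A1 A2 A12 x xN.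
  by apply: sepalg_sub sx => z /pdomP[t /onto[a [-> _]]]; apply: imA_i1.
have [h3] := adj_piso_ok A1 A2 xN yN ext.
exists (adj_piso i1 i2 x y); split=> //.
- by move=> a b /onto[c [-> ->]].
- exact: adj_piso_countable Gi.
- by exists y.
Qed.

Lemma piso_restrict G (B : subfield E) : piso V N1 N2 G -> ctbl (fun xy => G xy.1 xy.2) -> (forall x, x \in B -> dom G x) ->
  piso V N1 N2 (fun x y => G x y /\ x \in B) /\ ctbl (fun xy => G xy.1 xy.2 /\ xy.1 \in B).
move=> [[G1 GB GM GN] GV] cG BG; split; last by apply: countable_sub cG => ? [].
split; last by move=> x y [/GV h xB]; rewrite rpredV.
split.
- by rewrite rpred1.
- by move=> x y x' y' [h xB] [h' xB']; split; [apply: GB|apply: rpredB].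
- by move=> x y x' y' [h xB] [h' xB']; split; [apply: GM|apply: rpredM].
- by move=> x y [/GN].
Qed.

(* MacLane's theorem orders the generators so that each is generic or separable
   over the preceding ones. *)
Lemma finite_extension G n (u : 'I_n -> E) : piso V N1 N2 G -> ctbl (fun xy => G xy.1 xy.2) -> sep_ext pE (dom G) N1 ->
  (forall k, u k \in N1) -> exists G', [/\ piso V N1 N2 G', sub_piso G G',
    ctbl (fun xy => G' xy.1 xy.2) & forall k, dom G' (u k)].
move=> hG cG sG; elim: n u => [|n IH] u uN; first by exists G; split=> // -[].
have AN : {subset pdom hG <= N1} by (move=> x /pdomP[y]; have [[_ _ _ GN] _] := hG; move=> /GN[]).
have sA : sep_ext pE (fun x => x \in pdom hG) N1 by (have -> : (fun x => is_true (x \in pdom hG)) = dom G by apply: funext => x; apply/propext/pdomP).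
have [alg|gx] := pselect (alg_over (gen (pdom hG) (fun i => u (lift ord0 i))) (u ord0)).
  have [k sk] := maclane AN sA uN alg.
  have [G1 [hG1 GG1 cG1 uG1]] := IH (fun i => u (lift k i)) (fun => uN _).
  have [|G2 [hG2 GG2]] := separable_extension (hG := hG1) cG1 (uN k).
    apply: sepalg_sub sk; apply: gen_min => [x /pdomP[y /GG1 h]|i]; apply/pdomP => //.
    by exists y.
  exists G2; split=> // [x y /GG1/GG2 //|i]; have [j ->|->//] := unliftP k i.
  by have [y /GG2] := uG1 j; exists y.
have [G1 [hG1 GG1 cG1 uG1]] := IH (fun i => u (lift ord0 i)) (fun => uN _).
set B := gen (pdom hG) _ in gx.
have BG1 : forall x, x \in B -> dom G1 x.
  move=> x xB; apply/(pdomP hG1); move: x xB; apply: gen_min => [x /pdomP[y /GG1 h]|i]; apply/pdomP => //.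
  by exists y.
have [hG2 cG2] := piso_restrict hG1 cG1 BG1.
have [|G3 [hG3 GG3]] := generic_extension (hG := hG2) cG2 (uN ord0).
  move=> [P [BP P0 Pu]]; apply: gx; exists P; split=> //.
  by apply/polyOverP => i; have /pdomP[y []] := polyOverP BP i.
exists G3; split=> // [x y h|i].
  by apply: GG3; split; [apply: GG1|apply: gen_base; apply/pdomP; exists y].
have [j ->|->//] := unliftP ord0 i; have [y] := uG1 j; exists y; apply: GG3; split=> //.
exact: (gen_id).
Qed.

Lemma piso_sub_dom G (hG : piso V N1 N2 G) : {subset pdom hG <= N1}.
by move=> x /pdomP[y]; have [[_ _ _ GN] _] := hG; move=> /GN[]. Qed.

Lemma sep_ext_pdom G (hG : piso V N1 N2 G) : sep_ext pE (dom G) N1 -> sep_ext pE (fun x => x \in pdom hG) N1.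
by have -> : (fun x => is_true (x \in pdom hG)) = dom G by apply: funext => x; apply/propext/pdomP.
Qed.

(** An element algebraic over the domain would be separable over it by MacLane's criterion for one
    generator, and a separable element whose [p]-th power lies in the compositum is itself in the
    compositum. *)
Lemma cmps_generic G (hG : piso V N1 N2 G) w : sep_ext pE (dom G) N1 -> w \in N1 -> ~ cmps pE (pdom hG) N1 w -> generic hG w.
move=> /(@sep_ext_pdom G hG) sG wN wc [P [AP P0 Pw]]; apply: wc.
have AN := @piso_sub_dom G hG.
have [||k sk] := @maclane _ (pdom hG) p pE N1 AN 0 (fun=> w) sG.
- by [].
- by exists P; split=> //; apply/polyOverP => i; apply/gen_base/polyOverP.
have : sepalg (NA pE AN) w.
  apply: sepalg_sub sk; apply: gen_min => [x xA|[]//]; exact/NAP/cmps_base.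
move=> sw; apply/NAP/(sepalg_pth_power pE sw) => //; exact/NAP/cmps_pth.
Qed.

(** The image of [w] is chosen outside the compositum of the range with the [p]-th powers of [N2],
    so that [sep_ext_adjoin] applies on both sides. *)
Lemma pos_adjoin G w : pos G -> (forall n (b : 'I_n -> E), exists2 z, z \in N2 & ~ spans P2 b z) ->
  w \in N1 -> (forall hG : piso V N1 N2 G, ~ cmps pE (pdom hG) N1 w) -> exists G', [/\ pos G', sub_piso G G' & dom G' w].
move=> [hG cG s1 s2] inf2 wN /(_ hG) wc.
have gw := cmps_generic s1 wN wc.
have [A [i1 [i2 [Gi onto]]]] := piso_rmorphism hG.
have hGc := piso_conv hG.
have [[G1 GB GM GN] _] := hG.
have [s [sG hs]] : exists s : nat -> E, (forall n, dom (conv G) (s n)) /\ forall y, dom (conv G) y -> exists n, s n = y.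
  apply: (@countable_enum _ 1); last by exists 1.
  have [s hs] := cG; exists (fun n => omap snd (s n)) => y [x h].
  by have [n e] := hs (x, y) h; exists n; rewrite e.
have [|m n z mn|y [yN ext yb]] := @transc_step G A i1 i2 w id (fun n i => s i) hG cG Gi wN (generic_i1 Gi gw).
- by [].
- move=> h; apply: spans_trans h _ => i.
  exact: (spans_id P2 (fun i : 'I_n => s i) (widen_ord mn i)).
have A1 a : i1 a \in N1 by have [] := GN _ _ (Gi a).
have A2 a : i2 a \in N2 by have [] := GN _ _ (Gi a).
have [h3] := adj_piso_ok A1 A2 wN yN ext.
exists (adj_piso i1 i2 w y); split; last by exists y.
  split=> //; first exact: adj_piso_countable Gi.
    have -> : dom (adj_piso i1 i2 w y) = fracs (pdom hG) w by (apply: funext => x; apply/propext/(dom_adjoin)).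
    by apply: sep_ext_adjoin => //; [apply: piso_sub_dom|apply: sep_ext_pdom].
  have -> : dom (conv (adj_piso i1 i2 w y)) = fracs (pdom hGc) y.
    apply: funext => x; apply/propext; rewrite -(dom_adjoin hGc y w (i1 := i2) (i2 := i1)) //.
      by split=> -[z [P [Q [Q0 e1 e2]]]]; exists z, P, Q; move: Q0; rewrite (rveq_eq0 (ext Q)).
    by move=> a b /onto[c [-> ->]]; exists c.
  have AN2 : {subset pdom hGc <= N2} by move=> x /pdomP[z /GN[]].
  have sA2 : sep_ext pE (fun x => x \in pdom hGc) N2.
    by have -> : (fun x => is_true (x \in pdom hGc)) = dom (conv G) by apply: funext => x; apply/propext/pdomP.
  apply: sep_ext_adjoin => // -[n [a [aA ya]]].
  have /choice[k hk] : forall i, exists k, s k = a i by move=> i; apply: hs; apply/(pdomP hGc).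
  apply: (yb (\max_i k i).+1); apply: spans_trans ya _ => i; rewrite -hk.
  have ki : (k i < (\max_i k i).+1)%N by rewrite ltnS; apply: (leq_bigmax).
  exact: (spans_id P2 (fun i : 'I_(\max_i k i).+1 => s i) (Ordinal ki)).
by move=> a b /onto[c [-> ->]].
Qed.

Definition dependent G x := exists n (a : 'I_n -> E), (forall i, dom G (a i)) /\ spans P1 a x.

Lemma dependent_dom G x : dom G x -> dependent G x.
exists 1%N, (fun=> x); split=> //; apply: (spans_id _ (fun=> x) ord0). Qed.
Lemma dependent_sub G G' x : sub_piso G G' -> dependent G x -> dependent G' x.
move=> GG' [n [a [aG h]]]; exists n, a; split=> // i.
by have [y] := aG i; exists y; apply: GG'.
Qed.

Lemma pos_dependent G n (u : 'I_n -> E) : pos G -> pdeg_ok pE N1 N2 G -> (forall k, u k \in N1) ->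
  exists G', [/\ pos G', sub_piso G G' & forall k, dependent G' (u k)].
move=> pG okG uN.
suff /(_ n)[G' [pG' GG' hG']] : forall j, exists G', [/\ pos G', sub_piso G G' & forall k : 'I_n, (k < j)%N -> dependent G' (u k)].
  by exists G'; split=> // k; apply: hG'.
elim=> [|j [G1 [pG1 GG1 hG1]]]; first by exists G; split.
have [jn|nj] := ltnP j n; last first.
  by exists G1; split=> // k _; apply: hG1; apply: leq_trans.
suff [G2 [pG2 GG2]] : exists G2, [/\ pos G2, sub_piso G1 G2 & dependent G2 (u (Ordinal jn))].
  exists G2; split=> // [x y /GG1/GG2 //|k]; rewrite ltnS leq_eqVlt => /predU1P[kj|/hG1 hk].
    by have -> : k = Ordinal jn by apply: val_inj.
  exact: dependent_sub hk.
have [inf2|[m [b [bG span]]]] := pdeg_ok_sub GG1 okG; last first.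
  by exists G1; split=> //; exists m, b; split=> //; apply: span.
have [h|h] := pselect (dependent G1 (u (Ordinal jn))); first by exists G1; split.
have [|hG c|G2 []] := @pos_adjoin G1 (u (Ordinal jn)) pG1 inf2.
- by [].
- apply: h; have [m [a [ha]]] := c; exists m, a; split=> // i; exact/(pdomP hG).
by exists G2; split=> //; apply: dependent_dom.
Qed.

(** Once the [u k] are [p]-dependent on the domain, they are sums of terms [c ^+ p * e] with [e] a
    [p]-free family in the domain. Extending the isomorphism to the coefficients [c] gives images of
    the [u k] that keep [p]-freeness, although the fields need not be separable over the new
    domain. *)
Lemma finite_transfer G n (u : 'I_n -> E) : pos G -> pdeg_ok pE N1 N2 G -> (forall k, u k \in N1) ->
  exists G', [/\ piso V N1 N2 G', sub_piso G G', forall k, dom G' (u k)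
    & forall m f (v : 'I_m -> E), (forall k, G' (u (f k)) (v k)) -> lfree P1 (fun k => u (f k)) -> lfree P2 v].
move=> pG okG uN; have [G1 [pG1 GG1 hd]] := pos_dependent pG okG uN.
have [m hm] := choice hd; pose a k := sval (cid (hm k)).
have aG k i : dom G1 (a k i) by rewrite /a; case: cid => b [].
have ua k : spans P1 (a k) (u k) by rewrite /a; case: cid => b [].
have [hG1 cG1 s1] := pG1.
pose T : finType := {k : 'I_n & 'I_(m k)}.
have [d [e [eG fe he]]] := s1 _ (fun t : 'I_#|T| => a (tag (enum_val t)) (tagged (enum_val t))) (fun => aG _ _).
have {he} he k i : spans P1 e (a k i).
  have := he (enum_rank (Tagged (fun k => 'I_(m k)) i : T)); rewrite enum_rankK.
  move=> [g [gG ->]]; exists (fun j => g j ^+ p); split=> // j.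
  apply/ppowP; exists (g j) => //.
  have [[_ _ _ GN]] := hG1; by have [y /GN[]] := gG j.
have /choice[c {ua}hc] : forall k, exists c : 'I_d -> E, (forall j, c j \in N1) /\ u k = \sum_j c j ^+ p * e j.
  move=> k; have [z [zN ->]] := spans_trans (ua k) (he k).
  have /choice[c hc] : forall j, exists c, c \in N1 /\ z j = c ^+ p by (move=> j; have /ppowP[c] := zN j; exists c).
  exists c; split=> [j|]; first by have [] := hc j.
  by apply: eq_bigr => j _; have [_ ->] := hc j.
have [|G2 [hG2 GG2 cG2 cG]] := @finite_extension G1 _
  (fun t : 'I_#|{: 'I_n * 'I_d}| => c (enum_val t).1 (enum_val t).2) hG1 cG1 s1.
  by move=> t; have [] := hc (enum_val t).1.
have /choice[c' hc'] : forall kj : 'I_n * 'I_d, exists y, G2 (c kj.1 kj.2) y.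
  by move=> kj; have [y] := cG (enum_rank kj); rewrite enum_rankK; exists y.
have /choice[e' Ge] : forall j, exists y, G1 (e j) y by [].
have fe' := pos_lfree pG1 Ge fe.
have Gu k : G2 (u k) (\sum_j c' (k, j) ^+ p * e' j).
  have [_ ->] := hc k; apply: (piso_sum hG2) => j; apply: (pisoM hG2); last exact: GG2.
  by apply: (pisoX hG2); apply: (hc' (k, j)).
exists G2; split=> // [x y /GG1/GG2 //|k|l f v Gv].
  by exists (\sum_j c' (k, j) ^+ p * e' j).
apply: (lfree_transfer (e := e) hG2 _ _ _ fe').
- by move=> k j; apply: (hc' (f k, j)).
- by move=> k; have [] := hc (f k).
- by move=> k; apply: (piso_fun hG2).
Qed.

Lemma lfree_cast F (N : subfield F) n m (e : n = m) u : lfree N (fun i => u (cast_ord e i)) <-> lfree N u.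
case: m / e u => u; have -> // : (fun i => u (cast_ord erefl i)) = u.
by apply: funext => i; rewrite cast_ord_id.
Qed.

Lemma sep_witness (s : seq E) : exists r : seq E, (forall x, x \in s -> x \in N1) ->
  (forall x, x \in r -> x \in N1) /\ exists d (e : 'I_d -> E),
  [/\ forall j, e j \in r, lfree P1 e & forall i : 'I_(size s), exists g : 'I_d -> E,
    (forall j, g j \in r) /\ nth 0 s i = \sum_j g j ^+ p * e j].
have [sN|nsN] := pselect (forall x, x \in s -> x \in N1); last by exists [::] => /nsN.
have [d [e [fe se es]]] := spans_basis P1 (fun i : 'I_(size s) => nth 0 s i).
have P1N x : x \in P1 -> x \in N1 by move=> /ppowP[y yN ->]; rewrite rpredX.
have eN j : e j \in N1.
  have [a [aN ->]] := es j; apply: rpred_sum => i _; apply: rpredM; first exact: P1N.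
  by apply: sN; apply: mem_nth.
have /choice[g hg] : forall i : 'I_(size s), exists g : 'I_d -> E, (forall j, g j \in N1) /\ nth 0 s i = \sum_j g j ^+ p * e j.
  move=> i; have [z [zN ->]] := se i.
  have /choice[c hc] : forall j, exists c, c \in N1 /\ z j = c ^+ p by (move=> j; have /ppowP[c] := zN j; exists c).
  exists c; split=> [j|]; first by have [] := hc j.
  by apply: eq_bigr => j _; have [_ ->] := hc j.
exists ([seq e j | j <- enum 'I_d] ++ [seq g ij.1 ij.2 | ij <- enum {: 'I_(size s) * 'I_d}]) => _.
split.
  move=> x; rewrite mem_cat => /orP[/mapP[j _ ->] //|/mapP[ij _ ->]].
  by have [] := hg ij.1.
exists d, e; split=> // [j|i]; first by rewrite mem_cat map_f ?mem_enum.
exists (g i); split=> [j|]; last by have [] := hg i.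
by rewrite mem_cat orbC (map_f (fun ij => g ij.1 ij.2) (x := (i, j))) ?mem_enum.
Qed.

(** Close [dom G] and [x] under the field operations and under choosing, for each finite list, a
    [p]-free family together with the coefficients that express the list in it. *)
Lemma separable_hull G x : pos G -> x \in N1 -> exists d : nat -> E,
  [/\ forall n, d n \in N1, forall z, dom G z \/ z = x -> exists n, z = d n,
      sfclosed (fun z => exists n, z = d n) & sep_ext pE (fun z => exists n, z = d n) N1].
move=> [hG cG _ _] xN; have [[G1 _ _ GN]] := hG.
have [c [cN hc]] : exists c : nat -> E, (forall n, c n \in N1) /\ forall z, dom G z \/ z = x -> exists n, c n = z.
  have [||s [hs onto]] := @countable_enum E 1 (dom G).
  - have [s hs] := cG; exists (fun n => omap fst (s n)) => y [z h].
    by have [n e] := hs (y, z) h; exists n; rewrite e.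
  - by exists 1.
  exists (fun n => if n is m.+1 then s m else x); split=> [[|n] //|z [/onto[n <-]|->]].
  - by have [y /GN[]] := hs n.
  - by exists n.+1.
  - by exists 0%N.
have [r hr] := choice sep_witness.
pose f s := [:: 1, s`_0 - s`_1, s`_0 / s`_1 & r s].
have [|s sN i|d [dN cd fd]] := @countable_closure E 0 c (fun s i => (f s)`_i) (fun z => z \in N1) _ cN.
- exact: rpred0.
- have h z : z \in r s -> z \in N1.
    have [|hN _] := hr s; last exact: hN.
    by move=> t ts; rewrite -(nth_index 0 ts).
  case: i => [|[|[|i]]]; first exact: (rpred1).
  + exact: (rpredB).
  + exact: (rpredM (sN 0%N) (rpredVr (sN 1%N))).
  have [ir|ri] := ltnP i (size (r s)); first by apply: h; apply: mem_nth.
  by rewrite nth_default ?rpred0.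
have dE s i : exists m, (f [seq d k | k <- s])`_i = d m by [].
exists d; split=> //.
- by move=> z /hc[n <-].
- split; first exact: (dE [::] 0%N).
    by move=> _ _ [m ->] [n ->]; apply: (dE [:: m; n] 1%N).
  by move=> _ _ [m ->] [n ->]; apply: (dE [:: m; n] 2%N).
move=> n u /choice[k uk]; pose s := [seq d j | j <- [seq k i | i <- enum 'I_n]].
have rs z : z \in r s -> exists m, z = d m.
  have [m hm] := dE [seq k i | i <- enum 'I_n] (index z (r s)).+3.
  by exists m; rewrite -hm /= nth_index.
have sN z : z \in s -> z \in N1 by move=> /mapP[j _ ->].
have [_ [l [e [er fe he]]]] := hr s sN.
have ss : size s = n by rewrite 2!size_map size_enum_ord.
exists l, e; split=> // [j|i]; first exact: rs.
have [g [eg]] := he (cast_ord (esym ss) i).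
exists g; split=> [j|]; first exact: rs.
have si : s`_i = d (k i) by rewrite /s -map_comp (nth_map i) ?size_enum_ord // nth_ord_enum.
by rewrite uk -si.
Qed.

Lemma intl_imp (P : Prop) (R : (nat -> E) -> Prop) : (P -> intl R) -> intl (fun y => P -> R y).
have [h|h] := pselect P.
  by move=> /(_ h); apply: intl_iff => y; split=> // H; apply: H.
by move=> _; apply: intl_iff (intl_true _ True) => y.
Qed.

(** The whole countable hull of [x] is mapped at once. Every relation to be respected, [p]-freeness
    included, is an internal condition on the sequence of images, and any finite number of them is
    met by [finite_transfer]. *)
Lemma extension G x : pos G -> pdeg_ok pE N1 N2 G -> x \in N1 -> exists G', [/\ pos G', sub_piso G G' & dom G' x].
move=> pG okG xN; have [d [dN dG dcl dsep]] := separable_hull pG xN.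
have [hG cG _ _] := pG.
(* A code consists of three indices, used for membership, differences and products, and of a list,
   used for [p]-freeness. *)
pose C : Type := (nat * nat * nat * seq nat)%type.
pose R (c : C) (y : nat -> E) := let: (n, m, k, s) := c in (y n \in N2 /\ rveq V (d n) (y n)) /\
  ((forall b, G (d n) b -> y n = b) /\ ((d k = d n - d m -> y k = y n - y m) /\ ((d k = d n * d m -> y k = y n * y m) /\
  (lfree P1 (fun i : 'I_(size s) => d (nth 0%N s i)) -> lfree P2 (fun i : 'I_(size s) => y (nth 0%N s i)))))).
have iR c : intl (R c).
  case: c => [[[n m] k] s]; rewrite /R; have iv := @intl_var K.
  do ?apply: intl_and.
  - exact: intl_mem.
  - by apply: intl_rveq => //; apply: intl_cst.
  - have [[b hb]|nb] := pselect (exists b, G (d n) b); last first.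
      by apply: intl_iff (intl_true _ True) => y; split=> // _ b hb; case: nb; exists b.
    apply: intl_iff (intl_eq (iv n) (intl_cst b)) => y; split=> [-> b' hb'|h].
      exact: (piso_fun hG hb).
    exact: h.
  - by apply: intl_imp => _; apply: intl_eq => //; apply: intlB.
  - by apply: intl_imp => _; apply: intl_eq => //; apply: intlM.
  - by apply: intl_imp => _; apply: intl_plfree.
pose code j : C := odflt (0%N, 0%N, 0%N, [::]) (unpickle j).
have [|n|y hy] := @intl_saturation K (fun j => R (code j)).
- by [].
- pose bound (c : C) := let: (n, m, k, s) := c in (n + m + k + sumn s).+1.
  pose B := \sum_(j < n) bound (code j).
  have [G' [hG' GG' dG' lG']] := finite_transfer (u := fun i : 'I_B => d i) pG okG (fun i => dN i).
  pose y m := if pselect (exists z, G' (d m) z) is left h then sval (cid h) else 0.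
  have yE m z : G' (d m) z -> y m = z.
    rewrite /y => h; case: pselect => [h'|[]]; last by exists z.
    by case: cid => z' hz'; apply: (piso_fun hG' hz').
  have yG m : (m < B)%N -> G' (d m) (y m) by (move=> mB; have [z hz] := dG' (Ordinal mB); rewrite (yE _ _ hz)).
  have [[_ GB GM GN] _] := hG'.
  exists y => j jn; have : (bound (code j) <= B)%N by rewrite /B (bigD1 (Ordinal jn)) //= leq_addr.
  case: (code) => [[[m1 m2] m3] s] /= hB.
  have [lt1 [lt2 lt3]] : [/\ (m1 < B)%N, (m2 < B)%N & (m3 < B)%N] by split; lia.
  have sB i : (nth 0%N s i < B)%N.
    suff : (nth 0%N s i <= sumn s)%N by lia.
    elim: (s) i => [|a s' IH] [|i] //=; first exact: leq_addr.
    by apply: leq_trans (IH i) _; apply: leq_addl.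
  split; first by have [] := GN _ _ (yG _ lt1).
  split; first by move=> b /GG'/yE.
  split; first by move=> e; apply: yE; rewrite e; apply: GB; apply: yG.
  split; first by move=> e; apply: yE; rewrite e; apply: GM; apply: yG.
  by apply: (lG' _ (fun i => Ordinal (sB i))) => i; apply: yG.
have hR n m k s : R (n, m, k, s) y by have := hy (pickle (n, m, k, s)); rewrite /code pickleK.
pose G' a b := exists n, a = d n /\ b = y n.
pose D := sf_of dcl.
have DP z : z \in D <-> exists n, z = d n by apply: sf_ofE.
have yB n m k : d k = d n - d m -> y k = y n - y m by have [_ [_ [h]]] := hR n m k [::].
have yM n m k : d k = d n * d m -> y k = y n * y m by have [_ [_ [_ [h _]]]] := hR n m k [::].
have yN n : y n \in N2 /\ rveq V (d n) (y n) by have [] := hR n n n [::].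
have yl s : lfree P1 (fun i : 'I_(size s) => d (nth 0%N s i)) -> lfree P2 (fun i : 'I_(size s) => y (nth 0%N s i)).
  by have [_ [_ [_ [_ h]]]] := hR 0%N 0%N 0%N s.
have yG n b : G (d n) b -> y n = b by have [_ [h _]] := hR n n n [::]; apply: h.
have G1 : G 1 1 by have [[]] := hG.
have GG' : sub_piso G G'.
  move=> a b h; have [|n an] := dG a; first by left; exists b.
  by exists n; rewrite (yG n b) -an.
have G'1 := GG' _ _ G1.
have G'B a b a' b' : G' a b -> G' a' b' -> G' (a - a') (b - b').
  move=> [n [-> ->]] [m [-> ->]].
  have /DP[k] : d n - d m \in D by rewrite rpredB //; apply/DP; [exists n|exists m].
  by exists k; rewrite (yB n m k).
have G'M a b a' b' : G' a b -> G' a' b' -> G' (a * a') (b * b').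
  move=> [n [-> ->]] [m [-> ->]].
  have /DP[k] : d n * d m \in D by rewrite rpredM //; apply/DP; [exists n|exists m].
  by exists k; rewrite (yM n m k).
have hG' : piso V N1 N2 G'.
  split; first by split=> // a b [n [-> ->]]; have [] := yN n.
  move=> a b ab; have [a0|a0] := eqVneq a 0.
    have [n [ea eb]] := ab; have [_] := yN n; rewrite -ea -eb a0 rveq0l => /eqP ->.
    by rewrite !invr0 -(subrr 1); apply: G'B.
  have [n [eb]] := ab.
  have /DP[k ek] : a^-1 \in D by rewrite rpredV; apply/DP; exists n.
  have h : G' (a^-1) (y k) by exists k.
  have := G'M _ _ _ _ ab h; rewrite divff // => -[m [e1 e2]].
  have := yG m 1; rewrite -e1 -e2 => /(_ G1) => e3.
  have b0 : b != 0 by apply: contra_eqN e3 => /eqP ->; rewrite mul0r eq_sym oner_eq0.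
  by have -> : b^-1 = y k by rewrite -[b^-1]mulr1 -e3 mulKf.
have xD : exists n, x = d n by apply: dG; right.
exists G'; split=> //; last by have [n ->] := xD; exists (y n), n.
split=> //.
- by apply: (@countable_image) => -[a b] /= [n [-> ->]]; exists n.
- have -> // : dom G' = (fun z => exists n, z = d n) by (apply: funext => z; apply/propext; split=> [[b [n [-> _]]]|[n ->]]; [exists n|exists (y n), n]).
move=> n u hu; have /choice[k] : forall i, exists k, u i = y k.
  by move=> i; have [a [k [_ ->]]] := hu i; exists k.
have [l [e [eD fe he]]] := dsep _ (fun i => d (k i)) (fun i => ex_intro _ (k i) erefl).
have /choice[t] := eD.
exists l, (fun j => y (t j)); split.
- by move=> j; exists (d (t j)), (t j).
- have es : size [seq t j | j <- enum 'I_l] = l by rewrite size_map size_enum_ord.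
  have et (i : 'I_(size [seq t j | j <- enum 'I_l])) : nth 0%N [seq t j | j <- enum 'I_l] i = t (cast_ord es i).
    rewrite (nth_map (cast_ord es i)); last by rewrite size_enum_ord -[X in (_ < X)%N]es.
    by rewrite (nth_ord_enum (cast_ord es i) (cast_ord es i)).
  have := yl [seq t j | j <- enum 'I_l].
  have -> : (fun i : 'I_(size [seq t j | j <- enum 'I_l]) => y (nth 0%N [seq t j | j <- enum 'I_l] i)) = (fun i => (fun j => y (t j)) (cast_ord es i)).
    by apply: funext => i; rewrite et.
  have -> : (fun i : 'I_(size [seq t j | j <- enum 'I_l]) => d (nth 0%N [seq t j | j <- enum 'I_l] i)) = (fun i => e (cast_ord es i)).
    by apply: funext => i; rewrite et.
  by rewrite (lfree_cast) (lfree_cast P2 es (fun j => y (t j))); apply.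
move=> i; have [g [gD eg]] := he i; have /choice[r] := gD.
exists (fun j => y (r j)); split=> [j|]; first by exists (d (r j)), (r j).
apply: (piso_fun hG' (x := d (k i))); first by exists (k i).
rewrite eg; apply: (piso_sum hG') => j; apply: (pisoM hG').
  by apply: (pisoX hG'); exists (r j).
by exists (t j).
Qed.
End Game.

(** * Elementary equivalence of ultraproducts *)

Definition sub_struct (K : fieldType) (O : valring K) (N : subfield K) : structure unit :=
  @Structure unit (sfT N) 0 1 -%R +%R *%R (fun _ x => val x \in O).

Section Equivalence.
Variables (K : closedF) (O : valring K) (p : nat) (pK : p \in [pchar K]).
Notation E := (UP K).
Notation V := (upO O).
Notation pE := (up_pchar pK).

Definition nonarchimedean (N : subfield E) := exists2 pi, pi \in N & pi != 0 /\ pi <_[V] 1.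

Definition rv_sub (N N' : subfield K) := forall x, x \in N -> exists2 y, y \in N' & rveq O x y.

Lemma pos_conv (N1 N2 : subfield E) G : pos V pE N1 N2 G -> pos V pE N2 N1 (conv G).
move=> [h1 [s hs] h3 h4]; split=> //; first exact: piso_conv.
exists (fun n => omap (fun xy => (xy.2, xy.1)) (s n)) => -[x y] h.
by have [n e] := hs (y, x) h; exists n; rewrite e.
Qed.

Lemma piso_teval M1 M2 G (e1 : nat -> forall i, sfT (M1 i)) (e2 : nat -> forall i, sfT (M2 i)) t : piso V (upF M1) (upF M2) G ->
  (forall n, G (cls (fun i => val (e1 n i))) (cls (fun i => val (e2 n i)))) ->
  G (cls (fun i => val (teval (M := sub_struct O (M1 i)) (fun n => e1 n i) t)))
    (cls (fun i => val (teval (M := sub_struct O (M2 i)) (fun n => e2 n i) t))).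
move=> hG h; have [[G1 _ _ _] _] := hG; elim: t => //=.
- by have := piso0 hG; rewrite -!cls0.
- by move: G1; rewrite -!cls1.
- move=> t IH; have := pisoB hG (piso0 hG) IH; rewrite -!cls0 -!clsB.
  by congr G; congr cls; apply: funext => i; rewrite sub0r.
- by move=> t IH t' IH'; have := pisoD hG IH IH'; rewrite -!clsD.
- by move=> t IH t' IH'; have := pisoM hG IH IH'; rewrite -!clsM.
Qed.

Definition game_ok (M1 M2 : nat -> subfield K) := [/\ SG V p (upF M1), forall i, rv_sub (M1 i) (M2 i) & nonarchimedean (upF M1)].

Definition env (M : nat -> subfield K) (e : nat -> forall i, sfT (M i)) n (x : forall i, sfT (M i)) m :=
  if m == n then x else e m.

Lemma update_env M (e : nat -> forall i, sfT (M i)) n (x : forall i, sfT (M i)) i :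
  update (A := sub_struct O (M i)) (fun m => e m i) n (x i) = fun m => env e n x m i.
by apply: funext => m; rewrite /update /env; case: eqP. Qed.

Lemma upF_lift (M : nat -> subfield K) x : x \in upF M -> exists f : forall i, sfT (M i), x = cls (fun i => val (f i)).
by move=> /upF_rep[f [fM ->]]; exists (fun i => exist _ (f i) (fM i)). Qed.

(** A sequence of counterexamples in the [M2 i] is an element of their ultraproduct; [extension],
    applied to the converse relation, answers it with a sequence in the [M1 i]. *)
Lemma ae_forall M1 M2 G (P1 : forall i, sfT (M1 i) -> Prop) (P2 : forall i, sfT (M2 i) -> Prop) :
  game_ok M1 M2 -> game_ok M2 M1 -> pos V pE (upF M1) (upF M2) G -> pdeg_ok pE (upF M2) (upF M1) (conv G) ->
  (forall G' (x1 : forall i, sfT (M1 i)) (x2 : forall i, sfT (M2 i)), pos V pE (upF M1) (upF M2) G' ->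
    sub_piso G G' -> G' (cls (fun i => val (x1 i))) (cls (fun i => val (x2 i))) ->
    (ae (fun i => P1 i (x1 i)) <-> ae (fun i => P2 i (x2 i)))) ->
  ae (fun i => forall x, P1 i x) -> ae (fun i => forall x, P2 i x).
move=> [sg1 rv1 sm1] [sg2 rv2 sm2] pG okG IH h1; apply: contrapT => /ae_not h2.
have [x2 hx2] : exists x2 : forall i, sfT (M2 i), forall i, ~ (forall x, P2 i x) -> ~ P2 i (x2 i).
  have hx i : exists x, ~ (forall x, P2 i x) -> ~ P2 i x.
    have [h|h] := pselect (forall x, P2 i x); first by exists 0.
    by have /asboolPn/existsp_asboolPn[x] : ~ forall x, P2 i x := h; exists x.
  by exists (fun i => sval (cid (hx i))) => i; case: cid.
have xN : cls (fun i => val (x2 i)) \in upF M2 by apply/upFP/aeT => i; apply: (valP).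
have [G' [pG' GG' [y hy]]] := extension rv2 sg2 sg1 sm1 (pos_conv pG) okG xN.
have [[[_ _ _ GN]]] := pG'.
have [x1 ex1] := upF_lift (let: And3 _ h _ := GN _ _ hy in h).
have [] := IH (conv G') x1 x2 (pos_conv pG').
- by move=> b ab; apply: GG'.
- by rewrite -ex1.
have h1' : ae (fun i => P1 i (x1 i)) by apply: ae_imp h1 => i.
move=> /(_ h1') h.
by have [i [/hx2]] := ae_ex (ae_and h h2).
Qed.

(** Truth almost everywhere stands for truth in the ultraproduct, so the theorem of Los is built
    into the statement. *)
Lemma equivalence M1 M2 phi : game_ok M1 M2 -> game_ok M2 M1 -> forall G e1 e2, pos V pE (upF M1) (upF M2) G ->
  pdeg_ok pE (upF M1) (upF M2) G -> pdeg_ok pE (upF M2) (upF M1) (conv G) ->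
  (forall n, G (cls (fun i => val (e1 n i))) (cls (fun i => val (e2 n i)))) ->
  (ae (fun i => satisfies (M := sub_struct O (M1 i)) (fun n => e1 n i) phi) <->
   ae (fun i => satisfies (M := sub_struct O (M2 i)) (fun n => e2 n i) phi)).
move=> ok1 ok2; elim: phi => [|t t'|u t|f IHf g IHg|n f IH] G e1 e2 pG ok12 ok21 h.
- by [].
- have [hG] := pG; have h1 := piso_teval t hG h; have h2 := piso_teval t' hG h.
  split=> ee.
  + have e0 : ae (fun i => val (teval (M := sub_struct O (M1 i)) (fun n => e1 n i) t) =
        val (teval (M := sub_struct O (M1 i)) (fun n => e1 n i) t')) by apply: ae_imp ee => i ->.
    move/cls_eq: e0 => e0; rewrite e0 in h1; have /cls_eq := piso_fun hG h1 h2.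
    by apply: ae_imp => i /val_inj.
  + have e0 : ae (fun i => val (teval (M := sub_struct O (M2 i)) (fun n => e2 n i) t) =
        val (teval (M := sub_struct O (M2 i)) (fun n => e2 n i) t')) by apply: ae_imp ee => i ->.
    move/cls_eq: e0 => e0; rewrite e0 in h1; have /cls_eq := piso_inj hG h1 h2.
    by apply: ae_imp => i /val_inj.
- have [hG] := pG; have h1 := piso_teval t hG h.
  have [[_ _ _ GN]] := hG; have [_ _ /rveq_nv nve] := GN _ _ h1.
  by rewrite -!in_upOP -![_ \in in_upO O]/(_ \in V) -!nv_le1 nve.
- have {}IHf := IHf G e1 e2 pG ok12 ok21 h; have {}IHg := IHg G e1 e2.
  have ae_impl (P Q : nat -> Prop) : ae (fun i => P i -> Q i) <-> (ae P -> ae Q).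
    split=> [hPQ hP|hPQ]; first exact: ae2 hPQ hP => i.
    have [/hPQ|/ae_not] := pselect (ae P); first exact: ae_imp.
    exact: ae_imp => /nP.
  by rewrite !ae_impl IHf IHg.
- split=> /=.
  + apply: (ae_forall (G := G)) => // G' x1 x2 pG' GG' hx.
    under [in X in X <-> _]eq_fun => i do rewrite update_env.
    under [in X in _ <-> X]eq_fun => i do rewrite update_env.
    apply: (IH G') => //; first exact: pdeg_ok_sub ok12.
      by apply: pdeg_ok_sub ok21 => a b; apply: GG'.
    by move=> m; rewrite /env; case: eqP => // _; apply: GG'.
  + apply: (ae_forall (G := conv G)) => //; first exact: pos_conv.
    move=> G' x2 x1 pG' GG' hx.
    under [in X in X <-> _]eq_fun => i do rewrite update_env.
    under [in X in _ <-> X]eq_fun => i do rewrite update_env.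
    apply: iff_sym; apply: (IH (conv G')) => //; first exact: pos_conv.
    * by apply: pdeg_ok_sub ok12 => a b; apply: GG'.
    * exact: pdeg_ok_sub ok21 => b.
    by move=> m; rewrite /env; case: eqP => // _; apply: GG'.
Qed.
End Equivalence.

(** * The starting position *)

Section FreeFamilies.
Variables (E : fieldType) (N : subfield E).

Lemma lfree_extend n (e : 'I_n -> E) z : lfree N e -> ~ spans N e z ->
  exists e' : 'I_n.+1 -> E, lfree N e' /\ forall k, e' k = z \/ exists j, e' k = e j.
move=> fe ze; exists (fun k => if unlift ord0 k is Some j then e j else z); split; last first.
  by move=> k; case: unliftP => [j _|_]; [right; exists j|left].
move=> a aN; rewrite big_ord_recl unlift_none; under eq_bigr => j do rewrite liftK.
move=> s0; have a0 : a ord0 = 0.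
  apply: contrapT => /eqP a0; apply: ze; exists (fun j => - (a (lift ord0 j) / a ord0)).
  split=> [j|]; first by rewrite rpredN rpredM ?rpredV.
  under eq_bigr => j do rewrite mulNr mulrAC.
  rewrite sumrN -mulr_suml; apply: (mulfI a0); rewrite mulrN mulrCA divff // mulr1.
  by apply/eqP; rewrite -addr_eq0 s0.
move: s0; rewrite a0 mul0r add0r => s0 k.
by have [j ->|->//] := unliftP ord0 k; apply: (fe (fun j => a (lift ord0 j))).
Qed.
End FreeFamilies.

(** A separable relation in the ultraproduct has a fixed degree and descends to almost all
    coordinates, where the hypothesis for that degree applies; the set of good coordinates may
    depend on the degree. *)
Lemma up_sepclosed K (N N' : nat -> subfield K) : (forall n, ae (fun i => forall x P, x \in N' i -> P \over (N i) ->
    (size P <= n)%N -> root P x -> ~~ root P^`() x -> x \in N i)) -> forall x, x \in upF N' -> sepalg (upF N) x -> x \in upF N.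
move=> h _ /upF_rep[f [fN ->]] [P [NP rP rP']].
have [c hc] := choice (fun j => upF_rep (polyOverP NP j)).
pose Q i : {poly K} := \poly_(j < size P) c j i.
have sQ i : (size (Q i) <= size P)%N by apply: size_poly.
have eP : P = clsP (size P) Q.
  apply/polyP => j; rewrite clsP_coef //; have [jP|jP] := ltnP j (size P).
    by rewrite (proj2 (hc j)); congr cls; apply: funext => i; rewrite coef_poly jP.
  rewrite nth_default // -cls0; congr cls; apply: funext => i.
  by rewrite coef_poly ltnNge jP.
have rQ : ae (fun i => root (Q i) (f i)).
  move: rP; rewrite /root eP clsP_horner // => /eqP/cls_eq0; apply: ae_imp => i ->.
  by [].
have rQ' : ae (fun i => ~~ root (Q i)^`() (f i)).
  apply: contrapT => /ae_not rn; move/negP: rP'; apply.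
  rewrite eP clsP_deriv // /root clsP_horner => [|i]; last first.
    have [->|/lt_size_deriv q'] := eqVneq (Q i) 0; first by rewrite deriv0 size_poly0.
    by rewrite ltnW // (leq_trans q').
  by apply/eqP/cls_eq0; apply: ae_imp rn => i /negP; rewrite negbK => /eqP.
apply/upFP; apply: ae_imp (ae_and (h (size P)) (ae_and rQ rQ')) => i [hi [ri']].
by apply: hi ri' => //; apply: polyOver_poly => j _; case: (hc j).
Qed.

Section Diagonal.
Variables (K : fieldType) (p : nat) (pK : p \in [pchar K]) (F : subfield K).

Lemma diagF_closed : sfclosed (fun x : UP K => exists2 a, a \in F & x = diag a).
split; first by exists 1; rewrite ?rpred1 ?rmorph1.
  by move=> _ _ [a aF ->] [b bF ->]; exists (a - b); rewrite ?rpredB ?rmorphB.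
by move=> _ _ [a aF ->] [b bF ->]; exists (a / b); rewrite ?rpredM ?rpredV // fmorph_div.
Qed.

Definition diagF := sf_of diagF_closed.

Lemma diagFP x : x \in diagF <-> exists2 a, a \in F & x = diag a.
exact: sf_ofE. Qed.
Lemma diag_in a : a \in F -> diag a \in diagF.
by move=> aF; apply/diagFP; exists a. Qed.
Lemma diagF_sub : {subset diagF <= upF (fun=> F)}.
by move=> _ /diagFP[a aF ->]; apply/upFP/aeT. Qed.

Lemma diag_plfree n (u : 'I_n -> K) : lfree (ppow pK F) u -> lfree (ppow (up_pchar pK) (upF (fun=> F))) (fun k => diag (u k)).
move=> h; rewrite (lfree_eq _ (fun x => ppow_upF pK (fun=> F) x)).
exact/(up_lfree (fun=> ppow pK F) (fun k _ => u k))/aeT.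
Qed.

(** A sequence of roots of one fixed polynomial takes finitely many values, so it is constant almost
    everywhere. *)
Lemma diagF_algebraic x : x \in upF (fun=> F) -> alg_over diagF x -> x \in diagF.
move=> /upF_rep[f [fF ->]] [P [DP P0 Px]].
have /choice[c hc] : forall k, exists a, a \in F /\ P`_k = diag a by (move=> k; have /diagFP[a] := polyOverP DP k; exists a).
pose Q := \poly_(k < size P) c k.
have eP : P = map_poly (@diag K) Q.
  apply/polyP => k; rewrite coef_map coef_poly; case: ltnP => h; first by have [] := hc k.
  by rewrite nth_default //; apply/esym/rmorph0.
have Q0 : Q != 0 by apply: contra_neq P0 => Q0; rewrite eP Q0 rmorph0.
have ePx : P = clsP (size Q) (fun=> Q).
  rewrite //.
move: Px; rewrite ePx /root clsP_horner // => /eqP/cls_eq0 hroot.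
have [rs hrs] : exists rs : seq K, forall z, root Q z -> z \in rs.
  suff H n (T : {poly K}) : (size T <= n)%N -> T != 0 -> exists rs : seq K, forall z, root T z -> z \in rs.
    exact: H.
  elim: n T => [|n IH] T; first by rewrite leqn0 size_poly_eq0 => ->.
  move=> sT T0; have [[z Tz]|no] := pselect (exists z, root T z); last by exists [::] => z Tz; case: no; exists z.
  have /factor_theorem[S eS] := Tz; have S0 : S != 0 by apply: contra_neq T0 => S0; rewrite eS S0 mul0r.
  have [|rs hrs] := IH S _ S0.
    by move: sT; rewrite eS size_mul ?polyXsubC_eq0 // size_XsubC addn2.
  exists (z :: rs) => t; rewrite eS rootM inE root_XsubC => /orP[/hrs ->|->]; first exact: orbT.
  by [].
have [z zae] : exists z, ae (fun i => f i = z).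
  have : ae (fun i => f i \in rs) by apply: ae_imp hroot => i /eqP /hrs.
  elim: (rs) => [h|z rs' IH h]; first by have [i] := ae_ex h.
  have /ae_or[h'|/IH //] : ae (fun i => f i = z \/ f i \in rs') by (apply: ae_imp h => i; rewrite inE => /predU1P[]; [left|right]).
  by exists z.
apply/diagFP; exists z; last exact/cls_eq.
by have [i <-] := ae_ex zae.
Qed.
End Diagonal.

Section Start.
Variables (K : closedF) (O : valring K) (p : nat) (pK : p \in [pchar K]).
Variables (F : subfield K) (sgF : SG O p F).
Hypothesis cF : ctbl (fun x => x \in F).
Hypothesis smallF : exists2 pi, pi \in F & pi != 0 /\ pi <_[O] 1.
Notation L := (upF (fun=> F)).
Notation D := (diagF F).
Notation pU := (up_pchar pK).
Notation pE := (up_pchar pU).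

Lemma diagF_sg : SG (upO O) p D.
apply: (@sg_sepclosed _ _ _ pU D L); [exact: diagF_sub|exact: up_sg|].
move=> x xL [P [DP Px P'x]]; apply: diagF_algebraic => //; exists P; split=> //.
by apply: contraNneq P'x => ->; rewrite deriv0 root0.
Qed.

(** The inner ultrapower contains the fields [M i], the outer one their ultraproduct. The game
    starts from the identity on [F], embedded diagonally twice. *)
Definition start (x y : UP (UP K)) : Prop := x = y /\ exists2 a, a \in D & x = diag a.

Lemma diag2_lfree (M : nat -> subfield (UP K)) (ML : forall i, {subset M i <= L}) n (e : 'I_n -> K) : lfree (ppow pK F) e ->
  lfree (ppow pE (upF M)) (fun k => diag (diag (e k))).
move=> fe; rewrite (lfree_eq _ (fun x => ppow_upF pU M x)).
apply/(up_lfree (fun i => ppow pU (M i)) (fun k _ => diag (e k)))/aeT => i.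
by apply: (lfree_sub _ (diag_plfree fe)); apply: ppow_sub.
Qed.

Lemma diag2_sep (M : nat -> subfield (UP K)) (ML : forall i, {subset M i <= L}) : sep_ext pE (fun x => exists2 a, a \in F & x = diag (diag a)) (upF M).
move=> n u hu; have /choice[a ha] : forall k, exists a, a \in F /\ u k = diag (diag a).
  by move=> k; have [a] := hu k; exists a.
have [d [e [fe se es]]] := spans_basis (ppow pK F) a.
have PF x : x \in ppow pK F -> x \in F by move=> /ppowP[y yN ->]; rewrite rpredX.
exists d, (fun j => diag (diag (e j))); split; last 1 first.
- move=> k; have [c [cF' ec]] := se k.
  have /choice[g hg] : forall j, exists g, g \in F /\ c j = g ^+ p by (move=> j; have /ppowP[g] := cF' j; exists g).
  exists (fun j => diag (diag (g j))); split=> [j|]; first by exists (g j) => //; have [] := hg j.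
  have [_ ->] := ha k; rewrite ec !rmorph_sum; apply: eq_bigr => j.
  by have [_ ->] := hg j; rewrite !rmorphM !rmorphXn.
- move=> j; exists (e j) => //; have [c [cF' ->]] := es j.
  by apply: rpred_sum => k _; apply: rpredM; [apply: PF|have [] := ha k].
- exact: diag2_lfree.
Qed.

Lemma domD x : (exists2 a, a \in D & x = diag a) <-> exists2 a, a \in F & x = diag (diag a).
split=> [[_ /diagFP[a aF ->] ->]|[a aF ->]]; first by exists a.
by exists (diag a) => //; apply: diag_in.
Qed.

Lemma dom_start : dom start = (fun x => exists2 a, a \in F & x = diag (diag a)).
apply: funext => x; apply/propext; rewrite -domD; split=> [[y [_ //]]|h].
by exists x.
Qed.

Lemma dom_start_conv : dom (conv start) = (fun x => exists2 a, a \in F & x = diag (diag a)).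
apply: funext => x; apply/propext; rewrite -domD; split=> [[y [-> //]]|h].
by exists x.
Qed.

Variable M : nat -> subfield (UP K).
Hypotheses (DM : forall i, {subset D <= M i}) (ML : forall i, {subset M i <= L}).
Hypothesis sepM : forall n, ae (fun i => forall x (P : {poly UP K}), x \in L ->
  P \over (M i) -> (size P <= n)%N -> root P x -> ~~ root P^`() x -> x \in M i).
Hypotheses (rvMD : forall i, rv_sub (upO O) (M i) D).
Hypothesis degM : forall i n (b : 'I_n -> K), (forall k, b k \in F) -> (forall x, x \in F -> spans (ppow pK F) b x) ->
  forall x, x \in M i -> spans (ppow pU (M i)) (fun k => diag (b k)) x.

Lemma pos_start : pos (upO (upO O)) pE (upF (fun=> D)) (upF M) start.
have DL : forall i : nat, {subset D <= L} by move=> _; apply: diagF_sub.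
split.
- split; last first.
    move=> x y [-> [a aD ea]]; split=> //; exists a^-1; rewrite ?rpredV //.
    rewrite ea; exact/esym/(clsV).
  split.
  + by split=> //; exists 1; [rewrite rpred1|apply/esym/cls1].
  + move=> x y x' y' [-> [a aD ea]] [-> [b bD eb]]; split=> //; exists (a - b); rewrite ?rpredB //.
    by rewrite ea eb [RHS]rmorphB.
  + move=> x y x' y' [-> [a aD ea]] [-> [b bD eb]]; split=> //; exists (a * b); rewrite ?rpredM //.
    by rewrite ea eb; apply/esym/(clsM).
  + move=> x y [-> [a aD ->]]; rewrite rveqxx; split=> //; apply/upFP/aeT => i //.
    exact: DM.
- have [s hs] := cF; exists (fun n => omap (fun a => (diag (diag a), diag (diag a))) (s n)).
  move=> [x y] [/= <- /domD[a aF ->]]; have [n e] := hs a aF.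
  by exists n; rewrite e.
- by rewrite dom_start; apply: diag2_sep.
- by rewrite dom_start_conv; apply: diag2_sep.
Qed.

Lemma pdeg_dichotomy : (exists n (b : 'I_n -> K), (forall k, b k \in F) /\ forall x, x \in F -> spans (ppow pK F) b x) \/
  forall n, exists b : 'I_n -> K, (forall k, b k \in F) /\ lfree (ppow pK F) b.
have [h|h] := pselect (exists n (b : 'I_n -> K), (forall k, b k \in F) /\
    forall x, x \in F -> spans (ppow pK F) b x); [by left|right].
elim=> [|n [b [bF fb]]]; first by exists (fun=> 0); split=> [[]|a _ _ []].
have [z zF zb] : exists2 z, z \in F & ~ spans (ppow pK F) b z.
  apply: contrapT => nz; apply: h; exists n, b; split=> // x xF.
  by apply: contrapT => xb; apply: nz; exists x.
have [e' [fe' he']] := lfree_extend fb zb; exists e'; split=> // k.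
by have [->|[j ->]] := he' k.
Qed.

Lemma infinite_pdeg (N : nat -> subfield (UP K)) n (b : 'I_n -> UP (UP K)) :
  (forall i, {subset D <= N i}) -> (forall i, {subset N i <= L}) ->
  (forall n, exists b : 'I_n -> K, (forall k, b k \in F) /\ lfree (ppow pK F) b) ->
  exists2 z, z \in upF N & ~ spans (ppow pE (upF N)) b z.
move=> DN NL inf; have [e [eF fe]] := inf n.+1.
apply: contrapT => nz; apply: (span_dep (ltnSn n) (u := b) _ (diag2_lfree NL fe)) => j.
apply: contrapT => h; apply: nz; exists (diag (diag (e j))) => //.
by apply/upFP/aeT => i; apply/DN/diag_in.
Qed.

Lemma finite_pdeg (N : nat -> subfield (UP K)) n (b : 'I_n -> K) :
  (forall i x, x \in N i -> spans (ppow pU (N i)) (fun k => diag (b k)) x) ->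
  forall x, x \in upF N -> spans (ppow pE (upF N)) (fun k => diag (diag (b k))) x.
move=> h x /upF_rep[f [fN ->]]; rewrite (spans_eq _ _ (fun x => ppow_upF pU N x)).
apply/(up_spans (fun i => ppow pU (N i)) (fun k _ => diag (b k)))/aeT => i.
exact: h.
Qed.

Lemma ultraproduct_equivalence phi : satisfies (M := sub_struct (upO O) D) (fun=> 0) phi ->
  ae (fun i => satisfies (M := sub_struct (upO O) (M i)) (fun=> 0) phi).
have DL : forall i : nat, {subset D <= L} by move=> _; apply: diagF_sub.
have DD : forall i : nat, {subset D <= D} by move=> x.
have [pi piF [pi0 pi1]] := smallF.
have small (N : nat -> subfield (UP K)) : (forall i, {subset D <= N i}) -> nonarchimedean (upO O) (upF N).
  move=> DN; exists (diag (diag pi)); first by apply/upFP/aeT => i; apply/DN/diag_in.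
  split; first by rewrite !fmorph_eq0.
  rewrite -[1]cls1 /diag; apply/up_lt/aeT => i; rewrite -[1]cls1; exact/up_lt/aeT.
have ok1 : game_ok (upO O) p (fun=> D) M by (split; [apply: up_sg => _; apply: diagF_sg|move=> i x /DM xM; exists x; rewrite ?rveqxx|apply: small]).
(* [SG] is inherited from the ultrapower of [L], in which the ultraproduct of the [M i] is
   relatively separably closed. *)
have ok2 : game_ok (upO O) p M (fun=> D).
  split=> //; last exact: small.
  apply: (@sg_sepclosed _ _ _ (up_pchar pU)).
  - by move=> _ /upF_rep[f [fM ->]]; apply/upFP/aeT => i; apply: ML.
  - by apply: up_sg => _; apply: up_sg.
  - exact: up_sepclosed.
move=> h; apply/(@equivalence _ _ _ pU _ _ phi ok1 ok2 start (fun => 0)).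
- exact: pos_start.
- have [[n [b [bF hb]]]|inf] := pdeg_dichotomy; last first.
    by left=> n b; apply: infinite_pdeg.
  right; exists n, (fun k => diag (diag (b k))); split.
    by move=> k; rewrite dom_start; exists (b k).
  apply: finite_pdeg => _ _ /diagFP[a aF ->]; have [c [cF' ->]] := hb _ aF.
  exists (fun k => diag (c k)); split=> [k|]; last first.
    by rewrite rmorph_sum; apply: eq_bigr => k _; rewrite rmorphM.
  have /ppowP[g gF ->] := cF' k; apply/ppowP; exists (diag g); rewrite ?rmorphXn //.
  exact: diag_in.
- have [[n [b [bF hb]]]|inf] := pdeg_dichotomy; last first.
    by left=> n b; apply: infinite_pdeg.
  right; exists n, (fun k => diag (diag (b k))); split; last by apply: finite_pdeg => i; apply: degM.
  by move=> k; rewrite dom_start_conv; exists (b k).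
- split=> //; exists 0; first by rewrite rpred0.
  by [].
- exact: aeT.
Qed.
End Start.

(** * Countable elementary subfields and their valued algebraic closures *)

Section Coincidence.
Variables (U : countType) (M : structure U).

Lemma teval_ext (e e' : nat -> M) t : {in tvars t, e =1 e'} -> teval e t = teval e' t.
elim: t => //= [n h|t IH h|t IH t' IH' h|t IH t' IH' h]; first by apply: h; rewrite inE.
- by rewrite IH.
- by rewrite IH ?IH' // => n nt; apply: h; rewrite mem_cat nt ?orbT.
- by rewrite IH ?IH' // => n nt; apply: h; rewrite mem_cat nt ?orbT.
Qed.

Lemma satisfies_ext phi (e e' : nat -> M) : {in free_vars phi, e =1 e'} -> satisfies e phi <-> satisfies e' phi.
elim: phi e e' => //= [t t'|u t|f IHf g IHg|n f IH] e e' h.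
- by rewrite ?(teval_ext (e' := e')) // => n nt; apply: h; rewrite mem_cat nt ?orbT.
- by rewrite (teval_ext h).
- have hf : {in free_vars f, e =1 e'} by move=> n nf; apply: h; rewrite mem_cat nf.
  have hg : {in free_vars g, e =1 e'} by move=> n nf; apply: h; rewrite mem_cat nf orbT.
  by rewrite (IHf _ _ hf) (IHg _ _ hg).
- have {}IH x : satisfies (update e n x) f <-> satisfies (update e' n x) f.
    apply: IH => m mf; rewrite /update; case: eqP => // /eqP mn.
    by apply: h; rewrite mem_filter mn.
  by split=> H x; apply/IH.
Qed.

Lemma satisfies_sentence phi (e e' : nat -> M) : sentence phi -> satisfies e phi -> satisfies e' phi.
by move=> /eqP s; rewrite (@satisfies_ext _ e e') // s. Qed.
End Coincidence.

Section Residues.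
Variables (K : fieldType) (O : valring K).

Lemma residue_nmod : nmod_morphism (@residue K O).
by split=> [|x y]; rewrite /residue ?rmorph0 ?rmorphD. Qed.
Lemma residue_monoid : monoid_morphism (@residue K O).
by split=> [|x y]; rewrite /residue ?rmorph1 ?rmorphM. Qed.

HB.instance Definition _ := GRing.isNmodMorphism.Build _ _ (@residue K O) residue_nmod.
HB.instance Definition _ := GRing.isMonoidMorphism.Build _ _ (@residue K O) residue_monoid.

Lemma nv_lt1 x : x \in O -> (x <_[O] 1) = ~~ vunit O x.
move=> xO; rewrite ltNge nvE /vunit xO div1r.
by case: eqVneq => [_|]; rewrite ?oner_eq0.
Qed.
Lemma residue_eq0 (x : vring O) : (residue x == 0) = (val x <_[O] 1).
rewrite nv_lt1 ?(valP x) // -(rmorph0 (@residue K O)) residue_eq subr0.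
by [].
Qed.

Lemma hensel_lift : henselian O -> forall (P : {poly K}) u, (forall i, P`_i <=_[O] 1) ->
  u <=_[O] 1 -> P.[u] <_[O] 1 -> nv O P^`().[u] = nv O 1 -> exists2 b, root P b & b - u <_[O] 1.
move=> hens P u P1; rewrite nv_le1 => uO Pu P'u.
pose a : vring O := exist _ u uO.
have PO i : P`_i \in O by rewrite -nv_le1.
pose f : {poly vring O} := \poly_(i < size P) (exist _ P`_i (PO i) : vring O).
have eP : P = map_poly val f.
  apply/polyP => i; rewrite coef_map coef_poly; case: ltnP => //= h.
  by rewrite nth_default.
have [||b fb rb] := hens f a.
- by rewrite /root horner_map residue_eq0 -horner_map -eP.
- have e1 : val f^`().[a] = P^`().[u] by rewrite eP deriv_map -[u]/(val a) horner_map.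
  by rewrite deriv_map /root horner_map residue_eq0 e1 P'u ltxx.
exists (val b); first by rewrite eP /root horner_map.
move/eqP: rb; rewrite -subr_eq0 -rmorphB residue_eq0 //.
Qed.
End Residues.

Section Elementary.
Variables (K : fieldType) (O : valring K).
Hypothesis hens : henselian O.
Notation KS := (valued_field_structure O).

Definition hensel_in (E : fieldType) (V : valring E) (N : subfield E) :=
  forall P u, P \over N -> (forall i, P`_i <=_[V] 1) -> u \in N -> u <=_[V] 1 -> P.[u] <_[V] 1 -> nv V P^`().[u] = nv V 1 ->
  exists2 b, b \in N & root P b /\ b - u <_[V] 1.

Lemma skolem_witness s j : exists x : K, forall n phi,
  j = npair n (formula_code phi) -> (exists y, ~ satisfies (M := KS) (update (nth 0 s) n y) phi) ->
  ~ satisfies (M := KS) (update (nth 0 s) n x) phi.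
have [[n [phi [x [ej hx]]]]|no] := pselect (exists n phi x, j = npair n (formula_code phi) /\
    ~ satisfies (M := KS) (update (nth 0 s) n x) phi).
  by exists x => n' phi'; rewrite ej => /npair_inj[<- /formula_code_inj <-].
by exists 0 => n phi ej [y hy]; case: no; exists n, phi, y.
Qed.

Lemma hensel_witness (s : seq K) : exists b : K, let P := Poly (behead s) in let u := head 0 s in
  (exists b, root P b /\ b - u <_[O] 1) -> root P b /\ b - u <_[O] 1.
have [[b hb]|no] := pselect (exists b, root (Poly (behead s)) b /\ b - head 0 s <_[O] 1).
  by exists b.
by exists 0.
Qed.

Lemma factor_witness s : exists Q : {poly K}, let P := Poly s in
  (exists Q, [/\ Q %| P, size Q != 1%N & ~~ (Q %= P)]) -> [/\ Q %| P, size Q != 1%N & ~~ (Q %= P)].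
have [[Q hQ]|no] := pselect (exists Q, [/\ Q %| Poly s, size Q != 1%N & ~~ (Q %= Poly s)]).
  by exists Q.
by exists 0.
Qed.

(** Skolem hulls with two additional operations, for Hensel lifts and for factors of polynomials.
    The latter keep irreducible polynomials over [F] irreducible over [K], so that degrees can be
    studied over [K], where the hypotheses are given. *)
Lemma elementary_subfield (c : nat -> K) : exists F : subfield K, [/\ ctbl (fun x => x \in F), forall n, c n \in F,
      forall phi (e : nat -> sfT F), satisfies (M := sub_struct O F) e phi <-> satisfies (M := KS) (fun n => val (e n)) phi,
      hensel_in O F & forall P, irr F P -> irreducible_poly P].
have /choice[sk hsk] : forall sj : seq K * nat, exists x : K, forall n phi,
    sj.2 = npair n (formula_code phi) -> (exists y, ~ satisfies (M := KS) (update (nth 0 sj.1) n y) phi) ->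
    ~ satisfies (M := KS) (update (nth 0 sj.1) n x) phi.
  by move=> sj; apply: skolem_witness.
have [hw hhw] := choice hensel_witness; have [fw hfw] := choice factor_witness.
(* Operations 0 to 2 generate a field and 3 gives Hensel lifts; the remaining ones alternate between
   Skolem functions and coefficients of factors. *)
pose f s i : K := match i with 0 => 1 | 1 => s`_0 - s`_1 | 2 => s`_0 / s`_1 | 3 => hw s
  | j.+4 => if odd j then (fw s)`_(j./2) else sk (s, j./2) end.
have [//|d [_ cd fd]] := @countable_closure K 0 c f (fun=> True) I (fun=> I).
have dE s i : exists m, f [seq d k | k <- s] i = d m by [].
have dcl : sfclosed (fun x => exists m, x = d m).
  split; first exact: (dE [::] 0%N).
    by move=> _ _ [m ->] [n ->]; apply: (dE [:: m; n] 1%N).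
  by move=> _ _ [m ->] [n ->]; apply: (dE [:: m; n] 2%N).
pose F := sf_of dcl.
have FP x : x \in F <-> exists m, x = d m by apply: sf_ofE.
have lift s : (forall x, x \in s -> x \in F) -> exists t : seq nat, s = [seq d k | k <- t].
  elim: s => [|x s IH] h; first by exists [::].
  have [|t ->] := IH; first by move=> y ys; apply: h; rewrite inE ys orbT.
  by have /FP[m ->] := h x (mem_head _ _); exists (m :: t).
have fF s i : (forall x, x \in s -> x \in F) -> f s i \in F by (move=> /lift[t ->]; apply/FP).
have skF s j : (forall x, x \in s -> x \in F) -> sk (s, j) \in F by (move=> sF; have := fF s (j.*2.+4) sF; rewrite /= odd_double doubleK).
have fwF s : (forall x, x \in s -> x \in F) -> fw s \over F.
  move=> sF; apply/polyOverP => j; have := fF s (j.*2.+1.+4) sF.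
  by rewrite /= odd_double uphalf_double.
have polyF P : P \over F -> forall x, x \in (P : seq K) -> x \in F by (move=> FP' x /(nthP 0)[i _ <-]; apply/polyOverP).
exists F; split.
- by apply: (@countable_image nat _ d) => x /FP.
- by move=> n; apply/FP.
- have ev t e : val (teval (M := sub_struct O F) e t) = teval (M := KS) (fun n => val (e n)) t.
    by elim: t => //= [t <-|t <- t' <-|t <- t' <-].
  elim=> [|t t'|u t|g IHg h IHh|n g IH] e //=.
  + by rewrite -!ev; split=> [->//|/val_inj].
  + by rewrite ev.
  + by rewrite IHg IHh.
  have upd x : (fun m => val (update e n x m)) = update (fun m => val (e m)) n (val x) by (apply: funext => m; rewrite /update; case: eqP).
  split=> [H x|H x]; last by apply/IH; rewrite upd.
  apply: contrapT => nx.
  pose m := (\max_(i <- free_vars g) i).+1; pose s := [seq val (e i) | i <- iota 0 m].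
  have sF y : y \in s -> y \in F by move=> /mapP[i _ ->]; apply: (valP).
  have es y : satisfies (M := KS) (update (nth 0 s) n y) g <-> satisfies (M := KS) (update (fun m => val (e m)) n y) g.
    apply: satisfies_ext => i ig; rewrite /update.
    have im : (i < m)%N by rewrite ltnS; apply: (leq_bigmax_seq).
    by rewrite (nth_map 0%N) ?size_iota // nth_iota.
  apply: (hsk (s, npair n (formula_code g)) n g erefl); first by exists x => /es.
  apply/es; have := H (exist (fun y : K => y \in F) _ (skF s (npair n (formula_code g)) sF) : sfT F).
  by move/IH; rewrite upd.
- move=> P u FPo P1 uF u1 Pu P'u; have [b Pb bu] := hensel_lift hens P1 u1 Pu P'u.
  have sF x : x \in u :: P -> x \in F by rewrite inE => /predU1P[->|/(polyF _ FPo)].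
  have := hhw (u :: P); rewrite polyseqK => /(_ (ex_intro _ b (conj Pb bu))).
  by exists (hw (u :: P)) => //; apply: (fF _ 3%N).
- move=> P [FPo sP irP]; split=> // Q sQ QP; apply: contrapT => nQ.
  have := hfw P; rewrite polyseqK => -[|h1 h2 h3].
    by exists Q; split=> //; apply/negP.
  by move/negP: h3; apply; apply: irP => //; apply: fwF; apply: polyF.
Qed.
End Elementary.

Lemma nv_inv_lt1 E (V : valring E) x : x != 0 -> (x^-1 <_[V] 1) = (x \notin V).
by move=> x0; have := nv_ltV V x0 (oner_neq0 E); rewrite invr1 => ->; rewrite ltNge nv_le1.
Qed.

Section AlgClosure.
Variables (K : fieldType) (O : valring K) (F : subfield K).
Hypothesis cF : ctbl (fun x => x \in F).

(** Chevalley's theorem is applied to the image of [O] and of its maximal ideal: keeping the ideal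
    inside the new maximal ideal forces the valuation to restrict to the given one. *)
Lemma valued_closure : exists (E : closedF) (i : {rmorphism sfT F -> E}) (V : valring E),
  (forall x, (i x \in V) = (val x \in O)) /\ ctbl (fun _ : E => True).
have [s hs] := cF.
have /choice[g hg] : forall x : sfT F, exists n, s n = Some (val x) by move=> x; apply: hs; apply: (valP).
pose h n : option (sfT F) := if s n is Some x then insub x else None.
have gh : pcancel g h by move=> x; rewrite /h hg valK.
pose C := HB.pack_for countFieldType (sfT F) (PCanIsCountable gh).
have [E [i _]] := countable_algebraic_closure C.
pose j : {rmorphism sfT F -> E} := i.
pose R z := exists2 x : sfT F, val x \in O & z = j x.
pose I z := exists2 x : sfT F, val x <_[O] 1 & z = j x.
have [|V [RV IV]] := @chevalley E R I.
  split; split.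
  - by exists 1; rewrite ?rmorph1 ?rpred1.
  - by move=> _ _ [x xO ->] [y yO ->]; exists (x - y); rewrite ?rmorphB ?rpredB.
  - by move=> _ _ [x xO ->] [y yO ->]; exists (x * y); rewrite ?rmorphM ?rpredM.
  - by exists 0; rewrite ?rmorph0 ?nv_gt0 ?oner_eq0.
  - by move=> _ _ [x xO ->] [y yO ->]; exists (x - y); rewrite ?rmorphB ?nv_ltB.
  - move=> _ _ [x xO ->] [y yO ->]; exists (x * y); rewrite ?rmorphM //= mulrC.
    by apply: nv_ltM1; rewrite ?nv_le1.
  - by move=> _ [x xO ->]; exists x => //; rewrite -nv_le1 ltW.
  - by move=> [x x1] /esym/eqP; rewrite fmorph_eq1 => /eqP ex; move: x1; rewrite ex ltxx.
exists E, j, V; split; last first.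
  by exists unpickle => x _; exists (pickle x); apply: pickleK.
move=> x; apply/idP/idP => [xV|xO]; last by apply: RV; exists x.
have [x0|x0] := eqVneq x 0; first by rewrite x0 rpred0.
apply: contraLR xV => xO.
have : val x^-1 <_[O] 1 by rewrite nv_inv_lt1.
move=> xi; have Ix : I (j x^-1) by exists x^-1.
have := IV _ Ix.
by rewrite fmorphV nv_inv_lt1 ?fmorph_eq0.
Qed.
End AlgClosure.

(** * Symmetric functions of roots, and conjugates of equal absolute value *)

Section Symmetric.
Variables (E : fieldType) (N : subfield E) (n : nat) (z : 'I_n -> E).
Hypothesis Nz : \prod_i ('X - (z i)%:P) \over N.
Notation ev := (mmap intr z : {mpoly int[n]} -> E).

Lemma mesym_in k : ev (mesym n int k) \in N.
have [nk|kn] := ltnP n k.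
  rewrite (_ : mesym n int k = 0) ?rmorph0 ?rpred0 //.
  rewrite /mesym big1 // => h /eqP hk; have := max_card h.
  by rewrite hk card_ord leqNgt nk.
have -> : ev (mesym n int k) = (mesym n E k).@[z] by (rewrite !mesymE (raddf_sum) rmorph_sum; apply: eq_bigr => h _; rewrite /= mmapX mevalX).
have := mroots_coeff [tuple z i | i < n] (Ordinal (kn : (k < n.+1)%N)).
have -> : \prod_(c <- [tuple z i | i < n]) ('X - c%:P) = \prod_i ('X - (z i)%:P) by (rewrite big_tuple; apply: eq_bigr => i _; rewrite tnth_mktuple).
have -> : tnth [tuple z i | i < n] = z by apply: funext => i; rewrite tnth_mktuple.
move=> e; have := polyOverP Nz (n - k)%N; rewrite e => h.
have := rpredM (rpredX k (rpredN1 N)) h.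
by rewrite mulrA -exprMn mulrNN mulr1 expr1n mul1r.
Qed.

Lemma symmetric_in Q : Q \is symmetric -> ev Q \in N.
move=> /sym_fundamental[t [<- _]]; rewrite rmorph_sum.
apply: rpred_sum => m _; rewrite rmorphM /= mmapC rpredM ?rpred_int //.
rewrite rmorph_prod; apply: rpred_prod => i _; rewrite rmorphXn rpredX //=.
by rewrite tnth_mktuple; apply: mesym_in.
Qed.

Lemma symmetric_poly_in (Q : {poly {mpoly int[n]}}) : (forall s, map_poly (msym s) Q = Q) -> map_poly ev Q \over N.
move=> sQ; apply/polyOverP => k; rewrite coef_map; apply: symmetric_in.
by apply/issymP => s; rewrite -{2}(sQ s) coef_map.
Qed.

Lemma msym_var s i : msym s ('X_i : {mpoly int[n]}) = 'X_(s i).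
by rewrite /msym mmapX mmap1U. Qed.

Let b (h : {set 'I_n}) : {mpoly int[n]} := \prod_(i in h) 'X_i.

Let msym_b s h : msym s (b h) = b [set s i | i in h].
rewrite /b rmorph_prod big_imset /=; last by move=> i j _ _; apply: perm_inj.
by apply: eq_bigr => i _; apply: msym_var.
Qed.

Let card_perm (s : {perm 'I_n}) (h : {set 'I_n}) : #|[set s i | i in h]| = #|h|.
by rewrite card_imset //; apply: perm_inj. Qed.

Let reindex_perm (R : Type) (idx : R) (op : Monoid.com_law idx) s (P : pred {set 'I_n}) (F : {set 'I_n} -> R) :
  \big[op/idx]_(h | P h) F h = \big[op/idx]_(h : {set 'I_n} | P [set (s : {perm 'I_n}) i | i in h]) F [set s i | i in h].
apply: reindex; exists (fun h : {set 'I_n} => [set (s^-1)%g i | i in h]) => h _; rewrite -imset_comp.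
  by rewrite -[RHS]imset_id; apply: eq_imset => i /=; rewrite permK.
by rewrite -[RHS]imset_id; apply: eq_imset => i /=; rewrite permKV.
Qed.

Let evb P : map_poly ev (\prod_(h | P h) ('X - (b h)%:P)) = \prod_(h | P h) ('X - (\prod_(i in h) z i)%:P).
rewrite rmorph_prod; apply: eq_bigr => h _; rewrite rmorphB /= map_polyX map_polyC /= rmorph_prod.
by congr (_ - _%:P); apply: eq_bigr => i _; rewrite /= mmapX mmap1U.
Qed.

Let msymb s P : map_poly (msym s) (\prod_(h | P h) ('X - (b h)%:P)) = \prod_(h | P h) ('X - (b [set s i | i in h])%:P).
by rewrite rmorph_prod; apply: eq_bigr => h _; rewrite rmorphB /= map_polyX map_polyC /= msym_b.
Qed.

Lemma subset_product_in r : \prod_(h : {set 'I_n} | #|h| == r) ('X - (\prod_(i in h) z i)%:P) \over N.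
have := @symmetric_poly_in (\prod_(h : {set 'I_n} | #|h| == r) ('X - (b h)%:P)); rewrite evb; apply=> s.
by rewrite msymb [RHS](reindex_perm _ s); apply: eq_bigl => h; rewrite card_perm.
Qed.

(** The numerator of Lagrange interpolation. At the product over a subset [T] only the term of [T]
    survives, which gives the [j]-th coefficient of the factor with roots in [T], times a product of
    differences. *)
Lemma subset_factor_in r j : \sum_(h : {set 'I_n} | #|h| == r) ((\prod_(i in h) ('X - (z i)%:P))`_j)%:P *
    \prod_(k : {set 'I_n} | (#|k| == r) && (k != h)) ('X - (\prod_(i in k) z i)%:P) \over N.
pose c (h : {set 'I_n}) : {mpoly int[n]} := (\prod_(i in h) ('X - ('X_i : {mpoly int[n]})%:P))`_j.
have ec h : ev (c h) = (\prod_(i in h) ('X - (z i)%:P))`_j.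
  rewrite -coef_map rmorph_prod; apply: (congr1 (fun Q : {poly E} => Q`_j)); apply: eq_bigr => i.
  by rewrite rmorphB /= map_polyX map_polyC /= mmapX mmap1U.
have sc s h : msym s (c h) = c [set s i | i in h].
  rewrite /c -coef_map rmorph_prod big_imset /=; last by move=> i k _ _; apply: perm_inj.
  apply: (congr1 (fun Q : {poly {mpoly int[n]}} => Q`_j)); apply: eq_bigr => i.
  by rewrite rmorphB /= map_polyX map_polyC /= msym_var.
suff : map_poly ev (\sum_(h : {set 'I_n} | #|h| == r) (c h)%:P *
    \prod_(k : {set 'I_n} | (#|k| == r) && (k != h)) ('X - (b k)%:P)) \over N.
  by rewrite rmorph_sum; under eq_bigr do rewrite rmorphM /= map_polyC /= ec evb.
apply: symmetric_poly_in => s; rewrite rmorph_sum [RHS](reindex_perm _ s).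
apply: eq_big => [h|h _]; first by rewrite card_perm.
rewrite rmorphM /= map_polyC /= sc; congr (_ * _); rewrite msymb [RHS](reindex_perm _ s) /=.
apply: eq_bigl => k; rewrite card_perm; congr (_ && ~~ _); apply/eqP/eqP => [-> //|].
by apply: imset_inj; apply: perm_inj.
Qed.
End Symmetric.

Section EqualRoots.
Variables (E : closedF) (O : valring E) (N : subfield E).
Hypothesis hN : hensel_in O N.

Lemma coef_roots_le I s (Q : pred I) F k : (forall i, Q i -> F i <=_[O] 1) -> (\prod_(i <- s | Q i) ('X - (F i)%:P))`_k <=_[O] 1.
move=> h; have hs i : i \in [seq F i | i <- s & Q i] -> i <=_[O] 1.
  elim: s => //= a s IH; case: ifP => //= Qa; rewrite inE => /predU1P[->|/IH //]; exact: h.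
rewrite -big_filter -(big_map F xpredT (fun x => 'X - x%:P)).
have -> : \prod_(x <- [seq F i | i <- s & Q i]) ('X - x%:P) = \prod_(x <- [seq F i | i <- s & Q i]) (1 *: 'X + (- x)%:P).
  by apply: eq_bigr => x _; rewrite scale1r polyCN.
apply: le_trans (coef_prod_le (m := 1) _ _ _) _ => // [i ir|]; first by rewrite nvN; apply: hs.
by rewrite big1.
Qed.

(* The product of the roots of maximal absolute value strictly dominates the
   other products of as many roots, so Hensel's lemma puts it in [N]. *)
Lemma hensel_equal_roots P z t : irr N P -> P \is monic -> root P z -> root P t -> nv O z = nv O t.
move=> iP mP; have [NP sP irP] := iP.
have [rs eP] := monic_roots mP.
pose n := size rs; pose w (i : 'I_n) := rs`_i.
have eP' : P = \prod_i ('X - (w i)%:P) by rewrite eP (big_nth 0) big_mkord.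
have [i0 _ hmax] : exists2 i0 : 'I_n, true & forall i, w i <=_[O] w i0.
  have n0 : (0 < n)%N by move: sP; rewrite eP size_prod_XsubC.
  suff [i0] : exists i0 : 'I_n, forall i, w i <=_[O] w i0 by exists i0.
  have : [arg max_(i > Ordinal n0 | true) (nv O (w i))]%O = [arg max_(i > Ordinal n0 | true) (nv O (w i))]%O by [].
  by case: arg_maxP => // i0 _ h _; exists i0 => i; apply: h.
pose T := [set i | nv O (w i) == nv O (w i0)].
suff T_all : T = [set: 'I_n].
  have wT i : nv O (w i) = nv O (w i0) by have : i \in T; [rewrite T_all inE | rewrite inE => /eqP].
  have hroot x : root P x -> nv O x = nv O (w i0) by (rewrite eP root_prod_XsubC => /(nthP 0)[i ir <-]; apply: (wT (Ordinal ir))).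
  by move=> /hroot -> /hroot ->.
have [wi0|wi0] := eqVneq (w i0) 0.
  apply/setP => i; rewrite !inE; have := hmax i; rewrite wi0 nv_le0 => /eqP ->; exact: eqxx.
have Nz : \prod_i ('X - (w i)%:P) \over N by rewrite -eP'.
pose r := #|T|; pose beta (h : {set 'I_n}) := \prod_(i in h) w i.
have betaT0 : beta T != 0 by (apply/prodf_neq0 => i; rewrite inE -(nv_eq0 O) => /eqP ->; rewrite nv_eq0).
have card_w (h : {set 'I_n}) : \prod_(i <- enum h) w i0 = w i0 ^+ #|h| by rewrite big_enum prodr_const.
have nvT : nv O (beta T) = nv O (w i0 ^+ r).
  rewrite -card_w /beta -big_enum /=; apply/le_anti/andP; split; apply: nv_prod_le => i.
    by [].
  by rewrite mem_enum inE => /eqP ->.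
have beta_lt (h : {set 'I_n}) : #|h| = r -> h != T -> beta h <_[O] beta T.
  move=> hr hT; have /subsetPn[i ih iT] : ~~ (h \subset T).
    by apply: contra hT => hT; rewrite eqEcard hT hr leqnn.
  rewrite nvT -hr -card_w /beta -big_enum /=.
  apply: (nv_prod_lt (k := i)) => [j _|j _||]; [exact: hmax|exact: wi0|by rewrite mem_enum|].
  by rewrite lt_neqAle hmax andbT; move: iT; rewrite inE.
pose s := \sum_(h : {set 'I_n} | #|h| == r) beta h.
have sN : s \in N.
  have := mesym_in Nz r; rewrite rmorph_sum; congr (_ \in N); apply: eq_bigr => h _.
  by rewrite rmorph_prod; apply: eq_bigr => i _; rewrite /= mmapX mmap1U.
have sT : s - beta T <_[O] beta T.
  rewrite /s (bigD1 T) //= addrAC subrr add0r; apply: nv_lt_sum => // h /andP[/eqP hr hT].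
  exact: beta_lt.
have nvs : nv O s = nv O (beta T) by rewrite -(rveq_nv (rveq_lt sT)).
have s0 : s != 0 by rewrite -(nv_eq0 O) nvs nv_eq0.
(* The sum [s] has the leading term of [beta T]; after division by [s] one root is congruent to 1
   and the others are small, so 1 is a simple approximate root. *)
pose R1 := \prod_(h : {set 'I_n} | #|h| == r) ('X - (beta h / s)%:P).
have NR1 : R1 \over N.
  have NR := subset_product_in Nz r; set R := \prod_(h | _) _ in NR.
  suff -> : R1 = (\prod_(h : {set 'I_n} | #|h| == r) (s^-1)%:P) * (R \Po (s *: 'X)).
    apply: rpredM; first by apply: rpred_prod => h _; rewrite polyOverC rpredV.
    by rewrite polyOver_comp // polyOverZ //; exact: polyOverX.
  rewrite rmorph_prod -big_split; apply: eq_bigr => h _.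
  rewrite rmorphB /= comp_polyX comp_polyC mulrBr mul_polyC scalerA mulVf // scale1r.
  by rewrite -polyCM mulrC.
have g1 : 1 - beta T / s <_[O] 1 by rewrite -[X in X - _](divff s0) -mulrBl nv_lt_divl // mul1r nvs.
have gle (h : {set 'I_n}) : #|h| == r -> beta h / s <=_[O] 1.
  move=> /eqP hr; rewrite nv_le_divl // mul1r nvs; have [->//|hT] := eqVneq h T.
  by apply: ltW; apply: beta_lt.
have glt (h : {set 'I_n}) : #|h| == r -> h != T -> beta h / s <_[O] 1 by (move=> /eqP hT; rewrite nv_lt_divl // mul1r nvs; apply: beta_lt).
pose H := \prod_(k : {set 'I_n} | (#|k| == r) && (k != T)) ('X - (beta k / s)%:P).
have eR1 : R1 = ('X - (beta T / s)%:P) * H by rewrite /R1 (bigD1 T).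
have Hle i : H`_i <=_[O] 1 by (apply: coef_roots_le => h /andP[hr _]; apply: gle).
have H1 : nv O H.[1] = nv O 1.
  rewrite horner_prod big_mkcond (@nv_prod_eq _ _ _ _ _ (fun=> 1)) ?big1 // => k.
  case: ifP => // /andP[kr kT]; rewrite hornerXsubC nv_domB //; exact: glt.
have [b bN [R1b b1]] : exists2 b, b \in N & root R1 b /\ b - 1 <_[O] 1.
  apply: hN => //; rewrite ?rpred1 //.
  - by move=> i; apply: coef_roots_le => h /= hr; apply: gle.
  - rewrite eR1 hornerM hornerXsubC; apply: nv_ltM1 => //; apply: horner_int_le => //.
  - rewrite eR1 derivM derivXsubC mul1r hornerD hornerM hornerXsubC.
    rewrite nv_dom; rewrite H1 //; apply: nv_ltM1 => //; apply: horner_int_le => // i.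
    rewrite coef_deriv -mulr_natr; apply: nv_leM1 => //.
    by rewrite nv_le1 rpred_nat.
have eb : b = beta T / s.
  move: R1b; rewrite eR1 rootM root_XsubC => /orP[/eqP //|].
  rewrite /root horner_prod => /prodf_eq0[k /andP[kr kT]].
  rewrite hornerXsubC subr_eq0 => /eqP bk; have := glt k kr kT.
  by rewrite -bk (rveq_nv (rveq_lt b1)) ltxx.
have bTN : beta T \in N by rewrite -[beta T](divfK s0) -eb rpredM.
pose D := \prod_(k : {set 'I_n} | (#|k| == r) && (k != T)) (beta T - beta k).
have D0 : D != 0.
  apply/prodf_neq0 => k /andP[/eqP kr kT]; rewrite subr_eq0; apply/eqP => e.
  by have := beta_lt _ kr kT; rewrite e ltxx.
pose QT := \prod_(i in T) ('X - (w i)%:P).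
(* Interpolation at [beta T] shows that the factor of [P] with the roots of maximal absolute value
   is defined over [N]; by irreducibility it is all of [P]. *)
have fac j : QT`_j * D \in N.
  have := rpred_horner (subset_factor_in Nz r j) bTN; congr (_ \in N).
  rewrite horner_sum (bigD1 T) //= [X in _ + X]big1 ?addr0.
    rewrite hornerM hornerC horner_prod; congr (_ * _); apply: eq_bigr => k.
    by rewrite hornerXsubC.
  move=> h /andP[hr hT]; rewrite hornerM horner_prod (bigD1 T) ?eqxx 1?eq_sym //=.
  by rewrite hornerXsubC subrr mul0r mulr0.
have sQT : size QT = r.+1 by rewrite /QT -big_enum size_prod_XsubC -cardE.
have mQT : QT \is monic by apply: monic_prod_XsubC.
have DN : D \in N by have := fac r; rewrite -[r]/(r.+1.-1) -sQT -lead_coefE (monicP mQT) mul1r.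
have NQT : QT \over N by (apply/polyOverP => j; rewrite -[QT`_j](mulfK D0) rpredM ?rpredV).
have QTP : QT %| P by rewrite eP' (bigID (mem T)) dvdp_mulr.
have r0 : (0 < r)%N by apply/card_gt0P; exists i0; rewrite inE.
have QTeq : QT %= P by apply: irP; rewrite // sQT -lt0n.
have := eqp_size QTeq; rewrite sQT eP size_prod_XsubC => -[rn].
by apply/eqP; rewrite eqEcard finset.subsetT cardsT card_ord; apply: eq_leq.
Qed.
End EqualRoots.

(** * Separable degrees over the given field are prime to [p] *)

Section Index.
Variables (G : zmodType) (H : G -> Prop) (n p : nat).
Hypotheses (H0 : H 0) (HB : forall x y, H x -> H y -> H (x - y)).
Hypothesis idxH : has_index H n.
Hypotheses (pp : prime p) (Hp : forall g, H (g *+ p) -> H g).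

(* Cauchy's theorem in the group of translations of the quotient. *)
Lemma index_coprime : ~~ (p %| n)%N.
apply/negP => pn; have [r hr] := idxH.
have HN x : H x -> H (- x) by move=> h; rewrite -sub0r; apply: HB.
have HD x y : H x -> H y -> H (x + y) by move=> h h'; rewrite -[y]opprK; apply: HB => //; apply: HN.
have /choice[idx hidx] : forall g, exists i, H (g - r i) by move=> g; have [i [hi]] := hr g; exists i.
have idx_eq g i : H (g - r i) -> idx g = i by (move=> h; have [k [_ ku]] := hr g; rewrite -(ku _ (hidx g)) (ku _ h)).
have idx_eqH g g' : H (g - g') -> idx g = idx g'.
  move=> h; apply: idx_eq; have := HD _ _ h (hidx g').
  by rewrite addrA subrK.
have idx_inv g g' : idx g = idx g' -> H (g - g').
  move=> e; have := HB (hidx g) (hidx g'); rewrite e opprB addrA subrK //.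
have sig_inj g : injective (fun j => idx (g + r j)).
  move=> j k /idx_inv; rewrite opprD addrACA subrr add0r => h.
  by rewrite -(idx_eq (r j) j) ?subrr // (idx_eq (r j) k).
pose sig g : {perm 'I_n} := perm (@sig_inj g).
have sigE g j : sig g j = idx (g + r j) by rewrite permE.
have sigD g h : sig (g + h) = (sig h * sig g)%g.
  apply/permP => j; rewrite permM !sigE; apply: idx_eqH.
  rewrite -[g + h + r j]addrA opprD addrACA subrr add0r.
  by [].
have sig1 g : H g -> sig g = 1%g.
  move=> h; apply/permP => j; rewrite sigE perm1; apply: idx_eq.
  by rewrite addrK.
have sigH g : sig g = 1%g -> H g by (move=> e; have := hidx (g + r (idx 0)); rewrite -sigE e perm1 addrK).
pose S := [set sig (r i) | i : 'I_n].
have sigS g : sig g \in S.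
  apply/imsetP; exists (idx g) => //.
  have e : sig (g - r (idx g)) = 1%g by apply: sig1.
  by rewrite -[g in LHS](subrK (r (idx g))) sigD e mulg1.
have gS : group_set S.
  apply/group_setP; split; first by rewrite -(sig1 0).
  by move=> _ _ /imsetP[i _ ->] /imsetP[j _ ->]; rewrite -sigD.
have cS : #|S| = n.
  rewrite card_imset ?card_ord // => i j e.
  have k0 : H (r (idx 0)) by have := HN _ (hidx 0); rewrite sub0r opprK.
  have ek m : sig (r m) (idx 0) = m by rewrite sigE; apply: idx_eq; rewrite addrAC subrr add0r.
  by rewrite -(ek i) e.
have [] := @Cauchy _ p (Group gS) pp; first by rewrite cS.
move=> x xS ox; have /imsetP[i _ ex] := xS.
have sigX g m : sig (g *+ m) = (sig g ^+ m)%g.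
  elim: m => [|m IH]; first by rewrite expg0; apply: sig1.
  by rewrite mulrS sigD IH expgSr.
have : H (r i *+ p) by apply: sigH; rewrite sigX -ex -ox expg_order.
move/Hp/sig1; rewrite -ex => x1; move: ox; rewrite x1 order1 => p1.
by move: pp; rewrite -p1.
Qed.
End Index.

Section FinExt.
Variables (k l : fieldType) (rho : {rmorphism k -> l}) (n : nat).
Hypothesis deg : has_degree (fun a : l => exists x, a = rho x) n.

Definition extC : Type := l.

HB.instance Definition _ := GRing.Field.on extC.

Definition ext_scale (a : k) (u : extC) : extC := rho a * u.

Fact ext_scaleA a b u : ext_scale a (ext_scale b u) = ext_scale (a * b) u.
by rewrite /ext_scale rmorphM mulrA. Qed.

Fact ext_scale1 u : ext_scale 1 u = u.
by rewrite /ext_scale rmorph1 mul1r. Qed.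

Fact ext_scaleDr a u v : ext_scale a (u + v) = ext_scale a u + ext_scale a v.
exact: mulrDr. Qed.

Fact ext_scaleDl v a b : ext_scale (a + b) v = ext_scale a v + ext_scale b v.
by rewrite /ext_scale rmorphD mulrDl. Qed.

HB.instance Definition _ := GRing.Zmodule_isLmodule.Build k extC ext_scaleA ext_scale1 ext_scaleDr ext_scaleDl.

Fact ext_scaleAl a (u v : extC) : a *: (u * v) = (a *: u) * v.
exact: mulrA. Qed.

HB.instance Definition _ := GRing.Lmodule_isLalgebra.Build k extC ext_scaleAl.

Fact ext_scaleAr a (u v : extC) : a *: (u * v) = u * (a *: v).
exact: mulrCA. Qed.

HB.instance Definition _ := GRing.Lalgebra_isAlgebra.Build k extC ext_scaleAr.

Lemma ext_basis : exists b : 'I_n -> extC, forall y : extC, exists! r : 'rV[k]_n, y = \sum_i r 0 i *: b i.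
have [b hb] := deg; exists b => y; have [c [[ck ey] uc]] := hb y.
have /choice[r hr] := ck; exists (\row_i r i); split.
  by rewrite ey; apply: eq_bigr => i _; rewrite mxE [c 0 i]hr.
move=> r' ey'; have h : c = \row_i rho (r' 0 i).
  apply: uc; split=> [j|]; first by exists (r' 0 j); rewrite mxE.
  by rewrite [LHS]ey'; apply: eq_bigr => j _; rewrite mxE.
by apply/rowP => i; rewrite mxE; apply: (fmorph_inj rho); rewrite -hr h mxE.
Qed.

Lemma ext_vector : Vector.axiom n extC.
have [b hb] := cid ext_basis.
pose r2v (v : 'rV[k]_n) : extC := \sum_i v 0 i *: b i.
have r2v_lin : linear r2v.
  move=> a u v; rewrite scaler_sumr -big_split /=; apply: eq_bigr => i.
  by rewrite scalerA -scalerDl !mxE.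
pose r2vL : {linear _ -> _} := HB.pack r2v (GRing.isLinear.Build _ _ _ _ r2v r2v_lin).
pose v2r y := sval (cid (hb y)).
have v2rK : cancel v2r r2vL by move=> y; rewrite /v2r; case: cid => r [].
have : cancel r2v v2r by (move=> r; have [_ ur] := svalP (cid (hb (r2v r))); apply: ur).
by exists v2r; [apply: can2_linear v2rK | exists r2v].
Qed.

HB.instance Definition _ := Lmodule_hasFinDim.Build k extC ext_vector.

Lemma finite_extension_type : exists L : fieldExtType k, \dim {: L} = n.
by exists extC; rewrite dimvf. Qed.
End FinExt.

Section PerfectField.
Variables (k : fieldType) (p : nat).
Hypotheses (pk : p \in [pchar k]) (perf : perfect_field k).

(** An inseparable minimal polynomial would be one in [X ^+ p], hence the [p]-th power of a
    polynomial over [k] that has the same root and smaller degree. *)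
Lemma perfect_separable (L : fieldExtType k) : separable 1 {: L}.
have pp : prime p := pcharf_prime pk.
have pL : p \in [pchar L] by rewrite (fmorph_pchar (in_alg L)).
apply/separableP => x _; apply: contrapT => /negP /separablePn_pchar[q qL [g gK em]].
have eqp : q = p by apply/eqP; rewrite -[_ == _]/(q \in (p : nat_pred)) -(pcharf_eq pL).
have /polyOver1P[g0 eg] := gK.
have /choice[h hh] := fun i => perf pk g0`_i.
pose S := map_poly (in_alg L) (\poly_(i < size g0) h i).
have eS : g \Po 'X^q = S ^+ p.
  rewrite eqp eg -rmorphXn -[X in _ \Po X](map_polyXn (in_alg L)) -map_comp_poly; congr (_ _).
  have pkX : p \in [pchar {poly k}] by rewrite pchar_poly.
  rewrite poly_def comp_polyE.
  rewrite (big_morph (fun y : {poly k} => y ^+ p) (id1 := 0) (op1 := +%R)).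
  - by apply: eq_bigr => i _; rewrite exprZn hh -!exprM mulnC.
  - by move=> y z; rewrite -!(pFrobenius_autE) rmorphD.
  - by rewrite expr0n gtn_eqF ?prime_gt0.
have Sx : root S x.
  have := root_minPoly 1 x; rewrite em eS /root horner_exp expf_eq0 => /andP[//].
have S1 : S \over 1%VS by apply/polyOver1P; exists (\poly_(i < size g0) h i).
have := minPoly_dvdp S1 Sx; rewrite em eS => dv.
have S0 : S != 0 by apply: contraTneq (monic_minPoly 1 x) => S0; rewrite em eS S0 expr0n gtn_eqF ?prime_gt0 // monicE lead_coef0 eq_sym oner_eq0.
have := dvdp_leq S0 dv; rewrite leqNgt => /negP.
have sS : (1 < size S)%N by rewrite (root_size_gt1 S0 Sx).
have : ((size S).-1 < (size S).-1 * p)%N by rewrite -[X in (X < _)%N]muln1 ltn_pmul2l ?prime_gt1 // -subn1 subn_gt0.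
have es := size_exp.
rewrite -es; case: (size) (size (S ^+ p)) => [|m] [] //=.
Qed.
End PerfectField.

Section Morphisms.
Variables (A E1 E2 : fieldType) (j1 : {rmorphism A -> E1}) (j2 : {rmorphism A -> E2}).
Variables (O1 : valring E1) (O2 : valring E2).
Hypothesis j12 : forall x, (j1 x \in O1) = (j2 x \in O2).

Lemma nv_morph_le x y : (j1 x <=_[O1] j1 y) = (j2 x <=_[O2] j2 y).
by rewrite !nvE !fmorph_eq0 -!fmorph_div j12. Qed.
Lemma nv_morph_lt x y : (j1 x <_[O1] j1 y) = (j2 x <_[O2] j2 y).
by rewrite !ltNge nv_morph_le. Qed.

Lemma nv_morph_eq x y : (nv O1 (j1 x) == nv O1 (j1 y)) = (nv O2 (j2 x) == nv O2 (j2 y)).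
by rewrite !eq_le !nv_morph_le. Qed.
End Morphisms.

Section Copy.
Variables (K : fieldType) (O : valring K) (F : subfield K).
Variables (E : closedF) (i : {rmorphism sfT F -> E}) (V : valring E).
Hypothesis iV : forall x, (i x \in V) = ((val : {rmorphism sfT F -> K}) x \in O).

Lemma copy_hensel : hensel_in O F -> hensel_in V (imA i).
move=> hF R u /imA_polyOver[R' eR] cR /imAP[a eu]; rewrite eu eR -(rmorph1 i) => u1.
rewrite deriv_map !horner_map (nv_morph_lt iV) => Ru /eqP; rewrite (nv_morph_eq iV) /= => /eqP Ru'.
have [||||||b bF [rb hb]] := hF (map_poly val R') (val a).
- by apply/over_sfP; exists R'.
- move=> k'; have := cR k'; rewrite eR !coef_map -(rmorph1 i) (nv_morph_le iV) /=; exact.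
- exact: valP.
- by move: u1; rewrite (nv_morph_le iV).
- by rewrite horner_map.
- by rewrite deriv_map horner_map.
exists (i (Sub b bF)); first by apply/imAP; exists (Sub b bF).
split; last by rewrite -rmorphB (nv_morph_lt iV).
rewrite /root horner_map fmorph_eq0; move: rb; rewrite /root -[b]/((val : {rmorphism sfT F -> K}) (Sub b bF)).
by rewrite horner_map.
Qed.

Lemma copy_irr Q : irr (imA i) (map_poly i Q) <-> irr F (map_poly val Q).
split=> -[_ sP iP]; split; rewrite ?size_map_poly // in sP *.
- by apply/over_sfP; exists Q.
- move=> R /over_sfP[R' ->]; rewrite dvdp_map size_map_poly eqp_map => sR.
  have := iP (map_poly i R'); rewrite dvdp_map size_map_poly eqp_map; apply=> //.
  by apply/polyOverP => j; rewrite coef_map; apply/imAP; exists R'`_j.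
- by apply/polyOverP => j; rewrite coef_map; apply/imAP; exists Q`_j.
- move=> R /imA_polyOver[R' ->]; rewrite dvdp_map size_map_poly eqp_map => sR.
  have := iP (map_poly val R'); rewrite dvdp_map size_map_poly eqp_map; apply=> //.
  by apply/over_sfP; exists R'.
Qed.
End Copy.

Section Slope.
(** If [n] roots have the same absolute value [r], the constant coefficient has absolute value
    [r ^ n] and the one of index [k] at most [r ^ (n - k)]: the Newton polygon has one slope. *)
Lemma equal_roots_slope (E : closedF) V (P : {poly E}) k : P \is monic ->
  (1 < size P)%N -> (forall z t, root P z -> root P t -> nv V z = nv V t) -> P`_k ^+ (size P).-1 <=_[V] P`_0 ^+ ((size P).-1 - k).
move=> mP sP eqr; have [rs eP] := monic_roots mP.
have en : (size P).-1 = size rs by rewrite eP size_prod_XsubC.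
have [z0 rz0] := size_gt1_root sP.
have rr z : z \in rs -> nv V z = nv V z0 by (move=> h; apply: eqr => //; rewrite eP root_prod_XsubC).
have n0 : (0 < (size P).-1)%N by rewrite -ltnS prednK // ltnW.
have [kn|kn] := ltnP (size P).-1 k.
  have -> : P`_k = 0 by apply: nth_default; rewrite -[size P]prednK // ltnW.
  by rewrite expr0n gtn_eqF // nv_ge0.
have [z00|z00] := eqVneq z0 0.
  have eX : P = 'X^((size P).-1).
    rewrite en [LHS]eP -[size rs](count_predT) -iter_mulr_1 -big_const_seq.
    apply: eq_big_seq => z /rr; rewrite z00 => /eqP; rewrite nv_eq0 => /eqP ->.
    by rewrite subr0.
  rewrite [in P`_k]eX coefXn; case: eqP => [->|_]; first by rewrite expr1n subnn.
  by rewrite expr0n gtn_eqF // nv_ge0.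
have prodE s : (forall z, z \in s -> nv V z = nv V z0) -> nv V (\prod_(z <- s) (0 - z)) = nv V (z0 ^+ size s).
  elim: s => [|z s IH] h; first by rewrite big_nil.
  rewrite big_cons exprS; apply: nv_eqM; first by rewrite sub0r nvN h ?mem_head.
  by apply: IH => t ts; apply: h; rewrite inE ts orbT.
have P0 : nv V P`_0 = nv V (z0 ^+ (size P).-1).
  rewrite -horner_coef0 eP horner_prod -eP en -(prodE rs rr).
  by congr nv; apply: eq_bigr => z _; rewrite !hornerE.
have : P`_k <=_[V] z0 ^+ ((size P).-1 - k).
  rewrite -(nv_leM2r V _ _ (expf_neq0 k z00)) -exprD subnK // -P0.
  have := @tc_far_le _ V rs 0 z0 k; rewrite -eP horner_coef0 /tc addr0 comp_polyXr; apply.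
  by move=> w /rr e; rewrite sub0r nvN e.
rewrite (nv_eqX _ P0) -exprM mulnC exprM; exact: nv_leX.
Qed.

Variables (K : fieldType) (O : valring K).
Hypothesis hens : henselian O.

(** The roots are compared in the valued closure of a countable subfield that contains the
    coefficients; irreducibility descends to this subfield, and [hensel_equal_roots] applies. *)
Lemma hensel_slope P k : P \is monic -> irreducible_poly P -> P`_k ^+ (size P).-1 <=_[O] P`_0 ^+ ((size P).-1 - k).
move=> mP iP; have [F [cF PF _ hF _]] := elementary_subfield hens (fun n => P`_n).
have [E [i [V [hV _]]]] := valued_closure O cF.
have /over_sfP[Q eQ] : P \over F by apply/polyOverP.
have iV x : (i x \in V) = (val x \in O) by [].
have hN := copy_hensel iV hF.
have iPi : irr (imA i) (map_poly i Q).
  apply/copy_irr; rewrite -eQ; split=> [||R _ dR sR]; first exact/polyOverP.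
    by case: iP.
  by case: iP => _; apply.
have mQ : map_poly i Q \is monic by move: mP; rewrite eQ !map_monic.
have sQ : size (map_poly i Q) = size P by rewrite eQ !size_map_poly.
have := @equal_roots_slope E V (map_poly i Q) k mQ; rewrite sQ; case: (iP) => sP _ /(_ sP).
rewrite eQ !coef_map -!rmorphXn (nv_morph_le iV).
by apply=> rz rt; apply: (hensel_equal_roots hN).
Qed.

Lemma nv_ltXn m n x : 1 <_[O] x -> (m < n)%N -> x ^+ m <_[O] x ^+ n.
move=> x1 mn; have x0 : x != 0 by apply: contraTneq x1 => ->; rewrite -leNgt nv_ge0.
by rewrite -(subnK (ltnW mn)) exprD -[X in (nv O X < _)%O]mul1r nv_ltM2r ?expf_neq0 // nv_gtX1 ?subn_gt0.
Qed.
End Slope.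

Section ValueGroup.
Variables (K : fieldType) (O : valring K).

Lemma nzval_nv x y : nzval O x = nzval O y <-> nv O (val x) = nv O (val y).
rewrite nzval_eq /veq /vunit mulf_neq0 ?invr_neq0 ?(valP x) ?(valP y) //= invfM invrK [_^-1 * _]mulrC.
have := nvE O (val x) (val y); have := nvE O (val y) (val x).
rewrite !ifN ?(valP x) ?(valP y) // => <- <-; rewrite -eq_le.
by split=> [/eqP|->].
Qed.

Lemma nzvalX (x : nonzero K) n : exists2 z, val z = val x ^+ n & nzval O x *+ n = nzval O z.
elim: n => [|n [z ez IH]]; first by exists (nz1 K).
by exists (nzM x z); [rewrite exprS -ez | rewrite mulrS IH; apply: nzvalM].
Qed.

Lemma nzvalB x y : nzval O x - nzval O y = nzval O (nzM x (nzV y)).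
by rewrite -nzvalM -nzvalV. Qed.
End ValueGroup.

Section Prolongation.
Variables (K : fieldType) (O : valring K) (L : fieldExtType K) (W : valring L).
Hypothesis OW : prolongs O W.

Let OW' x : (in_alg L x \in W) = ((idfun : {rmorphism K -> K}) x \in O).
exact: OW. Qed.

Lemma prolong_le x y : (x%:A <=_[W] y%:A) = (x <=_[O] y).
exact: nv_morph_le OW' x y. Qed.
Lemma prolong_lt x y : (x%:A <_[W] y%:A) = (x <_[O] y).
exact: nv_morph_lt OW' x y. Qed.
Lemma prolong_eq x y : (nv W x%:A == nv W y%:A) = (nv O x == nv O y).
exact: nv_morph_eq OW' x y. Qed.

(** The right-hand side does not mention [W]: over a henselian field the prolongation is unique. *)
Lemma mem_prolongation (hens : henselian O) y q : q \is monic -> irreducible_poly q ->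
  root (map_poly (in_alg L) q) y -> (y \in W) = (q`_0 \in O).
move=> mq iq ry; have slope k := hensel_slope hens k mq iq.
have n0 : (0 < (size q).-1)%N by case: iq => sq _; rewrite -ltnS prednK // ltnW.
apply/idP/idP => [yW|qO].
  apply: contraLR isT => q0.
  have q0' : 1 <_[O] q`_0 by rewrite ltNge nv_le1.
  have q00 : q`_0 != 0 by apply: contraNneq q0 => ->; apply: rpred0.
  have small k : (0 < k)%N -> q`_k <_[O] q`_0.
    move=> k0; rewrite -(nv_ltX2 O _ _ n0); apply: le_lt_trans (slope k) _.
    by apply: nv_ltXn => //; rewrite ltn_subrL k0.
  move: ry; rewrite /root horner_coef size_map_poly; case: (size) n0 => [|m _] => //.
  rewrite big_ord_recl mulr1 addrC => /eqP r0.
  suff lt0 : \sum_(i < m) (map_poly (in_alg L) q)`_(lift ord0 i) * y ^+ lift ord0 i <_[W] (map_poly (in_alg L) q)`_0.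
    have /eqP := nv_dom lt0; rewrite addrC r0 eq_sym nv_eq0 coef_map fmorph_eq0.
    by rewrite (negbTE q00).
  apply: nv_lt_sum => [|i _]; first by rewrite coef_map fmorph_eq0.
  rewrite -[X in (_ < nv W X)%O]mulr1; apply: nv_ltM_le; rewrite ?oner_eq0 //.
    by rewrite !coef_map prolong_lt small.
  by rewrite nv_leX1 // nv_le1.
suff : y <=_[W] 1 by rewrite -nv_le1.
have hm : map_poly (in_alg L) q \is monic by rewrite map_monic.
refine (monic_root_le1 hm _ ry) => k.
 rewrite coef_map /=; have := prolong_le q`_k 1; rewrite scale1r => ->.
rewrite -(nv_leX2 O _ _ n0) expr1n; apply: le_trans (slope k) _.
by rewrite nv_leX1 // nv_le1.
Qed.

(** If [p] times a value lies in the value group of [K], it is [p] times an element of that group,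
    and value groups are torsion-free; so the quotient has no element of order [p]. *)
Lemma value_subgroup_coprime p n : prime p -> (forall g : valueGroup O, exists h, g = h *+ p) ->
  ramification_index W n -> ~~ (p %| n)%N.
move=> pp divO idx; apply: (index_coprime _ _ idx pp).
- by exists (nz1 L) => //; exists 1; rewrite scale1r.
- move=> _ _ [x -> [a ea]] [y -> [b eb]]; exists (nzM x (nzV y)); first exact: nzvalB.
  by exists (a / b); rewrite /= ea eb -(fmorph_div (in_alg L)).
- move=> g [y ey [a ea]].
  have [z eg] := nzval_surj g; have [z' ez' ez] := nzvalX W z p.
  have a0 : a != 0 by have := valP y; rewrite ea /=; apply: contraNneq => ->; rewrite scale0r.
  have [h eh] := divO (nzval O (exist _ a a0)).
  have [b eb] := nzval_surj h; have [b' eb'] := nzvalX O b p.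
  have b0 : (val b)%:A != 0 :> L by rewrite scaler_eq0 negb_or (valP b) oner_eq0.
  exists (exist _ (val b)%:A b0); last by exists (val b).
  rewrite eg; apply/nzval_nv => /=; apply/eqP; rewrite -(nv_eqX2 W _ _ (prime_gt0 pp)) -ez'.
  have /nzval_nv -> : nzval W z' = nzval W y by rewrite -ez -eg.
  rewrite ea -(rmorphXn (in_alg L)) prolong_eq -eb'; apply/eqP.
  by have /nzval_nv : nzval O (exist _ a a0) = nzval O b' by rewrite eh eb.
Qed.

Definition vring_lift (x : vring O) : vring W := exist _ (val x)%:A (etrans (OW (val x)) (valP x)).

Lemma vring_liftB x y : vring_lift (x - y) = vring_lift x - vring_lift y.
by apply: val_inj; apply: scalerBl. Qed.
Lemma residue_surj (a : residueField O) : exists x, a = residue x.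
by have := reprK a; exists (repr a). Qed.

Definition resmap (a : residueField O) : residueField W := residue (vring_lift (sval (cid (residue_surj a)))).

Lemma resmapE x : resmap (residue x) = residue (vring_lift x).
apply/eqP; rewrite /resmap; case: cid => y /= /eqP exy.
rewrite -subr_eq0 -rmorphB -vring_liftB residue_eq0.
have := prolong_lt (val y - val x) 1; rewrite scale1r => ->.
have : residue (y - x) == 0 by rewrite rmorphB subr_eq0 eq_sym.
by rewrite residue_eq0.
Qed.

Lemma resmap_nmod : nmod_morphism resmap.
split.
  rewrite -(rmorph0 (@residue K O)) resmapE -(rmorph0 (@residue L W)); congr residue; apply: val_inj.
  by rewrite /= scale0r.
move=> a b; have [x ->] := residue_surj a; have [y ->] := residue_surj b.
rewrite -rmorphD !resmapE -rmorphD; congr residue; apply: val_inj.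
by rewrite /= scalerDl.
Qed.

Lemma resmap_monoid : monoid_morphism resmap.
split.
  rewrite -(rmorph1 (@residue K O)) resmapE -(rmorph1 (@residue L W)); congr residue; apply: val_inj.
  by rewrite /= scale1r.
move=> a b; have [x ->] := residue_surj a; have [y ->] := residue_surj b.
rewrite -rmorphM !resmapE -rmorphM; congr residue; apply: val_inj.
by rewrite /= -(rmorphM (in_alg L)).
Qed.

HB.instance Definition _ := GRing.isNmodMorphism.Build _ _ resmap resmap_nmod.
HB.instance Definition _ := GRing.isMonoidMorphism.Build _ _ resmap resmap_monoid.

Lemma residue_subfieldE a : residue_subfield O a <-> exists b, a = resmap b.
split=> [[y -> [x xO ey]]|[b ->]].
  exists (residue (exist _ x xO : vring O)); rewrite resmapE; congr residue.
  exact: val_inj.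
have [x ->] := residue_surj b; rewrite resmapE; exists (vring_lift x) => //.
by exists (val x); first exact: valP.
Qed.

(** The residue extension is separable because the residue field is perfect; were its degree
    divisible by [p], it would be an excluded one. *)
Lemma inertia_coprime p n : p \in [pchar residueField O] -> perfect_field (residueField O) ->
  ~ (exists l : fieldExtType (residueField O), [/\ separable 1 {: l}, (1 < \dim {: l})%N & (p %| \dim {: l})%N]) ->
  (0 < n)%N -> inertia_degree O W n -> ~~ (p %| n)%N.
move=> pO perf nex n0 deg; apply/negP => pn; apply: nex.
have [|l dl] := @finite_extension_type _ _ resmap n.
  have [b hb] := deg; exists b => y; have [c [[hc ey] uc]] := hb y; exists c; split.
    by split=> // i; apply/residue_subfieldE.
  by move=> c' [hc' ey']; apply: uc; split=> // i; apply/residue_subfieldE.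
exists l; rewrite dl; split=> //; first exact: perfect_separable pO perf l.
exact: leq_trans (prime_gt1 (pcharf_prime pO)) (dvdn_leq n0 pn).
Qed.
End Prolongation.

(** The prolongation being unique, defectlessness equates the degree with a single product of
    ramification index and inertia degree, and the Kaplansky condition makes both factors prime to
    [p]. *)
Theorem separable_degree_coprime (p : nat) (K : fieldType) (O : valring K) (P : {poly K}) :
  p \in [pchar residueField O] -> separably_defectless O -> kaplansky O -> henselian O ->
  P \is monic -> irreducible_poly P -> separable_poly P -> ~~ (p %| (size P).-1)%N.
move=> pO defO [q [qO divO perf nex]] hens mP iP sP.
have eqp : q = p by apply/eqP; rewrite -[_ == _]/(q \in (p : nat_pred)) -(pcharf_eq pO).
rewrite {}eqp {q} in qO divO nex.
have [L dL [z rz genz]] := irredp_FAdjoin iP.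
have sepL : separable 1 {: L}.
  rewrite -genz -adjoin_separable_eq.
  have : minPoly 1 z %| map_poly (in_alg L) P by apply: minPoly_dvdp => //; apply/polyOver1P; exists P.
  by move/dvdp_separable; apply; rewrite separable_map.
have [r [w [e [f [prol wI _ wef dim]]]]] := defO L sepL.
have minp y : exists q, [/\ q \is monic, irreducible_poly q & root (map_poly (in_alg L) q) y].
  have /polyOver1P[q eq] := minPolyOver 1 y.
  exists q; rewrite -eq root_minPoly; split=> //; first by rewrite -(map_monic (in_alg L)) -eq monic_minPoly.
  split=> [|R sR dR]; first by rewrite -(size_map_poly (in_alg L)) -eq size_minPoly.
  rewrite -(eqp_map (in_alg L)).
  have := @minPoly_irr _ _ 1 y (map_poly (in_alg L) R); rewrite eq dvdp_map => /(_ _ dR).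
  have -> : map_poly (in_alg L) R \over 1%AS by apply/polyOver1P; exists R.
  case/(_ isT)/orP => //; rewrite -size_poly_eq1 size_map_poly => h.
  by rewrite h in sR.
have w_eq i j : w i =i w j.
  move=> y; have [q [mq iq ry]] := minp y.
  by rewrite (mem_prolongation (prol i) hens mq iq ry) (mem_prolongation (prol j) hens mq).
rewrite -dL dim; have : (0 < \dim {: L})%N by rewrite dL; case: iP => s _; rewrite -ltnS prednK // ltnW.
rewrite dim; case: r w e f prol wI wef w_eq {dim} => [|[|r]] w e f prol wI wef w_eq; first by rewrite big_ord0.
  rewrite big_ord1 muln_gt0 => /andP[e0 f0]; have [he hf] := wef ord0.
  rewrite Euclid_dvdM ?(pcharf_prime pO) // negb_or (value_subgroup_coprime (prol ord0) (pcharf_prime pO) divO he).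
  exact: inertia_coprime hf.
by have := wI ord0 ord_max (w_eq _ _).
Qed.

Section Countable.
Variables (p : nat) (K : fieldType) (O : valring K).
Hypotheses (equicharO : equicharacteristic O p) (defectlessO : separably_defectless O).
Hypotheses (kaplanskyO : kaplansky O) (henselianO : henselian O) (nontrivialO : nontrivial O).

Lemma countable_model c0 : exists F (E : closedF) (i : {rmorphism sfT F -> E}) V,
  [/\ c0 \in F, ctbl (fun _ : E => True), p \in [pchar E], SG V p (imA i) & exists2 pi, pi \in imA i & pi != 0 /\ pi <_[V] 1]
  /\ [/\ forall phi (e : nat -> sfT F), satisfies (M := sub_struct O F) e phi <->
        satisfies (M := valued_field_structure O) (fun n => val (e n)) phi & forall x, (i x \in V) = (val x \in O)].
have [t tO] := nontrivialO.
have [F [cF cin elF hF iF]] := elementary_subfield henselianO (fun n => if n is 0 then c0 else t).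
have [E [i [V [hV cE]]]] := valued_closure O cF.
have iV x : (i x \in V) = (val x \in O) by [].
exists F, E, i, V; split => //.
have [pk] := equicharO.
split=> //; first exact: (cin 0%N).
- by rewrite (fmorph_pchar i) -(fmorph_pchar val).
- move=> P iP mP sP; split; last first.
    by move=> rz ru; apply: (hensel_equal_roots (copy_hensel iV hF)).
  have [/imA_polyOver[Q eQ] _ _] := iP; rewrite eQ in iP mP sP *.
  rewrite size_map_poly -(size_map_poly val).
  apply: (@separable_degree_coprime p K O) => //.
  + by rewrite map_monic -(map_monic i).
  + by have := copy_irr i Q; move=> [+ _] => /(_ iP); apply: iF.
  + by rewrite separable_map -(separable_map i).
have tF : t \in F := cin 1%N.
have : t != 0 by apply: contraNneq tO => ->; apply: rpred0.
exists (i (Sub t tF)^-1); first by apply/imAP; exists (Sub t tF)^-1.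
have i0 : i (Sub t tF) != 0 by rewrite fmorph_eq0.
rewrite fmorphV invr_eq0 i0; rewrite nv_inv_lt1 //.
by rewrite hV.
Qed.
End Countable.

(** * Transitivity of separability *)

Section SepTower.
Variables (E : fieldType) (p : nat) (pE : p \in [pchar E]) (N : subfield E).

Lemma sepmod_list (s : seq E) : (forall x, x \in s -> sepalg N x) ->
  exists n (u : 'I_n -> E), sepmod p N u /\ forall x, x \in s -> spans N u x.
elim: s => [_|x s IH h].
  have [n [u [su]]] := sepalg_sepmod pE (sepalg_base (rpred1 N)).
  by exists n, u.
have [n [u [su us]]] := IH (fun y ys => h y (mem_behead (s := x :: s) ys)).
have [m [v [sv]]] := sepalg_sepmod pE (h x (mem_head x s)).
have [k [w [sw wu wv]]] := sepmod_prod su sv.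
exists k, w; split=> // y; rewrite inE => /orP[/eqP->|ys].
  exact: spans_trans wv.
exact: spans_trans (us _ ys) wu.
Qed.

(** The products of a separable algebra containing the coefficients with powers of [z] form again
    such an algebra: the span of their [p]-th powers is a field that contains the coefficients and
    [z ^+ p], hence also [z]. *)
Lemma sepalg_trans (B : subfield E) z : {subset N <= B} -> (forall x, x \in B -> sepalg N x) -> sepalg B z -> sepalg N z.
move=> NB sB /sepalg_minpoly[P [iP mP sP rP]]; have [BP sizeP _] := iP.
have [n [u [su uP]]] := @sepmod_list P (fun x xP => sB x (allP BP x xP)).
have [u1 _ up] := su.
have uM x y := @sepmod_mul _ _ _ _ u x y su.
have uPk k : spans N u P`_k by (have [kP|kP] := ltnP k (size P); [apply/uP/mem_nth|rewrite nth_default //; apply: spans0]).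
have m0 : (0 < (size P).-1)%N by rewrite -subn1 subn_gt0.
pose m := (size P).-1.
pose v := pfam u (fun j : 'I_m => z ^+ j).
have vP x (j : 'I_m) : spans N u x -> spans N v (x * z ^+ j) by (move=> ux; apply: spans_product => //; apply: spans_id).
have zm : z ^+ m = - \sum_(k < m) P`_k * z ^+ k.
  apply/eqP; rewrite eq_sym eqr_oppLR -addr_eq0 -[z ^+ m]mul1r -(monicP mP).
  have eP : size P = m.+1 by rewrite prednK // ltnW.
  by move: rP; rewrite /root horner_coef eP big_ord_recr.
have vz x : spans N v x -> spans N v (x * z).
  move=> [a [aN ->]]; rewrite mulr_suml; apply: spans_sum => k _.
  rewrite -mulrA; apply: spansZ => //; rewrite /v /pfam; case: (enum_val) => i j.
  rewrite -mulrA -exprSr; have [jm|jm] := ltnP j.+1 m.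
    exact: (vP _ (Ordinal jm) (spans_id N u i)).
  have -> : j.+1 = m by apply/eqP; rewrite eqn_leq ltn_ord.
  rewrite zm mulrN -mulN1r; apply: spansZ; first by rewrite rpredN1.
  rewrite mulr_sumr; apply: spans_sum => l _; rewrite mulrA; apply: vP.
  by apply: uM => //; apply: spans_id.
have vX x k : spans N u x -> spans N v (x * z ^+ k).
  move=> ux; elim: k => [|k IH]; first by rewrite expr0; apply: (vP x (Ordinal m0)).
  by rewrite exprSr mulrA; apply: vz.
have vu x : spans N u x -> spans N v x by move/(vX x 0%N); rewrite mulr1.
have vM k l : spans N v (v k * v l) by (rewrite mulrACA -exprD; apply/vX/uM; apply: spans_id).
have vp x : spans N v x -> spans N (fun k => v k ^+ p) (x ^+ p).
  move=> [a [aN ->]]; rewrite -(pFrobenius_autE) rmorph_sum; apply: spans_sum => k _.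
  rewrite rmorphM /= !pFrobenius_autE; apply: spansZ; first exact: rpredX.
  exact: spans_id.
have fT : sfclosed (spans N (fun k => v k ^+ p)).
  apply: span_algebra_closed => [|x y [a [aN ->]] [b [bN ->]]].
    by rewrite -(expr1n _ p); apply/vp/vu.
  rewrite mulr_suml; apply: spans_sum => i _; rewrite mulr_sumr; apply: spans_sum => j _.
  by rewrite mulrACA -exprMn; apply: spansZ; [rewrite rpredM|apply: vp].
have uT x : spans N u x -> x \in sf_of fT.
  move=> ux; apply/sf_ofE; apply: spans_trans ux _ => i.
  by apply: spans_trans (up i) _ => j; apply/vp/vu/spans_id.
have PT : P \over (sf_of fT) by apply/polyOverP => k; apply/uT.
have zT : z \in sf_of fT.
  apply: (sepalg_pth_power pE (N := sf_of fT)) => //.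
    by exists P; split=> //; apply: coprimep_root rP; move: sP; rewrite separable_poly.unlock.
  by apply/sf_ofE/vp; have := vX 1 1%N u1; rewrite mul1r.
apply: (@sepmod_sepalg _ p pE N _ v); last by have := vX 1 1%N u1; rewrite mul1r.
split=> //; first exact: vu.
move=> k; apply/sf_ofE; rewrite rpredM ?rpredX //; exact/uT/spans_id.
Qed.
End SepTower.

(** * The equation [z ^+ q - z = g] and values not divisible by [q] *)

Section Ramification.
Variables (E : fieldType) (W : valring E) (D : subfield E) (q : nat).
Hypotheses (pq : prime q).

(** An equality would give a power of [t], with exponent prime to [q], the value of an element of
    [D]; a Bezout relation with [t ^+ q] would then do the same for [t]. *)
Lemma coset_distinct t d0 : d0 \in D -> nv W (t ^+ q) = nv W d0 -> (forall d, d \in D -> nv W t <> nv W d) ->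
  forall (i j : 'I_q) a b, a \in D -> b \in D -> i != j -> a * t ^+ i != 0 -> b * t ^+ j != 0 ->
  nv W (a * t ^+ i) != nv W (b * t ^+ j).
move=> dD tq nt i j a b; wlog ij : i j a b / (i < j)%N.
  move=> H aD bD; case: (ltngtP i j) => ij neq a0 b0; first exact: H.
    by rewrite eq_sym; apply: H => //; rewrite eq_sym.
  by move: neq; rewrite (val_inj ij) eqxx.
move=> aD bD _; rewrite !mulf_eq0 !negb_or => /andP[a0 ti] /andP[b0 tj].
apply/eqP => e.
have t0 : t != 0 by move: tj; rewrite expf_eq0; have := leq_ltn_trans (leq0n i) => ->.
have d00 : d0 != 0 by (apply: contraNneq t0 => d00; move/eqP: tq; rewrite d00 nv_eq0 expf_eq0 => /andP[]).
have k0 : (0 < j - i)%N by rewrite subn_gt0.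
have ek : nv W (t ^+ (j - i)) = nv W (a / b).
  apply/eqP; rewrite -(nv_eqM2r W _ _ ti) -exprD subnK ?(ltnW ij) //.
  rewrite -(nv_eqM2r W _ _ b0); apply/eqP.
  have -> : a / b * t ^+ i * b = a * t ^+ i by field.
  by rewrite mulrC.
have [r s ers _] := egcdnP q k0.
have g1 : gcdn (j - i) q = 1%N.
  apply/eqP; rewrite -/(coprime _ _) coprime_sym prime_coprime // gtnNdvd //.
  exact: leq_ltn_trans (leq_subr _ _) (ltn_ord j).
rewrite {}g1 in ers.
apply: (nt ((a / b) ^+ r / d0 ^+ s)); first by rewrite rpredM ?rpredV ?rpredX ?rpredM ?rpredV.
apply/eqP; rewrite -(nv_eqM2r W _ _ (expf_neq0 s d00)) divfK ?expf_neq0 //; apply/eqP.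
rewrite -(nv_eqX r ek) -exprM mulnC ers exprD mulnC exprM mulrC.
by apply: nv_eqM => //; apply: nv_eqX.
Qed.

Variables (pi y : E).
Hypotheses (piD : pi \in D) (piq : forall d, d \in D -> nv W pi <> nv W (d ^+ q)).
Hypothesis yq : nv W (y ^+ q) = nv W pi.

Lemma root_notin d : d \in D -> nv W y <> nv W d.
by move=> dD e; apply: (piq dD); rewrite -yq; apply: nv_eqX. Qed.
Lemma root_neq0 : y != 0.
by apply: contra_notN (root_notin (subfieldN0 D)) => /eqP ->. Qed.

Lemma root_powers_lfree : lfree D (fun i : 'I_q => y ^+ i).
move=> a aD; have := @sum_distinct _ W q (fun i => a i * y ^+ i).
case=> [i0 j0||[k [k0 _ ek]] e].
- exact: (coset_distinct piD yq root_notin).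
- move=> h _ i; have /eqP := h i; rewrite mulf_eq0 (negbTE (expf_neq0 i root_neq0)) orbF.
  exact: eqP.
- by move/esym/eqP: ek; rewrite e nv_eq0 (negbTE k0).
Qed.

(* Write [z = d_0 + u]: the value of [u] has order [q] modulo that of [D].  If
   [u] dominates, so is the value of [z]; otherwise the terms of degree less
   than [q] of the expansion at [d_0] dominate [u ^+ q]. *)
Lemma artin_schreier_descent g z : (2 < q)%N -> nv W q%:R = nv W 1 -> g \in D -> z ^+ q - z = g ->
  (1 <_[W] g -> exists2 d, d \in D & nv W g = nv W (d ^+ q)) -> spans D (fun i : 'I_q => y ^+ i) z -> z \in D.
move=> q2 nvq gD zg hg [a [aD ez]]; apply: contraT => zD.
have q0 : (0 < q)%N := prime_gt0 pq.
pose i0 := Ordinal q0; pose d0 := a i0; pose u := z - d0.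
have ud : exists (i : 'I_q) , [/\ i != i0, a i != 0 & nv W u = nv W (a i * y ^+ i)].
  pose b i := if i == i0 then 0 else a i.
  have b0 : b i0 = 0 by [].
  have bE i : i != i0 -> b i = a i by rewrite /b => /negbTE ->.
  have bD i : b i \in D by rewrite /b; case: ifP => // _; rewrite rpred0.
  have := @sum_distinct _ W q (fun i => b i * y ^+ i).
  have eu : \sum_(i < q) b i * y ^+ i = u.
    have := ez; rewrite (bigD1 i0) //= mulr1 -/d0 /u => ->.
    rewrite addrAC subrr add0r (bigD1 i0) //= mul0r add0r.
    by apply: eq_bigr => i /bE ->.
  rewrite eu; case=> [i j ij i1 j1|h|[k [k0 _ ek]]].
  - by apply: (coset_distinct piD yq root_notin (bD i) (bD j) ij i1 j1).
  - by move: zD; rewrite -(subrK d0 z) -/u -eu big1 // add0r aD.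
  - have ki : k != i0 by apply: contraNneq k0 => ->; rewrite b0 mul0r.
    exists k; split=> //; rewrite -(bE k ki) //.
    by apply: contraNneq k0 => ->; rewrite mul0r.
have [i [ii0 ai eu]] := ud.
have u0 : u != 0 by rewrite -(nv_gt0 W) eu nv_gt0 mulf_neq0 // expf_neq0 // root_neq0.
have uD d : d \in D -> nv W u <> nv W d.
  move=> dD; rewrite eu => e.
  have d1 : d != 0 by apply: contra_eq_neq e => ->; rewrite (nv_eq0) mulf_neq0 // expf_neq0 // root_neq0.
  have := coset_distinct piD yq root_notin (aD i) dD ii0.
  rewrite mulr1 mulf_neq0 ?expf_neq0 ?root_neq0 // d1 => /(_ isT isT).
  by rewrite e eqxx.
have uq : nv W (u ^+ q) = nv W (a i ^+ q * pi ^+ i).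
  rewrite (nv_eqX q eu) exprMn -exprM mulnC exprM; apply: nv_eqM => //; exact: nv_eqX.
have uqD : a i ^+ q * pi ^+ i \in D by rewrite rpredM ?rpredX.
have d0D : d0 \in D := aD i0.
have zu : z = d0 + u by rewrite addrC subrK.
case: (ltgtP (nv W d0) (nv W u)) => [lt|lt|e]; last by case: (uD _ d0D).
  have ezu : nv W z = nv W u by rewrite zu addrC nv_dom.
  case: (ltgtP (nv W z) (nv W 1)) => [z1|z1|e]; last by case: (uD _ (rpred1 D)); rewrite -ezu.
    case: (uD _ gD); rewrite -zg -ezu -opprB nvN nv_domB //.
    have z0 : z != 0 by rewrite -(nv_gt0 W) ezu nv_gt0.
    rewrite -[X in (_ < nv W X)%O]mulr1 -[q]prednK // exprS nv_ltM2l //.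
    by rewrite nv_ltX1 // -subn1 subn_gt0 ltnW.
  have zq : z <_[W] z ^+ q by rewrite -[X in (nv W X < _)%O]expr1; apply: nv_ltXn => //; apply: ltnW.
  have gz : nv W g = nv W (z ^+ q) by rewrite -zg nv_domB.
  have [|d dD] := hg; first by rewrite gz (lt_trans z1).
  by move/eqP; rewrite gz nv_eqX2 // => /eqP e; case: (uD _ dD); rewrite -ezu.
(* The coefficients of the expansion of [(d0 + u) ^+ q - (d0 + u) - g] in [u] below degree [q]. The
   terms have distinct values, as that of [u] has order [q] modulo [D], so they cannot cancel. *)
pose f (k : 'I_q) := 'C(q, k)%:R * d0 ^+ (q - k) - (k == 1%N :> nat)%:R - (k == 0%N :> nat)%:R * (d0 + g).
have fD k : f k \in D by rewrite !rpredB ?rpredM ?rpredX ?rpred_nat ?rpredD.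
have sf : \sum_k f k * u ^+ k = - u ^+ q.
  have pick j (F : 'I_q -> E) (jq : (j < q)%N)  : \sum_(k < q) (k == j :> nat)%:R * F k = F (Ordinal jq).
    rewrite (bigD1 (Ordinal jq)) //= eqxx mul1r big1 ?addr0 // => k kj.
    by rewrite -val_eqE in kj; rewrite (negbTE kj) mul0r.
  have : z ^+ q - z - g = 0 by rewrite -zg subrr.
  rewrite {1 2}zu exprDn big_ord_recr /= subnn mul1r binn mulr1n => e.
  under eq_bigr => k do rewrite !mulrBl -!mulrA.
  rewrite !sumrB (pick _ (fun k => u ^+ k) (ltnW q2)) (pick) mulr1 expr1.
  apply/eqP; rewrite -addr_eq0; apply/eqP; rewrite -[RHS]e.
  have -> : \sum_(k < q) 'C(q, k)%:R * (d0 ^+ (q - k) * u ^+ k) = \sum_(i < q) d0 ^+ (q - i) * u ^+ i *+ 'C(q, i).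
    by apply: eq_bigr => k _; rewrite mulr_natl.
  ring.
(* The term of index [q.-1] alone exceeds [u ^+ q]. As [2 < q], this index is not 1, whose
   coefficient also contains [-1]. *)
pose l := Ordinal (ltac:(by rewrite prednK) : (q.-1 < q)%N).
have fl : f l = q%:R * d0.
  rewrite /f /= -[q in 'C(q, _)]prednK // binSn -subn1 subKn //.
  by case: (q) q2 => [|[|[|m]]] // _; rewrite !mul0r !subr0.
have d00 : d0 != 0 by rewrite -(nv_gt0 W); apply: le_lt_trans (nv_ge0 W u) lt.
have fl0 : f l * u ^+ l != 0 by rewrite fl !mulf_neq0 ?expf_neq0 // -(nv_gt0 W) nvq nv_gt0 oner_eq0.
have := @sum_distinct _ W q (fun k => f k * u ^+ k).
case=> [j0 k0|h|[k [k0 kd ek]]].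
- exact: (coset_distinct uqD).
- by move: fl0; rewrite h eqxx.
have : f l * u ^+ l <=_[W] f k * u ^+ k.
  by have [->|/kd/ltW] := eqVneq l k.
rewrite -ek sf nvN leNgt; case/negP.
rewrite -[q in X in (X < _)%O]prednK // exprS fl nv_ltM2r ?expf_neq0 //.
by apply: (lt_le_trans lt); rewrite -[d0 in nv W d0]mul1r; apply: nv_leM; rewrite ?nvq.
Qed.
End Ramification.

(** * Coding finite sets by solvability of equations *)

Section CodedSets.
Variables (E : fieldType) (V : valring E) (M : subfield E) (q : nat) (c b1 : E).

Definition pole_free (g : E) := exists2 z, z \in M & z ^+ q - z = g.

(** Singles out the elements without poles: if [x] has a pole, multiplication by [x ^+ q] destroys
    solvability for a suitable [g]. *)
Definition const (x : E) : Prop := x \in V /\ forall g, g \in M -> g <_[V] 1 -> pole_free g -> pole_free (g * x ^+ q).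

(** The factor [1 / (c - b)] has a pole at the place [c = b], not divisible by [q], which [f ^+ q]
    must cancel; so [f] codes [b] by vanishing there. The auxiliary condition at [b1] controls the
    behaviour at infinity, where all [c - b] have the same value. *)
Definition codes (f b : E) := [/\ f != 0, f \in V, pole_free (f ^+ q / (c - b1)), const b & pole_free (f ^+ q / (c - b))].

Definition coded_sets (F : subfield E) := [/\ [/\ c \in M, b1 \in M, c != b1 & {in F, forall b, c != b}],
  forall x, x \in M -> const x <-> x \in F /\ x \in V,
  forall f, f \in M -> exists s : seq E, forall b, b \in M -> codes f b -> b \in s,
  exists2 f, f \in M & forall b, b \in M -> ~ codes f b & forall f b0, f \in M -> b0 \in M -> const b0 ->
    exists2 f', f' \in M & forall b, b \in M -> codes f' b <-> codes f b \/ b = b0].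
End CodedSets.

(** * The subfield of the ultrapower attached to the prime [q] *)

Section Tower.
Variables (E : closedF) (V : valring E) (p : nat) (pE : p \in [pchar E]).
Variables (F C L : subfield E) (cn : nat -> E).
Hypotheses (FC : {subset F <= C}) (FL : {subset F <= L}).
Hypothesis closC : forall P z, P \over C -> P != 0 -> root P z -> z \in C.
Hypothesis CL : forall x, x \in C -> x \in L -> x \in F.
Hypothesis rvL : forall x z, x \in L -> z \in C -> rveq V x z -> exists2 y, y \in F & rveq V x y.
Hypotheses (cnL : forall k, cn k \in L) (cnp : forall k, cn k.+1 ^+ p = cn k).
Hypothesis cut_c : forall z, z \in C -> exists2 b, b \in C & cn 0 - b <_[V] z - b.
Implicit Type W : valring E.

Let p0 : (0 < p)%N. Proof. exact: prime_gt0 (pcharf_prime pE). Qed.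

Lemma cn_root k : cn k ^+ (p ^ k) = cn 0.
by elim: k => [|k IH]; rewrite // expnS exprM cnp. Qed.

Lemma transc_cn P k : P \over C -> P != 0 -> P.[cn k] != 0.
move=> CP P0; apply/negP => /(closC CP P0) ck.
have [|b] := @cut_c (cn 0); first by rewrite -(cn_root k) rpredX.
by rewrite ltxx.
Qed.

Lemma fracs_step k x : fracs F (cn k) x -> fracs F (cn k.+1) x.
move=> [P [Q [FP FQ Q0 ->]]]; exists (P \Po 'X^p), (Q \Po 'X^p).
by rewrite !horner_comp !hornerXn cnp; split=> //; apply: polyOver_comp => //; apply: polyOverXn.
Qed.

Lemma fracs_le k l x : (k <= l)%N -> fracs F (cn k) x -> fracs F (cn l) x.
by move/subnK <-; elim: (l - k)%N => // m IH /IH /fracs_step. Qed.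
Lemma fracs_poly k P : P \over F -> fracs F (cn k) P.[cn k].
exists P, 1%:P; rewrite hornerC divr1 oner_eq0 rpred1.
by [].
Qed.

Lemma tower_closed : sfclosed (fun x => exists k, fracs F (cn k) x).
have both x y : (exists k, fracs F (cn k) x) -> (exists k, fracs F (cn k) y) -> exists k, fracs F (cn k) x /\ fracs F (cn k) y.
  move=> [k hk] [l hl]; exists (maxn k l).
  by split; [apply: fracs_le hk|apply: fracs_le hl]; rewrite ?leq_maxl ?leq_maxr.
split=> [|x y hx hy|x y hx hy]; first by exists 0%N; have [] := fracs_closed F (cn 0).
  by have [k [h1 h2]] := both _ _ hx hy; exists k; have [_ h _] := fracs_closed F (cn k); apply: h.
by have [k [h1 h2]] := both _ _ hx hy; exists k; have [_ _ h] := fracs_closed F (cn k); apply: h.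
Qed.

Definition tower := sf_of tower_closed.

Lemma towerP x : x \in tower <-> exists k, fracs F (cn k) x.
exact: sf_ofE. Qed.
Lemma tower_poly k P : P \over F -> P.[cn k] \in tower.
by move=> FP; apply/towerP; exists k; apply: fracs_poly. Qed.
Lemma tower_base : {subset F <= tower}.
by move=> x xF; have := @tower_poly 0 x%:P; rewrite polyOverC hornerC; apply. Qed.
Lemma tower_cn k : cn k \in tower.
by have := @tower_poly k 'X; rewrite polyOverX hornerX; apply. Qed.

Lemma tower_min (B : subfield E) : {subset F <= B} -> (forall k, cn k \in B) -> {subset tower <= B}.
move=> FB cB x /towerP[k [P [Q [FP FQ _ ->]]]].
have hB R : R \over F -> R.[cn k] \in B by (move=> FR; apply: rpred_horner => //; apply: polyOverS FR).
by apply: rpredM; [|rewrite rpredV]; apply: hB.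
Qed.

(** For elements of [L] the hypothesis [rvL] then moves the leading term into [F]. *)
Definition immed (x : E) := exists2 z, z \in C & rveq V x z.

Lemma immedM x y : immed x -> immed y -> immed (x * y).
by move=> [z zC xz] [t tC yt]; exists (z * t); [exact: rpredM|exact: rveqM]. Qed.

Lemma immed_root k x : immed (x ^+ (p ^ k)) -> immed x.
move=> [z zC xz]; have pk : (0 < p ^ k)%N by rewrite expn_gt0 p0.
have [|t rt] := @size_gt1_root _ ('X^(p ^ k) - z%:P); first by rewrite size_XnsubC.
have et : t ^+ (p ^ k) = z by (move: rt; rewrite /root !hornerE subr_eq0 => /eqP).
exists t; last by rewrite -(rveq_pX _ k _ _ pE) et.
apply: closC rt; first by rewrite rpredB ?polyOverXn ?polyOverC.
by rewrite -size_poly_gt0 size_XnsubC.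
Qed.

(** For each root [z] there is [b] in [C] with [c - b] smaller than [z - b], so that the linear
    factor at [c] has the leading term of [b - z]. *)
Lemma immed_c P : P \over C -> immed P.[cn 0].
move=> CP; have [->|P0] := eqVneq P 0; first by rewrite horner0; exists 0; rewrite ?rveqxx ?rpred0.
have [rs eP] := closed_field_poly_normal P.
have rsC z : z \in rs -> z \in C by (move=> zr; apply: (closC CP P0); rewrite eP rootZ ?lead_coef_eq0 // root_prod_XsubC).
have -> : P.[cn 0] = lead_coef P * \prod_(z <- rs) ('X - z%:P).[cn 0] by rewrite {1}eP hornerZ horner_prod.
apply: immedM.
  by exists (lead_coef P); [apply: (polyOverP CP)|apply: rveqxx].
elim: (rs) rsC => [|z s IH] h; first by rewrite big_nil; exists 1; rewrite ?rpred1 ?rveqxx.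
rewrite big_cons; apply: immedM; last by apply: IH => t ts; apply: h; rewrite inE ts orbT.
have zC := h z (mem_head z s); have [b] := cut_c zC.
exists (b - z); first exact: rpredB.
by rewrite !hornerE; apply: rveq_lt; rewrite opprB addrA subrK [X in (_ < X)%O]nvB.
Qed.

(** Raising to the power [p ^ k] turns a polynomial value at [cn k] into one at [cn 0], which can be
    estimated directly. *)
Let frob k (P : {poly E}) := \poly_(i < size P) (P`_i ^+ (p ^ k)).

Let frobE P k : P.[cn k] ^+ (p ^ k) = (frob k P).[cn 0].
rewrite -(cn_root k) horner_poly horner_coef (frobk_sum pE); apply: eq_bigr => i.
by rewrite exprMn -!exprM mulnC.
Qed.

Let frob_over k P : P \over F -> frob k P \over F.
by move=> FP; apply: polyOver_poly => i _; rewrite rpredX // (polyOverP FP). Qed.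

Let frob_neq0 k P : P.[cn k] != 0 -> frob k P != 0.
apply: contraNneq => h; have := frobE P k; rewrite h horner0 => /eqP.
by rewrite expf_eq0 => /andP[_ ->].
Qed.

Lemma immed_tower x : x \in tower -> immed x.
have h k P : P \over F -> immed P.[cn k].
  move=> FP; apply: (@immed_root k); rewrite frobE; apply: immed_c.
  exact/(polyOverS FC)/frob_over.
move=> /towerP[k [P [Q [FP FQ _ ->]]]]; apply: immedM; first exact: h.
by have [z] := h k Q FQ; exists z^-1; [rewrite rpredV|apply: rveqV].
Qed.

(* Up to [rveq] a relation for [x] may be given coefficients in [C]; then [x] is
   close to one of its roots, which belong to [C]. *)
Lemma immed_algebraic x : alg_over tower x -> immed x.
move=> [P [TP P0 rP]]; have [->|x0] := eqVneq x 0; first by exists 0; rewrite ?rveqxx ?rpred0.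
have /choice[f hf] : forall i, exists z, z \in C /\ rveq V P`_i z by (move=> i; have [z] := immed_tower (polyOverP TP i); exists z).
pose Q := \poly_(i < size P) f i.
have eQ i : rveq V Q`_i P`_i.
  rewrite coef_poly; case: ltnP => iP; first by apply: rveq_sym; case: (hf i).
  by rewrite nth_default // rveqxx.
have CQ : Q \over C by apply: polyOver_poly => i _; case: (hf i).
have Q0 : Q != 0 by (apply: contraNneq P0 => Q0; rewrite -lead_coef_eq0 -(rveq_eq0 (eQ _)) Q0 coef0).
have [rs eQr] := closed_field_poly_normal Q.
apply: contrapT => nx.
have far z : z \in rs -> x <=_[V] x - z.
  move=> zr; rewrite leNgt; apply/negP => h; apply: nx; exists z.
    by apply: (closC CQ Q0); rewrite eQr rootZ ?lead_coef_eq0 // root_prod_XsubC.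
  by apply/rveq_sym/rveq_lt; rewrite nvB.
have le i : Q`_i * x ^+ i <=_[V] Q.[x].
  rewrite -coef_comp_scale {2}eQr hornerZ horner_prod {1}eQr comp_polyZ coefZ; apply: nv_leM => //.
  have -> : (\prod_(z <- rs) ('X - z%:P)) \Po (x *: 'X) = \prod_(z <- rs) (x *: 'X + (- z)%:P).
    rewrite rmorph_prod /=; apply: eq_bigr => z.
    by rewrite comp_polyB comp_polyX comp_polyC polyCN.
  under [X in (_ <= nv V X)%O]eq_bigr => z do rewrite !hornerE.
  apply: coef_prod_le => z zr; first exact: far.
  by rewrite nvN; have := nv_leB (far z zr) (lexx (nv V (x - z))); rewrite subKr.
have Qx : Q.[x] != 0.
  rewrite -(nv_gt0 V); apply: lt_le_trans (le (size Q).-1).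
  by rewrite nv_gt0 mulf_neq0 ?expf_neq0 // lead_coef_eq0.
have := rveq_horner_lt Qx eQ (rveqxx V x) le.
by rewrite (eqP rP) subr0 ltxx.
Qed.

Hypotheses (sgL : SG V p L) (c_large : 1 <_[V] cn 0).
Variable q : nat.
Hypotheses (pq : prime q) (q2 : (2 < q)%N) (qp : q != p).

Lemma sep_tower_closed : sfclosed (fun x => x \in L /\ sepalg tower x).
have [h1 hB hM] := sepalg_closed pE tower.
split=> [|x y [xL sx] [yL sy]|x y [xL sx] [yL sy]]; split; rewrite ?rpred1 ?rpredB ?rpredM ?rpredV //.
- exact: hB.
- exact: hM.
Qed.

Definition sep_tower := sf_of sep_tower_closed.

Lemma sep_towerP x : x \in sep_tower <-> x \in L /\ sepalg tower x.
exact: sf_ofE. Qed.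
Lemma tower_L : {subset tower <= L}.
exact: tower_min. Qed.
Lemma tower_sep : {subset tower <= sep_tower}.
by move=> x xT; apply/sep_towerP; split; [apply: tower_L|apply: sepalg_base]. Qed.

Lemma sep_tower_sepclosed (B : subfield E) x : {subset tower <= B} -> {subset B <= sep_tower} ->
  x \in L -> sepalg B x -> x \in sep_tower.
move=> TB BS xL sx; apply/sep_towerP; split=> //; apply: (sepalg_trans pE TB _ sx).
by move=> b /BS/sep_towerP[].
Qed.

Lemma sep_tower_rv x : x \in sep_tower -> exists2 y, y \in F & rveq V x y.
move=> /sep_towerP[xL /sepalg_alg /immed_algebraic[xz]].
exact: rvL.
Qed.

Definition unram W (pi : E) (D : subfield E) :=
  [/\ {subset tower <= D}, {subset D <= sep_tower} & forall d, d \in D -> nv W pi <> nv W (d ^+ q)].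

Definition adm W (pi : E) (D : subfield E) := [/\ {subset F <= W}, pi \in tower, pi != 0, unram W pi D
  & forall D', unram W pi D' -> {subset D <= D'} -> {subset D' <= D}].

Lemma adm_exists W pi : {subset F <= W} -> pi \in tower -> pi != 0 ->
  (forall d, d \in tower -> nv W pi <> nv W (d ^+ q)) -> exists D, adm W pi D.
move=> FW piT pi0 hpi; have uT : unram W pi tower by split=> //; apply: tower_sep.
pose P (X : set E) := exists2 D : subfield E, unram W pi D & X = [set x | x \in D]%classic.
have [||A X AX AP up|X [D uD ->] mX] := @maximal_set _ P [set x | x \in tower]%classic 1.
- exact: rpred1.
- by exists tower.
- set B := fun s => exists2 Z, A Z & Z s.
  have {}up s t : B s -> B t -> exists D : subfield E, [/\ unram W pi D, s \in D, t \in D & forall x, x \in D -> B x].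
    move=> Bs Bt; have [Z AZ] := up _ _ Bs Bt; have [D uD eD] := AP _ AZ; rewrite eD => -[sD tD].
    by exists D; split=> // x xD; exists Z; rewrite // eD.
  have in0 x : x \in tower -> B x.
    by have [D [TD _ _] eD] := AP _ AX; move=> /TD xD; exists X; rewrite // eD.
  have cl : sfclosed B.
    split=> [|x y hx hy|x y hx hy]; first exact/in0/rpred1.
      by have [D [_ xD yD]] := up _ _ hx hy; apply; rewrite rpredB.
    by have [D [_ xD yD]] := up _ _ hx hy; apply; rewrite rpredM ?rpredV.
  exists (sf_of cl); last by apply/seteqP; split=> x; [move=> h; apply/sf_ofE|move/sf_ofE].
  split=> [x /in0 h|x /sf_ofE h|x /sf_ofE h]; first exact/sf_ofE.
    by have [D [[_ DS _] xD _ _]] := up _ _ h h; apply: DS.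
  by have [D [[_ _ DS] xD _ _]] := up _ _ h h; apply: DS.
exists D; split=> // D' uD' DD' x xD'.
by apply: (mX [set x | x \in D']%classic _ _ x xD') => //; exists D'.
Qed.

Lemma core_closed : sfclosed (fun x => x \in sep_tower /\ forall W pi D, adm W pi D -> x \in D).
split=> [|x y [xS xD] [yS yD]|x y [xS xD] [yS yD]]; split; rewrite ?rpred1 ?rpredB ?rpredM ?rpredV //.
- by move=> W pi D _; apply: rpred1.
- by move=> W pi D h; rewrite rpredB ?(xD _ _ _ h) ?(yD _ _ _ h).
- by move=> W pi D h; rewrite rpredM ?rpredV ?(xD _ _ _ h) ?(yD _ _ _ h).
Qed.

(** All places are treated at once, so that solvability in [core] sees every pole; each single [D],
    being maximal, omits only what would make the value of its [pi] divisible by [q]. *)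
Definition core := sf_of core_closed.

Lemma coreP x : x \in core <-> x \in sep_tower /\ forall W pi D, adm W pi D -> x \in D.
exact: sf_ofE. Qed.
Lemma tower_core : {subset tower <= core}.
by move=> x xT; apply/coreP; split=> [|W pi D [_ _ _ [TD _ _] _]]; [apply: tower_sep|apply: TD]. Qed.
Lemma core_sep : {subset core <= sep_tower}. Proof. by move=> x /coreP[]. Qed.

(** Every [cn k] is the [p]-th power of the next one, so [tower] lies in the compositum of [F] with
    the [p]-th powers of [core]. Elements of [core] are separable over [tower] and have their [p]-th
    powers in this compositum, hence belong to it. *)
Lemma core_pspan n (b : 'I_n -> E) : (forall k, b k \in F) -> (forall x, x \in F -> spans (ppow pE F) b x) ->
  forall x, x \in core -> spans (ppow pE core) b x.
move=> bF hb x xM; have FM : {subset F <= core} by move=> y /tower_base/tower_core.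
have TN : {subset tower <= NA pE FM}.
  apply: tower_min => [y yF|k]; first exact/NAP/cmps_base.
  rewrite -cnp; apply/NAP/cmps_pth; exact/tower_core/tower_cn.
have /NAP[m [a [aF xa]]] : x \in NA pE FM.
  have /sep_towerP[_ sx] := core_sep xM; apply: (sepalg_pth_power pE sx TN).
  exact/NAP/cmps_pth.
apply: spans_trans xa _ => i; apply: spans_sub (hb _ (aF i)).
exact: ppow_sub.
Qed.

(** By maximality of [D], adjoining [z] makes the value of [pi] divisible by [q], as witnessed by
    some [y]. The powers of [y] below [q] are free over [D], so the degree of [z] is [q] and these
    powers span the extension. *)
Lemma adm_adjoin W pi D z P : adm W pi D -> z \in sep_tower -> z \notin D ->
  P \over D -> P != 0 -> root P z -> (size P <= q.+1)%N ->
  exists2 y, nv W (y ^+ q) = nv W pi & size P = q.+1 /\ spans D (fun i : 'I_q => y ^+ i) z.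
move=> [FW piT pi0 [TD DS hpi] mD] zS zD DP P0 rP sP.
have az : alg_over D z by exists P.
pose D' := sf_of (polyvals_closed az).
have DD' : {subset D <= D'} by move=> x xD; apply/sf_ofE; exists x%:P; rewrite ?polyOverC ?hornerC.
have zD' : z \in D' by apply/sf_ofE; exists 'X; rewrite ?polyOverX ?hornerX.
have [y yD' ey] : exists2 y, y \in D' & nv W pi = nv W (y ^+ q).
  apply: contrapT => h; move/negP: zD; apply; apply: (mD D') => //; split=> [x /TD /DD' //|x|d dD' e].
    move=> /sf_ofE[S DS' ->]; apply: rpred_horner => //; exact: polyOverS DS'.
  by apply: h; exists d.
have red x : x \in D' -> spans D (fun i : 'I_(size P).-1 => z ^+ i) x.
  by move=> /sf_ofE[T DT ->]; apply: span_powers.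
have free := root_powers_lfree pq (TD _ piT) hpi (esym ey).
have qP : (q <= (size P).-1)%N.
  rewrite leqNgt; apply/negP => lt; apply: (span_dep lt _ free) => i; apply: red.
  exact: rpredX.
have eP : size P = q.+1.
  apply/eqP; rewrite eqn_leq sP; case: (size) qP => //=.
  by rewrite leqn0 => /eqP q0; move: q2; rewrite q0.
exists y => //; split=> //; apply: contrapT => nz.
have [e [fe he]] := lfree_extend free nz.
apply: (span_dep (ltnSn q) _ fe) => k.
have red' x : x \in D' -> spans D (fun i : 'I_q => z ^+ i) x by move/red; rewrite eP.
by apply: red'; have [->|[j ->]] := he k; rewrite ?rpredX.
Qed.

(** A degree less than [q] leaves no room for the witness of [adm_adjoin]. As [q] grows, this
    bounded form of relative separable closedness becomes the full one in the ultraproduct. *)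
Lemma core_sepclosed x P : x \in L -> P \over core -> (size P <= q)%N -> root P x -> ~~ root P^`() x -> x \in core.
move=> xL MP sP rP rP'; have xS : x \in sep_tower.
  by apply: (sep_tower_sepclosed tower_core core_sep xL); exists P.
apply/coreP; split=> // W pi D aD; apply: contraT => xD.
have DP : P \over D by apply: polyOverS MP => y /coreP[_ h]; apply: h aD.
have P0 : P != 0 by apply: contraNneq rP' => ->; rewrite deriv0 root0.
have [y _ [eP]] := adm_adjoin aD xS xD DP P0 rP (leqW sP).
by move: sP; rewrite eP ltnn.
Qed.

Lemma nv_q W : nv W (q%:R : E) = nv W 1.
by apply: (nv_nat1 W pE); rewrite dvdn_prime2 ?(pcharf_prime pE) // eq_sym. Qed.

Notation pfree := (pole_free core q).

(** Where [g] is large so is a solution, and its [q]-th power then has the value of [g]. Conversely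
    the equation has a root small for [V], which is in [L] by Hensel's lemma;
    [artin_schreier_descent] shows that no [D] can miss it. *)
Lemma pole_freeP g : g \in core -> g <_[V] 1 -> pfree g <-> forall W pi D, adm W pi D -> 1 <_[W] g ->
    exists2 d, d \in D & nv W g = nv W (d ^+ q).
have q0 : (0 < q)%N := prime_gt0 pq.
have q1 : (0 < q.-1)%N by rewrite -subn1 subn_gt0 prime_gt1.
move=> gM g1; split=> [[z zM zg] W pi D aD gW|h].
  have /coreP[_ /(_ _ _ _ aD)] := zM; exists z => //.
  have z1 : 1 <_[W] z.
    rewrite ltNge; apply/negP => z1; move: gW; rewrite -zg ltNge; case/negP.
    by apply: nv_leB => //; apply: nv_leX1.
  by rewrite -zg nv_domB // -[X in nv W X]expr1; apply: nv_ltXn => //; apply: prime_gt1.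
pose P : {poly E} := 'X^q - ('X + g%:P).
have hP t : P.[t] = t ^+ q - t - g by rewrite !hornerE opprD addrA.
have sPg : (size (- ('X + g%:P)) < size ('X^q : {poly E}))%N by rewrite size_polyN size_XaddC size_polyXn ltnS prime_gt1.
have sP : size P = q.+1 by rewrite size_polyDl // size_polyXn.
have mP : P \is monic by rewrite monicE lead_coefDl // lead_coefXn.
have PN (N : subfield E) : g \in N -> P \over N by (move=> gN; rewrite rpredB ?rpredD ?polyOverXn ?polyOverX ?polyOverC).
have [rs eP] := monic_roots mP.
have [z rz z1] : exists2 z, root P z & z <_[V] 1.
  apply: contrapT => hn; move: g1; rewrite -(nvN V g) ltNge; case/negP.
  have <- : P.[0] = - g by rewrite hP expr0n gtn_eqF // subr0 sub0r.
  rewrite eP horner_prod; have := @nv_prod_le _ V _ rs (fun=> 1) (fun w => ('X - w%:P).[0]).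
  rewrite big1_eq; apply=> w wr; rewrite hornerXsubC sub0r nvN leNgt; apply/negP => w1; apply: hn.
  by exists w; rewrite // eP root_prod_XsubC.
have eg t : root P t -> t ^+ q - t = g by rewrite /root hP subr_eq0 => /eqP.
have rz' : ~~ root P^`() z.
  apply/negP; rewrite /root !derivE !hornerE subr_eq0 => /eqP e.
  have := nv_ltX1 q1 z1; rewrite -[X in (_ < nv V X)%O]e hornerMn hornerXn -mulr_natl.
  by rewrite -[X in (nv V X < _)%O]mul1r lt_neqAle (nv_eqM ((nv_q V)) (erefl)) eqxx.
have sz : sepalg core z by exists P; rewrite PN.
have zL : z \in L.
  have LM : {subset core <= L} by move=> x /core_sep/sep_towerP[].
  apply: (sg_hensel pE sgL (sepalg_sub LM sz) (PN L (LM _ gM)) rz (rpred0 L)) => t rt.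
  rewrite !subr0 => etz; apply/eqP; rewrite -subr_eq0; apply: contraT => u0.
  have : (t - z) * (\sum_(i < q) t ^+ (q.-1 - i) * z ^+ i) = (t - z) * 1.
    rewrite -subrXX; have := eg t rt; rewrite -(eg z rz) => /eqP.
    by rewrite subr_eq => /eqP ->; ring.
  move/(mulfI u0) => e1; suff : \sum_(i < q) t ^+ (q.-1 - i) * z ^+ i <_[V] 1 by rewrite e1 ltxx.
  apply: nv_lt_sum => [|i _]; first exact: oner_neq0.
  have t1 : t <_[V] 1 by rewrite etz.
  have [i0|i0] := posnP i; first by rewrite i0 subn0 mulr1 nv_ltX1.
  by rewrite mulrC; apply: nv_ltM1; [apply: nv_ltX1|apply/nv_leX1/ltW].
have zS : z \in sep_tower := sep_tower_sepclosed tower_core core_sep zL sz.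
exists z; last exact: eg.
apply/coreP; split=> // W pi D aD; apply: contraT => zD.
have gD : g \in D by have /coreP[_ /(_ _ _ _ aD)] := gM.
have [|y ey [_ zy]] := adm_adjoin aD zS zD (PN D gD) (monic_neq0 mP) rz; first by rewrite sP.
have [_ piT pi0 [TD _ hpi]] := aD.
have := artin_schreier_descent pq (TD _ piT) hpi ey q2 (nv_q W) gD (eg z rz) (h _ _ _ aD) zy.
by rewrite (negbTE zD).
Qed.

(** * Places of the function field generated by [c] *)

Hypothesis smallF : exists2 pi, pi \in F & pi != 0 /\ pi <_[V] 1.
Notation c := (cn 0).

Lemma nv_trivial W a : {subset F <= W} -> a \in F -> a != 0 -> nv W a = nv W 1.
move=> FW aF a0; apply/eqP; rewrite eq_le nv_le1 FW //=.
by rewrite -(nv_leV _ a0 (oner_neq0 _)) invr1 nv_le1 FW // rpredV.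
Qed.

Lemma nv_poly_le W R x : {subset F <= W} -> R \over F -> x <=_[W] 1 -> R.[x] <=_[W] 1.
by move=> FW FR x1; apply: horner_int_le => // i; rewrite nv_le1 FW // (polyOverP FR). Qed.

Let c_le1 W b : {subset F <= W} -> b \in F -> c - b <_[W] 1 -> c <=_[W] 1.
by move=> FW bF /ltW h; rewrite -[c](subrK b) nv_leD // nv_le1 FW. Qed.

(** The place [e = 0] of the rational function field in [e] over [F], extended to [E] by Chevalley's
    theorem. *)
Lemma transc_place e : (forall P, P \over F -> P != 0 -> P.[e] != 0) -> exists W, {subset F <= W} /\ e <_[W] 1.
move=> te; pose R0 x := exists2 P, P \over F & x = P.[e].
pose I0 x := exists2 P, P \over F & x = e * P.[e].
have [|W [RW IW]] := @chevalley E R0 I0.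
  split; split.
  - by exists 1%:P; rewrite ?rpred1 ?hornerC.
  - by move=> _ _ [P FP ->] [Q FQ ->]; exists (P - Q); rewrite ?rpredB ?hornerD ?hornerN.
  - by move=> _ _ [P FP ->] [Q FQ ->]; exists (P * Q); rewrite ?rpredM ?hornerM.
  - by exists 0; rewrite ?rpred0 // horner0 mulr0.
  - by move=> _ _ [P FP ->] [Q FQ ->]; exists (P - Q); rewrite ?rpredB // hornerD hornerN mulrBr.
  - by move=> _ _ [P FP ->] [Q FQ ->]; exists (P * Q); rewrite ?rpredM // hornerM mulrCA.
  - by move=> _ [P FP ->]; exists ('X * P); rewrite ?rpredM ?polyOverX // hornerM hornerX.
  - move=> [P FP e1]; have := te ('X * P - 1%:P).
    rewrite rpredB ?rpredM ?polyOverX ?rpred1 // !hornerE -e1 subrr eqxx => /(_ isT) h.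
    suff /h : 'X * P - 1%:P != 0 by [].
    apply/eqP => /(congr1 (horner^~ 0)) /eqP.
    by rewrite !hornerE oppr_eq0 oner_eq0.
exists W; split=> [x xF|]; first by apply: RW; exists x%:P; rewrite ?polyOverC ?hornerC.
by apply: IW; exists 1%:P; rewrite ?rpred1 // hornerC mulr1.
Qed.

(** [pi] is a uniformiser for the rational functions in [c]; putting powers of [pi] on both sides
    avoids negative exponents. *)
Definition gens W (pi : E) := [/\ pi != 0, pi <_[W] 1 &
  forall R, R \over F -> R != 0 -> exists i j, nv W (R.[c] * pi ^+ i) = nv W (pi ^+ j)].

Lemma transc_c P : P \over F -> P != 0 -> P.[c] != 0.
by move=> FP; apply: transc_cn; apply: polyOverS FP. Qed.

(** Least degree makes [P] the irreducible polynomial of the place, and repeated division by [P]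
    computes orders. *)
Lemma gens_poly W P : {subset F <= W} -> c <=_[W] 1 -> P \over F -> P != 0 ->
  P.[c] <_[W] 1 -> (forall R, R \over F -> R != 0 -> (size R < size P)%N -> nv W R.[c] = nv W 1) -> gens W P.[c].
move=> FW c1 FP P0 Pc mP; split=> // [|R FR R0]; first exact: transc_c.
suff [j] : exists j, nv W R.[c] = nv W (P.[c] ^+ j) by exists 0%N, j; rewrite mulr1.
elim: {R}(size) {-2}R (leqnn (size R)) FR R0 => [|n IH] R sR FR R0.
  by move: R0; rewrite -size_poly_eq0 -leqn0 sR.
have FQ : R %/ P \over F by apply: sf_divp.
have : R %% P \over F by apply: sf_modp.
have [S0|S0] := eqVneq (R %% P) 0; last first.
  exists 0%N; have es : nv W (R %% P).[c] = nv W 1 by apply: mP; rewrite ?ltn_modp.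
  rewrite {1}(divp_eq R P) hornerD addrC nv_dom // hornerM es mulrC.
  by apply: nv_ltM1 => //; apply: nv_poly_le.
have eR : R = R %/ P * P by rewrite {1}(divp_eq R P) S0 addr0.
have Q0 : R %/ P != 0 by apply: contraNneq R0 => h; rewrite eR h mul0r.
have sP : (1 < size P)%N.
  rewrite ltnNge; apply/negP => /size1_polyC eP; move: Pc; rewrite eP hornerC.
  rewrite (nv_trivial) ?ltxx //; first exact: (polyOverP).
  by apply: contraNneq P0 => h; rewrite eP h.
have [|j] := IH (R %/ P) _ FQ Q0.
  rewrite -ltnS (leq_trans _ sR) // size_divp //; case: (size) sP => [|[|m]] //.
  by rewrite ltn_subrL size_poly_gt0.
by exists j.+1; rewrite eR hornerM exprSr; apply: nv_eqM.
Qed.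

Lemma gens_inv W : {subset F <= W} -> 1 <_[W] c -> gens W c^-1.
move=> FW c1; have : c != 0 by rewrite -(nv_gt0 W) (le_lt_trans _ c1) ?nv_ge0.
split=> [||R FR R0]; first by rewrite invr_eq0.
  by rewrite nv_ltV1.
exists (size R).-1, 0%N; rewrite exprVn; set n := (size R).-1.
have sR : size R = n.+1 by rewrite prednK ?size_poly_gt0.
have lead : nv W (R`_n * c ^+ n) = nv W (c ^+ n).
  apply/nv_eqMl/nv_trivial => //; first exact: (polyOverP).
  by rewrite lead_coef_eq0.
suff e : nv W R.[c] = nv W (c ^+ n).
  by rewrite (nv_eqM e (erefl)) divff ?expf_neq0.
rewrite horner_coef sR big_ord_recr /= addrC nv_dom //; apply: nv_lt_sum => [|i _].
  by rewrite mulf_neq0 ?expf_neq0 // lead_coef_eq0.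
rewrite lead -[X in (_ < nv W X)%O]mul1r mulrC [X in (_ < nv W X)%O]mulrC.
apply: nv_ltM_le; rewrite ?oner_neq0 //; first exact: nv_ltXn.
by rewrite nv_le1 FW // (polyOverP FR).
Qed.

Lemma gens_tower W pi y : gens W pi -> y \in tower -> y != 0 -> exists k i j, nv W (y ^+ (p ^ k) * pi ^+ i) = nv W (pi ^+ j).
move=> [pi0 _ gen] /towerP[k [P [Q [FP FQ Q0 ->]]]] y0.
have P0 : P.[cn k] != 0 by apply: contraNneq y0 => ->; rewrite mul0r.
have gk R : R \over F -> R.[cn k] != 0 -> exists i j, nv W (R.[cn k] ^+ (p ^ k) * pi ^+ i) = nv W (pi ^+ j).
  by move=> FR R0; rewrite frobE; apply: gen; [apply: frob_over|apply: frob_neq0].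
have [i [j e]] := gk P FP P0; have [i' [j' e']] := gk Q FQ Q0.
exists k, (i + j')%N, (j + i')%N; rewrite expr_div_n !exprD; apply/eqP.
rewrite -(nv_eqM2r W _ _ (expf_neq0 (p ^ k) Q0)) (_ : _ * _ * _ = P.[cn k] ^+ (p ^ k) * pi ^+ i * pi ^+ j').
  rewrite (nv_eqM e (esym e')); apply/eqP; congr nv; ring.
by field; rewrite expf_neq0.
Qed.

Lemma nv_expI W pi i j : pi != 0 -> pi <_[W] 1 -> nv W (pi ^+ i) = nv W (pi ^+ j) -> i = j.
move=> pi0 pi1; wlog ij : i j / (i < j)%N.
  by move=> H e; case: (ltngtP i j) => // lt; [apply: H|apply/esym/H].
move/eqP; rewrite -(subnK (ltnW ij)) exprD -[X in nv W X == _]mul1r nv_eqM2r ?expf_neq0 //.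
by rewrite eq_sym lt_eqF // nv_ltX1 ?subn_gt0.
Qed.

(** Values of [tower] are [p]-power roots of powers of that of [pi]. If the latter were a [q]-th
    power, comparing exponents would make [q] divide a power of [p]. *)
Lemma gens_indiv W pi d : gens W pi -> d \in tower -> nv W pi <> nv W (d ^+ q).
move=> gen dT e; have [pi0 pi1] := gen.
have d0 : d != 0 by (apply: contra_eq_neq e => ->; rewrite expr0n gtn_eqF ?prime_gt0 // nv_eq0).
have [k [i [j ekij]]] := gens_tower gen dT d0.
have : nv W (pi ^+ (p ^ k + i * q)) = nv W (pi ^+ (j * q)).
  rewrite exprD [in RHS]exprM -(nv_eqX q ekij) exprMn -!exprM.
  by apply: nv_eqM => //; rewrite mulnC exprM; apply: nv_eqX.
move/(nv_expI pi0 pi1) => h; have : (q %| p ^ k)%N by rewrite -(dvdn_addl _ (dvdn_mull i (dvdnn q))) h dvdn_mull.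
by rewrite Euclid_dvdX // dvdn_prime2 ?(pcharf_prime pE) // (negbTE qp).
Qed.

Lemma place_at b : b \in F -> exists W D, adm W (c - b) D /\ c - b <_[W] 1.
move=> bF; have Fb : 'X - b%:P \over F by rewrite polyOverXsubC.
have hb : ('X - b%:P).[c] = c - b by rewrite !hornerE.
have [P FP P0|W [FW cb]] := @transc_place (c - b).
  have := @transc_c (P \Po ('X - b%:P)); rewrite horner_comp hb; apply.
    exact: polyOver_comp.
  by rewrite comp_poly2_eq0 ?size_XsubC.
have gen : gens W (c - b).
  rewrite -hb; apply: gens_poly => //; rewrite ?polyXsubC_eq0 ?hb //.
    exact: c_le1 cb.
  move=> R FR R0; rewrite size_XsubC => /size1_polyC eR; rewrite eR hornerC.
  apply: nv_trivial => //; first exact: (polyOverP).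
  by apply: contraNneq R0 => h; rewrite eR h.
have [|||D] := @adm_exists W (c - b) FW; last by exists W, D.
- by rewrite -hb; apply: tower_poly.
- by case: gen.
- by move=> d; apply: gens_indiv.
Qed.

Lemma algebraic_value B W x : alg_over B x -> x != 0 -> exists n a, [/\ (0 < n)%N, a \in B, a != 0 & nv W (x ^+ n) = nv W a].
move=> [P [BP P0 rP]] x0; apply: contrapT => hn.
have := @sum_distinct _ W (size P) (fun i => P`_i * x ^+ i).
have dist (i j : 'I_(size P)) : (i < j)%N -> P`_i * x ^+ i != 0 -> P`_j * x ^+ j != 0 ->
    nv W (P`_i * x ^+ i) != nv W (P`_j * x ^+ j).
  move=> ij; rewrite !mulf_eq0 !negb_or => /andP[i0 _] /andP[j0 _]; apply/eqP => e.
  apply: hn; exists (j - i)%N, (P`_i / P`_j); split; rewrite ?subn_gt0 ?mulf_neq0 ?invr_eq0 //.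
    by rewrite rpredM ?rpredV // (polyOverP BP).
  apply/eqP; rewrite -(nv_eqM2r W _ _ (expf_neq0 i x0)) -exprD subnK ?(ltnW ij) //.
  rewrite -(nv_eqM2r W _ _ j0) mulrAC divfK // e; apply/eqP; congr nv; ring.
case=> [i j ij i0 j0|h|[k [k0 _ ek]]].
- case: (ltngtP i j) => lt; [exact: dist|by rewrite eq_sym dist|by rewrite (val_inj lt) eqxx in ij].
- have sP : ((size P).-1 < size P)%N by rewrite prednK ?size_poly_gt0.
  have /eqP := h (Ordinal sP); rewrite mulf_eq0 (negbTE (expf_neq0 _ x0)).
  by rewrite lead_coef_eq0 (negbTE P0).
- by move: k0; rewrite -(nv_gt0 W) -ek -horner_coef (eqP rP) ltxx.
Qed.

Lemma F_closed x : x \in L -> x \notin F -> forall P, P \over F -> P != 0 -> P.[x] != 0.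
move=> xL xF P FP P0; apply: contraNN xF => rP; apply: CL => //.
by apply: closC rP => //; apply: polyOverS FP.
Qed.

(** As [x] is transcendental over [F], some place trivial on [F] makes it infinite. Since [x] is
    algebraic over [tower], the place is not trivial there; it is the one at infinity or that of an
    irreducible polynomial in [c], and so has a uniformiser [pi]. *)
Lemma pole_exists x : x \in core -> x \notin F -> exists W pi D N, [/\ adm W pi D, pi <_[W] 1, 1 <_[W] x & 1 <=_[W] x ^+ N * pi].
move=> xM xF; have /sep_towerP[xL sx] := core_sep xM.
have x0 : x != 0 by apply: contraNneq xF => ->; apply: rpred0.
have xiF : x^-1 \notin F by rewrite rpredV.
have [W [FW xi]] : exists W, {subset F <= W} /\ x^-1 <_[W] 1.
  apply: transc_place => P FP P0; apply: F_closed xiF _ FP P0.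
  by rewrite rpredV.
have x1 : 1 <_[W] x by rewrite -nv_ltV1.
have [n [a [n0 aT a0 ea]]] := algebraic_value W (sepalg_alg sx) x0.
have a1 : 1 <_[W] a by rewrite -ea nv_gtX1.
have ak1 k : 1 <_[W] a ^+ (p ^ k) by rewrite nv_gtX1 ?expn_gt0 ?p0.
have [pi [gen piT]] : exists pi, gens W pi /\ pi \in tower.
  have [c1|c1] := leP (nv W c) (nv W 1); last first.
    by exists c^-1; split; [apply: gens_inv|rewrite rpredV tower_cn].
  have ex : exists n, `[< exists R : {poly E}, [/\ size R = n, R \over F, R != 0 & R.[c] <_[W] 1] >].
    have /towerP[k [P [Q [FP FQ Q0 ePQ]]]] := aT.
    exists (size (frob k Q)); apply/asboolP; exists (frob k Q); split=> //; [exact: frob_over|exact: frob_neq0|].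
    rewrite -frobE; apply: (lt_le_trans (y := nv W (a ^+ (p ^ k) * Q.[cn k] ^+ (p ^ k)))).
      by rewrite -[X in (nv W X < _)%O]mul1r; apply: nv_ltM_le; rewrite ?expf_neq0 ?ak1.
    by rewrite -exprMn ePQ divfK // frobE; apply/nv_poly_le/c1/frob_over.
  case: (ex_minnP ex) => m /asboolP[P [sP FP P0 Pc]] hm.
  exists P.[c]; split; last exact: tower_poly.
  apply: gens_poly => // R FR R0 sR; apply/eqP; rewrite eq_le nv_poly_le //= leNgt.
  apply/negP => R1; move: sR; rewrite ltnNge sP; case/negP; apply: hm; apply/asboolP.
  by exists R.
have [pi0 pi1] := gen.
have [D] := adm_exists FW piT pi0 (fun d dT => gens_indiv gen dT).
have [k [i [j e]]] := gens_tower gen aT a0.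
have piX m : pi ^+ m <=_[W] 1 by apply/nv_leX1/ltW.
have ji : (j < i)%N.
  rewrite ltnNge; apply/negP => ij; have := lexx (nv W (pi ^+ j)); rewrite -{1}e leNgt; case/negP.
  apply: (le_lt_trans (y := nv W (pi ^+ i))).
    by rewrite -(subnK ij) exprD nv_leMl.
  by rewrite -[X in (nv W X < _)%O]mul1r nv_ltM2r ?expf_neq0 ?ak1.
exists W, pi, D, (n * p ^ k)%N; split=> //.
rewrite -(nv_leM2r W _ _ (expf_neq0 j pi0)) mul1r -e exprM.
rewrite (nv_eqM (esym (nv_eqX (p ^ k) ea)) (erefl)) -mulrA -exprS.
by apply: nv_leM => //; rewrite -(subnK ji) exprD nv_leMl.
Qed.

(** Leading terms of [core] lie in [F]. Constants do not affect the places, so the smallness for [V]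
    demanded by [pole_freeP] can always be arranged. *)
Lemma core_scale f : f \in core -> exists a, [/\ a \in F, a != 0 & a * f <_[V] 1].
move=> fM; have [pi piF []] := smallF.
have [f0|f0] := eqVneq f 0; first by exists 1; rewrite rpred1 f0 mulr0 nv_gt0 oner_neq0.
have [y yF fy] := sep_tower_rv (core_sep fM).
have : y != 0 by rewrite -(rveq_eq0 fy).
exists (pi / y); rewrite rpredM ?rpredV // mulf_neq0 ?invr_eq0 //.
rewrite (nv_eqM (erefl) (rveq_nv fy)) divfK //.
Qed.

Notation cst := (const V core q).

Lemma core_adm W pi D x : adm W pi D -> x \in core -> x \in D.
by move=> aD /coreP[_ /(_ _ _ _ aD)]. Qed.

(** A constant does not change values at the places. If [x] has a pole at [W], take [dl] with value
    not divisible by [q], small at [W] but large after multiplication by [x ^+ q]. The poles of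
    [dl / (1 + dl) ^+ q] are zeros of [1 + dl] and divisible by [q], while its product with [x ^+ q]
    has a bad pole at [W]. *)
Lemma constP x : x \in core -> cst x <-> x \in F /\ x \in V.
move=> xM; have q0 : (0 < q)%N := prime_gt0 pq.
have q1 : (0 < q.-1)%N by rewrite -subn1 subn_gt0 prime_gt1.
have F_core : {subset F <= core} by move=> y /tower_base/tower_core.
have gx g : x \in V -> g <_[V] 1 -> g * x ^+ q <_[V] 1.
  by move=> xV g1; apply: nv_ltM1 => //; rewrite nv_leX1 // nv_le1.
split=> [[xV hx]|[xF xV]]; last first.
  split=> // g gM g1 pg; have [->|x0] := eqVneq x 0.
    by rewrite expr0n gtn_eqF // mulr0; exists 0; rewrite ?rpred0 // expr0n gtn_eqF // subr0.
  have [pgx _] := pole_freeP gM g1; have gxM : g * x ^+ q \in core by rewrite rpredM ?rpredX.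
  apply/(pole_freeP gxM (gx g xV g1)) => W pi D aD.
  have [FW _ _ _ _] := aD.
  have -> : nv W (g * x ^+ q) = nv W g.
    by apply/nv_eqMr/nv_trivial; rewrite ?rpredX ?expf_neq0.
  exact: (pgx pg W pi).
split=> //; apply: contraT => xF.
have [W [pi [D [N [aD pi1 x1 xN]]]]] := pole_exists xM xF.
have [_ piT pi0 [TD _ hpi]] := aD; have xD := core_adm aD xM.
have x0 : x != 0 by apply: contraNneq xF => ->; apply: rpred0.
(* If the value of [x] is not divisible by [q], its inverse serves; otherwise [pi] is multiplied by
   the last power of [x] that keeps the product small. *)
have [dl [dM dW dx nd]] : exists dl, [/\ dl \in core, dl <_[W] 1, 1 <_[W] dl * x ^+ q
    & forall d, d \in D -> nv W dl <> nv W (d ^+ q)].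
  have [[d0 [d0D ed0]]|nx] := pselect (exists d, d \in D /\ nv W x = nv W (d ^+ q)); last first.
    exists x^-1; rewrite rpredV; split=> //.
    - by rewrite nv_ltV1.
    - by rewrite -[q]prednK // exprS mulKf // nv_gtX1.
    - move=> d dD e; apply: nx; exists d^-1; rewrite rpredV; split=> //.
      by rewrite -[x]invrK exprVn; apply: nv_eqV.
  have ex : exists n, 1 <=_[W] x ^+ n * pi by exists N.
  have [[|n] hn mn] := ex_minnP ex; first by move: hn; rewrite mul1r leNgt pi1.
  exists (x ^+ n * pi); split.
  - by rewrite rpredM ?rpredX // tower_core.
  - by rewrite ltNge; apply/negP => /mn; rewrite ltnn.
  - have -> : x ^+ n * pi * x ^+ q = x ^+ q.-1 * (x ^+ n.+1 * pi) by (rewrite -[in LHS](prednK q0) !exprS; ring).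
    rewrite -[X in (nv W X < _)%O]mul1r; apply: nv_ltM_le => //; last by rewrite -(nv_gt0 W) (lt_le_trans _ hn) // nv_gt0 oner_neq0.
    exact: nv_gtX1.
  - move=> d dD e; apply: (hpi (d / d0 ^+ n)); first by rewrite rpredM ?rpredV ?rpredX.
    have d00 : d0 ^+ n ^+ q != 0.
      rewrite !expf_neq0 //; apply: contra_eq_neq ed0 => ->.
      by rewrite expr0n gtn_eqF // nv_eq0.
    apply/eqP; rewrite -(nv_eqM2r W _ _ d00) expr_div_n divfK // -e; apply/eqP.
    rewrite mulrC; apply: nv_eqM => //; rewrite -exprM mulnC exprM; exact: nv_eqX.
have d1 : nv W (1 + dl) = nv W 1 by apply: nv_dom.
have d10 : 1 + dl != 0 by rewrite -(nv_gt0 W) d1 nv_gt0 oner_neq0.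
have d1M : 1 + dl \in core by rewrite rpredD ?rpred1.
have g0M : dl / (1 + dl) ^+ q \in core by rewrite rpredM ?rpredV ?rpredX.
have [a [aF a0 ag]] := core_scale g0M.
have gM : a * (dl / (1 + dl) ^+ q) \in core by rewrite rpredM // F_core.
have [|z zM zg] := hx _ gM ag.
  apply/(pole_freeP gM ag) => W' pi' D' aD' g1; have [FW'] := aD'.
  have nva := nv_trivial FW' aF a0.
  have ng : nv W' (a * (dl / (1 + dl) ^+ q)) = nv W' (dl / (1 + dl) ^+ q) by apply: nv_eqMl.
  rewrite ng in g1 *.
  have : 1 + dl <_[W'] 1.
    rewrite ltNge; apply/negP => le1; move: g1; rewrite ltNge; case/negP.
    rewrite nv_le_divl ?expf_neq0 // mul1r; apply: (le_trans).
      have e : dl = 1 + dl - 1 by ring.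
      by rewrite {1}e; apply: nv_leB.
    rewrite -[q](subnK q0) exprD nv_geMl //.
    by rewrite -[X in (nv W' X <= _)%O](expr1n _ (q - 1)); apply: nv_leX.
  exists (1 + dl)^-1; first by rewrite rpredV (core_adm aD').
  rewrite exprVn; apply: nv_eqMl.
  have : nv W' (1 - (1 + dl)) = nv W' 1 by apply: nv_domB.
  by rewrite opprD addrA subrr add0r nvN.
have gxM : a * (dl / (1 + dl) ^+ q) * x ^+ q \in core by rewrite rpredM ?rpredX.
have [FW] := aD.
have ngx : nv W (a * (dl / (1 + dl) ^+ q) * x ^+ q) = nv W (dl * x ^+ q).
  rewrite -mulrA (nv_eqMl _ (nv_trivial FW aF a0)) mulrAC; apply: nv_eqMr.
  by rewrite -[X in _ = nv W X]invr1; apply: nv_eqV; rewrite (nv_eqX q d1) expr1n.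
have [+] := pole_freeP gxM (gx _ xV ag).
move=> /(_ (ex_intro2 _ _ z zM zg)) /(_ _ _ _ aD); rewrite ngx => /(_ dx) [d dD e].
case: (nd (d / x)); first by rewrite rpredM ?rpredV.
apply/eqP; rewrite expr_div_n -(nv_eqM2r W _ _ (expf_neq0 q x0)) divfK ?expf_neq0 //.
exact/eqP.
Qed.

(** At a place finite on [c] where [f] is infinite, some coefficient of its minimal polynomial over
    [tower] is at least as large as [f]. So a denominator of one of these finitely many coefficients
    vanishes there. *)
Lemma denominators f : f \in sep_tower -> exists rs : seq {poly E}, (forall R, R \in rs -> R \over F /\ R != 0) /\
  forall W, {subset F <= W} -> c <=_[W] 1 -> 1 <_[W] f -> exists R N, [/\ R \in rs, (0 < N)%N & R.[c] * f ^+ N <=_[W] 1].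
move=> /sep_towerP[_ /sepalg_minpoly[P [[TP sP _] mP _ rP]]].
have hR i : exists RN : {poly E} * nat, [/\ RN.1 \over F, RN.1 != 0, (0 < RN.2)%N
    & forall W, {subset F <= W} -> c <=_[W] 1 -> RN.1.[c] * P`_i ^+ RN.2 <=_[W] 1].
  have /towerP[k [A [B [FA FB B0 ->]]]] := polyOverP TP i.
  exists (frob k B, (p ^ k)%N); rewrite expn_gt0 p0; split=> //; [exact: frob_over|exact: frob_neq0|].
  by move=> W FW c1; rewrite /= -frobE -exprMn mulrC divfK // frobE nv_poly_le ?frob_over.
have /choice[g hg] := hR; pose n := (size P).-1.
exists [seq (g i).1 | i <- iota 0 n]; split=> [R /mapP[i _ ->]|W FW c1 f1]; first by have [] := hg i.
have f0 : f != 0 by rewrite -(nv_gt0 W) (le_lt_trans _ f1) ?nv_ge0.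
have en : size P = n.+1 by rewrite prednK // ltnW.
have [i [le]] : exists i, (i < n)%N /\ f <=_[W] P`_i.
  apply: contrapT => hn; have := rP; rewrite /root horner_coef en big_ord_recr /= -/(lead_coef P).
  rewrite (monicP mP) mul1r addrC => /eqP e.
  have : nv W (f ^+ n + \sum_(i < n) P`_i * f ^+ i) = nv W (f ^+ n).
    apply: nv_dom; apply: nv_lt_sum => [|i _]; first exact: expf_neq0.
    have n0 : (0 < n)%N by apply: leq_ltn_trans (ltn_ord i).
    rewrite -[n in X in (_ < X)%O]prednK // exprS; apply: nv_ltM_le; rewrite ?expf_neq0 //.
      by rewrite ltNge; apply/negP => le; apply: hn; exists i.
    have in1 : (i <= n.-1)%N by rewrite -ltnS prednK.
    rewrite -(subnK in1) exprD nv_geMl //.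
    by rewrite -[X in (nv W X <= _)%O](expr1n _ (n.-1 - i)); apply/nv_leX/ltW.
  by move/eqP; rewrite e eq_sym nv_eq0 expf_eq0 (negbTE f0) andbF.
have [_ _ N0 hW] := hg i; exists (g i).1, (g i).2; split=> //.
  by apply/mapP; exists i => //; rewrite mem_iota.
by apply: le_trans (hW W FW c1); apply: nv_leM => //; apply: nv_leX.
Qed.

Lemma residue_horner W b R : {subset F <= W} -> b \in F -> c - b <_[W] 1 -> R \over F -> R.[b] != 0 -> nv W R.[c] = nv W 1.
move=> FW bF cb FR Rb.
have c1 := c_le1 FW bF cb.
have RbF : R.[b] \in F by apply: rpred_horner.
have /factor_theorem[S eS] : root (R - R.[b]%:P) b by rewrite /root !hornerE subrr.
have FS : S \over F.
  have -> : S = (R - R.[b]%:P) %/ ('X - b%:P) by rewrite eS mulpK // polyXsubC_eq0.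
  by apply: sf_divp; rewrite ?polyOverXsubC // rpredB ?polyOverC.
have -> : R.[c] = R.[b] + S.[c] * (c - b).
  have := congr1 (horner^~ c) eS; rewrite !hornerE => /eqP.
  by rewrite subr_eq addrC => /eqP.
have nb : nv W R.[b] = nv W 1 by apply: nv_trivial.
rewrite nv_dom ?nb //.
by rewrite mulrC; apply: nv_ltM1 => //; apply: nv_poly_le.
Qed.

Lemma order_at b R : b \in F -> R \over F -> R != 0 -> exists m, forall W,
  {subset F <= W} -> c - b <_[W] 1 -> (c - b) ^+ m <=_[W] R.[c].
move=> bF FR R0; have [m [S]] := multiplicity_XsubC R b; rewrite R0 => Sb eR; exists m => W FW cb.
have FS : S \over F.
  have -> : S = R %/ ('X - b%:P) ^+ m by rewrite eR mulpK // expf_neq0 // polyXsubC_eq0.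
  by apply: sf_divp => //; rewrite rpredX // polyOverXsubC.
rewrite eR !hornerE nv_geMl //.
by rewrite (residue_horner FW bF).
Qed.

(* [cond b f]: the zeros of [c - b] are zeros of [f] or divisible by [q], and so
   are the poles. *)
Definition cond (b f : E) := forall W pi D, adm W pi D -> c - b <_[W] f ^+ q -> exists2 d, d \in D & nv W (c - b) = nv W (d ^+ q).

Lemma F_core : {subset F <= core}. Proof. by move=> y /tower_base/tower_core. Qed.
Lemma c_core : c \in core. Proof. exact/tower_core/tower_cn. Qed.
Lemma cb_neq0 b : b \in F -> c - b != 0.
move=> bF; have := @transc_c ('X - b%:P); rewrite polyOverXsubC polyXsubC_eq0 !hornerE.
exact.
Qed.

Lemma condP f b : f \in core -> f != 0 -> f \in V -> b \in F -> 1 <_[V] c - b -> pfree (f ^+ q / (c - b)) <-> cond b f.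
move=> fM f0 fV bF cb; have cb0 := cb_neq0 bF.
have gM : f ^+ q / (c - b) \in core by rewrite rpredM ?rpredX // rpredV rpredB ?c_core ?F_core.
have g1 : f ^+ q / (c - b) <_[V] 1.
  by rewrite nv_lt_divl // mul1r (le_lt_trans _ cb) // nv_leX1 // nv_le1.
split=> [/(pole_freeP gM g1) h W pi D aD lt|h].
  have [|d dD e] := h W pi D aD; first by rewrite nv_lt_divr // mul1r.
  exists (f / d); first by rewrite rpredM ?rpredV // (core_adm aD).
  have d0 : d ^+ q != 0 by rewrite -(nv_gt0 W) -e nv_gt0 mulf_neq0 ?expf_neq0 ?invr_eq0.
  apply/eqP; rewrite expr_div_n -(nv_eqM2r W _ _ d0) divfK // mulrC.
  by rewrite (nv_eqM (esym e) (erefl)) divfK.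
apply/(pole_freeP gM g1) => W pi D aD; rewrite nv_lt_divr // mul1r => lt.
have [d] := h W pi D aD lt; exists (f / d); first by rewrite rpredM ?rpredV // (core_adm aD).
by rewrite expr_div_n; apply: nv_eqM => //; apply: nv_eqV.
Qed.

Lemma place_other W b b' : {subset F <= W} -> b \in F -> b' \in F -> b != b' -> c - b <_[W] 1 -> nv W (c - b') = nv W 1.
move=> FW bF bF' bb' cb; have -> : c - b' = (b - b') + (c - b) by ring.
have nb : nv W (b - b') = nv W 1 by apply: nv_trivial; rewrite ?rpredB // subr_eq0.
by rewrite nv_dom ?nb.
Qed.

Lemma place_inf W b : {subset F <= W} -> b \in F -> 1 <_[W] c -> nv W (c - b) = nv W c.
by move=> FW bF c1; apply: nv_domB; apply: le_lt_trans c1; rewrite nv_le1 FW. Qed.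

Lemma cond_local b f f' : b \in F -> (forall W, {subset F <= W} ->
  1 <_[W] c \/ c - b <_[W] 1 -> nv W f' = nv W f) -> cond b f -> cond b f'.
move=> bF h cf W pi D aD lt; have [FW _ _ _ _] := aD.
have [c1|c1] := ltP (nv W 1) (nv W c); first by apply: (cf W pi D aD); rewrite -(nv_eqX q (h W FW (or_introl c1))).
have [cb|cb] := ltP (nv W (c - b)) (nv W 1).
  by apply: (cf W pi D aD); rewrite -(nv_eqX q (h W FW (or_intror cb))).
exists 1; rewrite ?rpred1 // expr1n; apply/eqP; rewrite eq_le cb andbT.
by apply: nv_leB => //; rewrite nv_le1 FW.
Qed.

(** * Finite sets as zeros of functions *)

Section LargePoint.
Variable b1 : E.
Hypotheses (b1F : b1 \in F) (b1_large : c <_[V] b1).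
Notation smem := (codes V core q c b1).

Lemma memP f b : f \in core -> b \in core -> smem f b <-> [/\ f != 0, f \in V, cond b1 f, b \in F /\ b \in V & cond b f].
move=> fM bM; have : 1 <_[V] c - b1 by rewrite nvB nv_domB ?(lt_trans c_large).
have hb : b \in V -> 1 <_[V] c - b by move=> bV; rewrite nv_domB (le_lt_trans _ c_large) // nv_le1.
split=> [[f0 fV pf cb pb]|[f0 fV pf [bV]]].
  have [bV] := (constP bM).1 cb.
  by split=> //; apply/condP => //; apply: hb.
split=> //; first exact/condP.
  exact/constP.
by apply/condP => //; apply: hb.
Qed.

(** At the place [c = b] the uniformiser [c - b] is not divisible by [q], so [f] must vanish there;
    the zeros of [f] at such places are among the roots of the denominators of its inverse. *)
Lemma mem_finite f : f \in core -> exists s : seq E, forall b, b \in core -> smem f b -> b \in s.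
move=> fM; have [f0|f0] := eqVneq f 0; first by exists [::] => b _ []; rewrite f0 eqxx.
have [rs [hrs den]] := @denominators f^-1 (core_sep (etrans (rpredV _ _) fM)).
have [s es] := closed_field_poly_normal (\prod_(R <- rs) R).
have : \prod_(R <- rs) R != 0 by rewrite prodf_seq_neq0; apply/allP => R /hrs[_ ->].
exists s => b bM /(memP fM bM)[_ _ _ [bF _] cb].
have [W [D [aD lt]]] := place_at bF; have [FW _ _ [_ _ nd]] := aD.
have c1 := c_le1 FW bF lt.
have fq : f ^+ q <=_[W] c - b by (rewrite leNgt; apply/negP => /(cb _ _ _ aD)[d dD e]; apply: (nd d)).
have f1 : f <_[W] 1 by (rewrite -(nv_ltX2 W _ _ (prime_gt0 pq)) expr1n; apply: le_lt_trans lt).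
have [|R [N [Rrs N0 hR]]] := den W FW c1.
  by rewrite nv_gtV1.
have [FR] := hrs R Rrs.
have Rb : root R b.
  apply/negPn/negP => Rb; move: hR; rewrite exprVn nv_le_divl ?expf_neq0 // mul1r.
  rewrite (residue_horner FW bF lt FR Rb) leNgt; case/negP.
  exact: nv_ltX1.
rewrite -root_prod_XsubC -(rootZ _ (a := lead_coef (\prod_(R <- rs) R))) ?lead_coef_eq0 //.
by rewrite -es (big_rem R Rrs) rootM Rb.
Qed.

(** A place for the poles of the coding functions: [b2] lies outside [V], so it is never a possible
    member. *)
Lemma aux_point : exists b2, [/\ b2 \in F, b2 != b1 & b2 \notin V].
have [pi piF [pi0 pi1]] := smallF; have b10 : b1 != 0 by rewrite -(nv_gt0 V) (le_lt_trans _ b1_large) ?nv_ge0.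
have lt : b1 <_[V] b1 / pi by rewrite nv_lt_divr // mulrC nv_ltMl.
exists (b1 / pi); rewrite rpredM ?rpredV //; split=> //; first by apply: contraTneq lt => ->; rewrite ltxx.
by rewrite -nv_le1 -ltNge (lt_trans _ lt) // (lt_trans c_large).
Qed.

Lemma nv_scale W a f : {subset F <= W} -> a \in F -> a != 0 -> nv W (a * f) = nv W f.
by move=> FW aF a0; apply/nv_eqMl/nv_trivial. Qed.

Let ratio W b b' b'' : {subset F <= W} -> b' \in F -> b'' \in F ->
  1 <_[W] c \/ [/\ b \in F, b != b', b != b'' & c - b <_[W] 1] -> nv W ((c - b') / (c - b'')) = nv W 1.
move=> FW bF' bF'' [c1|[bF bb' bb'' cb]]; last first.
  by rewrite (nv_eqM (place_other FW bF bF' bb' cb) (nv_eqV (place_other FW bF bF'' bb'' cb))) divr1.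
by rewrite (nv_eqM (etrans (place_inf FW bF' c1) (esym (place_inf FW bF'' c1))) erefl) divff ?cb_neq0.
Qed.

Lemma mem_empty : exists2 f, f \in core & [/\ f != 0, f \in V, cond b1 f & forall b, b \in core -> ~ smem f b].
have [b2 [b2F]] := aux_point.
(* This quotient has value 1 at infinity, vanishes at [b1] and is a unit at every [b] in [V], so it
   meets the condition at [b1] and codes nothing. *)
have f1M : (c - b1) / (c - b2) \in core by rewrite rpredM ?rpredV ?rpredB ?c_core ?F_core.
have [a [aF a0]] := core_scale f1M.
have fM : a * ((c - b1) / (c - b2)) \in core by rewrite rpredM // F_core.
have : a * ((c - b1) / (c - b2)) != 0 by rewrite !mulf_neq0 ?invr_eq0 ?cb_neq0.
exists (a * ((c - b1) / (c - b2))) => //; split=> //.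
- by rewrite -nv_le1 ltW.
- move=> W pi D aD lt; have [FW] := aD; exists 1; rewrite ?rpred1 // expr1n.
  move: lt; rewrite (nv_eqX q (nv_scale _ FW aF a0)) => lt.
  have [c1|c1] := ltP (nv W 1) (nv W c).
    move: lt; rewrite (nv_eqX q (ratio (b := 0) FW b1F b2F (or_introl c1))).
    by rewrite expr1n (place_inf FW b1F c1) ltNge (ltW).
  have [cb|cb] := ltP (nv W (c - b1)) (nv W 1); last first.
    by apply/eqP; rewrite eq_le cb andbT; apply: nv_leB => //; rewrite nv_le1 FW.
  move: lt; rewrite (nv_eqX q (_ : _ = nv W (c - b1))); last first.
    rewrite (nv_eqM (erefl) (nv_eqV (place_other FW b1F b2F _ cb))) 1?eq_sym //.
    by rewrite invr1 mulr1.
  rewrite ltNge; case/negP; rewrite -(subnK (prime_gt0 pq)) exprD.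
  exact/nv_leMl/nv_leX1/ltW.
move=> b bM /(memP fM bM)[_ _ _ [bF bV] cb].
have [W [D [aD lt]]] := place_at bF; have [FW _ _ [_ _ nd] _] := aD.
have bb1 : b != b1 by (apply: contraTneq bV => ->; rewrite -nv_le1 -ltNge (lt_trans c_large)).
have bb2 : b != b2 by apply: contraTneq bV => ->.
have [|d] := cb _ _ _ aD; last exact: (nd).
rewrite (nv_eqX q (_ : _ = nv W 1)) ?expr1n // (nv_scale _ FW aF a0).
by apply: (ratio (b := b)) => //; right.
Qed.

(** Multiply [f] by a high power of [(c - b0) / (c - b2)]: it has value 1 at infinity and at the
    other places that matter, and it makes the product vanish at [b0]. A function that fails the
    condition at [b1] codes nothing and is first replaced by the code of the empty set. *)
Lemma mem_adjunction f b0 : f \in core -> b0 \in core -> cst b0 ->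
  exists2 f', f' \in core & forall b, b \in core -> smem f' b <-> smem f b \/ b = b0.
move=> fM b0M /(constP b0M)[b0F b0V].
wlog [f0 fV cf] : f fM / [/\ f != 0, f \in V & cond b1 f].
  move=> H; have [|nf] := pselect [/\ f != 0, f \in V & cond b1 f]; first exact: H.
  have [g gM [g0 gV cg ng]] := mem_empty.
  have [f' f'M hf'] := H g gM (And3 g0 gV cg); exists f' => // b bM; rewrite hf' //.
  split=> -[h|->]; [by case: (ng b bM)| by right| |by right].
  by case: nf; have [?] := (memP fM bM).1 h.
have [b2 [b2F b21 b2V]] := aux_point.
have [rs [hrs den]] := denominators (core_sep fM).
have [m hm] : exists m, forall R, R \in rs -> forall W, {subset F <= W} -> c - b0 <_[W] 1 -> (c - b0) ^+ m <=_[W] R.[c].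
  have : forall R, R \in rs -> R \over F /\ R != 0 := hrs.
  elim: (rs) => [_|R r IH h]; first by exists 0%N.
  have [m1 hm1] := IH (fun S Sr => h S (mem_behead (s := R :: r) Sr)).
  have [FR R0] := h R (mem_head _ _); have [m2 hm2] := order_at b0F FR R0.
  exists (m1 + m2)%N => S; rewrite inE => /orP[/eqP->|Sr] W FW lt.
    by apply: le_trans (hm2 W FW lt); rewrite exprD; apply/nv_leMl/nv_leX1/ltW.
  by apply: le_trans (hm1 S Sr W FW lt); rewrite exprD; apply/nv_leMr/nv_leX1/ltW.
(* The exponent [m] compensates a possible pole of [f] at [b0]; one more factor makes the product at
   most [c - b0] there. *)
pose u := ((c - b0) / (c - b2)) ^+ m.+1.
have uM : u \in core by rewrite rpredX // rpredM ?rpredV ?rpredB ?c_core ?F_core.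
have [a [aF a0 af]] : exists a, [/\ a \in F, a != 0 & a * (f * u) <_[V] 1] by apply: core_scale; rewrite rpredM.
have : a * (f * u) \in core by rewrite !rpredM // F_core.
have u0 : u != 0 by rewrite expf_neq0 // mulf_neq0 ?invr_eq0 ?cb_neq0.
have : a * (f * u) != 0 by rewrite !mulf_neq0.
have same W b : {subset F <= W} -> b \in F -> b != b0 -> b != b2 -> 1 <_[W] c \/ c - b <_[W] 1 -> nv W (a * (f * u)) = nv W f.
  move=> FW bF bb0 bb2 h; rewrite (nv_scale _ FW aF a0); apply: nv_eqMr.
  rewrite (nv_eqX m.+1 (ratio (b := b) FW b0F b2F _)) ?expr1n //.
  by case: h => h; [left|right].
have b10 : b1 != b0 by (apply: contraTneq b0V => <-; rewrite -nv_le1 -ltNge (lt_trans c_large)).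
have b12 : b1 != b2 by rewrite eq_sym.
have : a * (f * u) \in V by rewrite -nv_le1 ltW.
have : cond b1 (a * (f * u)) by apply: (cond_local b1F _ cf) => W FW h; apply: same h.
have : cond b0 (a * (f * u)).
  move=> W pi D aD lt; have [FW] := aD.
  have [c1|c1] := ltP (nv W 1) (nv W c).
    have [|d dD e] := cf W pi D aD.
      by rewrite -(nv_eqX q (same W b1 FW b1F b10 b12 (or_introl c1))) (place_inf FW b1F c1) -(place_inf FW b0F).
    by exists d => //; rewrite -e (place_inf FW b1F c1) (place_inf).
  have [cb|cb] := ltP (nv W (c - b0)) (nv W 1); last first.
    exists 1; rewrite ?rpred1 // expr1n; apply/eqP; rewrite eq_le cb andbT.
    by apply: nv_leB => //; rewrite nv_le1 FW.
  have b02 : b0 != b2 by apply: contraTneq b0V => ->.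
  have fm : f * (c - b0) ^+ m <=_[W] 1.
    have [f1|f1] := leP (nv W f) (nv W 1).
      by apply: nv_leM1 => //; apply/nv_leX1/ltW.
    have [R [N [Rrs N0 hR]]] := den W FW c1 f1.
    rewrite -(nv_leX2 W _ _ N0) expr1n exprMn; apply: le_trans hR; rewrite mulrC; apply: nv_leM => //.
    apply: le_trans (hm R Rrs W FW cb).
    by rewrite -(subnK N0) exprD; apply/nv_leMl/nv_leX1/nv_leX1/ltW.
  have nu : nv W (a * (f * u)) = nv W (f * (c - b0) ^+ m * (c - b0)).
    rewrite (nv_scale _ FW aF a0) -mulrA -exprSr; apply: nv_eqM => //; apply: nv_eqX.
    by rewrite (nv_eqM (erefl) (nv_eqV (place_other FW b0F b2F b02 cb))) divr1.
  move: lt; rewrite (nv_eqX q nu) ltNge; case/negP.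
  have le1 : f * (c - b0) ^+ m * (c - b0) <=_[W] c - b0 by apply: nv_leMl.
  rewrite -(subnK (prime_gt0 pq)) exprD; apply: le_trans (le1).
  exact/nv_leMl/nv_leX1/(le_trans le1)/ltW.
exists (a * (f * u)) => // b bM; rewrite !memP //; split=> [[_ _ _ [bF bV] cb]|[[_ _ _ [bF bV] cb]|->]].
- have [] := eqVneq b b0; [by right|left; split=> //].
  have bb2 : b != b2 by apply: contraTneq bV => ->.
  by apply: (cond_local bF _ cb) => W FW h; apply/esym/(same W b).
- split=> //; have [->|bb0] := eqVneq b b0 => //.
  have bb2 : b != b2 by apply: contraTneq bV => ->.
  by apply: (cond_local bF _ cb) => W h; apply: (same).
- by [].
Qed.
End LargePoint.

Theorem core_coded_sets : exists (M : subfield E) (b1 : E),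
  [/\ {subset F <= M}, {subset M <= L}, forall x, x \in M -> exists2 y, y \in F & rveq V x y,
      forall n (b : 'I_n -> E), (forall k, b k \in F) -> (forall x, x \in F -> spans (ppow pE F) b x) ->
        forall x, x \in M -> spans (ppow pE M) b x & forall x (P : {poly E}), x \in L -> P \over M -> (size P <= q)%N ->
        root P x -> ~~ root P^`() x -> x \in M] /\ coded_sets V M q c b1 F.
have [pi piF [pi0 pi1]] := smallF; have [y yF cy] := sep_tower_rv (tower_sep (tower_cn 0)).
have c0 : c != 0 by rewrite -(nv_gt0 V) (le_lt_trans _ c_large) ?nv_ge0.
have b1F : y / pi \in F by rewrite rpredM ?rpredV.
have b1c : c <_[V] y / pi by rewrite nv_lt_divr // -(rveq_nv cy) mulrC nv_ltMl.
exists core, (y / pi); split.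
  split; [exact: F_core|by move=> x /core_sep/sep_towerP[]|by move=> x /core_sep/sep_tower_rv| |].
    exact: core_pspan.
  exact: core_sepclosed.
split.
- by split; [apply: c_core|apply: F_core|rewrite -subr_eq0 cb_neq0|move=> b bF; rewrite -subr_eq0 cb_neq0].
- exact: constP.
- exact: mem_finite.
- by have [f fM [h]] := mem_empty b1F b1c; exists f.
- exact: mem_adjunction.
Qed.
End Tower.

(** * A pseudo-limit transcendental over the algebraic closure *)

Section PseudoLimit.
Variables (K : closedF) (O : valring K) (p : nat) (pK : p \in [pchar K]).
Variables (F : subfield K) (sgF : SG O p F).
Hypothesis cK : ctbl (fun _ : K => True).
Hypothesis smallF : exists2 pi, pi \in F & pi != 0 /\ pi <_[O] 1.
Notation L := (upF (fun=> F)).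
Notation V := (upO O).
Notation C := (imA (@diag K : {rmorphism K -> UP K})).

Lemma upF_immed x z : x \in L -> z \in C -> rveq V x z -> exists2 y, y \in diagF F & rveq V x y.
move=> /upF_rep[f [fF ->]] /imAP[a ->] /up_rveq h; have [i hi] := ae_ex h.
exists (diag (f i)); first exact/diag_in.
by apply/up_rveq; apply: ae_imp h => j hj; apply: rveq_trans (rveq_sym hi).
Qed.

Lemma diag_closed P z : P \over C -> P != 0 -> root P z -> z \in C.
move=> /imA_polyOver[Q ->]; rewrite map_poly_eq0 => Q0.
have [rs eQ] := closed_field_poly_normal Q.
rewrite eQ map_polyZ rootZ ?fmorph_eq0 ?lead_coef_eq0 // => rz; apply/imAP.
have : z \in [seq diag a | a <- rs].
  rewrite -root_prod_XsubC big_map; move: rz; rewrite rmorph_prod.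
  by under eq_bigr => a do rewrite rmorphB /= map_polyX map_polyC.
by case/mapP => a _ ->; exists a.
Qed.

Lemma diag_upF x : x \in C -> x \in L -> x \in diagF F.
by move=> /imAP[a ->] /upFP/ae_ex[i aF]; apply/diag_in. Qed.

(** Each ball excludes one more element [z n]. The first one has centre [pi^-1] and radius 1, so all
    its elements are larger than 1. *)
Lemma nested_balls z : exists b e : nat -> K, [/\ forall n, b n \in F, forall n, e n \in F,
  forall n, e n != 0, b 0%N != 0 /\ (b 0%N)^-1 <_[O] 1 & e 0%N = 1] /\
  forall n, [/\ b n.+1 - b n <_[O] e n, e n.+1 <_[O] e n & e n.+1 <=_[O] z n - b n.+1].
have [pi piF [pi0 pi1]] := smallF.
pose ok t := [/\ t.1 \in F, t.2 \in F & t.2 != 0].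
have /choice[g hg] : forall w : K * (K * K), exists t, ok w.2 ->
    ok t /\ [/\ t.1 - w.2.1 <_[O] w.2.2, t.2 <_[O] w.2.2 & t.2 <=_[O] w.1 - t.1].
  move=> [w [b e]]; have [[/= bF eF e0]|nok] := pselect (ok (b, e)); last by exists (b, e) => /nok.
  have : pi * e <_[O] e by rewrite nv_ltMl.
  (* If [w] is far from the centre, only shrink the ball; if it is near, also move the centre away
     by [pi * e]. *)
  have [] := leP (nv O (pi * e)) (nv O (w - b)).
    exists (b, pi * e) => _; rewrite /ok rpredM // mulf_neq0 // subrr nv_gt0.
    by [].
  exists (b + pi * e, pi * e) => _; rewrite /ok rpredD ?rpredM // mulf_neq0 //.
  rewrite [b + _]addrC addrK.
  rewrite -[w - _]opprB nvN -[_ + b - w]addrA nv_dom //.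
  by rewrite -opprB nvN.
pose s := fix s n := if n is m.+1 then g (z m, s m) else (pi^-1, 1).
have sok n : ok (s n) by (elim: n => [|n IH]; [rewrite /ok rpredV rpred1 oner_neq0|have [] := hg (z n, s n)]).
exists (fun n => (s n).1), (fun n => (s n).2); split.
  split=> [n|n|n||//]; try by have [] := sok n.
  by rewrite invrK invr_eq0.
by move=> n; have [_] := hg (z n, s n) (sok n).
Qed.

(** The element has to lie in all balls and to have a compatible system of [p]-power roots in [L].
    Any finite part of this is met by a [p ^ n]-th power in [F], since these powers are dense in
    [F]. *)
Lemma pseudo_limit : exists cn : nat -> UP K, [/\ forall k, cn k \in L, forall k, cn k.+1 ^+ p = cn k,
  forall z, z \in C -> exists2 b, b \in C & cn 0%N - b <_[V] z - b & 1 <_[V] cn 0%N].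
have [pi piF [pi0 pi1]] := smallF.
have [z hz] : exists z : nat -> K, forall x, exists n, z n = x.
  have [z [_ hz]] := countable_enum (x0 := 0) cK I; exists z => x; exact: hz.
have [b [e [[bF eF e0 [b0 bi] e1] nest]]] := nested_balls z.
have eV n : diag (e n) != 0 :> UP K by rewrite fmorph_eq0.
(* Membership in a ball becomes an equality of leading terms, a relation already known to be
   internal. *)
have in_ball n y : rveq V (y - diag (b n - e n)) (diag (e n)) <-> y - diag (b n) <_[V] diag (e n).
  have e2 : y - diag (b n - e n) - diag (e n) = y - diag (b n).
    ring.
  by rewrite rveqP; [rewrite e2|apply: eV].
pose R n y := [/\ rveq V (y 0%N - diag (b n - e n)) (diag (e n)), y n \in L & y n.+1 ^+ p = y n].
have nestle n m : (m <= n)%N -> e n <=_[O] e m /\ b n - b m <_[O] e m.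
  elim: n => [|n IH]; first by rewrite leqn0 => /eqP ->; rewrite subrr nv_gt0.
  rewrite leq_eqVlt => /orP[/eqP->|/IH[le lt]]; first by rewrite subrr nv_gt0.
  have [h2] := nest n; split; first by apply: le_trans le; apply: ltW.
  by rewrite -(subrK (b n) (b n.+1)) -addrA; apply: nv_ltD => //; apply: lt_le_trans le.
have intR n : intl (R n).
  have i1 : intl (fun y : nat -> UP K => rveq V (y 0%N - diag (b n - e n)) (diag (e n))).
    apply: intl_rveq; last exact: intl_cst.
    by apply: intlB; [apply: intl_var|apply: intl_cst].
  have i2 : intl (fun y : nat -> UP K => y n \in L) by apply/intl_mem/intl_var.
  have iX m : int_term (fun y : nat -> UP K => y n.+1 ^+ m).
    elim: m => [|m IH]; first exact: intl_cst.
    have -> : (fun y : nat -> UP K => y n.+1 ^+ m.+1) = (fun y => y n.+1 * y n.+1 ^+ m) by (apply: funext => y; rewrite exprS).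
    by apply: intlM => //; apply: intl_var.
  have i3 : intl (fun y : nat -> UP K => y n.+1 ^+ p = y n) by exact (intl_eq (iX p) (intl_var K n)).
  have [[D1 h1] [D2 h2] [D3 h3]] := And3 i1 i2 i3.
  exists (fun i f => [/\ D1 i f, D2 i f & D3 i f]) => f; split=> [[/h1 r1 /h2 r2 /h3 r3]|h].
    by apply: ae_imp (ae_and r1 (ae_and r2 r3)) => i [? []].
  by split; [apply/h1|apply/h2|apply/h3]; apply: ae_imp h => i [].
have diag_lt x y : x <_[O] y -> diag x <_[V] diag y by rewrite !ltNge diag_nv_le.
have [n|y hy] := intl_saturation intR.
  have [y0] := sg_dense pK n sgF (bF n) (eF n) (e0 n) piF pi0 pi1.
  exists (fun k => diag (y0 ^+ (p ^ (n - k)))) => k kn; have [le] := nestle n k (ltnW kn); split.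
  - apply/in_ball; rewrite subn0 -(rmorphB) /=; apply: diag_lt.
    by rewrite -(subrK (b n) (y0 ^+ _)) -addrA; apply: nv_ltD => //; apply: lt_le_trans le.
  - by apply/diagF_sub/diag_in; rewrite rpredX.
  - by rewrite -(rmorphXn) -exprM -expnSr subnSK.
have ball n : y 0%N - diag (b n) <_[V] diag (e n) by apply/in_ball; have [] := hy n.
exists y; split.
- by move=> k; have [] := hy k.
- by move=> k; have [] := hy k.
- move=> _ /imAP[a ->]; have [n en] := hz a; have [h] := nest n; exists (diag (b n.+1)).
    by apply/imAP; exists (b n.+1).
  apply: lt_le_trans (ball n.+1) _; rewrite -en -(rmorphB) diag_nv_le //.
have b01 : 1 <_[V] diag (b 0%N).
  rewrite -(rmorph1 (@diag K)) /=; apply: diag_lt.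
  by rewrite -nv_ltV1 ?invr_eq0.
have h0 : y 0%N - diag (b 0%N) <_[V] diag (b 0%N) by (apply: lt_trans (ball 0%N) _; rewrite e1 (rmorph1)).
by rewrite -[y 0%N](subrK (diag (b 0%N))) addrC nv_dom.
Qed.

(* The failure at each prime [q] of the divisibility by [q] is lost in the
   ultraproduct over all [q]. *)
Theorem coded_subfield q : prime q -> (2 < q)%N -> q != p -> exists (M : subfield (UP K)) (c b1 : UP K),
  [/\ {subset diagF F <= M}, {subset M <= L}, rv_sub V M (diagF F), forall n (b : 'I_n -> K), (forall k, b k \in F) ->
        (forall x, x \in F -> spans (ppow pK F) b x) -> forall x, x \in M -> spans (ppow (up_pchar pK) M) (fun k => diag (b k)) x
    & forall x (P : {poly UP K}), x \in L -> P \over M -> (size P <= q)%N -> root P x -> ~~ root P^`() x -> x \in M]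
  /\ coded_sets V M q c b1 (diagF F).
move=> pq q2 qp; have [cn [cnL cnp cut c1]] := pseudo_limit.
have FC : {subset diagF F <= C} by move=> _ /diagFP[a aF ->]; apply/imAP; exists a.
have FL := @diagF_sub K F; have sgL : SG V p L by apply: up_sg.
have small : exists2 pi, pi \in diagF F & pi != 0 /\ pi <_[V] 1.
  have [pi] := smallF; exists (diag pi); first exact: diag_in.
  by rewrite fmorph_eq0 -(rmorph1 (@diag K)) ltNge diag_nv_le -ltNge.
have pU := up_pchar pK.
have [M [b1 [[FM ML rvM spM scM] cs]]] := @core_coded_sets _ V p pU (diagF F) C L cn FC FL diag_closed
  diag_upF upF_immed cnL cnp cut sgL c1 q pq q2 qp small.
exists M, (cn 0%N), b1; split=> //; split=> // n b bF hb; apply: spM => [k|]; first exact: diag_in.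
move=> _ /diagFP[a aF ->]; have [r [rF ->]] := hb _ aF; exists (fun k => diag (r k)); split=> [k|].
  have /ppowP[g gF ->] := rF k; apply/ppowP; exists (diag g); rewrite ?rmorphXn //.
  exact: diag_in.
by rewrite (rmorph_sum (@diag K)); apply: eq_bigr => k _; rewrite rmorphM.
Qed.
End PseudoLimit.

Local Close Scope quotient_scope.
Local Close Scope ring_scope.

(** * Total recursive functions on codes *)

Section Recursive.
Lemma thead_nth n (x : n.+1.-tuple nat) : thead x = nth 0 x 0.
by rewrite /thead (tnth_nth 0). Qed.

Lemma computes_fun n (r : recfun n) x y y' : computes r x y -> computes r x y' -> y = y'.
elim: r x y y' => [m||m i|k m g IHg h IHh|m g IHg h IHh|m g IHg] x y y' /=; try by move=> -> ->.
- move=> [z hz gz] [z' hz' gz']; have e : z = z' by apply: eq_from_tnth => i; apply: IHh.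
  by apply: IHg gz _; rewrite e.
- move=> [u [u0 uS ->]] [u' [u0' uS' ->]].
  suff h' k : (k <= thead x)%N -> u k = u' k by apply: h'.
  elim: k => [_|k IH kx]; first exact: IHg u0'.
  by apply: IHh (uS k kx) _; rewrite (IH (ltnW kx)); apply: uS'.
- move=> [y0 hy] [y0' hy']; case: (ltngtP y y') => // lt.
    by have [z hz] := hy' y lt; have := IHg _ _ _ y0 hz.
  by have [z hz] := hy y' lt; have := IHg _ _ _ y0' hz.
Qed.

Definition recf n (F : n.-tuple nat -> nat) := exists r : recfun n, forall x, computes r x (F x).

Lemma recf_ext n (F G : n.-tuple nat -> nat) : F =1 G -> recf F -> recf G.
by move=> e [r hr]; exists r => x; rewrite -e. Qed.
Lemma recf_proj n (i : 'I_n) : recf (fun x => tnth x i).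
by exists (RProj i). Qed.

Lemma recf_comp n k G (H : 'I_k -> n.-tuple nat -> nat) : recf G ->
  (forall i, recf (H i)) -> recf (fun x => G [tuple H i x | i < k]).
move=> [g hg] /choice[h hh]; exists (RComp g h) => x.
by exists [tuple H i x | i < k] => // i; rewrite tnth_mktuple.
Qed.

Lemma recf_comp1 n f (H : n.-tuple nat -> nat) : recf (fun x : 1.-tuple nat => f (thead x)) -> recf H -> recf (fun x => f (H x)).
move=> hf hH; apply: recf_ext (recf_comp hf (fun=> hH)) => x.
by rewrite /thead tnth_mktuple.
Qed.

Lemma recf_succ n (H : n.-tuple nat -> nat) : recf H -> recf (fun x => (H x).+1).
by apply: (recf_comp1 (f := S)); exists RSucc. Qed.
Lemma recf_const n k : recf (fun _ : n.-tuple nat => k).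
by elim: k => [|k IH]; [exists (RZero n)|apply: recf_succ]. Qed.

Lemma recf_prec n (G : n.-tuple nat -> nat) (H : n.+2.-tuple nat -> nat) : recf G -> recf H ->
  recf (fun x : n.+1.-tuple nat => nat_rect (fun=> nat) (G [tuple of behead x])
    (fun m u => H [tuple of m :: u :: behead x]) (thead x)).
move=> [g hg] [h hh]; exists (RPrec g h) => x.
exists (nat_rect (fun=> nat) (G [tuple of behead x]) (fun m u => H [tuple of m :: u :: behead x])).
by [].
Qed.

Lemma recf_double n (H : n.-tuple nat -> nat) : recf H -> recf (fun x => (H x).*2).
apply: (recf_comp1).
have := recf_prec (recf_const 0 0) (recf_succ (recf_succ (recf_proj (lift ord0 ord0)))).
by [].
Qed.

Lemma recf_npair n a (H : n.-tuple nat -> nat) : recf H -> recf (fun x => npair a (H x)).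
move=> hH; elim: a => [|a IH].
  by apply: recf_ext (recf_succ (recf_double hH)) => x; rewrite /npair mul1n.
by apply: recf_ext (recf_double IH) => x; rewrite /npair expnS -mulnA mul2n.
Qed.

Lemma recf_npair2 n (A H : n.-tuple nat -> nat) : recf A -> recf H -> recf (fun x => npair (A x) (H x)).
move=> hA hH; have h2 : recf (fun x : 2.-tuple nat => npair (thead x) (nth 0 x 1)).
  have := recf_prec (recf_succ (recf_double (recf_proj ord0))) (recf_double (recf_proj (lift ord0 (ord0 : 'I_2)))).
  apply: recf_ext => x; rewrite [tnth _ _](tnth_nth 0) nth_behead.
  elim: (thead x) => [|m /= ->]; first by rewrite /npair mul1n.
  by rewrite /npair expnS -mulnA mul2n.
have := recf_comp (H := fun i : 'I_2 => if i == ord0 then A else H) h2.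
move=> /(_ (fun => ltac:(by case: ifP))) => h3; apply: recf_ext h3 => x.
by rewrite /thead tnth_mktuple -(tnth_nth 0 _ (lift ord0 ord0)) tnth_mktuple.
Qed.
End Recursive.

(** * Renaming of variables *)

Section Renaming.
Variable U : countType.

Fixpoint tren (rho : nat -> nat) (t : term) : term := match t with | tVar n => tVar (rho n) | tZero => tZero | tOne => tOne
  | tOpp t1 => tOpp (tren rho t1) | tAdd t1 t2 => tAdd (tren rho t1) (tren rho t2)
  | tMul t1 t2 => tMul (tren rho t1) (tren rho t2) end.

(** Bound variables become fresh ones from [s] upwards, which avoids capture. *)
Fixpoint ren (rho : nat -> nat) s (phi : formula U) : formula U := match phi with | fFalse => fFalse
  | fEq t1 t2 => fEq (tren rho t1) (tren rho t2) | fPred u t => fPred u (tren rho t)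
  | fImp phi1 phi2 => fImp (ren rho s phi1) (ren rho s phi2) | fAll n phi1 => fAll s (ren (update rho n s) s.+1 phi1) end.

Definition rename rho (phi : formula U) := ren rho (\max_(v <- free_vars phi) rho v).+1 phi.

Variable M : structure U.

Lemma tren_eval rho t (e : nat -> M) : teval e (tren rho t) = teval (fun v => e (rho v)) t.
by elim: t => //= [t ->|t -> t' ->|t -> t' ->]. Qed.

Lemma ren_sat phi rho s (e : nat -> M) : {in free_vars phi, forall v, (rho v < s)%N} ->
  satisfies e (ren rho s phi) <-> satisfies (fun v => e (rho v)) phi.
elim: phi rho s e => [|t1 t2|u t|f1 IH1 f2 IH2|n f IH] rho s e h /=; rewrite ?tren_eval //.
  have [h1 h2] : satisfies e (ren rho s f1) <-> satisfies (fun v => e (rho v)) f1 by (apply: IH1 => v hv; apply: h; rewrite mem_cat hv).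
  have [h3 h4] : satisfies e (ren rho s f2) <-> satisfies (fun v => e (rho v)) f2 by (apply: IH2 => v hv; apply: h; rewrite mem_cat hv orbT).
  by split=> H; [move/h2/H/h3|move/h1/H/h4].
have hv v : v \in free_vars f -> v != n -> (rho v < s)%N by (move=> vf vn; apply: h; rewrite mem_filter vn).
have key x : satisfies (update e s x) (ren (update rho n s) s.+1 f) <-> satisfies (update (fun v => e (rho v)) n x) f.
  rewrite IH => [|v vf]; last first.
    by rewrite /update; case: eqP => [_ //|/eqP vn]; apply: leqW; apply: hv.
  apply: satisfies_ext => v vf; rewrite /update; case: (eqVneq v) => [_|vn]; first by rewrite eqxx.
  by rewrite ltn_eqF // hv.
by split=> H x; apply/key.
Qed.

Lemma rename_sat phi rho (e : nat -> M) : satisfies e (rename rho phi) <-> satisfies (fun v => e (rho v)) phi.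
by apply: ren_sat => v vf; rewrite ltnS; rewrite (big_rem v vf) leq_maxl. Qed.
End Renaming.

(** * Representing recursive functions in a theory of coded sets *)

Section Language.
Variables (U : countType) (om : formula U) (q : nat).

(** An auxiliary language with named parameters, translated by [tr]: [PC], [PB] and [PT] stand for
    [c], [b1] and the base [tau] of the numerals. *)
Inductive tm := X of nat | PC | PB | PT | Zero | One | Opp of tm | Add of tm & tm | Mul of tm & tm | Pow of tm & nat.

Inductive fm := Eq of tm & tm | InO of nat | Not of fm | And of fm & fm | Or of fm & fm | Imp of fm & fm
  | Ex of nat & fm | All of nat & fm | Call of fm & (nat -> nat).

Section Semantics.
Variables (M : structure U) (ps : nat -> M).

Definition pw (x : M) n := iter n (s_mul x) (s_one M).

Fixpoint ev (xs : nat -> M) t : M := match t with | X j => xs j | PC => ps 0 | PB => ps 1 | PT => ps 2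
  | Zero => s_zero M | One => s_one M | Opp t => s_opp (ev xs t) | Add s t => s_add (ev xs s) (ev xs t)
  | Mul s t => s_mul (ev xs s) (ev xs t) | Pow t n => pw (ev xs t) n end.

(** The valuation ring enters through a formula [om], so that one treatment serves both languages:
    [om] is the predicate, or a ring formula defining it, with its parameters stored from index 3
    on. *)
Definition inO (x : M) : Prop := satisfies (fun i => if i is i'.+1 then ps (3 + i') else x) om.

Fixpoint sat (xs : nat -> M) f : Prop := match f with | Eq s t => ev xs s = ev xs t | InO j => inO (xs j) | Not f => ~ sat xs f
  | And f g => sat xs f /\ sat xs g | Or f g => sat xs f \/ sat xs g | Imp f g => sat xs f -> sat xs g
  | Ex j f => exists x, sat (update xs j x) f | All j f => forall x, sat (update xs j x) f
  | Call f rho => sat (fun v => xs (rho v)) f end.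

(** Separating parameters from working variables by parity keeps the quantifiers of the auxiliary
    language away from the parameters. *)
Definition mix (xs : nat -> M) v := if odd v then xs v./2 else ps v./2.

Lemma mix_update xs j x : update (mix xs) j.*2.+1 x = mix (update xs j x).
apply: funext => v; rewrite /update /mix; have [->|vj] := eqVneq.
  by rewrite /= odd_double uphalf_double eqxx.
case: (boolP (odd v)) => // ov; case: eqP => // vj'; move: vj.
by rewrite -vj' -[v in v != _]odd_double_half ov eqxx.
Qed.
End Semantics.

Fixpoint tr_tm t : term := match t with | X j => tVar j.*2.+1 | PC => tVar 0 | PB => tVar 2 | PT => tVar 4
  | Zero => tZero | One => tOne | Opp t => tOpp (tr_tm t) | Add s t => tAdd (tr_tm s) (tr_tm t)
  | Mul s t => tMul (tr_tm s) (tr_tm t) | Pow t n => iter n (tMul (tr_tm t)) tOne end.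

Fixpoint tr f : formula U := match f with | Eq s t => fEq (tr_tm s) (tr_tm t)
  | InO j => rename (fun i => if i is i'.+1 then (3 + i').*2 else j.*2.+1) om | Not f => fImp (tr f) fFalse
  | And f g => fImp (fImp (tr f) (fImp (tr g) fFalse)) fFalse | Or f g => fImp (fImp (tr f) fFalse) (tr g)
  | Imp f g => fImp (tr f) (tr g) | Ex j f => fImp (fAll j.*2.+1 (fImp (tr f) fFalse)) fFalse | All j f => fAll j.*2.+1 (tr f)
  | Call f rho => rename (fun v => if odd v then (rho v./2).*2.+1 else v) (tr f) end.

Lemma tr_tmE (M : structure U) (ps xs : nat -> M) t : teval (mix ps xs) (tr_tm t) = ev ps xs t.
elim: t => //= [j|t ->|s -> t ->|s -> t ->|t IH n] //.
  by rewrite /mix /= odd_double uphalf_double.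
by elim: n => //= n <-; rewrite IH.
Qed.

Lemma trE (M : structure U) (ps xs : nat -> M) f : satisfies (mix ps xs) (tr f) <-> sat ps xs f.
elim: f xs => [s t|j|f IH|f IHf g IHg|f IHf g IHg|f IHf g IHg|j f IH|j f IH|f IH rho] xs /=.
- by rewrite !tr_tmE.
- rewrite rename_sat /inO; suff -> : (fun v => mix ps xs (if v is i'.+1 then (3 + i').*2 else j.*2.+1)) =
    (fun i => if i is i'.+1 then ps (3 + i') else xs j) by [].
  by apply: funext => -[|i]; rewrite /mix /= odd_double ?uphalf_double ?doubleK.
- by rewrite IH.
- by rewrite IHf IHg; split=> [h|[hf hg] /(_ hf)//]; apply: contrapT => n; apply: h => hf hg; apply: n.
- rewrite IHf IHg; split=> [h|[hf /(_ hf)|]//].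
  by have [] := pselect (sat ps xs f); [left|right; apply: h].
- by rewrite IHf IHg.
- split=> [h|[x hx] /(_ x)]; last by rewrite mix_update IH.
  by apply: contrapT => n; apply: h => x; rewrite mix_update IH => hx; apply: n; exists x.
- by split=> h x; have := h x; rewrite mix_update IH.
- rewrite rename_sat -IH; suff -> : (fun v => mix ps xs (if odd v then (rho v./2).*2.+1 else v)) =
    mix ps (fun v => xs (rho v)) by [].
  apply: funext => v; rewrite /mix; case: (boolP (odd v)) => ov.
    by rewrite /= odd_double uphalf_double.
  by rewrite (negbTE ov).
Qed.

Definition pr a b := Add (Mul a a) (Mul PT (Mul b b)).
Definition as_root t := Ex 9 (Eq (Add (Pow (X 9) q) (Opp (X 9))) t).
Definition fm_small j := And (InO j) (Not (Ex 8 (And (InO 8) (Eq (Mul (X j) (X 8)) One)))).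
Definition fm_const := And (InO 0) (All 1 (Imp (fm_small 1) (Imp (as_root (X 1)) (as_root (Mul (X 1) (Pow (X 0) q)))))).
(** The equation behind [pole_free] for [f ^+ q / (c - t)], cleared of its denominator. *)
Definition fm_free f t := Ex 9 (Eq (Mul (Add (Pow (X 9) q) (Opp (X 9))) (Add PC (Opp t))) (Pow (X f) q)).
Definition fm_mem := And (Not (Eq (X 0) Zero)) (And (InO 0) (And (fm_free 0 PB)
  (And (Call fm_const (fun=> 1)) (fm_free 0 (X 1))))).
Definition mm a b := Call fm_mem (fun v => if v is 0 then a else b).
(** The element belongs to a coded set in which every member except 1 is [tau] times a member;
    finiteness of coded sets leaves only powers of [tau]. *)
Definition fm_nat := And (Not (Eq (X 0) Zero)) (Ex 1 (And (mm 1 0) (All 2 (Imp (mm 1 2)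
  (Or (Eq (X 2) One) (Ex 3 (And (mm 1 3) (Eq (X 2) (Mul PT (X 3)))))))))).
Definition nt a := Call fm_nat (fun=> a).
Definition pm a b := Ex 6 (And (Eq (X 6) (pr a b)) (mm 1 6)).

(* [X 0] holds the value and [X (10 + i)] the arguments; intermediate values are
   pushed on top of the arguments. *)
Definition push_var v := if v < 10 then v else if v == 10 then 9 else v.-1.

Fixpoint comp_fm (h : nat -> fm) g j m := if j is j'.+1 then
  Ex 9 (Call (And (Call (h j') (fun v => if v < 10 then 10 else v + m.+1)) (comp_fm h g j' m.+1)) push_var) else g.

(** The number [k] is represented by [tau ^+ k]. Primitive recursion and minimization quantify over
    one coded set, of which only downward closure is demanded: every member is justified by an
    earlier one. *)
Fixpoint rep n (r : recfun n) : fm := match r with | RZero _ => Eq (X 0) One | RSucc => Eq (X 0) (Mul PT (X 10))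
  | RProj _ i => Eq (X 0) (X (10 + i))
  | RComp k _ g h => comp_fm (fun j => if insub j is Some i then rep (h i) else Eq One One) (rep g) k 0
  | RPrec _ g h => And (nt 0) (Ex 1 (And (pm (X 10) (X 0)) (All 2 (Imp (mm 1 2) (Or
      (Ex 3 (And (Eq (X 2) (pr One (X 3))) (Call (rep g) (fun v => if v < 10 then 3 else v.+1))))
      (Ex 3 (Ex 4 (Ex 5 (And (nt 3) (And (nt 4) (And (Eq (X 2) (pr (Mul PT (X 3)) (X 5))) (And (pm (X 3) (X 4)) (Call (rep h)
          (fun v => if v < 10 then 5 else if v == 10 then 3 else if v == 11 then 4 else v.-1))))))))))))))
  | RMin _ g => And (nt 0) (And
      (Ex 1 (And (Eq (X 1) One) (Call (rep g) (fun v => if v < 10 then 1 else if v == 10 then 0 else v.-1))))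
      (Ex 1 (And (mm 1 0) (All 2 (Imp (mm 1 2) (Or (Eq (X 2) One) (Ex 3 (And (mm 1 3) (And (Eq (X 2) (Mul PT (X 3)))
        (Ex 4 (Ex 5 (And (nt 4) (And (Eq (X 5) (Mul PT (X 4))) (Call (rep g)
          (fun v => if v < 10 then 5 else if v == 10 then 3 else v.-1))))))))))))))) end.

(** A finitely axiomatised theory that represents all recursive functions in every structure
    satisfying it: an empty set, adjunction of constants, and closure of the constants under the
    operations used by numerals and pairs. *)
Definition fm_sets := And (And (Not (Eq One Zero)) (All 1 (Imp (Not (Eq (X 1) Zero)) (Not (Eq (Mul PT (X 1)) Zero)))))
  (And (And (Ex 1 (All 2 (Not (mm 1 2))))
    (All 1 (All 2 (Imp (Call fm_const (fun=> 2)) (Ex 3 (All 4 (And (Imp (mm 3 4) (Or (mm 1 4) (Eq (X 4) (X 2))))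
      (Imp (Or (mm 1 4) (Eq (X 4) (X 2))) (mm 3 4))))))))) (And (Ex 1 (And (Eq (X 1) One) (Call fm_const (fun=> 1))))
    (All 1 (Imp (Call fm_const (fun=> 1)) (And (Ex 3 (And (Eq (X 3) (Mul PT (X 1))) (Call fm_const (fun=> 3))))
      (All 2 (Imp (Call fm_const (fun=> 2)) (Ex 3 (And (Eq (X 3) (pr (X 1) (X 2))) (Call fm_const (fun=> 3))))))))))).

Section Meaning.
Variables (M : structure U) (ps : nat -> M).
Notation "x '⊕' y" := (s_add x y) (at level 50).
Notation "x '⊗' y" := (s_mul x y) (at level 40).
Notation "'⊖' x" := (s_opp x) (at level 35).
Notation c := (ps 0).
Notation b1 := (ps 1).
Notation tau := (ps 2).
Notation inO := (inO ps).

Definition has_as g := exists z : M, pw z q ⊕ ⊖ z = g.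
Definition smallS x := inO x /\ ~ exists y, inO y /\ x ⊗ y = s_one M.
Definition constS x := inO x /\ forall g, smallS g -> has_as g -> has_as (g ⊗ pw x q).
Definition freeS f b := exists z : M, (pw z q ⊕ ⊖ z) ⊗ (c ⊕ ⊖ b) = pw f q.
Definition memS f b := f <> s_zero M /\ inO f /\ freeS f b1 /\ constS b /\ freeS f b.
Definition natS z := z <> s_zero M /\ exists f, memS f z /\
  forall u, memS f u -> u = s_one M \/ exists v, memS f v /\ u = tau ⊗ v.
Definition pairS a b := (a ⊗ a) ⊕ (tau ⊗ (b ⊗ b)).
Definition num n : M := iter n (s_mul tau) (s_one M).

Definition setsS : Prop := (s_one M <> s_zero M /\ forall x : M, x <> s_zero M -> tau ⊗ x <> s_zero M) /\
  ((exists f, forall b, ~ memS f b) /\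
   forall f b, constS b -> exists f', forall y, (memS f' y -> memS f y \/ y = b) /\ (memS f y \/ y = b -> memS f' y)) /\
  constS (s_one M) /\ forall a, constS a -> constS (tau ⊗ a) /\ forall b, constS b -> constS (pairS a b).

Lemma sat_sets xs : sat ps xs fm_sets <-> setsS.
split=> [[h0 [h1 [[x [/= -> h2]] h3]]]|[h0 [h1 [h2 h3]]]]; (split; [exact: h0|split; [exact: h1|]]).
  split=> // a ca; have [[y [-> hy]] hp] := h3 a ca; split=> // b cb.
  by have [z [->]] := hp b cb.
split; first by exists (s_one M).
move=> a ca; have [h4 h5] := h3 a ca; split; first by exists (tau ⊗ a).
by move=> b cb; exists (pairS a b); split=> //; apply: h5.
Qed.

Section Soundness.
Hypothesis natN : forall z, natS z -> exists k, z = num k.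
Hypothesis pairN : forall j a j' a', pairS (num j) (num a) = pairS (num j') (num a') -> j = j' /\ a = a'.
Hypotheses (numI : injective num) (tauI : forall x y, tau ⊗ x = tau ⊗ y -> x = y).

Lemma comp_sound h g Ph n x : forall j m xs zs, size zs = m -> (forall i, i < m -> xs (10 + i) = num (nth 0 zs i)) ->
  (forall i, i < n -> xs (10 + m + i) = num (nth 0 x i)) ->
  (forall i xs, i < j -> (forall i, i < n -> xs (10 + i) = num (nth 0 x i)) -> sat ps xs (h i) ->
    exists w, xs 0 = num w /\ Ph i w) -> sat ps xs (comp_fm h g j m) ->
  exists ws xs', [/\ size ws = j, forall i, i < j -> Ph i (nth 0 ws i), xs' 0 = xs 0,
    forall i, i < j + m -> xs' (10 + i) = num (nth 0 (ws ++ zs) i) & sat ps xs' g].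
elim=> [|j IH] m xs zs sz hz hx hh; first by move=> gs; exists [::], xs.
move=> [a [ha hg]]; have [|w [ew]] := hh j _ (ltnSn j) _ ha.
  by move=> i i_n; rewrite -(hx i i_n) addnAC.
have [||||ws [xs' [sws hws x0 hxs]]] := IH m.+1 _ (w :: zs) _ _ _ _ hg.
- by rewrite /= sz.
- by case=> [_|i im]; [apply: ew|apply: hz].
- by [].
- by move=> i ys ij; apply: hh; apply: leqW.
exists (rcons ws w), xs'; rewrite size_rcons sws; split=> // i ij.
  move: ij; rewrite ltnS leq_eqVlt nth_rcons sws => /orP[/eqP->|ij]; first by rewrite ltnn eqxx.
  by rewrite ij; apply: hws.
by rewrite cat_rcons; apply: hxs; rewrite addnS.
Qed.

(** Holds in structures whose natural numbers are standard. Coded sets may contain other elements,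
    but the descent from a standard member meets only standard ones. *)
Lemma rep_sound n r (x : n.-tuple nat) xs : (forall i, i < n -> xs (10 + i) = num (nth 0 x i)) ->
  sat ps xs (rep r) -> exists m, xs 0 = num m /\ computes r x m.
elim: r x xs => [m||m i|k m g IHg h IHh|m g IHg h IHh|m g IHg] x xs hx.
- by move=> /= ->; exists 0.
- by move=> /= ->; exists (thead x).+1; rewrite (hx) // thead_nth.
- by move=> /= ->; exists (tnth x i); rewrite (hx) // (tnth_nth 0).
- pose hf j := if insub j is Some i then rep (h i) else Eq One One.
  pose Ph j w := forall i : 'I_k, i = j :> nat -> computes (h i) x w.
  move=> hs; have [||||ws [xs' [sws hws x0 hxs gs]]] :=
    @comp_sound hf (rep g) Ph m x k 0 xs [::] _ _ _ _ (hs : sat ps xs (comp_fm hf (rep g) k 0)).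
  + by [].
  + by [].
  + by [].
  + move=> i ys ik hys; rewrite /hf; case: insubP => [u _ eu|]; last by rewrite ik.
    move=> /(IHh u x ys hys)[w [ew hw]]; exists w; split=> // i' ei'.
    by rewrite (_ : i' = u) //; apply: val_inj; rewrite eu.
  have sk : size ws == k by apply/eqP.
  have [|y [ey hy]] := IHg (Tuple sk) xs' _ gs.
    by move=> i ik; rewrite hxs ?addn0 // cats0.
  exists y; split; first by rewrite -x0.
  by exists (Tuple sk) => // i; rewrite (tnth_nth 0); apply: hws.
- move=> [/natN[y ey] [f [[w [ew fw]] hf]]].
  have {w ew} fw : memS f (pairS (xs 10) (xs 0)) by rewrite -(ew : w = pairS (xs 10) (xs 0)).
  have base j a y0 : pairS (num j) (num a) = pairS (num 0) y0 -> (exists m, y0 = num m /\ computes g [tuple of behead x] m) ->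
      exists u : nat -> nat, [/\ computes g [tuple of behead x] (u 0),
        forall l, l < j -> computes h [tuple of l :: u l :: behead x] (u l.+1) & u j = a].
    by move=> e [b [eb hb]]; move: e; rewrite eb => /pairN[-> ->]; exists (fun=> b).
  have key j a : memS f (pairS (num j) (num a)) -> exists u : nat -> nat,
      [/\ computes g [tuple of behead x] (u 0), forall l, l < j -> computes h [tuple of l :: u l :: behead x] (u l.+1) & u j = a].
    have gb t y0 : sat ps (fun v => update (update (update xs 1 f) 2 t) 3 y0 (if v < 10 then 3 else v.+1)) (rep g) ->
        exists m, y0 = num m /\ computes g [tuple of behead x] m.
      by apply: (IHg) => i im; rewrite nth_behead; apply: (hx).
    elim: j a => [|j IH] a /hf [[y0 [e0 hg]]|[t [b [y' [/natN[i ei] [/natN[b' eb'] [e0 [[w' [ew' fw']] hr]]]]]]]].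
    + exact: base (gb _ _ hg).
    + have {}ei : t = num i := ei; have {}eb' : b = num b' := eb'.
      have [|d [ed hd]] := IHh [tuple of i :: b' :: behead x] _ _ hr.
        by case=> [|[|l]] lm; [exact: ei|exact: eb'|rewrite /= nth_behead; apply: (hx)].
      have {}ed : y' = num d := ed.
      have : pairS (num 0) (num a) = pairS (num i.+1) (num d) by rewrite -ed /num iterS -/(num i) -ei.
      by move/pairN => [].
    + exact: base (gb _ _ hg).
    + have {}ei : t = num i := ei; have {}eb' : b = num b' := eb'.
      have [|d [ed hd]] := IHh [tuple of i :: b' :: behead x] _ _ hr.
        by case=> [|[|l]] lm; [exact: ei|exact: eb'|rewrite /= nth_behead; apply: (hx)].
      have {}ed : y' = num d := ed.
      have : pairS (num j.+1) (num a) = pairS (num i.+1) (num d) by rewrite -ed -[num i.+1]/(tau ⊗ num i) -ei.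
      move/pairN => [[ij] ->].
      have {}ew' : w' = pairS t b := ew'.
      have {}fw' : memS f w' := fw'.
      move: fw'; rewrite ew' ei eb' -ij => /IH[u [u0 uS ej]].
      exists (fun l => if l == j.+1 then d else u l); split=> [//|l|]; last by rewrite eqxx.
      rewrite ltnS leq_eqVlt => /orP[/eqP->|lj]; first by rewrite eqxx ltn_eqF // ej ij.
      by rewrite (ltn_eqF (leqW lj)) eqSS (ltn_eqF lj); apply: uS.
  have {}ey : xs 0 = num y := ey.
  exists y; split=> //; move: fw; rewrite (hx) // ey => /key[u [u0 uS ej]].
  by exists u; rewrite thead_nth.
- move=> [/natN[y ey] [[w [ew hg]] [f [fy hf]]]].
  exists y; split=> //; split.
    have [|d [ed hd]] := IHg [tuple of y :: x] _ _ hg.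
      by case=> lm; [exact: ey|apply: hx].
    by move: hd; have -> : d = 0 by apply: numI; rewrite -ed.
  have key j : memS f (num j) -> forall l, l < j -> exists z, computes g [tuple of l :: x] z.+1.
    elim: j => [//|j IH] /hf [e|[t [ft [et [z [z' [/natN[b eb] [ez' hr]]]]]]]].
      by have := numI (e : num j.+1 = num 0).
    have {}et : t = num j by apply/esym/tauI.
    move=> l; rewrite ltnS leq_eqVlt => /orP[/eqP->|]; last by apply: IH; rewrite -et.
    have [|d [ed hd]] := IHg [tuple of j :: x] _ _ hr.
      by case=> lm; [exact: et|apply: hx].
    have {}eb : z = num b := eb; have {}ez' : z' = tau ⊗ z := ez'.
    by exists b; move: hd; have -> : d = b.+1 by apply: numI; rewrite -ed ez' eb.
  by apply: key; rewrite -ey.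
Qed.
End Soundness.

Section Completeness.
Hypothesis sets : setsS.

Lemma num_neq0 n : num n <> s_zero M.
by have [[h0 h1] _] := sets; elim: n => // n; apply: h1. Qed.
Lemma num_const n : constS (num n).
by have [_ [_ [c1 hc]]] := sets; elim: n => // n IH; have [] := hc _ IH. Qed.
Lemma pair_const a b : constS a -> constS b -> constS (pairS a b).
by have [_ [_ [_ hc]]] := sets; move=> ca cb; have [_] := hc _ ca; apply. Qed.

Lemma finite_coded g n : (forall k, k < n -> constS (g k)) -> exists f, forall y, memS f y <-> exists k, k < n /\ y = g k.
have [_ [[[f0 hf0] adj] _]] := sets.
elim: n => [_|n IH h]; first by exists f0 => y; split=> [/hf0|[k []]].
have [f hf] := IH (fun k kn => h k (leqW kn)); have [f' hf'] := adj f _ (h n (ltnSn n)).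
exists f' => y; have [h1] := hf' y; split=> [/h1[/hf[k [kn ->]]|->]|[k [+ ->]]].
- by exists k; split=> //; apply: leqW.
- by exists n.
- rewrite ltnS leq_eqVlt => /orP[/eqP->|kn]; first by have [_] := hf' (g n); apply; right.
  by have [_] := hf' (g k); apply; left; apply/hf; exists k.
Qed.

Lemma num_nat n : natS (num n).
split; first exact: num_neq0.
have [f hf] := finite_coded (fun k (_ : k < n.+1) => num_const k); exists f; split; first by apply/hf; exists n.
move=> u /hf[[|k] [kn ->]]; [by left|right].
by exists (num k); split=> //; apply/hf; exists k; split=> //; apply: ltnW.
Qed.

Lemma comp_complete h g n x y : forall ws m xs zs, size zs = m -> (forall i, i < m -> xs (10 + i) = num (nth 0 zs i)) ->
  (forall i, i < n -> xs (10 + m + i) = num (nth 0 x i)) -> xs 0 = y ->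
  (forall i xs, i < size ws -> (forall i, i < n -> xs (10 + i) = num (nth 0 x i)) -> xs 0 = num (nth 0 ws i) ->
    sat ps xs (h i)) ->
  (forall xs, (forall i, i < size ws + m -> xs (10 + i) = num (nth 0 (ws ++ zs) i)) -> xs 0 = y -> sat ps xs g) ->
  sat ps xs (comp_fm h g (size ws) m).
elim/last_ind=> [|ws w IH] m xs zs sz hz hx x0 hh hg; first exact: hg.
rewrite size_rcons; exists (num w); split.
  apply: hh; rewrite ?size_rcons //.
    by move=> i i_n; rewrite -(hx i i_n) addnAC.
  by rewrite nth_rcons ltnn eqxx.
apply: (IH m.+1 _ (w :: zs)) => //.
- by rewrite /= sz.
- by case=> [_|i im]; [|apply: hz].
- by move=> i ys iw hys y0; apply: hh; rewrite ?size_rcons ?leqW // nth_rcons iw.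
- by move=> ys hys; apply: hg => i; rewrite size_rcons cat_rcons addSn -addnS; apply: hys.
Qed.

(** Only the theory of coded sets is used, so this is available in arbitrary models, even those in
    which numerals coincide or pairs cannot be decoded. *)
Lemma rep_complete n r (x : n.-tuple nat) m xs : (forall i, i < n -> xs (10 + i) = num (nth 0 x i)) ->
  xs 0 = num m -> computes r x m -> sat ps xs (rep r).
elim: r x m xs => [n'||n' i|k n' g IHg h IHh|n' g IHg h IHh|n' g IHg] x m xs hx x0.
- by move=> /= e; rewrite x0 e.
- by move=> /= e; rewrite (hx) // x0 e thead_nth.
- by move=> /= e; rewrite (hx) // x0 e (tnth_nth 0).
- pose hf j := if insub j is Some i then rep (h i) else Eq One One.
  move=> [z hz gz].
  have := @comp_complete hf (rep g) n' x (num m) z 0 xs [::]; rewrite !size_tuple => H; apply: H => //.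
  + move=> i ys ik hys y0; rewrite /hf insubT.
    by apply: (IHh (Ordinal ik) x (nth 0 z i)) => //; have := hz (Ordinal ik); rewrite (tnth_nth 0).
  + by move=> ys; rewrite addn0 cats0 => hys y0; apply: IHg gz.
- move=> [u [u0 uS em]]; split; first by have := num_nat m; rewrite -x0.
  have [f hf] := @finite_coded (fun k => pairS (num k) (num (u k))) (thead x).+1
    (fun k _ => pair_const (num_const k) (num_const (u k))).
  exists f; split.
    exists (pairS (num (thead x)) (num m)); split; last by apply/hf; exists (thead x); rewrite em.
    by rewrite thead_nth -(hx) // -x0.
  move=> w /hf[[|j] [jx ew]]; [left|right].
    exists (num (u 0)); split => //.
    by apply: IHg u0 => // i i_n; rewrite nth_behead; apply: (hx).
  exists (num j), (num (u j)), (num (u j.+1)); split; first exact: num_nat.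
  split; first exact: num_nat.
  split => //.
  split; first by exists (pairS (num j) (num (u j))); split=> //; apply/hf; exists j; split=> //; apply: ltnW.
  apply: IHh (uS j jx) => //.
  by case=> [|[|l]] // lm; rewrite /= nth_behead; apply: (hx).
- move=> [g0 gm]; split; first by have := num_nat m; rewrite -x0.
  split; first by exists (num 0); split=> //; apply: IHg g0 => //; case=> lm; [exact: x0|apply: hx].
  have [f hf] := finite_coded (fun k (_ : k < m.+1) => num_const k); exists f; split.
    by apply/hf; exists m.
  move=> w /hf[[|j] [jm ew]]; [by left|right].
  have [z hz] := gm j jm; exists (num j); split; first by apply/hf; exists j; split=> //; apply: ltnW.
  split => //.
  exists (num z), (num z.+1); split; first exact: num_nat.
  by split=> //; apply: IHg hz => //; case=> lm; [|apply: hx].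
Qed.
End Completeness.
End Meaning.

Lemma closeE (M : structure U) vs phi (e : nat -> M) : satisfies e (foldr (@fAll U) phi vs) <->
  forall e', (forall v, v \notin vs -> e' v = e v) -> satisfies e' phi.
elim: vs e => [|w vs IH] e /=.
  split=> [h e' he|]; last by apply.
  by apply/(satisfies_ext (e := e)) => // v _; apply/esym/he.
split=> [h e' he|h x].
  apply: (proj1 (IH _) (h (e' w))) => v vn; rewrite /update; case: eqP => [->//|/eqP vw].
  by apply: he; rewrite negb_or vw.
apply/IH => e' he; apply: h => v; rewrite negb_or => /andP[vw vn].
by rewrite he // /update (negbTE vw).
Qed.

Lemma close_free vs phi : free_vars (foldr (@fAll U) phi vs) =i [predD free_vars phi & vs].
move=> v; elim: vs => [|w vs IH] => //.
by rewrite mem_filter IH !inE negb_or andbA.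
Qed.

(** Variable 4 holds the parameter [PT], by the convention of [mix]. *)
Definition numeral n : term := iter n (tMul (tVar 4)) tOne.

Lemma numeralE (N : structure U) (e : nat -> N) m : teval e (numeral m) = num (fun v => e v.*2) m.
by elim: m => // m IH; rewrite /= IH. Qed.
Lemma numeral_vars m v : v \in tvars (numeral m) -> v = 4.
by elim: m => // m IH; rewrite inE => /orP[/eqP|]. Qed.

(** Variable 21 holds the argument [X 10]. Substituting the numeral by an equation keeps the code of
    the result easy to compute. *)
Definition diagonal n (theta : formula U) := fAll 4 (fAll 21 (fImp (fEq (tVar 21) (numeral n)) theta)).

Lemma diagonal_code : exists2 D, recf (fun x : 1.-tuple nat => D (thead x)) &
  forall theta, formula_code (diagonal (formula_code theta) theta) = D (formula_code theta).
exists (fun n => npair 4 (npair 4 (npair 4 (npair 21 (npair 3 (npair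
  (npair 1 (npair (npair 0 21) (term_code (numeral n)))) n)))))) => [|theta]; last reflexivity.
have rT : recf (fun x : 1.-tuple nat => term_code (numeral (thead x))).
  have := recf_prec (recf_const 0 (npair 2 0)) (recf_npair 5 (recf_npair (npair 0 4) (recf_proj (lift ord0 ord0)))).
  apply: recf_ext => x; elim: (thead x) => [|m IH]; first reflexivity.
  by rewrite [LHS]/= IH.
by do 5!apply: recf_npair; apply: recf_npair2; [do 2!apply: recf_npair|apply: recf_proj].
Qed.

(** The sentence [sigma] says that, if the theory of coded sets holds, the supposed decision
    procedure answers 0 on the code of [sigma]. Were it a consequence of [S], it would be true in
    [M], where representations are sound, against the answer 1. Otherwise the answer is 0, and
    completeness makes [sigma] true in every model of [S]. *)
Lemma undecidable_Cons S (M : structure U) (ps : nat -> M) : (forall psi, List.In psi S -> models M psi) -> setsS ps ->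
  (forall z, natS ps z -> exists k, z = num ps k) ->
  (forall j a j' a', pairS ps (num ps j) (num ps a) = pairS ps (num ps j') (num ps a') -> j = j' /\ a = a') ->
  injective (num ps) -> (forall x y, s_mul (ps 2) x = s_mul (ps 2) y -> x = y) -> undecidable (Defs.Cons S).
move=> MS setsM natN pairN numI tauI [f hf].
have [D [d hd] codeD] := diagonal_code.
pose r := RComp f (fun _ : 'I_1 => d).
(* The element 1 is the numeral of 0, so it stands for the answer 0. *)
have [Psi hPsi] : exists Psi : formula U, forall (N : structure U) (qs xs : nat -> N),
    satisfies (mix qs xs) Psi <-> (setsS qs -> exists x, x = s_one N /\ sat qs (update xs 0 x) (rep r)).
  exists (tr (Imp fm_sets (Ex 0 (And (Eq (X 0) One) (rep r))))) => N qs xs.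
  rewrite trE; split=> h s; first by apply: h; apply/sat_sets.
  by apply: h; apply/(sat_sets qs xs).
pose Theta := foldr (@fAll U) Psi [seq v <- free_vars Psi | v \notin [:: 4; 21]].
have [n en] : exists n, n = formula_code Theta by exists (formula_code Theta).
have [sigma es] : exists sigma, sigma = diagonal n Theta by exists (diagonal n Theta).
have codeS : formula_code sigma = D n by rewrite es en.
have sigmaS : sentence sigma.
  rewrite /sentence -size_eq0; apply/contraT; rewrite -lt0n -has_predT => /hasP[v +].
  rewrite es !mem_filter => /and3P[v4 v21].
  rewrite mem_cat close_free [v \in [predD _ & _]]inE mem_filter !inE (negbTE v21) (negbTE v4).
  by rewrite andNb orbF => /numeral_vars/eqP; rewrite (negbTE v4).
have fS : (exists2 phi, Defs.Cons S phi & D n = formula_code phi) <-> Defs.Cons S sigma.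
  by split=> [[phi h]|h]; [rewrite -codeS => /formula_code_inj -> | exists sigma].
have [c|nc] := pselect (Defs.Cons S sigma).
  have [/(_ (proj2 fS c))f1] := hf (D n).
  pose xs (v : nat) := num ps n.
  have := proj2 c M MS (mix ps xs); rewrite es => /(_ (ps 2) (num ps n)).
  have mixE : update (update (mix ps xs) 4 (ps 2)) 21 (num ps n) = mix ps xs.
    apply: funext => v; rewrite /update; case: eqP => [->//|_]; by case: eqP => [->|].
  rewrite mixE => h.
  have /closeE/(_ (mix ps xs) (fun=> fun=> erefl))/hPsi : satisfies (mix ps xs) Theta by (apply: h; rewrite numeralE).
  move=> /(_ setsM)[x [ex hr]].
  have [|m [em [z hz fz]]] := rep_sound natN pairN numI tauI (x := [tuple n]) _ hr.
    by case.
  have m0 : m = 0 by apply: numI; rewrite -em.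
  have zE : z = [tuple D n].
    apply: eq_from_tnth => i; rewrite (ord1).
    exact: (computes_fun (hz ord0)).
  by move: fz; rewrite m0 zE => /(computes_fun f1).
have [_ /(_ (fun h => nc (proj1 fS h)))f0] := hf (D n).
apply: nc; split=> // N NS e; rewrite es => a b; rewrite numeralE => eb.
apply/closeE => e' he'.
have e4 : e' 4 = a by rewrite he' // mem_filter.
have e21 : e' 21 = b by rewrite he' // mem_filter.
pose qs v := e' v.*2; pose xs v := e' v.*2.+1.
have -> : e' = mix qs xs.
  apply: funext => v; rewrite /mix /xs; case: (boolP (odd v)) => ov.
    by rewrite -[in LHS](odd_double_half v) ov.
  by rewrite -[in LHS](odd_double_half v) (negbTE ov).
apply/hPsi => sN; exists (s_one N); split=> //.
apply: (@rep_complete N qs sN 1 r [tuple n] 0) => //.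
  case=> // _; rewrite /update /xs e21.
  move: eb; rewrite /update /= => ->; elim: (n) => //= m ->.
  by rewrite /qs e4.
by exists [tuple D n] => // i; rewrite (ord1).
Qed.
End Language.

Local Open Scope ring_scope.

(** * The intended structure satisfies the theory and has standard numbers *)

Section CodedModel.
Variables (E : closedF) (V : valring E) (M D : subfield E) (q : nat) (c b1 tau : E).
Hypotheses (DM : {subset D <= M}) (cs : coded_sets V M q c b1 D).
Hypotheses (tauD : tau \in D) (tau0 : tau != 0) (tau1 : tau <_[V] 1).
Variables (U : countType) (P : U -> sfT M -> Prop).

Definition sf_structure : structure U := @Structure U (sfT M) 0 1 -%R +%R *%R P.

Notation N := sf_structure.
Variables (om : formula U) (ps : nat -> N).
Hypotheses (ps0 : val (ps 0%N : sfT M) = c) (ps1 : val (ps 1%N : sfT M) = b1) (ps2 : val (ps 2%N : sfT M) = tau).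
Hypothesis inOE : forall x : sfT M, inO om ps x <-> val x \in V.

Lemma pwE (x : sfT M) n : val (pw (M := N) x n : sfT M) = val x ^+ n.
by elim: n => [|n IH] //; rewrite exprS -IH. Qed.
Lemma sub_ex Q : (exists x : sfT M, Q (val x)) <-> exists2 x, x \in M & Q x.
split=> [[x h]|[x xM h]]; first by exists (val x) => //; apply: valP.
by exists (Sub x xM).
Qed.

Lemma has_asE (g : sfT M) : has_as (M := N) q g <-> pole_free M q (val g).
rewrite /pole_free -sub_ex; split=> [[z <-]|[z h]]; exists z; first by rewrite /= pwE.
by apply: val_inj; rewrite -h -pwE.
Qed.

Lemma smallE (x : sfT M) : smallS om (M := N) ps x <-> val x <_[V] 1.
split=> [[/inOE xV nu]|x1].
  rewrite lt_neqAle nv_le1 xV andbT; apply/eqP => e; apply: nu.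
  have : x != 0 by rewrite -(nv_gt0 V) e nv_gt0 oner_neq0.
  exists (x^-1); split; last exact: divff.
  by apply/inOE; rewrite -nv_le1 (nv_eqV e) invr1.
split=> [|[y [/inOE yV e]]]; first by apply/inOE; rewrite -nv_le1 ltW.
have {}e : val x * val y = 1 by rewrite -rmorphM [x * y]e.
by have := nv_ltM1 x1 (etrans (nv_le1 _ _) yV); rewrite e ltxx.
Qed.

Lemma constE (x : sfT M) : constS om q (M := N) ps x <-> const V M q (val x).
split=> [[/inOE xV h]|[xV h]]; (split; first by [|apply/inOE]).
  move=> g gM g1 pg; have -> : g * val x ^+ q = val ((Sub g gM : sfT M) * pw (M := N) x q) by rewrite /= pwE.
  by apply/has_asE/h; [apply/smallE|apply/has_asE].
move=> g g1 pg; apply/has_asE; rewrite [val _](_ : _ = val g * val x ^+ q).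
  by apply: h; [apply: valP|apply/smallE|apply/has_asE].
by rewrite -pwE.
Qed.

Lemma freeE (f b : sfT M) : c != val b -> freeS q (M := N) ps f b <-> pole_free M q (val f ^+ q / (c - val b)).
rewrite -subr_eq0 => cb; rewrite /pole_free -sub_ex.
have valE z : val ((pw (M := N) z q - z) * ((ps 0%N : sfT M) - b) : sfT M) =
    (val z ^+ q - val z) * (c - val b) by rewrite -pwE -ps0.
split=> [[z h]|[z h]]; exists z.
  by rewrite -[val f ^+ q]pwE -(h : (_ - z) * (_ - b) = _) valE mulfK.
by apply: val_inj; rewrite [RHS]pwE [LHS]valE h divfK.
Qed.

Lemma const_mem (b : sfT M) : const V M q (val b) -> c != val b.
by have [[_ _ _ cD] cM _ _ _] := cs; move=> /(cM _ (valP b))[/cD]. Qed.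

Lemma memE (f b : sfT M) : memS om q (M := N) ps f b <-> codes V M q c b1 (val f) (val b).
have [[_ _ cb1 _] _ _ _ _] := cs.
have f1E : freeS q ps f (ps 1%N) <-> pole_free M q (val f ^+ q / (c - b1)) by rewrite freeE ps1.
split=> [[f0 [/inOE fV [/f1E h1 [/constE cb h2]]]]|[f0 fV /f1E h1 cb h2]].
  split=> //; last by apply/freeE => //; apply: const_mem.
  by apply/eqP => e; apply: f0; apply: val_inj; rewrite e rmorph0.
split; first by move=> e; move: f0; rewrite e rmorph0 eqxx.
split; first exact/inOE.
split=> //; split; first exact/constE.
by apply/freeE => //; apply: const_mem.
Qed.

Lemma numE k : val (num (M := N) ps k : sfT M) = tau ^+ k.
by elim: k => [|k IH] //; rewrite exprS -IH -ps2. Qed.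
Lemma tau_inj i j : tau ^+ i = tau ^+ j -> i = j.
by move=> e; apply: (nv_expI tau0 tau1); rewrite e. Qed.
Lemma num_inj : injective (num (M := N) ps).
by move=> i j e; apply: tau_inj; rewrite -!numE e. Qed.

Lemma tau_cancel x y : s_mul (ps 2%N) x = s_mul (ps 2%N) y -> x = y.
move=> e; apply: val_inj; apply: (mulfI tau0); rewrite -ps2.
by rewrite -[LHS]rmorphM -[RHS]rmorphM; congr val.
Qed.

Lemma pairE (a b : sfT M) : val (pairS (M := N) ps a b : sfT M) = val a * val a + tau * (val b * val b).
by rewrite -ps2. Qed.

(** For numerals the two summands are powers of [tau] with an even and an odd exponent; the sum
    determines the smaller exponent, hence also which summand has it. *)
Lemma pair_inj j a j' a' : pairS (M := N) ps (num (M := N) ps j) (num (M := N) ps a) =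
  pairS (M := N) ps (num (M := N) ps j') (num (M := N) ps a') -> j = j' /\ a = a'.
move=> /(congr1 (fun x : sfT M => val x)); rewrite !pairE !numE -!exprD -!exprS !addnn => e.
have low i k : exists2 m, nv V (tau ^+ i.*2 + tau ^+ k.*2.+1) = nv V (tau ^+ m) & m = i.*2 \/ m = k.*2.+1.
  have ltX m n : (m < n)%N -> tau ^+ n <_[V] tau ^+ m.
    by move=> mn; rewrite -(subnK (ltnW mn)) exprD nv_ltMl ?expf_neq0 // nv_ltX1 // subn_gt0.
  have [] := ltngtP i.*2 k.*2.+1; last by lia.
    by exists i.*2; [apply/nv_dom/ltX|left].
  by exists k.*2.+1; [rewrite addrC; apply/nv_dom/ltX|right].
have [m e1 hm] := low j a; have [m' e2 hm'] := low j' a'.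
have em : m = m' by apply: (nv_expI tau0 tau1); rewrite -e1 e.
have [ej|ea] : j = j' \/ a = a' by lia.
  by move: e; rewrite ej => /addrI/tau_inj h; lia.
by move: e; rewrite ea => /addIr/tau_inj h; lia.
Qed.

(** An element that is no power of [tau] could be divided by [tau] forever inside a finite coded
    set. *)
Lemma nat_standard z : natS om q (M := N) ps z -> exists k, z = num (M := N) ps k.
move=> [z0 [f [fz hf]]]; apply: contrapT => nz.
have vz0 : val z != 0 by apply/eqP => e; apply: z0; apply: val_inj.
have [_ _ /(_ _ (valP f))[s hs] _ _] := cs.
have hk k : exists v : N, memS om q ps f v /\ val z = tau ^+ k * val v.
  elim: k => [|k [v [fv ev]]]; first by exists z; rewrite mul1r.
  have [v1|[w [fw vw]]] := hf v fv.
    by case: nz; exists k; apply: val_inj; rewrite numE ev v1 mulr1.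
  exists w; rewrite ev vw exprSr -mulrA.
  by rewrite /= ps2.
have : {subset [seq val z / tau ^+ k | k <- iota 0 (size s).+1] <= s}.
  move=> _ /mapP[k _ ->]; have [v [/memE fv ->]] := hk k; rewrite mulrC mulKf ?expf_neq0 //.
  by apply: hs => //; apply: valP.
move=> /uniq_leq_size; rewrite size_map size_iota ltnn => H; apply: notF; apply: H.
rewrite map_inj_uniq ?iota_uniq // => i j /(mulfI vz0)/invr_inj; exact: tau_inj.
Qed.

Lemma sets_hold : setsS om q (M := N) ps.
have [[cM b1M cb1 cD] cst _ [f0 f0M hf0] adj] := cs.
have tV : tau \in V by rewrite -nv_le1 ltW.
have mk x : val x \in D -> val x \in V -> constS om q ps x by (move=> xD xV; apply/constE/cst => //; apply: valP).
split; first split.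
- by apply/eqP; exact: oner_neq0.
- move=> x x0 h; apply: x0; apply: tau_cancel; rewrite h; apply: val_inj.
  by rewrite [RHS]rmorphM mulr0.
split; first split.
- by exists (Sub f0 f0M) => b /memE; apply: hf0; apply: valP.
- move=> f b /constE cb; have [f' f'M h] := adj _ _ (valP f) (valP b) cb.
  exists (Sub f' f'M : sfT M) => y; have hy := h _ (valP y); split.
    by move=> /memE; rewrite SubK => /hy[/memE|/val_inj]; [left|right].
  by move=> H; apply/memE; apply/hy; case: H => [/memE|->]; [left|right].
split; first by apply: mk; rewrite rpred1.
have cmem x : constS om q ps x -> val x \in D /\ val x \in V by move=> /constE/(cst _ (valP x)).
move=> a /cmem[aD aV]; split=> [|b /cmem[bD bV]].
  by apply: mk; rewrite /= ps2 rpredM.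
by apply: mk; rewrite pairE rpredD ?rpredM.
Qed.

Lemma coded_undecidable S : (forall psi, List.In psi S -> models N psi) -> undecidable (Defs.Cons S).
move=> NS; apply: (undecidable_Cons NS sets_hold nat_standard pair_inj num_inj tau_cancel).
Qed.
End CodedModel.

Lemma satisfies_iso U (A B : structure U) f : (forall y, exists x, y = f x) -> injective f ->
  f (s_zero A) = s_zero B -> f (s_one A) = s_one B -> (forall x, f (s_opp x) = s_opp (f x)) ->
  (forall x y, f (s_add x y) = s_add (f x) (f y)) -> (forall x y, f (s_mul x y) = s_mul (f x) (f y)) ->
  (forall u x, s_pred u (f x) <-> s_pred u x) -> forall phi e, satisfies e phi <-> satisfies (fun n => f (e n)) phi.
move=> onto inj f0 f1 fN fD fM fP; have tE t e : teval (fun n => f (e n)) t = f (teval e t).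
  by elim: t => //= [t ->|s -> t ->|s -> t ->].
elim=> [|t1 t2|u t|g IHg h IHh|n g IH] e //=; rewrite ?tE.
- by split=> [->|/inj].
- by rewrite fP.
- by rewrite IHg IHh.
- have up x : (fun m => f (update e n x m)) = update (fun m => f (e m)) n (f x) by (apply: funext => m; rewrite /update; case: eqP).
  split=> [H y|H x]; first by have [x ->] := onto y; rewrite -up; apply/IH.
  by apply/IH; rewrite up.
Qed.

(** * From the valued language to the language of rings *)

Section Reduct.
Definition reduct (M : structure unit) : structure void :=
  @Structure void M (s_zero M) (s_one M) (@s_opp _ M) (@s_add _ M) (@s_mul _ M) (fun u _ => match u with end).

Fixpoint expand (phi : formula void) : formula unit := match phi with | fFalse => fFalse | fEq t1 t2 => fEq t1 t2
  | fPred u _ => match u with end | fImp f g => fImp (expand f) (expand g) | fAll n f => fAll n (expand f) end.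

Lemma expand_free phi : free_vars (expand phi) = free_vars phi.
by elim: phi => [|//|[]|f IHf g IHg|n f IH] //=; rewrite ?IHf ?IHg ?IH. Qed.
Lemma reduct_teval (M : structure unit) (e : nat -> M) t : teval (M := reduct M) e t = teval e t.
by elim: t => //= [t ->|s -> t ->|s -> t ->]. Qed.

Lemma expandE (M : structure unit) e phi : satisfies e (expand phi) <-> satisfies (M := reduct M) e phi.
elim: phi e => [|t1 t2|[]|f IHf g IHg|n f IH] e //=; rewrite ?reduct_teval //.
  by rewrite IHf IHg.
by split=> h x; apply/IH.
Qed.

Variable phi : formula void.

Definition params := [seq v <- free_vars phi | v != 0%N].

(** Some choice of parameters makes [phi] define the valuation ring. The parameters are quantified
    away, so that this is a sentence and can be added to [S]. *)
Definition defines : formula unit := fImp (foldr (@fAll _) (fImp (fAll 0 (fImp (fImp (fImp (fPred tt (tVar 0)) (expand phi))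
  (fImp (fImp (expand phi) (fPred tt (tVar 0))) fFalse)) fFalse)) fFalse) params) fFalse.

Lemma definesE (M : structure unit) e : satisfies e defines <-> exists2 e' : nat -> M, forall v, v \notin params -> e' v = e v &
    forall x, s_pred tt x <-> satisfies (M := reduct M) (update e' 0%N x) phi.
have key e' : satisfies e' (fAll 0 (fImp (fImp (fImp (fPred tt (tVar 0)) (expand phi))
    (fImp (fImp (expand phi) (fPred tt (tVar 0))) fFalse)) fFalse)) <->
    forall x, s_pred tt x <-> satisfies (M := reduct M) (update e' 0%N x) phi.
  split=> [h x|h x]; last first.
    by apply; [move=> /h/expandE|move=> /expandE/h].
  by apply: contrapT => n; apply: (h) => h1 h2; apply: n; split=> [/h1/expandE|/expandE/h2].
split=> [h|[e' he' h]]; last by move/closeE => /(_ e' he'); apply; apply/key.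
apply: contrapT => n; apply: h; apply/closeE => e' he' /key h; apply: n; by exists e'.
Qed.

Lemma defines_sentence : sentence defines.
rewrite /sentence -size_eq0; apply/contraT; rewrite -lt0n -has_predT => /hasP[v +].
rewrite [free_vars _]/= cats0 close_free => /andP[/negP vp vf]; case: vp; move: vf.
rewrite [free_vars _]/= !cats0 mem_filter !mem_cat !inE expand_free mem_filter => /andP[v0].
by rewrite (negbTE v0) orbF orbb.
Qed.
End Reduct.

Lemma In_map A B (f : A -> B) s y : List.In y (map f s) -> exists2 x, List.In x s & y = f x.
elim: s => //= a s IH [<-|/IH[x xs ->]]; first by exists a => //; left.
by exists x => //; right.
Qed.

(** * Models of finite parts of the theory *)

Section Undecidability.
Variables (p : nat) (K : fieldType) (O : valring K).
Hypotheses (equicharO : equicharacteristic O p) (defectlessO : separably_defectless O).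
Hypotheses (kaplanskyO : kaplansky O) (henselianO : henselian O) (nontrivialO : nontrivial O).

Lemma coded_model S : (forall phi, List.In phi S -> Th (valued_field_structure O) phi) ->
  exists (E : closedF) V (M D : subfield E) q c b1 tau,
  [/\ {subset D <= M}, coded_sets V M q c b1 D, tau \in D, tau != 0 & tau <_[V] 1] /\
  forall phi, List.In phi S -> models (sub_struct V M) phi.
move=> ST; have [F [E [i [V [[_ cE pE sgF [pi piF [pi0 pi1]]] [elF iV]]]]]] :=
  countable_model equicharO defectlessO kaplanskyO henselianO nontrivialO 0.
have small : exists2 pi, pi \in imA i & pi != 0 /\ pi <_[V] 1 by exists pi.
(* The primes tend to infinity, so the bounds on degrees in [coded_subfield] disappear in the
   ultraproduct. *)
have /choice[q hq] n : exists q, [/\ prime q, (2 < q)%N, q != p & (n <= q)%N].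
  have [q] := prime_above (n + p + 2); exists q; split=> //; lia.
have /choice[M hM] n : exists M : subfield (UP E), exists c b1, [/\ {subset diagF (imA i) <= M},
    {subset M <= upF (fun=> imA i)}, rv_sub (upO V) M (diagF (imA i)), forall n (b : 'I_n -> E), (forall k, b k \in imA i) ->
        (forall x, x \in imA i -> spans (ppow pE (imA i)) b x) ->
        forall x, x \in M -> spans (ppow (up_pchar pE) M) (fun k => diag (b k)) x
    & forall x P, x \in upF (fun=> imA i) -> P \over M -> (size P <= q n)%N -> root P x -> ~~ root P^`() x -> x \in M]
  /\ coded_sets (upO V) M (q n) c b1 (diagF (imA i)).
  by have [pq q2 qp _] := hq n; apply: coded_subfield.
pose D := diagF (imA i).
have trD phi : List.In phi S -> satisfies (M := sub_struct (upO V) D) (fun=> 0) phi.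
  move=> /ST[sphi mphi].
  have hF : satisfies (M := sub_struct O F) (fun=> 0) phi by apply/elF.
  have gD x : diag (i x) \in D by apply/diag_in/imAP; exists x.
  pose g x : sfT D := Sub (diag (i x)) (gD x).
  have : satisfies (M := sub_struct (upO V) D) (fun=> g 0) phi.
    apply: (proj1 (@satisfies_iso _ (sub_struct O F) (sub_struct (upO V) D) g _ _ _ _ _ _ _ _ phi (0)) hF).
    - move=> y; have /diagFP[_ /imAP[x ->] ey] := valP y; exists x.
      exact: val_inj.
    - move=> x y /(congr1 (fun z : sfT D => val z)); rewrite !SubK => /(fmorph_inj (@diag E))/(fmorph_inj).
      by [].
    - by apply: val_inj; rewrite /= !rmorph0.
    - by apply: val_inj; rewrite /= !rmorph1.
    - by move=> x; apply: val_inj; change (diag (i (- x)) = - diag (i x)); rewrite !rmorphN.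
    - move=> x y; apply: val_inj; change (diag (i ((x : sfT F) + y)) = diag (i x) + diag (i y)).
      by rewrite !rmorphD.
    - move=> x y; apply: val_inj; change (diag (i ((x : sfT F) * y)) = diag (i x) * diag (i y)).
      by rewrite !rmorphM.
    - move=> u x; change (diag (i x) \in upO V <-> val (x : sfT F) \in O).
      by rewrite diag_in_upO iV.
  exact: satisfies_sentence.
have ae1 phi : List.In phi S -> ae (fun n => satisfies (M := sub_struct (upO V) (M n)) (fun=> 0) phi).
  move=> /trD h; apply: (ultraproduct_equivalence sgF _ small _ _ _ _ _ h).
  - by have [f hf] := cE; exists f => x _; apply: hf.
  - by move=> n; have [c [b1 [[]]]] := hM n.
  - by move=> n; have [c [b1 [[]]]] := hM n.
  - move=> n; apply: ae_imp (freeU n) => m nm x P xL PM sP.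
    have [c [b1 [[_ _ _ _ h5] _]]] := hM m; apply: h5 => //; apply: leq_trans sP _.
    by have [_ _ _] := hq m; apply: leq_trans.
  - by move=> n; have [c [b1 [[]]]] := hM n.
  - by move=> n; have [c [b1 [[]]]] := hM n.
have : ae (fun n => forall phi, List.In phi S -> satisfies (M := sub_struct (upO V) (M n)) (0) phi).
  elim: S ST ae1 {trD} => [_ _|phi S IH ST h]; first exact: aeT.
  apply: ae2 (h phi (or_introl erefl)) (IH (fun psi H => ST psi (or_intror H)) (fun psi H => h psi (or_intror H))).
  by move=> n h1 h2 psi [<-|/h2].
case/ae_ex=> n hn; have [c [b1 [[DM _ _ _ _]]]] := hM n.
exists (UP E : closedF), (upO V), (M n), D, (q n), c, b1, (diag pi); split.
  split=> //; [exact: diag_in|by rewrite fmorph_eq0|].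
  by rewrite -(rmorph1 (@diag E)) ltNge diag_nv_le -ltNge.
move=> phi hphi e; have [sphi _] := ST _ hphi.
have := hn _ hphi; exact: satisfies_sentence.
Qed.

Lemma valued_undecidable : finitely_undecidable (Th (valued_field_structure O)).
move=> S _ ST; have [E [V [M [D [q [c [b1 [tau [[DM cs tauD tau0 tau1] MS]]]]]]]]] := coded_model ST.
have [[cM b1M _ _] _ _ _ _] := cs.
pose ps n : sfT M := nth 0 [:: Sub c cM; Sub b1 b1M; Sub tau (DM _ tauD)] n.
exact: (coded_undecidable cs tauD tau0 tau1 (om := fPred tt (tVar 0)) (ps := ps) _ _ _ _ MS).
Qed.

(** Adding [defines phi] to [S] keeps the valuation ring definable in the resulting model, with
    parameters taken from that model, and definability is all that the coding asks of it. *)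
Lemma ring_undecidable : ring_definable O -> finitely_undecidable (Th (field_structure K)).
move=> [phi [e0 he0]] S _ ST.
have [|E [V [M [D [q [c [b1 [tau [[DM cs tauD tau0 tau1] MS]]]]]]]]] := @coded_model (defines phi :: [seq expand psi | psi <- S]).
  move=> psi [<-|h]; last first.
    have [psi' hpsi ->] := In_map h.
    have [m] := ST _ hpsi; split; first by rewrite /sentence expand_free.
    by move=> e; apply/expandE.
  split=> [|e]; first exact: defines_sentence.
  apply/definesE; exists (fun v => if v \in params phi then e0 v else e v) => [v /negbTE-> //|x].
  rewrite -[s_pred tt x]/(is_true (x \in O)) he0.
  apply: satisfies_ext => v vphi; rewrite /update; case: eqVneq => // v0.
  by rewrite mem_filter v0 vphi.
have [[cM b1M _ _] _ _ _ _] := cs.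
have /definesE[e _ he] := MS _ (or_introl erefl) (0).
pose ps n : sfT M := if n is n'.+3 then e n'.+1 else nth 0 [:: Sub c cM; Sub b1 b1M; Sub tau (DM _ tauD)] n.
apply: (coded_undecidable cs tauD tau0 tau1 (U := void) (P := fun u _ => match u with end) (om := phi) (ps := ps)) => //.
- move=> x; have -> : (val x \in V) <-> s_pred (s := sub_struct V M) tt x by [].
  rewrite he.
  rewrite (_ : update e 0 x = fun j => if j is j'.+1 then ps (3 + j')%N else x) //.
  by apply: funext => -[].
- move=> psi hpsi e'; apply/(expandE (M := sub_struct V M)); apply: MS; right.
  by elim: S hpsi {ST} => //= a S IH [->|/IH]; [left|right].
Qed.
End Undecidability.

Theorem theorem5p8 (p : nat) (K : fieldType) (O : valuationRing K) (equicharO : equicharacteristic O p)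
    (defectlessO : separably_defectless O) (kaplanskyO : kaplansky O) (henselianO : henselian O) (nontrivialO : nontrivial O) :
  finitely_undecidable (Th (valued_field_structure O)) /\ (ring_definable O -> finitely_undecidable (Th (field_structure K))).
by split; [exact: (valued_undecidable equicharO)|exact: (ring_undecidable equicharO)].
Qed.
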